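(* Let $F$ be an $\mathcal F_T$-measurable real random variable such that $E[e^{p\alpha F^+}]<\infty$ and $E[e^{\varepsilon F^-}]<\infty$ for some integer $p>1$ and some $\varepsilon>0$. Let $(Y,Z)$ be the unique solution of $Y_t=F+\int_t^Tf(s,Y_s,Z_s)ds-\int_t^TZ_s^{tr}dB_s$ with generator $$f(t,y,z)=\frac\alpha2\min_{\pi\in\mathcal C}\left|h(t)\sigma_t^{tr}\pi-\left(z+\frac1\alpha\theta_t\right)\right|^2-z^{tr}\theta_t-\frac1{2\alpha}|\theta_t|^2-\beta h(t)y-\frac{\beta h(t)}\alpha\left(\ln\frac{\beta h(t)}\lambda-1\right).$$ Then the value function $$V(0,x)=\sup_{(\pi,C)\in\mathcal A_D^C}E\left[-\exp\left(-\alpha\left(X_T^{\pi,C}-F\right)\right)-\int_0^T\lambda\exp(-\alpha C_u)du\right],\quad x\in\mathbb R,$$ is given by $$V(0,x)=-\exp(-\alpha(h(0)x-Y_0)),$$ and there exist an optimal trading strategy $\pi^\star$ and an optimal consumption process $C^\star$, with $(\pi^\star,C^\star)\in\mathcal A_D^C$, given, $\mathbb P$-a.s. for $t\in[0,T]$, by $$h(t)\sigma_t^{tr}\pi_t^\star=\mathrm{Proj}_{h(t)\sigma_t^{tr}\mathcal C}\left(Z_t+\frac{\theta_t}\alpha\right),\qquad C_t^\star=h(t)X_t^{\pi^\star,C^\star}-Y_t-\frac1\alpha\ln\frac{\beta h(t)}\lambda .$$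
   Context: Fix $T>0$, integers $1\le d\le m$ and constants $\alpha,\beta,\lambda>0$. $B$ is a standard $m$-dimensional Brownian motion on a complete probability space $(\Omega,\mathcal F,\mathbb P)$ with augmented natural filtration $(\mathcal F_t)$; predictability is with respect to this filtration, $E$ is expectation under $\mathbb P$, and $A^{tr}$ is the transpose of $A$. The processes $b$ ($\mathbb R^d$-valued) and $\sigma$ ($\mathbb R^{d\times m}$-valued) are predictable and bounded, $\sigma_t\sigma_t^{tr}$ is invertible, and $\theta_t=\sigma_t^{tr}(\sigma_t\sigma_t^{tr})^{-1}b_t$ is bounded. $\mathcal C\subset\mathbb R^d$ is closed and convex with $0\in\mathcal C$; $\mathrm{Proj}_K$ is Euclidean projection onto the closed convex set $K$; $h(t)\sigma_t^{tr}\mathcal C=\{h(t)\sigma_t^{tr}\pi:\pi\in\mathcal C\}$. The function $h$ is the unique solution of $h(t)=1-\int_t^T\beta h^2(s)ds$ on $[0,T]$, i.e. $h(t)=1/(1+\beta(T-t))$. Wealth: $X_t^{\pi,C}=x+\int_0^t\pi_u^{tr}\sigma_u(dB_u+\theta_udu)-\int_0^t\beta C_udu$. A solution of the BSDE is a pair of predictable processes $(Y,Z)$ with values in $\mathbb R\times\mathbb R^m$, $Y$ continuous, $\int_0^T|Z_t|^2dt<\infty$ and $\int_0^T|f(t,Y_t,Z_t)|dt<\infty$ a.s., satisfying the equation; the ''unique solution'' is unique in the class $E[e^{p\alpha Y_\star^+}+e^{\varepsilon Y_\star^-}+\int_0^T|Z_s|^2ds]<\infty$, $Y_\star^\pm=\sup_{t\le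 T}Y_t^\pm$, $y^+=\max\{y,0\}$, $y^-=\max\{-y,0\}$. Admissible set: $\mathcal A_D^C$ consists of pairs $(\pi,C)$ of predictable processes, $\pi$ $\mathbb R^d$-valued with $\int_0^T|\sigma_t^{tr}\pi_t|^2dt<\infty$ a.s. and $\pi_t\in\mathcal C$ $\mathbb P$-a.s. for $t\in[0,T]$, $C$ real-valued with $\int_0^T|C_t|dt<\infty$ a.s., such that $E[\int_0^T\exp(-\alpha C_u)du]<\infty$ and the family $\{e^{-\alpha h(\tau)X_\tau^{\pi,C}}e^{\alpha Y_\tau}:\tau\text{ a stopping time with values in }[0,T]\}$ is uniformly integrable. *)

(* Defs.v *)
From HB Require Import structures.
From mathcomp Require Import all_boot all_order all_algebra.
From mathcomp Require Import all_classical all_reals all_analysis.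

Set Implicit Arguments.
Unset Strict Implicit.
Unset Printing Implicit Defensive.

Import Order.TTheory GRing.Theory Num.Theory.
Import numFieldNormedType.Exports.

Local Open Scope classical_set_scope.
Local Open Scope ring_scope.

Section euclidean.
Variables (R : realType) (n : nat).

(* The norm that the library puts on matrices is the sup norm, so the Euclidean
   one is spelled out. *)
Definition sqnorm (v : 'cV[R]_n) : R := \sum_i v i 0 ^+ 2.

Definition dotv (u v : 'cV[R]_n) : R := \sum_i u i 0 * v i 0.

(* Euclidean projection; it is a genuine nearest point when K is nonempty,
   closed and convex, and the junk value 0 when there is no nearest point. *)
Definition Proj (K : set 'cV[R]_n) (v : 'cV[R]_n) : 'cV[R]_n :=
  xget 0 [set q | K q /\ forall r, K r -> sqnorm (v - q) <= sqnorm (v - r)].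

End euclidean.

(* Processes are total functions of a real time; every definition below only
   looks at times in [0, T]. *)
Section processes.
Variables (R : realType) (disp : measure_display) (Omega : measurableType disp).
Variables (P : probability Omega R) (T : R) (m : nat).
Variable B : R -> Omega -> 'cV[R]_m.

Local Notation mu := (@lebesgue_measure R).

(* The last condition says that, along any partition, all the coordinates of all
   the increments are independent centred Gaussian variables of variance
   t_{k+1} - t_k; the second parameter of normal_prob is the standard
   deviation. *)
Definition brownian_motion : Prop :=
  [/\ forall (t : R) i, 0 <= t <= T -> measurable_fun setT (fun w => B t w i 0),
      {ae P, forall w, B 0 w = 0},
      {ae P, forall w, forall i,
         {within `[0, T], continuous (fun t : R => B t w i 0)}} &
      forall (n : nat) (t : nat -> R) (U : 'I_n -> 'I_m -> set R),
        0 <= t 0%N -> (forall k, (k < n)%N -> t k < t k.+1) -> t n <= T ->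
        (forall k i, measurable (U k i)) ->
        P [set w | forall k i, U k i (B (t k.+1) w i 0 - B (t k) w i 0)] =
        (\prod_(k < n) \prod_(i < m)
           normal_prob 0 (Num.sqrt (t k.+1 - t k)) (U k i))%E].

(* Augmented natural filtration of B. *)
Definition filt (t : R) : set (set Omega) :=
  <<s [set A | (exists (s : R) i (U : set R), [/\ 0 <= s <= t, measurable U &
                   A = [set w | U (B s w i 0)]]) \/ P.-negligible A] >>.

Definition filt_measurable (t : R) (X : Omega -> R) : Prop :=
  forall U : set R, measurable U -> filt t (X @^-1` U).

Definition stopping_time (tau : Omega -> R) : Prop :=
  (forall w, 0 <= tau w <= T) /\
  (forall t : R, 0 <= t <= T -> filt t [set w | tau w <= t]).

(* Predictable sigma-algebra, on [0, T] x Omega. *)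
Definition predictable_sets : set (set (R * Omega)) :=
  <<s `[0, T] `*` setT,
      [set A | (exists2 E, filt 0 E & A = [set 0] `*` E) \/
               (exists (s t : R) E, [/\ 0 <= s, s < t, t <= T, filt s E &
                  A = `]s, t] `*` E])] >>.

Definition predictable (X : R -> Omega -> R) : Prop :=
  forall U : set R, measurable U ->
    predictable_sets [set z | 0 <= z.1 <= T /\ U (X z.1 z.2)].

Definition predictable_mx a b (X : R -> Omega -> 'M[R]_(a, b)) : Prop :=
  forall i j, predictable (fun t w => X t w i j).

Definition bounded_process a b (X : R -> Omega -> 'M[R]_(a, b)) : Prop :=
  exists K : R, forall (t : R) w i j, 0 <= t <= T -> `|X t w i j| <= K.

Definition unif_integrable (S : set (Omega -> R)) : Prop :=
  forall e : R, 0 < e -> exists K : R, forall X, S X ->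
    (\int[P]_(w in [set w | (K <= `|X w|)%R]) (`|X w|)%:E <= e%:E)%E.

(* Simple integrands  sum_(k < n) xi_k 1_{]t_k, t_{k+1}]}. *)
Record simple := Simple {
  simple_size : nat ;
  simple_time : nat -> R ;
  simple_coef : nat -> Omega -> 'cV[R]_m }.

Definition simple_wf (G : simple) : Prop :=
  let: Simple n t xi := G in
  [/\ 0 <= t 0%N, forall k, (k < n)%N -> t k <= t k.+1, t n <= T,
      forall k i, (k < n)%N -> filt_measurable (t k) (fun w => xi k w i 0) &
      exists K : R, forall k w i, (k < n)%N -> `|xi k w i 0| <= K].

Definition simple_val (G : simple) (s : R) (w : Omega) : 'cV[R]_m :=
  let: Simple n t xi := G in
  \sum_(k < n) (if t k < s <= t k.+1 then xi k w else 0).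

Definition simple_int (G : simple) (s : R) (w : Omega) : R :=
  let: Simple n t xi := G in
  \sum_(k < n)
     dotv (xi k w) (B (Num.min (t k.+1) s) w - B (Num.min (t k) s) w).

(* I is (a version of) the Ito integral of H against B: it is continuous and
   adapted, and it is the limit, uniformly on [0, T] in probability, of the
   integrals of simple integrands G_j such that int_0^T |G_j - H|^2 ds tends to
   0 in probability. *)
Definition is_ito_integral (H : R -> Omega -> 'cV[R]_m)
    (I : R -> Omega -> R) : Prop :=
  [/\ forall w, {within `[0, T], continuous (fun t : R => I t w)},
      forall t : R, 0 <= t <= T -> filt_measurable t (I t) &
      exists G : nat -> simple,
        [/\ forall j, simple_wf (G j),
            forall e : R, 0 < e ->
              P [set w | (e%:E <= \int[mu]_(s in `[0%R, T])
                           (sqnorm (simple_val (G j) s w - H s w))%:E)%E]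
              @[j --> \oo] --> 0%E &
            forall e : R, 0 < e ->
              P [set w | exists2 s : R, 0 <= s <= T &
                           e <= `|simple_int (G j) s w - I s w|]
              @[j --> \oo] --> 0%E]].

(* A version of t |-> int_0^t H_s^tr dB_s (it is unique up to
   indistinguishability; junk value 0 if H is not integrable). *)
Definition ito (H : R -> Omega -> 'cV[R]_m) : R -> Omega -> R :=
  xget (fun _ _ => 0) [set I | is_ito_integral H I].

(* Solutions of Y_t = F + int_t^T f(s, Y_s, Z_s) ds - int_t^T Z_s^tr dB_s. *)
Definition bsde_solution (F : Omega -> R)
    (f : R -> Omega -> R -> 'cV[R]_m -> R)
    (Y : R -> Omega -> R) (Z : R -> Omega -> 'cV[R]_m) : Prop :=
  [/\ predictable Y /\ predictable_mx Z,
      forall w, {within `[0, T], continuous (fun t : R => Y t w)},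
      {ae P, forall w, (\int[mu]_(t in `[0%R, T]) (sqnorm (Z t w))%:E < +oo)%E},
      {ae P, forall w,
         (\int[mu]_(t in `[0%R, T]) (`|f t w (Y t w) (Z t w)|)%:E < +oo)%E} &
      {ae P, forall w, forall t : R, 0 <= t <= T ->
         Y t w = F w + \int[mu]_(s in `[t, T]) f s w (Y s w) (Z s w)
                 - (ito Z T w - ito Z t w)}].

Definition bsde_class (a e : R) (Y : R -> Omega -> R)
    (Z : R -> Omega -> 'cV[R]_m) : Prop :=
  (\int[P]_w
     ((expR (a * sup [set Num.max (Y t w) 0 | t in `[0%R, T]]))%:E
      + (expR (e * sup [set Num.max (- Y t w) 0 | t in `[0%R, T]]))%:E
      + \int[mu]_(t in `[0%R, T]) (sqnorm (Z t w))%:E) < +oo)%E.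

End processes.

Section market.
Variables (R : realType) (disp : measure_display) (Omega : measurableType disp).
Variables (P : probability Omega R) (T : R) (d m : nat).
Variable B : R -> Omega -> 'cV[R]_m.
Variables (b : R -> Omega -> 'cV[R]_d) (sigma : R -> Omega -> 'M[R]_(d, m)).
Variables (alpha beta lambda : R) (C : set 'cV[R]_d).

Local Notation mu := (@lebesgue_measure R).

Definition theta (t : R) (w : Omega) : 'cV[R]_m :=
  (sigma t w)^T *m invmx (sigma t w *m (sigma t w)^T) *m b t w.

(* The solution of h(t) = 1 - int_t^T beta h(s)^2 ds. *)
Definition h (t : R) : R := (1 + beta * (T - t))^-1.

Definition hsigmaC (t : R) (w : Omega) : set 'cV[R]_m :=
  [set h t *: ((sigma t w)^T *m p) | p in C].

(* The infimum is a minimum: C is closed and nonempty, and sigma^tr is injective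
   as sigma sigma^tr is invertible. *)
Definition generator (t : R) (w : Omega) (y : R) (z : 'cV[R]_m) : R :=
  alpha / 2 * inf [set sqnorm (h t *: ((sigma t w)^T *m p)
                               - (z + alpha^-1 *: theta t w)) | p in C]
  - dotv z (theta t w) - (2 * alpha)^-1 * sqnorm (theta t w)
  - beta * h t * y
  - beta * h t / alpha * (ln (beta * h t / lambda) - 1).

Definition wealth (x : R) (pi : R -> Omega -> 'cV[R]_d) (c : R -> Omega -> R)
    (t : R) (w : Omega) : R :=
  x + ito P T B (fun u w => (sigma u w)^T *m pi u w) t w
  + \int[mu]_(u in `[0, t]) dotv ((sigma u w)^T *m pi u w) (theta u w)
  - \int[mu]_(u in `[0, t]) (beta * c u w).

(* The admissible set depends on the first component Y of the BSDE solution
   and, through the wealth, on x. *)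
Definition admissible (Y : R -> Omega -> R) (x : R) :
    set ((R -> Omega -> 'cV[R]_d) * (R -> Omega -> R)) :=
  [set pc | let: (pi, c) := pc in
    [/\ predictable_mx P T B pi /\ predictable P T B c,
        {ae P, forall w, (\int[mu]_(t in `[0%R, T])
           (sqnorm ((sigma t w)^T *m pi t w))%:E < +oo)%E} /\
        {ae P, forall w, (\int[mu]_(t in `[0%R, T]) (`|c t w|)%:E < +oo)%E},
        forall t : R, 0 <= t <= T -> {ae P, forall w, C (pi t w)},
        (\int[P]_w \int[mu]_(u in `[0%R, T]) (expR (- alpha * c u w))%:E
           < +oo)%E &
        unif_integrable P
          [set fun w => expR (- alpha * h (tau w) * wealth x pi c (tau w) w)
                        * expR (alpha * Y (tau w) w)
            | tau in stopping_time P T B]]].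

Definition objective (F : Omega -> R) (x : R)
    (pi : R -> Omega -> 'cV[R]_d) (c : R -> Omega -> R) : \bar R :=
  (\int[P]_w ((- expR (- alpha * (wealth x pi c T w - F w)))%:E
     - \int[mu]_(u in `[0%R, T]) (lambda * expR (- alpha * c u w))%:E))%E.

Definition value (F : Omega -> R) (Y : R -> Omega -> R) (x : R) : \bar R :=
  ereal_sup [set objective F x pc.1 pc.2 | pc in admissible Y x].

End market.

(* Main.v *)
Require Import Defs.
From HB Require Import structures.
From mathcomp Require Import all_boot all_order all_algebra.
From mathcomp Require Import all_classical all_reals all_analysis.
From mathcomp Require Import measurable_realfun ring lra.

Set Implicit Arguments.
Unset Strict Implicit.
Unset Printing Implicit Defensive.

Import Order.TTheory GRing.Theory Num.Theory.
Import numFieldNormedType.Exports.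
Local Open Scope classical_set_scope.
Local Open Scope ring_scope.

(* Put [S = exp (- alpha (h X - Y))].  Ito's formula reduces to integration by parts
   of the deterministic [h] with the wealth [X], because
   [- alpha (h X - Y)] is an Ito integral [N] of [L = - alpha (h sigma^T pi - Z)]
   plus an absolutely continuous part; writing [M = exp (N - 1/2 int |L|^2)] one
   gets [S = S_0 M exp (- int a)], and the definition of the generator (with the
   Fenchel inequality for the consumption) says exactly that
   [a <= lambda exp (- alpha C) / S], with equality for the candidate.  Hence
   [S_0 M_t <= S_t + M_t int_0^t lambda exp (- alpha C) / M].  Along stopping times
   that bound [int |L|^2], [M] has mean one, so [S_0 <= E S + E int lambda exp
   (- alpha C)], and uniform integrability removes the localisation.

   For the candidate, [S = S_0 M exp (- int beta h)], and the only difficulty is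
   uniform integrability, i.e. a bound on [E (M ln^+ M)] at stopping times.  Since
   [0] lies in the constraint set, [q . (Z + theta / alpha - q) >= 0] for the
   projection [q]; this gives [ln M / h <= alpha Y / h + c - alpha G + beta int ln^- M]
   where [G] is a martingale under [M dP], and Young's inequality with
   [E exp (p alpha Y^+) < oo], [p >= 2], concludes.

   The stochastic integral is constructed from the definition: the exponential
   martingales of simple integrands and Ville's inequality give the control in
   probability that makes simple integrals converge. *)

(** * Nonnegative integrals *)

(** The process [ito] is a chosen limit of simple integrals, so every fact about it is brought back
    to simple integrands; neither conditional expectations nor changes of measure are used. A
    martingale property is always an identity of integrals against nonnegative weights known at the
    earlier time, and Tonelli's theorem then moves the exponential inside a time integral, so that
    [E (M_t int k)] becomes [E int M_s k_s]. The mean of [G] under [M dP] is read off from a second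
    stochastic exponential, with integrand [L - eta sigma^T pi], to first order in [eta]; the choice
    [eta = alpha / n] at bracket level [n] turns the second-order error into a constant. The factor
    [1 / h] multiplies both [ln M] and [alpha Y], so Young's inequality with [1 / p <= 1 / 2] keeps
    at least half of [M ln^+ M], up to constants. Further obstacles: the constraint is given only at
    each fixed time, up to null sets; the generator contains an infimum, predictable thanks to a
    measurable minimiser; the optimal consumption is defined by feedback on its own wealth; and
    [Y_0] is constant because events of time 0 are trivial. *)

Section ge0_integral_EFin.
Context (d : measure_display) (T : measurableType d) (R : realType).
Variable mu : {measure set T -> \bar R}.
Implicit Types f g : T -> R.

Lemma le_integral_EFin f g : measurable_fun setT f -> measurable_fun setT g ->
  (forall w, 0 <= f w) -> (forall w, f w <= g w) ->
  (\int[mu]_w (f w)%:E <= \int[mu]_w (g w)%:E)%E.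
Proof.
move=> mf mg f0 fg; apply: ge0_le_integral => //.
- by move=> w _; rewrite lee_fin.
- exact/measurable_EFinP.
- exact/measurable_EFinP.
- by move=> w _; rewrite lee_fin.
Qed.

Lemma integralD_EFin f g : measurable_fun setT f -> measurable_fun setT g ->
  (forall w, 0 <= f w) -> (forall w, 0 <= g w) ->
  (\int[mu]_w (f w + g w)%:E = \int[mu]_w (f w)%:E + \int[mu]_w (g w)%:E)%E.
Proof.
move=> mf mg f0 g0; under eq_integral do rewrite EFinD.
rewrite ge0_integralD//.
- by move=> w _; rewrite lee_fin.
- exact/measurable_EFinP.
- by move=> w _; rewrite lee_fin.
- exact/measurable_EFinP.
Qed.

Lemma integralZ_EFin (k : R) f : measurable_fun setT f ->
  (forall w, 0 <= f w) -> 0 <= k ->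
  (\int[mu]_w (k * f w)%:E = k%:E * \int[mu]_w (f w)%:E)%E.
Proof.
move=> mf f0 k0; under eq_integral do rewrite EFinM.
rewrite ge0_integralZl//.
- exact/measurable_EFinP.
- by move=> w _; rewrite lee_fin.
Qed.

Lemma ae_eq_integral_EFin f g : measurable_fun setT f -> measurable_fun setT g ->
  {ae mu, forall w, f w = g w} ->
  (\int[mu]_w (f w)%:E = \int[mu]_w (g w)%:E)%E.
Proof.
move=> mf mg fg; apply: ae_eq_integral => //.
- exact/measurable_EFinP.
- exact/measurable_EFinP.
- by apply: filterS fg => w -> .
Qed.

Lemma ae_le_integral_EFin f g : measurable_fun setT f -> measurable_fun setT g ->
  (forall w, 0 <= f w) -> (forall w, 0 <= g w) -> {ae mu, forall w, f w <= g w} ->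
  (\int[mu]_w (f w)%:E <= \int[mu]_w (g w)%:E)%E.
Proof.
move=> mf mg f0 g0 fg; apply: ae_ge0_le_integral => //.
- by move=> w _; rewrite lee_fin.
- exact/measurable_EFinP.
- by move=> w _; rewrite lee_fin.
- exact/measurable_EFinP.
- by apply: filterS fg => w fgw _; rewrite lee_fin.
Qed.

Lemma integral_EFin_setI (A : set T) f : measurable A ->
  (\int[mu]_(w in A) (f w)%:E = \int[mu]_w (\1_A w * f w)%:E)%E.
Proof.
move=> mA; rewrite integral_mkcond; apply: eq_integral => w _.
rewrite /patch indicE; case: (w \in A); first by rewrite mul1r.
by rewrite mul0r.
Qed.

End ge0_integral_EFin.

(** * Passage to the limit under the expectation *)

Section vitali.
Context (R : realType) (d : measure_display) (Om : measurableType d).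
Variable P : probability Om R.

(** This is [unif_integrable] for the range of a sequence of nonnegative functions, hence without
    absolute values. *)
Definition uint (f_ : nat -> Om -> R) := forall e : R, 0 < e -> exists K : R,
  forall n, (\int[P]_(w in [set w | (K <= f_ n w)%R]) (f_ n w)%:E <= e%:E)%E.

Let mmin (f : Om -> R) (K : R) : measurable_fun setT f ->
  measurable_fun setT (fun w => Num.min (f w) K).
Proof. by move=> mf; apply: measurable_minr. Qed.

Let min0 (f : Om -> R) (K : nat) : (forall w, 0 <= f w) ->
  forall w, 0 <= Num.min (f w) K%:R.
Proof. by move=> f0 w; rewrite le_min f0/=. Qed.

(** The truncations [min f K] increase to [f], so monotone convergence turns a bound uniform in [K]
    into a bound for [f]. Later limits can thus be taken on bounded functions. *)
Lemma integral_minr_cvg (f : Om -> R) : measurable_fun setT f ->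
  (forall w, 0 <= f w) -> forall c : \bar R,
  (forall K : nat, \int[P]_w (Num.min (f w) K%:R)%:E <= c)%E ->
  (\int[P]_w (f w)%:E <= c)%E.
Proof.
move=> mf f0 c H.
have nd w n k : (n <= k)%N -> Num.min (f w) n%:R <= Num.min (f w) k%:R.
  by move=> nk; rewrite le_min !ge_min lexx/= ler_nat nk orbT.
have -> : (\int[P]_w (f w)%:E =
    limn (fun n => \int[P]_w (Num.min (f w) n%:R)%:E))%E.
  rewrite -monotone_convergence//.
  - apply: eq_integral => w _; apply/esym/cvg_lim => //.
    apply: cvg_near_cst; near=> n.
    rewrite min_l//; near: n.
    exact: nbhs_infty_ger.
  - by move=> n; apply/measurable_EFinP; apply: mmin.
  - by move=> n w _; rewrite lee_fin min0.
  - by move=> w _ n k nk; rewrite lee_fin nd.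
apply: lime_le; last by apply: nearW.
apply: ereal_nondecreasing_is_cvgn => n k nk.
by apply: le_integral_EFin; [exact: mmin|exact: mmin|exact: min0|move=> w; exact: nd].
Unshelve. all: by end_near. Qed.

(** At a fixed truncation level the constant [K] dominates, and constants are integrable under a
    probability. *)
Lemma integral_minr_cvg_ae (f_ : nat -> Om -> R) (f : Om -> R) (K : nat) :
  (forall n, measurable_fun setT (f_ n)) -> measurable_fun setT f ->
  (forall n w, 0 <= f_ n w) ->
  {ae P, forall w, f_ n w @[n --> \oo] --> f w} ->
  (\int[P]_w (Num.min (f_ n w) K%:R)%:E @[n --> \oo] -->
   \int[P]_w (Num.min (f w) K%:R)%:E)%E.
Proof.
move=> mf_ mf f0 cf.
have [//|||||//] := @dominated_convergence _ _ _ P setT measurableT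
   (fun n w => (Num.min (f_ n w) K%:R)%:E) (fun w => (Num.min (f w) K%:R)%:E)
   (fun=> K%:R%:E).
- by move=> n; apply/measurable_EFinP; apply: measurable_minr.
- by apply/measurable_EFinP; apply: measurable_minr.
- apply: filterS cf => w cw _.
  apply/fine_cvgP; split; first by apply: nearW.
  apply: (cvg_comp (fun n => f_ n w) (fun x => Num.min x K%:R)); first exact: cw.
  apply: (@continuous_min _ R^o id (cst K%:R)) => //; last exact: cvg_cst.
- exact: finite_measure_integrable_cst.
- apply: aeW => w n _; rewrite lee_fin ger0_norm ?ge_min ?lexx ?orbT//.
  by rewrite le_min f0/=.
Qed.

(* With bounded truncations, dominated convergence replaces both Fatou's lemma
   for [f_] and Vitali's theorem for [g_]. *)
Lemma le_integral_vitali (f_ g_ : nat -> Om -> R) (f g : Om -> R) :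
  (forall n, measurable_fun setT (f_ n)) -> measurable_fun setT f ->
  (forall n, measurable_fun setT (g_ n)) -> measurable_fun setT g ->
  (forall n w, 0 <= f_ n w) -> (forall w, 0 <= f w) ->
  (forall n w, 0 <= g_ n w) -> (forall w, 0 <= g w) ->
  {ae P, forall w, f_ n w @[n --> \oo] --> f w} ->
  {ae P, forall w, g_ n w @[n --> \oo] --> g w} ->
  uint g_ ->
  (forall n, \int[P]_w (f_ n w)%:E <= \int[P]_w (g_ n w)%:E)%E ->
  (\int[P]_w (f w)%:E <= \int[P]_w (g w)%:E)%E.
Proof.
move=> mf_ mf mg_ mg f_0 f0 g_0 g0 cf cg ug fg.
apply: (integral_minr_cvg mf f0) => K.
apply/lee_addgt0Pr => e e0.
have [K' HK'] := ug e e0.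
(* A natural number above [K'], as truncations are indexed by [nat]. Pointwise [g_ n] is at most
   [min (g_ n) N] plus [g_ n] on the set [K' <= g_ n], and the last part has integral at most
   [e]. *)
pose N := (Num.truncn K').+1.
have NK' : K' <= N%:R by apply/ltW/truncnS_gt.
have H n : (\int[P]_w (Num.min (f_ n w) K%:R)%:E <=
   \int[P]_w (Num.min (g_ n w) N%:R)%:E + e%:E)%E.
  apply: (@le_trans _ _ (\int[P]_w (f_ n w)%:E)%E).
    apply: le_integral_EFin => //; [exact: mmin|exact: min0|].
    by move=> w; rewrite ge_min lexx.
  apply: (le_trans (fg n)); apply: (le_trans _ (leeD2l _ (HK' n))).
  have mS : measurable [set w | K' <= g_ n w].
    by rewrite -[X in measurable X]setTI; apply: measurable_fun_le.
  rewrite (integral_EFin_setI _ _ mS) -integralD_EFin//; last 4 first.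
  - exact: mmin.
  - by apply: measurable_funM => //; exact: measurable_indic.
  - exact: min0.
  - by move=> w; rewrite mulr_ge0.
  apply: le_integral_EFin => //.
  - apply: measurable_funD; first exact: mmin.
    by apply: measurable_funM => //; exact: measurable_indic.
  - move=> w; rewrite indicE; have [|] := boolP (w \in _).
      by move=> _; rewrite mul1r lerDr min0.
    rewrite notin_setE/= => /negP; rewrite -ltNge => gK.
    by rewrite mul0r addr0 le_min lexx/= ltW// (lt_le_trans gK)// ltW.
have := @integral_minr_cvg_ae f_ f K mf_ mf f_0 cf.
have := @integral_minr_cvg_ae g_ g N mg_ mg g_0 cg.
set b := (X in _ --> X -> _); set a := (X in _ -> _ --> X -> _) => cb ca.
have ab : (a <= b + e%:E)%E.
  have ca' : ((\int[P]_w (Num.min (g_ n w) N%:R)%:E + e%:E) @[n --> \oo] --> b + e%:E)%E.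
    by apply: cvgeD; [rewrite fin_num_adde_defl|exact: cb|exact: cvg_cst].
  rewrite -(cvg_lim _ ca)// -(cvg_lim _ ca')//.
  apply: lee_lim; [by apply/cvg_ex; exists a|by apply/cvg_ex; eexists; exact: ca'|].
  exact: nearW.
apply: (le_trans ab); rewrite leeD2r//.
apply: le_integral_EFin => //; [exact: mmin|exact: min0|].
by move=> w; rewrite ge_min lexx.
Qed.

(** First Borel-Cantelli lemma: the bounds [2^-(n+1)] are summable, so almost every point eventually
    leaves the sets [E n] for good. *)
Lemma ae_cvg_of_small_sets (f_ : nat -> Om -> R) (f : Om -> R) (E : nat -> set Om) :
  (forall n, measurable (E n)) -> (forall n, P (E n) <= ((2^-1) ^+ n.+1)%:E)%E ->
  (forall n w, ~ E n w -> `|f_ n w - f w| <= (2^-1) ^+ n.+1) ->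
  {ae P, forall w, f_ n w @[n --> \oo] --> f w}.
Proof.
move=> mE PE H.
exists (lim_sup_set E); split.
- by apply: bigcapT_measurable => n; apply: bigcup_measurable.
- apply: lim_sup_set_cvg0 => //.
  apply: (@le_lt_trans _ _ (\sum_(n <oo) ((2^-1) ^+ n.+1)%:E)%E).
    by apply: lee_nneseries => // n *; exact: PE.
  apply: (le_lt_trans _ (le_lt_trans (@epsilon_trick0 R 1 xpredT ler01) (ltry _))).
  apply: lee_nneseries => [n *|n *]; first by rewrite lee_fin exprn_ge0.
  by rewrite lee_fin div1r natrX exprVn lexx.
- move=> w /= Hw n _.
  apply: contrapT => nE; apply: Hw.
  have {}nE : forall j, (n <= j)%N -> ~ E j w.
    by move=> j nj Ej; apply: nE; exists j.
  apply/subr_cvg0/norm_cvg0P.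
  apply: (@squeeze_cvgr _ _ _ _ (fun=> 0) (fun n => (2^-1) ^+ n.+1)).
  - near=> k; rewrite normr_ge0/=; apply: H; apply: nE; near: k.
    exact: nbhs_infty_ge.
  - exact: cvg_cst.
  - rewrite (cvg_shiftS (fun n => (2^-1 : R) ^+ n : R^o)); apply: cvg_expr.
    by rewrite ger0_norm// invf_lt1// ltr1n.
Unshelve. all: by end_near. Qed.

End vitali.

(** The formula [x * exp (- ln (x ^+ 2))] also agrees with the total inverse at 0, where the factor
    [x] makes both sides vanish. *)
Lemma measurable_invr (R : realType) : measurable_fun setT (@GRing.inv R).
Proof.
have -> : @GRing.inv R = (fun x => x * expR (- ln (x ^+ 2))).
  apply/funext => x; have [->|x0] := eqVneq x 0; first by rewrite invr0 mul0r.
  rewrite expRN lnK ?posrE ?exprn_even_gt0//.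
  by field.
apply: measurable_funM => //; apply: measurableT_comp => //.
by apply: measurable_funN; apply: measurableT_comp => //; exact: measurable_funX.
Qed.

(** * Measurability with respect to a sub-sigma-algebra *)

Section gmeas.
Context (R : realType) (T : pointedType) (G : set (set T)).
Hypothesis sG : sigma_algebra setT G.
Implicit Types X Y : T -> R.

(** Stated for a bare set of sets, so that it is convertible with [filt_measurable t] when [G] is
    [filt t], and also covers the predictable sigma-algebra. [gmeasP] passes to
    [g_sigma_algebraType] to inherit the usual closure properties. *)
Definition gmeas (X : T -> R) := forall U : set R, measurable U -> G (X @^-1` U).

Local Notation GT := (g_sigma_algebraType G).

Lemma gsetE (A : set T) : (measurable : set (set GT)) A = G A.
Proof. by rewrite measurable_g_measurableTypeE. Qed.

Lemma gmeasP X : gmeas X <-> measurable_fun (setT : set GT) (X : GT -> R).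
Proof.
split => [mX _ U mU|mX U mU]; rewrite -?gsetE.
  by rewrite setTI gsetE; exact: mX.
by have := mX measurableT U mU; rewrite setTI.
Qed.

Lemma gsetT : G setT. Proof. by rewrite -gsetE; exact: measurableT. Qed.
Lemma gset0 : G set0. Proof. by rewrite -gsetE; exact: measurable0. Qed.
Lemma gsetC A : G A -> G (~` A).
Proof. by rewrite -!gsetE; exact: measurableC. Qed.
Lemma gsetI A B : G A -> G B -> G (A `&` B).
Proof. by rewrite -!gsetE; exact: measurableI. Qed.
Lemma gsetU A B : G A -> G B -> G (A `|` B).
Proof. by rewrite -!gsetE; exact: measurableU. Qed.
Lemma gsetD A B : G A -> G B -> G (A `\` B).
Proof. by rewrite -!gsetE; exact: measurableD. Qed.
Lemma gset_bigcup (F : nat -> set T) : (forall n, G (F n)) -> G (\bigcup_n F n).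
Proof.
move=> GF; rewrite -gsetE; apply: bigcupT_measurable => n; rewrite gsetE; exact: GF.
Qed.
Lemma gset_bigcap (F : nat -> set T) : (forall n, G (F n)) -> G (\bigcap_n F n).
Proof.
move=> GF; rewrite -gsetE; apply: bigcapT_measurable => n; rewrite gsetE; exact: GF.
Qed.

Lemma gmeas_cst (k : R) : gmeas (fun=> k).
Proof. exact/gmeasP. Qed.
Lemma gmeasD X Y : gmeas X -> gmeas Y -> gmeas (fun z => X z + Y z).
Proof. by move=> /gmeasP ? /gmeasP ?; apply/gmeasP; exact: measurable_funD. Qed.
Lemma gmeasN X : gmeas X -> gmeas (fun z => - X z).
Proof. by move=> /gmeasP ?; apply/gmeasP; exact: measurable_funN. Qed.
Lemma gmeasB X Y : gmeas X -> gmeas Y -> gmeas (fun z => X z - Y z).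
Proof. by move=> /gmeasP ? /gmeasP ?; apply/gmeasP; exact: measurable_funB. Qed.
Lemma gmeasM X Y : gmeas X -> gmeas Y -> gmeas (fun z => X z * Y z).
Proof. by move=> /gmeasP ? /gmeasP ?; apply/gmeasP; exact: measurable_funM. Qed.
Lemma gmeas_comp (f : R -> R) X : measurable_fun setT f -> gmeas X ->
  gmeas (fun z => f (X z)).
Proof. by move=> mf /gmeasP ?; apply/gmeasP; exact: measurableT_comp. Qed.
Lemma gmeasX n X : gmeas X -> gmeas (fun z => X z ^+ n).
Proof. by move=> /gmeasP ?; apply/gmeasP; exact: measurable_funX. Qed.
Lemma gmeasV X : gmeas X -> gmeas (fun z => (X z)^-1).
Proof. by apply: gmeas_comp; exact: measurable_invr. Qed.
Lemma gmeas_expR X : gmeas X -> gmeas (fun z => expR (X z)).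
Proof. by apply: gmeas_comp; exact: measurable_expR. Qed.
Lemma gmeas_max X Y : gmeas X -> gmeas Y -> gmeas (fun z => Num.max (X z) (Y z)).
Proof. by move=> /gmeasP ? /gmeasP ?; apply/gmeasP; exact: measurable_maxr. Qed.
Lemma gmeas_sum (I : Type) (s : seq I) (Q : pred I) (F : I -> T -> R) :
  (forall i, Q i -> gmeas (F i)) -> gmeas (fun z => \sum_(i <- s | Q i) F i z).
Proof.
move=> mF; elim: s => [|a s IH].
  by under eq_fun do rewrite big_nil; exact: gmeas_cst.
under eq_fun do rewrite big_cons.
by have [Qa|] := boolP (Q a) => //; apply: gmeasD => //; exact: mF.
Qed.
Lemma gmeas_prod (I : Type) (s : seq I) (Q : pred I) (F : I -> T -> R) :
  (forall i, Q i -> gmeas (F i)) -> gmeas (fun z => \prod_(i <- s | Q i) F i z).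
Proof.
move=> mF; elim: s => [|a s IH].
  by under eq_fun do rewrite big_nil; exact: gmeas_cst.
under eq_fun do rewrite big_cons.
by have [Qa|] := boolP (Q a) => //; apply: gmeasM => //; exact: mF.
Qed.
Lemma gmeas_indic A : G A -> gmeas (\1_A).
Proof.
move=> GA; apply/gmeasP; apply: measurable_indic; by rewrite gsetE.
Qed.
Lemma gmeas_cvg (X_ : nat -> T -> R) X : (forall n, gmeas (X_ n)) ->
  (forall z, X_ n z @[n --> \oo] --> X z) -> gmeas X.
Proof.
move=> mX cX; apply/gmeasP.
apply: (@measurable_fun_cvg _ GT R setT X_ X) => [n|z _]; last exact: cX.
by apply/gmeasP; exact: mX.
Qed.
Lemma gset_le X Y : gmeas X -> gmeas Y -> G [set z | X z <= Y z].
Proof.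
move=> /gmeasP mX /gmeasP mY; rewrite -gsetE.
by have := measurable_fun_le measurableT mX mY; rewrite setTI.
Qed.
Lemma gset_lt X Y : gmeas X -> gmeas Y -> G [set z | X z < Y z].
Proof.
move=> mX mY; have -> : [set z | X z < Y z] = ~` [set z | Y z <= X z].
  by apply/seteqP; split => z /=; rewrite ltNge; move/negP.
exact/gsetC/gset_le.
Qed.
Lemma gmeas_if A X Y : G A -> gmeas X -> gmeas Y ->
  gmeas (fun z => if z \in A then X z else Y z).
Proof.
move=> GA mX mY.
have -> : (fun z => if z \in A then X z else Y z) =
  (fun z => \1_A z * X z + (1 - \1_A z) * Y z).
  apply/funext => z; rewrite indicE.
  by case: ifP => _; rewrite ?mul1r ?mul0r ?subrr ?subr0 ?mul0r ?mul1r ?addr0 ?add0r.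
by apply: gmeasD; apply: gmeasM => //; try apply: gmeasB => //;
  try exact: gmeas_cst; exact: gmeas_indic.
Qed.

End gmeas.

(** * Dyadic grids of [0, T] *)

Section grid.
Context (R : realType) (T : R) (T0 : 0 < T).

Definition grid (n k : nat) : R := T * k%:R / 2 ^+ n.

Lemma grid0 n : grid n 0 = 0. Proof. by rewrite /grid mulr0 mul0r. Qed.
Lemma gridT n : grid n (2 ^ n) = T.
Proof. by rewrite /grid natrX mulfK// expf_neq0. Qed.
Lemma grid_lt n i j : (grid n i < grid n j) = (i < j)%N.
Proof. by rewrite /grid ltr_pM2r ?invr_gt0 ?exprn_gt0// ltr_pM2l// ltr_nat. Qed.
Lemma grid_le n i j : (grid n i <= grid n j) = (i <= j)%N.
Proof. by rewrite leNgt grid_lt -leqNgt. Qed.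
Lemma grid_ge0 n i : 0 <= grid n i.
Proof. by rewrite -(grid0 n) grid_le. Qed.
Lemma grid_leT n i : (i <= 2 ^ n)%N -> grid n i <= T.
Proof. by rewrite -(grid_le n) gridT. Qed.
Lemma gridS n i : grid n i.+1 = grid n i + T / 2 ^+ n.
Proof. by rewrite /grid -natr1 mulrDr mulr1 mulrDl. Qed.
Lemma grid_refine n j k : grid (n + j) (k * 2 ^ j) = grid n k.
Proof.
rewrite /grid natrM natrX exprD; field.
by rewrite !expf_neq0.
Qed.

Lemma mesh_gt0 n : 0 < T / 2 ^+ n.
Proof. by rewrite divr_gt0// exprn_gt0. Qed.

Lemma mesh_le n k : (n <= k)%N -> T / 2 ^+ k <= T / 2 ^+ n.
Proof.
by move=> nk; rewrite ler_pM2l// lef_pV2 ?posrE ?exprn_gt0// ler_eXn2l// ltr1n.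
Qed.

Lemma mesh_cvg0 : (T / 2 ^+ n @[n --> \oo] --> (0 : R)).
Proof.
have : T * (2^-1) ^+ n @[n --> \oo] --> T * 0.
  apply: cvgM; first exact: cvg_cst.
  by apply: cvg_expr; rewrite ger0_norm// invf_lt1// ltr1n.
by rewrite mulr0; under eq_fun do rewrite exprVn.
Qed.

Lemma mesh_small (e : R) : 0 < e -> exists n, T / 2 ^+ n < e.
Proof.
move=> e0; have /cvgrPdist_lt/(_ e e0)[n _ H] := mesh_cvg0.
exists n; have := H n (leqnn n).
by rewrite sub0r normrN ger0_norm// ltW// mesh_gt0.
Qed.

(** Cells are open on the left and closed on the right, like simple integrands, so time 0 lies in no
    cell. The index is one less than the least [j] with [t <= grid T n j]. *)
Lemma grid_cell n (t : R) : 0 < t <= T -> exists k, (k < 2 ^ n)%N /\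
  grid n k < t <= grid n k.+1.
Proof.
move=> /andP[t0 tT].
have ex : exists j, t <= grid n j by exists (2 ^ n)%N; rewrite gridT.
case: (ex_minnP ex) => -[|k] tk mk.
  by move: tk; rewrite grid0 leNgt t0.
exists k; split; first by apply: mk; rewrite gridT.
by rewrite tk andbT ltNge; apply/negP => /mk; rewrite ltnn.
Qed.

Lemma grid_cell_sum (V : nmodType) n (t : R) (k : nat) (f : nat -> V) :
  (k < 2 ^ n)%N -> grid n k < t <= grid n k.+1 ->
  \sum_(i < 2 ^ n) (if grid n i < t <= grid n i.+1 then f i else 0) = f k.
Proof.
move=> kn tk; rewrite (bigD1 (Ordinal kn))//= tk big1 ?addr0// => i.
rewrite -val_eqE/= => ik; case: ifP => // /andP[it ti].
move: tk => /andP[kt tk]; move: ik; rewrite neq_ltn => /orP[ik|ki].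
  by have := lt_le_trans kt ti; rewrite grid_lt ltnS leqNgt ik.
by have := lt_le_trans it tk; rewrite grid_lt ltnS leqNgt ki.
Qed.

End grid.

(** * Filtration and predictable processes *)

Section filtration.
Context (R : realType) (disp : measure_display) (Omega : measurableType disp).
Context (P : probability Omega R) (T : R) (m : nat).
Variable B : R -> Omega -> 'cV[R]_m.
Hypotheses (T0 : 0 < T) (hP : measure_is_complete P).
Hypothesis hB : brownian_motion P T B.

Local Notation filt := (filt P B).
Local Notation filt_measurable := (filt_measurable P B).
Local Notation predictable := (predictable P T B).

Lemma sigma_filt t : sigma_algebra setT (filt t).
Proof. exact: smallest_sigma_algebra. Qed.
Hint Resolve sigma_filt : core.

Lemma filt_mono s t : s <= t -> filt s `<=` filt t.
Proof.
move=> st; apply: sub_sigma_algebra2 => A [[u [i [U [/andP[u0 us] mU ->]]]]|nA].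
  by left; exists u, i, U; split => //; rewrite u0 (le_trans us).
by right.
Qed.

Lemma filt_negligible t A : P.-negligible A -> filt t A.
Proof. by move=> nA; apply: sub_sigma_algebra; right. Qed.

(** The augmenting null sets are measurable because [P] is complete; [t <= T] appears because [B] is
    only known to be measurable at times of [[0, T]]. *)
Lemma filt_sub_measurable t : t <= T -> filt t `<=` measurable.
Proof.
move=> tT; apply: smallest_sub; first exact: sigma_algebra_measurable.
move=> A [[u [i [U [/andP[u0 us] mU ->]]]]|nA]; last exact: hP.
have [+ _ _ _] := hB => /(_ u i); rewrite u0 (le_trans us tT) => /(_ isT) mBu.
by rewrite -[X in measurable X]setTI; exact: mBu.
Qed.

Lemma filt_ae t A A' : filt t A -> P.-negligible (A `\` A') ->
  P.-negligible (A' `\` A) -> filt t A'.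
Proof.
move=> FA n1 n2; have -> : A' = (A `\` (A `\` A')) `|` (A' `\` A).
  apply/seteqP; split => w /=.
    by move=> A'w; have [Aw|nAw] := pselect (A w); [left; split => // -[]|right].
  by move=> [[Aw /not_andP[//|/contrapT]]|[]].
apply: (gsetU (sigma_filt t)); last exact: filt_negligible.
by apply: (gsetD (sigma_filt t)) => //; exact: filt_negligible.
Qed.

Lemma filt_measurable_ae t (X X' : Omega -> R) : filt_measurable t X ->
  {ae P, forall w, X w = X' w} -> filt_measurable t X'.
Proof.
move=> mX XX' U mU; apply: (filt_ae (mX U mU)).
  by apply: negligibleS XX' => w [/= UX nUX'] XX'; apply: nUX'; rewrite -XX'.
by apply: negligibleS XX' => w [/= UX nUX'] XX'; apply: nUX'; rewrite XX'.
Qed.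

Lemma filt_measurable_mono s t (X : Omega -> R) : s <= t ->
  filt_measurable s X -> filt_measurable t X.
Proof. by move=> st mX U mU; apply: (filt_mono st); exact: mX. Qed.

Lemma filt_measurableT t (X : Omega -> R) : t <= T ->
  filt_measurable t X -> measurable_fun setT X.
Proof.
by move=> tT mX _ U mU; rewrite setTI; apply: (filt_sub_measurable tT); exact: mX.
Qed.

(** [predictable_sets] is a sigma-algebra on the strip [[0, T] x Omega]. Asking only for a
    predictable trace on the strip extends it to all of [R * Omega], where the [gmeas] lemmas apply;
    membership ignores what happens outside [[0, T]]. *)
Definition pred_alg : set (set (R * Omega)) :=
  [set A | predictable_sets P T B (A `&` (`[0, T]%classic `*` setT))].

Lemma pred_algE A : pred_alg A = predictable_sets P T B (A `&` (`[0, T]%classic `*` setT)).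
Proof. by []. Qed.

Lemma sigma_predictable_sets :
  sigma_algebra (`[0, T]%classic `*` setT) (predictable_sets P T B).
Proof. exact: smallest_sigma_algebra. Qed.

Lemma sigma_pred : sigma_algebra setT pred_alg.
Proof.
have [s0 sC sU] := sigma_predictable_sets.
split; rewrite /pred_alg /=.
- by rewrite set0I.
- move=> A /= pA; rewrite setTD.
  have -> : ~` A `&` `[0, T]%classic `*` setT =
    `[0, T]%classic `*` setT `\` (A `&` `[0, T]%classic `*` setT).
    by apply/seteqP; split => z /= => [[nA ?]|[? /not_andP[|]]]; do ?split => //; move=> [].
  exact: sC.
- by move=> F pF; rewrite setI_bigcupl; exact: sU.
Qed.
Hint Resolve sigma_pred : core.

Lemma predictableP (X : R -> Omega -> R) :
  predictable X <-> gmeas pred_alg (fun z => X z.1 z.2).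
Proof.
have H U : [set z : R * Omega | 0 <= z.1 <= T /\ U (X z.1 z.2)] =
    (fun z => X z.1 z.2) @^-1` U `&` (`[0, T]%classic `*` setT).
  apply/seteqP; split => z /=; rewrite in_itv/=; first by move=> [].
  by move=> [? []].
by split => pX U mU; have := pX U mU; rewrite /pred_alg/= H.
Qed.

Lemma pred_alg_eq A A' : pred_alg A ->
  (forall t w, 0 <= t <= T -> A (t, w) <-> A' (t, w)) -> pred_alg A'.
Proof.
move=> pA AA'; rewrite /pred_alg/=.
suff <- : A `&` `[0, T]%classic `*` setT = A' `&` `[0, T]%classic `*` setT by [].
apply/seteqP; split => -[t w]/=; rewrite in_itv/= => -[Az [tT _]]; split => //.
  exact/(AA' t w).
exact/(AA' t w).
Qed.

Lemma predictable_eq (X X' : R -> Omega -> R) : predictable X ->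
  (forall t w, 0 <= t <= T -> X t w = X' t w) -> predictable X'.
Proof.
move=> /predictableP pX XX'; apply/predictableP => U mU.
by apply: (pred_alg_eq (pX U mU)) => t w tT /=; rewrite XX'.
Qed.

(** The sets whose section at [t] lies in [filt t] form a sigma-algebra containing the generators:
    the section of []s, u] x E] is either empty or [E], and in the second case [E] is known at
    [s < t]. *)
Lemma pred_section A t : 0 <= t <= T -> pred_alg A ->
  filt t [set w | A (t, w)].
Proof.
move=> /andP[t0 tT]; rewrite /pred_alg/= => pA.
have -> : [set w | A (t, w)] =
    [set w | (A `&` (`[0, T]%classic `*` setT)) (t, w)].
  by apply/seteqP; split => w /=; rewrite in_itv/= t0 tT; [|case].
move: pA; set A' := _ `&` _; move: A' => {}A.
pose H := [set A : set (R * Omega) | filt t [set w | A (t, w)]].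
suff : predictable_sets P T B `<=` H by exact.
apply: smallest_sub.
  split; rewrite /H/=.
  - exact: (gset0 (sigma_filt t)).
  - move=> E HE; rewrite (_ : [set w | _] = ~` [set w | E (t, w)]); first exact: (gsetC (sigma_filt t)).
    by apply/seteqP; split => w /=; rewrite in_itv/= t0 tT; [case|move=> nE].
  - move=> F HF; rewrite (_ : [set w | _] = \bigcup_n [set w | F n (t, w)]).
      exact: (gset_bigcup (sigma_filt t)).
    by apply/seteqP; split => w /= [n _ Fn]; exists n.
move=> _ [[E FE ->]|[s [u [E [s0 su uT FE ->]]]]]; rewrite /H/=.
  have [->|t'0] := eqVneq t 0.
    by rewrite (_ : [set w | _] = E)//; apply/seteqP; split => w //= [].
  rewrite (_ : [set w | _] = set0); first exact: (gset0 (sigma_filt t)).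
  by apply/seteqP; split => w //= [] /eqP; rewrite (negbTE t'0).
have [st|st] := boolP (s < t <= u).
  rewrite (_ : [set w | _] = E).
    by apply: (filt_mono _ FE); case/andP: st => /ltW.
  by apply/seteqP; split => w //=; rewrite in_itv/= st => -[].
rewrite (_ : [set w | _] = set0); first exact: (gset0 (sigma_filt t)).
by apply/seteqP; split => w //=; rewrite in_itv/= (negbTE st) => -[].
Qed.

Lemma predictable_adapted X t : 0 <= t <= T -> predictable X ->
  filt_measurable t (X t).
Proof. by move=> tT /predictableP pX U mU; exact: (pred_section tT (pX U mU)). Qed.

Lemma pred_measurable A : pred_alg A ->
  measurable ((A `&` (`[0, T]%classic `*` setT)) : set (measurableTypeR R * Omega)).
Proof.
rewrite /pred_alg/=; set A' := _ `&` _; move: A' => {}A.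
have mD : measurable (`[0, T]%classic `*` setT : set (measurableTypeR R * Omega)).
  by apply: measurableX.
pose H := [set A : set (R * Omega) |
  measurable (A : set (measurableTypeR R * Omega)) ].
suff : predictable_sets P T B `<=` H by exact.
apply: smallest_sub.
  split; rewrite /H/=.
  - exact: measurable0.
  - by move=> E HE; exact: measurableD.
  - by move=> F HF; exact: bigcupT_measurable.
move=> _ [[E FE ->]|[s [u [E [s0 su uT FE ->]]]]]; rewrite /H/=.
  by apply: measurableX => //; exact: (filt_sub_measurable (ltW T0)).
apply: measurableX => //; apply: (filt_sub_measurable _ FE).
exact: (le_trans (ltW su)).
Qed.

Lemma predictable_measurable X : predictable X ->
  measurable_fun (`[0, T]%classic `*` setT : set (measurableTypeR R * Omega))
    (fun z => X z.1 z.2).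
Proof.
by move=> /predictableP pX _ U mU; rewrite setIC; apply: pred_measurable; exact: pX.
Qed.

Lemma predictable_rect s u (xi : Omega -> R) : 0 <= s -> s <= u -> u <= T ->
  filt_measurable s xi ->
  predictable (fun t w => if s < t <= u then xi w else 0).
Proof.
move=> s0 su uT mxi; apply/predictableP.
have [->|s'u] := eqVneq s u.
  rewrite (_ : (fun _ => _) = fun=> 0); last first.
    apply/funext => z; case: ifP => // /andP[uz zu].
    by have := lt_le_trans uz zu; rewrite ltxx.
  exact: gmeas_cst.
have {s'u} su' : s < u by rewrite lt_neqAle s'u.
have pR E : filt s E -> pred_alg (`]s, u]%classic `*` E).
  move=> FE; rewrite /pred_alg/= (_ : _ `&` _ = `]s, u]%classic `*` E).
    by apply: sub_sigma_algebra; right; exists s, u, E.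
  apply/seteqP; split => -[t w]/=; first by case.
  rewrite !in_itv/= => -[/andP[st tu] Ew]; do ![split => //]; first by rewrite st.
  by rewrite (le_trans s0 (ltW st)) (le_trans tu).
(* The process vanishes off the rectangle, so the preimage of [U] is a rectangle, or the complement
   of one when [U] contains 0. *)
move=> U mU; have [U0|U0] := pselect (U 0).
  rewrite (_ : _ @^-1` _ = ~` (`]s, u]%classic `*` (xi @^-1` (~` U)))).
    apply: (gsetC sigma_pred); by apply: pR; apply: mxi; exact: measurableC.
  apply/seteqP; split => -[t w]/=; rewrite in_itv/=; case: ifP => // _.
  - by move=> ? [_]; exact.
  - by move=> _ [].
  - by move=> /not_andP[//|/contrapT].
rewrite (_ : _ @^-1` _ = (`]s, u]%classic `*` (xi @^-1` U))).
  by apply: pR; exact: mxi.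
apply/seteqP; split => -[t w]/=; rewrite in_itv/=; case: ifP => // _.
  by case.
by case.
Qed.

Lemma predictable_at0 (xi : Omega -> R) : filt_measurable 0 xi ->
  predictable (fun t w => if t == 0 then xi w else 0).
Proof.
move=> mxi; apply/predictableP.
have pR E : filt 0 E -> pred_alg ([set 0] `*` E).
  move=> FE; rewrite /pred_alg/= (_ : _ `&` _ = [set 0] `*` E).
    by apply: sub_sigma_algebra; left; exists E.
  apply/seteqP; split => -[t w]/=; first by case.
  by rewrite in_itv/= => -[-> ?]; rewrite lexx (ltW T0).
move=> U mU; have [U0|U0] := pselect (U 0).
  rewrite (_ : _ @^-1` _ = ~` ([set 0] `*` (xi @^-1` (~` U)))).
    apply: (gsetC sigma_pred); by apply: pR; apply: mxi; exact: measurableC.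
  apply/seteqP; split => -[t w]/=; case: eqP => // t0.
  - by move=> ? [_]; exact.
  - by move=> _ [].
  - by move=> /not_andP[//|/contrapT].
rewrite (_ : _ @^-1` _ = ([set 0] `*` (xi @^-1` U))).
  by apply: pR; exact: mxi.
apply/seteqP; split => -[t w]/=; case: eqP => // t0; first by case.
by case.
Qed.

(** The processes frozen at the left end of each dyadic cell are finite sums of predictable
    rectangles and converge by continuity of paths. Time 0, which no cell contains, contributes a
    separate term. *)
Lemma continuous_adapted_predictable (X : R -> Omega -> R) :
  (forall w, {within `[0, T], continuous (fun t : R => X t w)}) ->
  (forall t, 0 <= t <= T -> filt_measurable t (X t)) -> predictable X.
Proof.
move=> cX aX.
pose Xn n t w := (if t == 0 then X 0 w else 0) +
   \sum_(k < 2 ^ n) (if grid T n k < t <= grid T n k.+1 then X (grid T n k) w else 0).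
pose D := (`[0, T]%classic `*` setT) : set (R * Omega).
have pXn n : predictable (Xn n).
  apply/predictableP; apply: gmeasD => //.
    apply: (iffLR (predictableP (fun t w => if t == 0 then X 0 w else 0))).
    by apply: predictable_at0; apply: aX; rewrite lexx ltW.
  apply: gmeas_sum => // k _.
  apply: (iffLR (predictableP (fun t w =>
    if grid T n k < t <= grid T n k.+1 then X (grid T n k) w else 0))).
  apply: predictable_rect.
  - exact: grid_ge0.
  - by rewrite grid_le.
  - by rewrite grid_leT.
  - by apply: aX; rewrite grid_ge0// grid_leT// ltnW.
(* Convergence is required at every point of [R * Omega], hence the cut-off by the strip [D]. *)
apply: (@predictable_eq (fun t w => if (t, w) \in D then X t w else 0)); last first.
  by move=> t w tT; rewrite ifT// inE; split => //=; rewrite in_itv.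
apply/predictableP.
pose Xn' n (z : R * Omega) := if z \in D then Xn n z.1 z.2 else 0.
have pD : pred_alg D.
  rewrite /pred_alg/= setIid -[D]setD0; have [s0 sC _] := sigma_predictable_sets.
  exact: sC.
apply: (@gmeas_cvg _ _ _ sigma_pred Xn').
  move=> n; apply: gmeas_if => //; last exact: gmeas_cst.
  exact/predictableP.
move=> [t w]/=; rewrite /Xn'; case: ifPn => [|_]; last exact: cvg_cst.
rewrite inE => -[/=]; rewrite in_itv/= => /andP[t0 tT] _.
have [->|t'0] := eqVneq t 0.
  apply: cvg_near_cst; apply: nearW => n; rewrite /Xn eqxx big1 ?addr0// => k _.
  by case: ifP => // /andP[+ _]; rewrite ltNge grid_ge0.
have {}t0 : 0 < t by rewrite lt_neqAle eq_sym t'0.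
apply/cvgrPdist_lt => e e0.
have tI : `[0, T]%classic t by rewrite /= in_itv/= ltW.
have /subspace_continuousP/(_ t tI) := cX w.
move=> /cvgrPdist_lt/(_ e e0); rewrite near_withinE => -[d /= d0 Hd].
have [N HN] := mesh_small T0 d0.
near=> n.
rewrite /Xn (negbTE t'0) add0r.
have [k [kn /andP[kt tk]]] : exists k, (k < 2 ^ n)%N /\
    grid T n k < t <= grid T n k.+1 by apply: grid_cell => //; rewrite t0.
rewrite (grid_cell_sum T0 (fun i => X (grid T n i) w) kn); last by rewrite kt.
apply: Hd => /=.
  rewrite ger0_norm ?subr_ge0 ?(ltW kt)//.
  apply: le_lt_trans HN; apply: (@le_trans _ _ (T / 2 ^+ n)).
    by rewrite lerBlDl -gridS.
  by apply: (mesh_le T0); near: n; exact: nbhs_infty_ge.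
by rewrite in_itv/= grid_ge0// grid_leT// ltnW.
Unshelve. all: by end_near. Qed.

End filtration.

(** * Algebra of predictable processes *)

Section predictable_algebra.
Context (R : realType) (disp : measure_display) (Omega : measurableType disp).
Context (P : probability Omega R) (T : R) (m : nat).
Variable B : R -> Omega -> 'cV[R]_m.
Local Notation predictable := (predictable P T B).
Local Notation sP := (sigma_pred P T B).

Lemma gmeas_predictable (X : R -> Omega -> R) :
  gmeas (pred_alg P T B) (fun z => X z.1 z.2) -> predictable X.
Proof. by move=> H; apply/predictableP. Qed.

Lemma predictable_gmeas (X : R -> Omega -> R) :
  predictable X -> gmeas (pred_alg P T B) (fun z => X z.1 z.2).
Proof. by move=> H; apply/(predictableP _ _ _ X). Qed.

Lemma predictable_det n (X : R -> Omega -> 'M[R]_n) :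
  predictable_mx P T B X -> predictable (fun t w => \det (X t w)).
Proof.
move=> pX; apply: gmeas_predictable; apply: (gmeas_sum sP) => s _.
apply: (gmeasM sP); first exact: (gmeas_cst sP).
by apply: (gmeas_prod sP) => i _; exact: (predictable_gmeas (X := fun t w => X t w i _) (pX i _)).
Qed.

Lemma predictable_mulmx a b c (X : R -> Omega -> 'M[R]_(a, b)) (X' : R -> Omega -> 'M[R]_(b, c)) :
  predictable_mx P T B X -> predictable_mx P T B X' ->
  predictable_mx P T B (fun t w => X t w *m X' t w).
Proof.
move=> pX pX' i j; apply: gmeas_predictable.
rewrite (_ : (fun z => _) = fun z => \sum_k X z.1 z.2 i k * X' z.1 z.2 k j); last first.
  by apply/funext => z; rewrite mxE.
apply: (gmeas_sum sP) => k _; apply: (gmeasM sP).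
  exact: (predictable_gmeas (pX i k)).
exact: (predictable_gmeas (pX' k j)).
Qed.

Lemma predictable_trmx a b (X : R -> Omega -> 'M[R]_(a, b)) :
  predictable_mx P T B X -> predictable_mx P T B (fun t w => (X t w)^T).
Proof.
move=> pX i j; apply: predictable_eq (pX j i) _.
by move=> t w _; rewrite mxE.
Qed.

(** Cramer's rule expresses the entries of the inverse through determinants, and the total inverse
    of real numbers is measurable. *)
Lemma predictable_invmx n (X : R -> Omega -> 'M[R]_n) :
  predictable_mx P T B X -> (forall t w, 0 <= t <= T -> X t w \in unitmx) ->
  predictable_mx P T B (fun t w => invmx (X t w)).
Proof.
move=> pX uX i j.
apply: (@predictable_eq _ _ _ _ _ _ _ (fun t w => (\det (X t w))^-1 *
    ((-1) ^+ (j + i) * \det (row' j (col' i (X t w)))))); last first.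
  by move=> t w tT; rewrite /invmx uX// !mxE /cofactor.
apply: gmeas_predictable; apply: (gmeasM sP).
  apply: (gmeasV sP); exact: (predictable_gmeas (predictable_det pX)).
apply: (gmeasM sP); first exact: (gmeas_cst sP).
apply: (predictable_gmeas (X := fun t w => \det (row' j (col' i (X t w))))).
apply: predictable_det => k l; apply: predictable_eq (pX (lift j k) (lift i l)) _.
by move=> t w _; rewrite !mxE.
Qed.

Lemma predictable_dotv n (X X' : R -> Omega -> 'cV[R]_n) :
  predictable_mx P T B X -> predictable_mx P T B X' ->
  predictable (fun t w => dotv (X t w) (X' t w)).
Proof.
move=> pX pX'; apply: gmeas_predictable; apply: (gmeas_sum sP) => i _; apply: (gmeasM sP).
  exact: (predictable_gmeas (pX i 0)).
exact: (predictable_gmeas (pX' i 0)).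
Qed.

Lemma predictable_sqnorm n (X : R -> Omega -> 'cV[R]_n) :
  predictable_mx P T B X -> predictable (fun t w => sqnorm (X t w)).
Proof.
move=> pX; apply: gmeas_predictable; apply: (gmeas_sum sP) => i _; apply: (gmeasX sP).
exact: (predictable_gmeas (pX i 0)).
Qed.

Lemma predictable_mxZ a b (X : R -> Omega -> R) (X' : R -> Omega -> 'M[R]_(a, b)) :
  predictable X -> predictable_mx P T B X' -> predictable_mx P T B (fun t w => X t w *: X' t w).
Proof.
move=> pX pX' i j; apply: gmeas_predictable.
rewrite (_ : (fun z => _) = fun z => X z.1 z.2 * X' z.1 z.2 i j); last first.
  by apply/funext => z; rewrite mxE.
by apply: (gmeasM sP); [exact: predictable_gmeas|exact: (predictable_gmeas (pX' i j))].
Qed.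

Lemma predictable_mxD a b (X X' : R -> Omega -> 'M[R]_(a, b)) :
  predictable_mx P T B X -> predictable_mx P T B X' -> predictable_mx P T B (fun t w => X t w + X' t w).
Proof.
move=> pX pX' i j; apply: gmeas_predictable.
rewrite (_ : (fun z => _) = fun z => X z.1 z.2 i j + X' z.1 z.2 i j); last first.
  by apply/funext => z; rewrite mxE.
by apply: (gmeasD sP); [exact: (predictable_gmeas (pX i j))|exact: (predictable_gmeas (pX' i j))].
Qed.

Lemma predictable_mxB a b (X X' : R -> Omega -> 'M[R]_(a, b)) :
  predictable_mx P T B X -> predictable_mx P T B X' -> predictable_mx P T B (fun t w => X t w - X' t w).
Proof.
move=> pX pX' i j; apply: gmeas_predictable.
rewrite (_ : (fun z => _) = fun z => X z.1 z.2 i j - X' z.1 z.2 i j); last first.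
  by apply/funext => z; rewrite !mxE.
by apply: (gmeasB sP); [exact: (predictable_gmeas (pX i j))|exact: (predictable_gmeas (pX' i j))].
Qed.

End predictable_algebra.

(** * Gaussian increments *)

Section density.
Context (R : realType).
Local Notation mu := (@lebesgue_measure R).
Import HBNNSimple.

(** Both sides are limits along the simple approximations of [g]; on their level sets the identity
    is the hypothesis on [nu]. *)
Lemma integral_density (nu : {measure set (measurableTypeR R) -> \bar R}) (f : R -> R)
    (g : R -> \bar R) :
  (forall x, 0 <= f x) -> measurable_fun setT f ->
  (forall A : set (measurableTypeR R), measurable A ->
     nu A = (\int[mu]_(x in A) (f x)%:E)%E) ->
  (forall x, 0 <= g x)%E -> measurable_fun setT g ->
  (\int[nu]_x g x = \int[mu]_x (g x * (f x)%:E))%E.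
Proof.
move=> f0 mf nuE g0 mg.
pose g_ := @nnsfun_approx _ (measurableTypeR R) _ setT measurableT g mg.
have mg_ n : measurable_fun setT (fun x => (g_ n x)%:E).
  by apply/measurable_EFinP; exact: measurable_funP.
have mfE : measurable_fun setT (EFin \o f) by exact/measurable_EFinP.
transitivity (lim (\int[nu]_x (g_ n x)%:E @[n --> \oo])%E).
  rewrite -monotone_convergence//=.
  - apply: eq_integral => x _; apply/esym/cvg_lim => //=.
    exact: cvg_nnsfun_approx.
  - by move=> n ? _; rewrite lee_fin.
  - by move=> ? _ ? ? mn; rewrite lee_fin; exact/lefP/nd_nnsfun_approx.
transitivity (lim (\int[mu]_x ((g_ n x)%:E * (f x)%:E) @[n --> \oo])%E); last first.
  rewrite -monotone_convergence//=.
  - apply: eq_integral => x _; apply/cvg_lim => //=.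
    apply: cvgeZr => //; exact: cvg_nnsfun_approx.
  - by move=> n; apply: emeasurable_funM => //; exact: mg_.
  - by move=> n ? _; rewrite mule_ge0// lee_fin.
  - move=> x _ ? ? mn; rewrite -!EFinM lee_fin ler_wpM2r//.
    by move: x; exact/lefP/nd_nnsfun_approx.
apply: congr_lim; apply/funext => n /=.
transitivity (\sum_(k \in range (g_ n)) k%:E * \int[mu]_x (\1_(g_ n @^-1` [set k]) x * f x)%:E)%E.
  rewrite integralT_nnsfun sintegralE; apply: eq_fsbigr => r _.
  congr (_ * _)%E; rewrite nuE// integral_mkcond.
  apply: eq_integral => x _; rewrite patchE indicE.
  by case: ifPn => _; rewrite ?mul1r ?mul0r.
have mF r : measurable_fun setT (fun x => (\1_(g_ n @^-1` [set r]) x * f x)%:E).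
  by apply/measurable_EFinP; apply: measurable_funM.
transitivity (\int[mu]_x (\sum_(k \in range (g_ n)) (k * (\1_(g_ n @^-1` [set k]) x * f x))%:E))%E; last first.
  apply: eq_integral => x _; rewrite fsumEFin// -EFinM; congr (_%:E).
  rewrite [in RHS](fimfunE (g_ n) x) !fsbig_finite//= mulr_suml.
  by apply: eq_bigr => r _; rewrite mulrA.
rewrite ge0_integral_fsum//; last 2 first.
- move=> r; under eq_fun do rewrite EFinM.
  by apply: emeasurable_funM => //.
- move=> r x _; rewrite mulrA EFinM mule_ge0 ?lee_fin//.
  by have := nnfun_muleindic_ge0 (g_ n) r x; rewrite -EFinM lee_fin.
apply: eq_fsbigr => r /[!inE] -[x0 _ x0r].
under [RHS]eq_integral do rewrite EFinM.
rewrite ge0_integralZl//.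
- by move=> x _; rewrite lee_fin mulr_ge0// f0.
- by rewrite lee_fin -x0r.
Qed.

Lemma integral_normal_mgf (s a : R) : s != 0 ->
  (\int[normal_prob 0 s]_y (expR (a * y - 2^-1 * a ^+ 2 * s ^+ 2))%:E = 1)%E.
Proof.
move=> s0; rewrite (@integral_density _ (normal_pdf 0 s)).
(* Completing the square turns the tilted density into the normal density of mean [a * s ^+ 2], of
   total mass 1. *)
rewrite -(integral_normal_pdf (a * s ^+ 2) s).
apply: eq_integral => y _; rewrite -EFinM; congr (_%:E).
rewrite !normal_pdfE// mulrCA; congr (_ * _).
rewrite /normal_fun -expRD; congr expR; field.
by [].
- exact: normal_pdf_ge0.
- exact: measurable_normal_pdf.
- by [].
- by [].
- apply/measurable_EFinP; apply: measurableT_comp => //.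
  by apply: measurable_funB => //; exact: measurable_funM.
Qed.

End density.

Section gauss_step.
Context (R : realType) (d : measure_display) (Om : measurableType d).
Variables (P : probability Om R) (G : set (set Om)).
Hypotheses (sG : sigma_algebra setT G) (Gm : G `<=` measurable).
Local Notation GT := (g_sigma_algebraType G).

(** Independence makes the law of the pair formed by the identity into [G] and [X] the product of
    [P] restricted to [G] and a normal law. Tonelli's theorem integrates [X] first, with [eta w]
    frozen, and the Gaussian exponential moment gives 1. *)
Lemma gauss_step (X eta Phi : Om -> R) (s : R) : s != 0 ->
  measurable_fun setT X ->
  (forall A U, G A -> measurable U ->
     P (A `&` X @^-1` U) = (P A * normal_prob 0 s U)%E) ->
  gmeas G eta -> gmeas G Phi -> (forall w, 0 <= Phi w) ->
  (\int[P]_w (Phi w * expR (eta w * X w - 2^-1 * eta w ^+ 2 * s ^+ 2))%:E =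
   \int[P]_w (Phi w)%:E)%E.
Proof.
move=> s0 mX indep /gmeasP-/(_ sG) meta /gmeasP-/(_ sG) mPhi Phi0.
have mid : measurable_fun setT (id : Om -> GT).
  by move=> _ A; rewrite gsetE// => GA; rewrite setTI; exact: Gm.
pose idm : {mfun Om >-> GT} := HB.pack (id : Om -> GT) (isMeasurableFun.Build _ _ _ _ _ mid).
pose phi := fun w : Om => ((w : GT), (X w : measurableTypeR R)).
have mphi : measurable_fun setT phi by exact: measurable_fun_pair.
pose phim : {mfun Om >-> (GT * measurableTypeR R)%type} :=
  HB.pack phi (isMeasurableFun.Build _ _ _ _ _ mphi).
pose PG0 := (pushforward P idm : {measure set GT -> \bar R}).
have [PG PGE] : exists PG : {measure set GT -> \bar R}, PG = pushforward P idm :> (set GT -> \bar R).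
  by exists (PG0 mid).
(* The restriction of [P] to [G] receives the structure of a finite measure, so that its product
   with the normal law can be formed. *)
have PGfin : fin_num_fun PG.
  move=> A mA; rewrite PGE; apply: fin_num_measure.
  by apply: Gm; rewrite -gsetE.
pose H1 := isFinite.Build _ _ _ _ PGfin.
have PGsf : sfinite_measure PG.
  exists (fun n => if n is O then PG else mzero) => [[]//|U mU].
  by rewrite /mseries nneseries_recl// eseries0 ?adde0// => -[|].
have PGsif : sigma_finite [set: GT] PG.
  by apply: fin_num_fun_sigma_finite => //; rewrite measure0.
pose H2 := isSFinite.Build _ _ _ _ PGsf.
pose H3 := isSigmaFinite.Build _ _ _ _ PGsif.
pose PG' := HB.pack_for (FiniteMeasure.type GT R) (Measure.sort PG) H1 H2 H3.
pose law0 := (pushforward P phim : {measure set (GT * measurableTypeR R)%type -> \bar R}).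
pose law := law0 mphi.
have lawE : forall C : set (GT * measurableTypeR R), measurable C ->
    (PG' \x normal_prob 0 s)%E C = law C.
  apply: product_measure_unique => A U mA mU.
  rewrite /PG'/= PGE /law/= /pushforward/= -indep//; last by rewrite -gsetE.
pose g (z : GT * measurableTypeR R) :=
  (Phi z.1 * expR (eta z.1 * z.2 - 2^-1 * eta z.1 ^+ 2 * s ^+ 2))%:E.
have mg : measurable_fun setT g.
  apply/measurable_EFinP; apply: measurable_funM; first exact: measurableT_comp.
  apply: measurableT_comp => //; apply: measurable_funB.
    by apply: measurable_funM => //; exact: measurableT_comp.
  apply: measurable_funM => //; apply: measurable_funM => //.
  by apply: measurable_funX; exact: measurableT_comp.
have g0 z : (0 <= g z)%E by rewrite lee_fin mulr_ge0.
transitivity (\int[law]_z g z)%E.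
  by rewrite ge0_integral_pushforward.
transitivity (\int[(PG' \x normal_prob 0 s)%E]_z g z)%E.
  by apply: eq_measure_integral => C mC _; exact: esym (lawE C mC).
rewrite fubini_tonelli1//.
transitivity (\int[PG']_w (Phi w)%:E)%E.
  apply: eq_integral => w _; rewrite /fubini_F/= /g/=.
  under eq_integral do rewrite EFinM.
  rewrite ge0_integralZl//; last 2 first.
    - by apply/measurable_EFinP; apply: measurableT_comp => //;
        apply: measurable_funB => //; exact: measurable_funM.
    - by rewrite lee_fin.
  by rewrite integral_normal_mgf// mule1.
rewrite /PG'/= PGE ge0_integral_pushforward//.
- exact/measurable_EFinP.
- by move=> w _; rewrite lee_fin.
Qed.

End gauss_step.

(** * Independence of Brownian increments from the past *)

Section indep_dynkin.
Context (R : realType) (d : measure_display) (Om : measurableType d).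
Variable P : probability Om R.

(** The mass of the trace on [S] and the multiple [q] of [P] are finite measures that agree on a
    pi-system containing the whole space. *)
Lemma indep_dynkin (E : set (set Om)) (S : set Om) (q : {nonneg R}) :
  E `<=` measurable -> setI_closed E -> E setT -> measurable S ->
  (forall A, E A -> P (A `&` S) = (q%:num%:E * P A)%E) ->
  forall A, <<s E >> A -> P (A `&` S) = (q%:num%:E * P A)%E.
Proof.
move=> Em EI ET mS H A EA.
have cov : \bigcup_(k : nat) (fun=> setT : set Om) k = setT.
  by apply/seteqP; split => // w _; exists 0%N.
apply: (@g_sigma_algebra_measure_unique _ R _ E Em (fun=> setT) (fun=> ET) cov
  (mrestr P mS) (mscale q P) EI _ _ A EA).
- by move=> ? EA'; exact: H.
- by move=> _; rewrite /= /mrestr setTI (le_lt_trans (probability_le1 _ _))// ltry.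
Qed.

End indep_dynkin.

Section eprod.
Context (R : realType) (n : nat).

Lemma eprod_recr (F : 'I_n.+1 -> \bar R) : (\prod_(k < n.+1) F k =
  \prod_(k < n) F (widen_ord (leqnSn n) k) * F ord_max)%E.
Proof. by rewrite big_ord_recr. Qed.

Lemma eprodD1 (F : 'I_n -> \bar R) j :
  (\prod_(k < n) F k = F j * \prod_(k < n | k != j) F k)%E.
Proof. by rewrite (bigD1 j). Qed.

End eprod.

Section independence.
Context (R : realType) (disp : measure_display) (Omega : measurableType disp).
Context (P : probability Omega R) (T : R) (m : nat).
Variable B : R -> Omega -> 'cV[R]_m.
Hypotheses (T0 : 0 < T) (hP : measure_is_complete P).
Hypothesis hB : brownian_motion P T B.

Local Notation filt := (filt P B).
Local Notation filt_measurable := (filt_measurable P B).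

Let incr_in (u v : R) (V : 'I_m -> set R) : set Omega :=
  [set w | forall i, V i (B v w i 0 - B u w i 0)].

Let mB t i : 0 <= t <= T -> measurable_fun setT (fun w => B t w i 0).
Proof. by have [+ _ _ _] := hB; exact. Qed.

Let measurable_forall (n : nat) (F : 'I_n -> set Omega) :
  (forall i, measurable (F i)) -> measurable [set w | forall i, F i w].
Proof.
move=> mF; have -> : [set w | forall i, F i w] = \bigcap_(i in [set: 'I_n]) F i.
  by apply/seteqP; split => [w H i _|w H i]; [exact: H|exact: (H i I)].
by apply: fin_bigcap_measurable => //; exact: finite_finset.
Qed.

Let measurable_incr_in u v V : 0 <= u <= T -> 0 <= v <= T ->
  (forall i, measurable (V i)) -> measurable (incr_in u v V).
Proof.
move=> uT vT mV; apply: (@measurable_forall _ (fun i => [set w | V i (B v w i 0 - B u w i 0)])) => i.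
have mf : measurable_fun setT (fun w => B v w i 0 - B u w i 0).
  by apply: measurable_funB; exact: mB.
by rewrite -[X in measurable X]setTI; exact: mf.
Qed.

Let incr_law u v V : 0 <= u -> u < v -> v <= T -> (forall i, measurable (V i)) ->
  P (incr_in u v V) = (\prod_(i < m) normal_prob 0 (Num.sqrt (v - u)) (V i))%E.
Proof.
move=> u0 uv vT mV; have [_ _ _ /(_ 1%N (fun k => if k is 0%N then u else v))] := hB.
move=> /(_ (fun _ i => V i)); rewrite big_ord1/= => <- //; last by case.
congr (P _); apply/seteqP; split => [w H k i|w H i]; first by case: k => -[].
exact: (H ord0).
Qed.

Section partition.
Variables (n : nat) (t : nat -> R) (v : R).
Hypotheses (t0 : t 0%N = 0) (tn : forall k, (k < n)%N -> t k < t k.+1).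
Hypotheses (tv : t n < v) (vT : v <= T).

Let rect : set (set Omega) := [set A | exists U : 'I_n -> 'I_m -> set R,
  (forall k i, measurable (U k i)) /\
  A = [set w | forall k i, U k i (B (t k.+1) w i 0 - B (t k) w i 0)]].

Let t_le k : (k <= n)%N -> 0 <= t k <= T.
Proof.
have H j i : (i + j <= n)%N -> t i <= t (i + j)%N.
  elim: j => [|j IH] ij; first by rewrite addn0.
  rewrite addnS; apply: le_trans (IH _) (ltW (tn _)); last by rewrite -addnS.
  by apply: leq_trans ij; rewrite addnS.
move=> kn; apply/andP; split; first by rewrite -t0 -(add0n k) H.
have := H (n - k)%N k; rewrite subnKC// leqnn => /(_ isT) tkn.
by apply: le_trans tkn _; apply: le_trans vT; exact: ltW.
Qed.

Let rect_measurable : rect `<=` measurable.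
Proof.
move=> A [U [mU ->]].
apply: (@measurable_forall _ (fun k => [set w | forall i, U k i _])) => k.
by apply: measurable_incr_in => //; apply: t_le => //; exact: ltnW.
Qed.

Let rectI : setI_closed rect.
Proof.
move=> A A' [U [mU ->]] [U' [mU' ->]]; exists (fun k i => U k i `&` U' k i).
split; first by move=> k i; exact: measurableI.
by apply/seteqP; split => [w [H H'] k i|w H]; [split|split=> k i; case: (H k i)].
Qed.

Let rectT : rect setT.
Proof. by exists (fun _ _ => setT); split => //; apply/seteqP; split. Qed.

Let rect_indep V A : (forall i, measurable (V i)) -> rect A ->
  P (A `&` incr_in (t n) v V) = (P (incr_in (t n) v V) * P A)%E.
Proof.
move=> mV [U [mU ->]].
have tn0 : 0 <= t n by have /andP[] := t_le (leqnn n).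
(* The partition is extended by the point [v] and the rectangle by [V]; the joint Gaussian law along
   the longer partition then factors. *)
have [t' [t'k t'n1]] : exists t' : nat -> R,
    (forall k, (k <= n)%N -> t' k = t k) /\ t' n.+1 = v.
  exists (fun k => if (k <= n)%N then t k else v).
  by split; [move=> k ->|rewrite ltnn].
have wE (k : 'I_n) : widen_ord (leqnSn n) k = lift ord_max k.
  by apply: val_inj; rewrite /= /bump leqNgt ltn_ord add0n.
have [U' [U'w U'm mU']] : exists U' : 'I_n.+1 -> 'I_m -> set R,
    [/\ forall k, U' (widen_ord (leqnSn n) k) = U k, U' ord_max = V &
      forall k i, measurable (U' k i)].
  exists (fun k => if unlift ord_max k is Some j then U j else V); split.
  - by move=> k; rewrite wE liftK.
  - by rewrite unlift_none.
  - by move=> k i; case: unliftP.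
have lt' k : (k < n.+1)%N -> t' k < t' k.+1.
  rewrite ltnS leq_eqVlt => /orP[/eqP ->|kn]; first by rewrite t'n1 t'k.
  by rewrite !t'k ?tn// ltnW.
have [_ _ _ H] := hB.
have E1 := H n t U; rewrite E1//; last 2 first.
- by rewrite t0.
- by have /andP[] := t_le (leqnn n).
have E2 := H n.+1 t' U'.
transitivity (P [set w | forall (k : 'I_n.+1) i, U' k i (B (t' k.+1) w i 0 - B (t' k) w i 0)]).
  congr (P _); apply/seteqP; split => w /=.
    move=> [H1 H2] k i; case: (unliftP ord_max k) => [j ->|->].
      by rewrite -wE U'w/= !t'k ?(ltnW (ltn_ord j))//; exact: H1.
    by rewrite U'm/= t'n1 t'k//; exact: H2.
  move=> H1; split => [k i|i].
    by have := H1 (widen_ord (leqnSn n) k) i; rewrite U'w/= !t'k// ltnW.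
  by have := H1 ord_max i; rewrite U'm/= t'n1 t'k.
rewrite E2//; last 2 first.
- by rewrite t'k// t0.
- by rewrite t'n1.
rewrite eprod_recr; apply: (etrans (muleC _ _)); apply: (f_equal2 mule).
  rewrite (incr_law tn0 tv vT mV) U'm.
  have -> : t' (@ord_max n).+1 = v by exact: t'n1.
  by have -> : t' (@ord_max n) = t n by exact: t'k.
apply: eq_bigr => k _; apply: eq_bigr => i _; rewrite U'w.
exact: (f_equal2 (fun a b => normal_prob 0 (Num.sqrt (a - b)) (U k i))
  (t'k k.+1 (ltn_ord k)) (t'k k (ltnW (ltn_ord k)))).
Qed.

(** The filtration is generated by values of [B] and null sets, the rectangles by increments. As
    [B 0 = 0] only almost surely, a value of [B] is a sum of increments up to a null set, so events
    are compared modulo null sets. *)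
Let modnull : set (set Omega) := [set A | exists A0, [/\ <<s rect >> A0,
  P.-negligible (A `\` A0) & P.-negligible (A0 `\` A)]].

Let sigma_modnull : sigma_algebra setT modnull.
Proof.
split.
- by exists set0; split; rewrite ?setDv; [exact: sigma_algebra0|exact: negligible_set0..].
- move=> A [A0 [sA0 n1 n2]]; exists (setT `\` A0).
  by split; rewrite ?setTD; [exact: sigma_algebraC|rewrite setDE setCK setIC -setDE..].
- move=> F /choice[F0 HF0]; exists (\bigcup_n F0 n); split.
  + by apply: sigma_algebra_bigcup => k; have [] := HF0 k.
  + apply: (@negligibleS _ _ _ _ (\bigcup_n (F n `\` F0 n))).
      by move=> w [[k _ Fk] nF0]; exists k => //; split => // ?; apply: nF0; exists k.
    by apply: negligible_bigcup => k; have [] := HF0 k.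
  + apply: (@negligibleS _ _ _ _ (\bigcup_n (F0 n `\` F n))).
      by move=> w [[k _ Fk] nF0]; exists k => //; split => // ?; apply: nF0; exists k.
    by apply: negligible_bigcup => k; have [] := HF0 k.
Qed.

Let B_modnull k i U : (k <= n)%N -> measurable U ->
  modnull [set w | U (B (t k) w i 0)].
Proof.
move=> kn mU; have ss : sigma_algebra setT <<s rect >> by exact: smallest_sigma_algebra.
have mincr (j : 'I_n) : gmeas <<s rect >> (fun w => B (t j.+1) w i 0 - B (t j) w i 0).
  move=> W mW; apply: sub_sigma_algebra.
  exists (fun k' i' => if (k' == j) && (i' == i) then W else setT); split.
    by move=> k' i'; case: ifP.
  apply/seteqP; split => w /= H; last by have := H j i; rewrite !eqxx.
  by move=> k' i'; case: ifP => // /andP[/eqP -> /eqP ->].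
have mS : gmeas <<s rect >> (fun w => \sum_(j < n | (j < k)%N)
    (B (t j.+1) w i 0 - B (t j) w i 0)) by apply: gmeas_sum.
have BE w : B 0 w = 0 -> \sum_(j < n | (j < k)%N)
    (B (t j.+1) w i 0 - B (t j) w i 0) = B (t k) w i 0.
  move=> B0; rewrite (big_ord_narrow kn)/=.
  rewrite -(big_mkord xpredT (fun j => B (t j.+1) w i 0 - B (t j) w i 0)).
  by rewrite telescope_sumr// t0 B0 mxE subr0.
exists ((fun w => \sum_(j < n | (j < k)%N) (B (t j.+1) w i 0 - B (t j) w i 0)) @^-1` U).
have [_ nB0 _ _] := hB.
split; first exact: mS.
- by apply: negligibleS nB0 => w [/= + H1] B0; rewrite -BE.
- by apply: negligibleS nB0 => w [/= + H1] B0; rewrite BE.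
Qed.

Lemma partition_indep (S : set R) V A : (forall i, measurable (V i)) ->
  (forall s, S s -> exists k, (k <= n)%N /\ s = t k) ->
  <<s [set A | (exists s i (U : set R), [/\ S s, measurable U &
        A = [set w | U (B s w i 0)]]) \/ P.-negligible A] >> A ->
  P (A `&` incr_in (t n) v V) = (P (incr_in (t n) v V) * P A)%E.
Proof.
move=> mV St sA.
have tn0T : 0 <= t n <= T by exact: t_le.
have mI : measurable (incr_in (t n) v V).
  apply: measurable_incr_in => //; rewrite vT andbT.
  by apply: le_trans (ltW tv); case/andP: tn0T.
have : modnull A.
  move: A sA; apply: smallest_sub => // A [[s [i [U [/St[k [kn ->]] mU ->]]]]|nA].
    exact: B_modnull.
  exists set0; split; first exact: sigma_algebra0.
    by rewrite setD0.
  by rewrite set0D; exact: negligible_set0.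
move=> [A0 [sA0 n1 n2]].
have mA0 : measurable A0.
  by move: sA0; apply: smallest_sub; [exact: sigma_algebra_measurable|exact: rect_measurable].
have PE (C C' : set Omega) : measurable C' -> P.-negligible (C `\` C') ->
    P.-negligible (C' `\` C) -> P C = P C'.
  move=> mC' nC nC'; have mCC' := hP nC; have mC'C := hP nC'.
  have mCI : measurable (C' `&` C) by rewrite -setDD; exact: measurableD.
  have CE (D D' : set Omega) : D = (D' `&` D) `|` (D `\` D').
    apply/seteqP; split => w /=; last by move=> [] [].
    by move=> Dw; have [D'w|D'w] := pselect (D' w); [left|right].
  have PD (D D' : set Omega) : measurable (D' `&` D) -> P.-negligible (D `\` D') ->
      P D = P (D' `&` D).
    move=> mI' nD; rewrite {1}(CE D D') measureU//; last 2 first.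
    - exact: hP.
    - by apply/seteqP; split => w //= [[? ?] []].
    by rewrite (measure_negligible (hP nD) nD) adde0.
  by rewrite (PD C C')// (PD C' C) 1?setIC.
have PA : P A = P A0 by exact: PE.
have PAI : P (A `&` incr_in (t n) v V) = P (A0 `&` incr_in (t n) v V).
  apply: PE; first exact: measurableI.
    by apply: negligibleS n1 => w [[? ?] /not_andP[]].
  by apply: negligibleS n2 => w [[? ?] /not_andP[]].
have qE : (fine (P (incr_in (t n) v V)))%:E = P (incr_in (t n) v V).
  by rewrite fineK// fin_num_measure.
have q0 : 0 <= fine (P (incr_in (t n) v V)) by rewrite fine_ge0.
rewrite PA PAI -qE.
have := @indep_dynkin _ _ _ P rect (incr_in (t n) v V) (NngNum q0)
  rect_measurable rectI rectT mI.
apply => // A1 rA1; rewrite /= qE; exact: rect_indep.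
Qed.

End partition.

Let gen (S : seq R) : set (set Omega) :=
  [set A | (exists s i (U : set R), [/\ s \in S, measurable U &
        A = [set w | U (B s w i 0)]]) \/ P.-negligible A].

Let gen_indep (S : seq R) (u v : R) V A : 0 <= u -> u < v -> v <= T ->
  (forall i, measurable (V i)) -> (forall s, s \in S -> 0 <= s <= u) ->
  <<s gen S >> A ->
  P (A `&` incr_in u v V) = (P (incr_in u v V) * P A)%E.
Proof.
move=> u0 uv vT mV Su sA.
(* Inserting 0 and [u] and sorting without repetition gives a strictly increasing partition that
   starts at 0 and ends at [u]. *)
pose ts := sort <=%R (undup (0 :: u :: S)).
have mem_ts s : (s \in ts) = (s \in 0 :: u :: S) by rewrite mem_sort mem_undup.
have sts : sorted <%R ts by rewrite sort_lt_sorted undup_uniq.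
have ts_itv s : s \in ts -> 0 <= s <= u.
  rewrite mem_ts !inE => /or3P[/eqP ->|/eqP ->|/Su//]; first by rewrite lexx u0.
  by rewrite u0 lexx.
have sz0 : (0 < size ts)%N.
  have h0 : 0 \in ts by rewrite mem_ts mem_head.
  by rewrite lt0n size_eq0; apply/eqP => E; rewrite E in h0.
pose n := (size ts).-1.
have szn : size ts = n.+1 by rewrite prednK.
have nth_lt i j : (i < j < size ts)%N -> nth v ts i < nth v ts j.
  move=> /andP[ij js]; apply: (sorted_ltn_nth lt_trans _ sts) => //.
  by rewrite inE; exact: ltn_trans js.
have nth_le i j : (i <= j < size ts)%N -> nth v ts i <= nth v ts j.
  by rewrite leq_eqVlt andb_orl => /orP[/andP[/eqP ->]//|/nth_lt/ltW].
have t0 : nth v ts 0 = 0.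
  have /ts_itv/andP[t00 _] := mem_nth v sz0.
  have h0 : 0 \in ts by rewrite mem_ts mem_head.
  have := nth_le 0%N (index 0 ts); rewrite index_mem h0 leq0n => /(_ isT).
  by rewrite nth_index// => t00'; apply/eqP; rewrite eq_le t00 t00'.
have tnu : nth v ts n = u.
  have nsz : (n < size ts)%N by rewrite szn.
  have /ts_itv/andP[_ tnu] := mem_nth v nsz.
  have hu : u \in ts by rewrite mem_ts !inE eqxx orbT.
  have := nth_le (index u ts) n; rewrite nsz andbT -ltnS -szn index_mem hu => /(_ isT).
  by rewrite nth_index// => t00'; apply/eqP; rewrite eq_le t00' tnu.
have := @partition_indep n (nth v ts) v t0 _ _ vT [set` S] V A mV _ sA.
rewrite tnu; apply => //.
- by move=> k kn; apply: nth_lt; rewrite szn ltnSn ltnS.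
- move=> s /= sS; have hs : s \in ts by rewrite mem_ts !inE sS !orbT.
  exists (index s ts); rewrite nth_index//; split => //.
  by rewrite -ltnS -szn index_mem.
Qed.

(** Events depending on finitely many times up to [u] form a pi-system, stable under intersection by
    concatenating the lists of times, and they generate [filt u]. On them the claim is the case of a
    finite partition. *)
Lemma incr_indep (u v : R) V A : 0 <= u -> u < v -> v <= T ->
  (forall i, measurable (V i)) -> filt u A ->
  P (A `&` [set w | forall i, V i (B v w i 0 - B u w i 0)]) =
  (P A * \prod_(i < m) normal_prob 0 (Num.sqrt (v - u)) (V i))%E.
Proof.
move=> u0 uv vT mV FA; rewrite -incr_law// muleC -/(incr_in u v V).
pose E : set (set Omega) := [set A | exists S : seq R,
   (forall s, s \in S -> 0 <= s <= u) /\ <<s gen S >> A].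
have gen_mono S S' : {subset S <= S'} -> <<s gen S >> `<=` <<s gen S' >>.
  move=> SS'; apply: sub_sigma_algebra2 => C [[s [i [U [sS mU ->]]]]|nC].
    by left; exists s, i, U; split => //; exact: SS'.
  by right.
have Em : E `<=` measurable.
  move=> C [S [Su]]; move: C; apply: smallest_sub; first exact: sigma_algebra_measurable.
  move=> C [[s [i [U [/Su/andP[s0 su] mU ->]]]]|nC]; last exact: hP.
  rewrite -[X in measurable X]setTI; apply: mB => //.
  by rewrite s0 (le_trans su)// (le_trans (ltW uv)).
have EI : setI_closed E.
  move=> C C' [S [Su sC]] [S' [Su' sC']]; exists (S ++ S'); split.
    by move=> s; rewrite mem_cat => /orP[/Su|/Su'].
  apply: (gsetI (smallest_sigma_algebra _ _)).
    by apply: gen_mono sC => s sS; rewrite mem_cat sS.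
  by apply: gen_mono sC' => s sS; rewrite mem_cat sS orbT.
have ET : E setT.
  by exists [::]; split => //; exact: (gsetT (smallest_sigma_algebra _ _)).
have mI : measurable (incr_in u v V).
  apply: measurable_incr_in => //.
    by rewrite u0 (le_trans (ltW uv)).
  by rewrite vT (le_trans u0 (ltW uv)).
have qE : (fine (P (incr_in u v V)))%:E = P (incr_in u v V).
  by rewrite fineK// fin_num_measure.
have q0 : 0 <= fine (P (incr_in u v V)) by rewrite fine_ge0.
have sEA : <<s E >> A.
  move: A FA; apply: smallest_sub; first exact: smallest_sigma_algebra.
  move=> C [[s [i [U [/andP[s0 su] mU ->]]]]|nC]; apply: sub_sigma_algebra.
    exists [:: s]; split; first by move=> s'; rewrite inE => /eqP ->; rewrite s0.
    by apply: sub_sigma_algebra; left; exists s, i, U; split => //; rewrite mem_head.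
  by exists [::]; split => //; apply: sub_sigma_algebra; right.
have := @indep_dynkin _ _ _ P E (incr_in u v V) (NngNum q0) Em EI ET mI.
rewrite /= qE; apply => // C [S [Su sC]]; exact: gen_indep sC.
Qed.

(** The coordinates of the increment are integrated out one at a time. For coordinate [j], the
    sigma-algebra generated by [filt u] and the earlier coordinates plays the role of [G] in
    [gauss_step]. *)
Lemma gauss_step_vec (u v : R) (eta : Omega -> 'cV[R]_m) (Phi : Omega -> R) :
  0 <= u -> u < v -> v <= T ->
  (forall i, filt_measurable u (fun w => eta w i 0)) ->
  filt_measurable u Phi -> (forall w, 0 <= Phi w) ->
  (\int[P]_w (Phi w * expR (dotv (eta w) (B v w - B u w)
      - 2^-1 * sqnorm (eta w) * (v - u)))%:E = \int[P]_w (Phi w)%:E)%E.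
Proof.
move=> u0 uv vT meta mPhi Phi0.
have uT : u <= T by exact: le_trans (ltW uv) vT.
have v0 : 0 <= v by exact: le_trans u0 (ltW uv).
set s := Num.sqrt (v - u).
have s0 : s != 0 by rewrite gt_eqF// sqrtr_gt0 subr_gt0.
have s2 : s ^+ 2 = v - u by rewrite sqr_sqrtr// subr_ge0 ltW.
pose dB i w := B v w i 0 - B u w i 0.
have mdB i : measurable_fun setT (dB i).
  by apply: measurable_funB; apply: mB; rewrite ?u0 ?v0.
pose ex i w := eta w i 0 * dB i w - 2^-1 * eta w i 0 ^+ 2 * s ^+ 2.
pose Psi j w := Phi w * \prod_(i < m | (i < j)%N) expR (ex i w).
suff H j : (j <= m)%N -> (\int[P]_w (Psi j w)%:E = \int[P]_w (Phi w)%:E)%E.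
  rewrite -(H m (leqnn m)); apply: eq_integral => w _; congr (_%:E).
  rewrite /Psi; congr (_ * _).
  rewrite -expR_sum; congr expR.
  rewrite (eq_bigl xpredT); last by move=> i; rewrite ltn_ord.
  rewrite sumrB /dotv /sqnorm s2 mulr_sumr mulr_suml; congr (_ - _).
  by apply: eq_bigr => i _; rewrite /dB !mxE.
elim: j => [_|j IH jm].
  by apply: eq_integral => w _; rewrite /Psi big_pred0_eq mulr1.
rewrite -IH ?(ltnW jm)//.
pose k := Ordinal jm.
(* Events of [filt u] intersected with conditions on the coordinates below [j] only: from [j] on the
   conditions are trivial. *)
pose E : set (set Omega) := [set A | exists A0 (V : 'I_m -> set R),
  [/\ filt u A0, forall i, measurable (V i), forall i : 'I_m, (j <= i)%N -> V i = setT &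
      A = A0 `&` [set w | forall i, V i (dB i w)]]].
have Em : E `<=` measurable.
  move=> A [A0 [V [FA0 mV _ ->]]]; apply: measurableI.
    exact: (filt_sub_measurable hP hB uT FA0).
  by apply: measurable_incr_in => //; rewrite ?u0 ?v0.
have EI : setI_closed E.
  move=> A A' [A0 [V [FA0 mV VT ->]]] [A0' [V' [FA0' mV' VT' ->]]].
  exists (A0 `&` A0'), (fun i => V i `&` V' i); split.
  - exact: (gsetI (sigma_filt _ _ _)).
  - by move=> i; exact: measurableI.
  - by move=> i ji; rewrite VT// VT'// setIT.
  - apply/seteqP; split => w /=; first by move=> [[? H] [? H']].
    by move=> [[? ?] H]; do ![split => //]; move=> i; case: (H i).
have EF A : filt u A -> E A.
  by move=> FA; exists A, (fun=> setT); split => //; apply/seteqP; split => w //= [].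
have ET : E setT by apply: EF; exact: (gsetT (sigma_filt _ _ _)).
have sE : sigma_algebra setT <<s E >> by exact: smallest_sigma_algebra.
have ind A W : <<s E >> A -> measurable W ->
    P (A `&` dB k @^-1` W) = (P A * normal_prob 0 s W)%E.
  move=> sA mW.
  have NW : normal_prob 0 s W \is a fin_num by apply: fin_num_measure.
  have q0 : 0 <= fine (normal_prob 0 s W) by rewrite fine_ge0.
  rewrite [RHS]muleC -(fineK NW).
  have mdW : measurable (dB k @^-1` W) by rewrite -[X in measurable X]setTI; exact: mdB.
  have := @indep_dynkin _ _ _ P E (dB k @^-1` W) (NngNum q0) Em EI ET mdW.
  apply => // {sA}A [A0 [V [FA0 mV VT ->]]]; rewrite /= fineK//.
  have Vk : V k = setT by exact: VT.
  rewrite (incr_indep u0 uv vT mV FA0).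
  rewrite (_ : _ `&` _ = A0 `&` [set w | forall i, (if i == k then W else V i) (dB i w)]).
    rewrite (@incr_indep _ _ (fun i => if i == k then W else V i))//; last first.
      by move=> i; case: ifP.
    rewrite muleCA; congr (_ * _)%E.
    rewrite (@eprodD1 _ _ _ k) [in RHS](@eprodD1 _ _ _ k) eqxx Vk probability_setT mul1e.
    by congr (_ * _)%E; apply: eq_bigr => i /negbTE ->.
  apply/seteqP; split => w /=.
    by move=> [[? H] HW]; split => // i; case: ifP => [/eqP ->|].
  move=> [? H]; split; last by have := H k; rewrite eqxx.
  split => // i; have := H i; case: ifP => // /eqP ->.
  by rewrite Vk.
have FE t' X : t' <= u -> filt_measurable t' X -> gmeas <<s E >> X.
  by move=> t'u mX U mU; apply: sub_sigma_algebra; apply: EF; apply: (filt_mono t'u); exact: mX.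
have mdE (i : 'I_m) : (i < j)%N -> gmeas <<s E >> (dB i).
  move=> ij U mU; apply: sub_sigma_algebra.
  exists setT, (fun i' => if i' == i then U else setT); split.
  - exact: (gsetT (sigma_filt _ _ _)).
  - by move=> i'; case: ifP.
  - by move=> i' ji'; case: eqP => // i'i; move: ij; rewrite -i'i ltnNge ji'.
  - apply/seteqP; split => w /=; last by move=> [_ /(_ i)]; rewrite eqxx.
    by move=> Uw; split => // i'; case: eqP => // ->.
have mex (i : 'I_m) : (i < j)%N -> gmeas <<s E >> (ex i).
  move=> ij; apply: gmeasB => //.
    by apply: gmeasM => //; [exact: (FE u)|exact: mdE].
  apply: gmeasM => //; last exact: gmeas_cst.
  by apply: gmeasM => //; [exact: gmeas_cst|apply: gmeasX => //; exact: (FE u)].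
have -> : (fun w => (Psi j.+1 w)%:E) = (fun w => (Psi j w * expR (eta w k 0 * dB k w
     - 2^-1 * eta w k 0 ^+ 2 * s ^+ 2))%:E).
  apply/funext => w; congr (_%:E); rewrite /Psi -mulrA; congr (_ * _).
  rewrite (bigD1 k)/= ?ltnS// mulrC; congr (_ * _).
  by apply: eq_bigl => i; rewrite ltnS leq_eqVlt -val_eqE/=; case: (ltngtP i j).
apply: (@gauss_step _ _ _ P <<s E >> sE _ (dB k) (fun w => eta w k 0) (Psi j) s) => //.
- by apply: smallest_sub => //; exact: sigma_algebra_measurable.
- exact: (FE u).
- apply: gmeasM => //; first exact: (FE u).
  by apply: gmeas_prod => // i ij; apply: gmeas_expR => //; exact: mex.
- by move=> w; rewrite mulr_ge0// prodr_ge0// => i _; exact: expR_ge0.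
Qed.

End independence.

(** * Uniform continuity on [0, T] *)

Section uniform_continuity.
Context (R : realType) (T : R) (T0 : 0 < T).

(* The modulus is indexed by the dyadic meshes [T / 2 ^ N]. *)
Definition ucont (f : R -> R) := forall e : R, 0 < e -> exists N : nat, forall u v : R,
  0 <= u <= T -> 0 <= v <= T -> `|u - v| <= T / 2 ^+ N -> `|f u - f v| <= e.

Lemma ucont_continuous f : ucont f -> {within `[0, T], continuous f}.
Proof.
move=> uf; apply/subspace_continuousP => t /=; rewrite in_itv/= => tT.
apply/cvgrPdist_le => e e0; have [N HN] := uf e e0.
rewrite near_withinE; exists (T / 2 ^+ N); first exact: mesh_gt0.
move=> u/= tu; rewrite in_itv/= => uT; apply: HN => //; exact: ltW.
Qed.

Lemma continuous_ucont f : {within `[0, T], continuous f} -> ucont f.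
Proof.
move=> /subspace_continuousP cf e e0.
have /compact_near_coveringP cpt := @segment_compact R 0 T.
pose Q (N : nat) (u : R) := u \in `[0, T] -> forall v : R, 0 <= v <= T ->
  `|u - v| <= T / 2 ^+ N -> `|f u - f v| <= e.
have [|N _ HN] := cpt nat \oo Q _.
  move=> x xT; have := cf x xT => /cvgrPdist_le/(_ (e / 2)).
  rewrite divr_gt0// => /(_ isT); rewrite near_withinE => -[d/= d0 Hd].
  have d20 : 0 < d / 2 by rewrite divr_gt0.
  have [N0 HN0] := mesh_small T0 d20.
  exists (ball x (d / 2), [set N | (N0 <= N)%N]); first split => /=.
  - exact: nbhsx_ballx.
  - by exists N0.
  move=> [u N]/= [xu N0N] uT v vT uv.
  have vd : `|x - v| < d.
    rewrite (le_lt_trans (ler_distD u _ _))// [ltRHS](splitr d) ltrD//.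
    by apply: le_lt_trans uv (le_lt_trans _ HN0); exact: (mesh_le T0).
  have ud : `|x - u| < d.
    by apply: (lt_le_trans xu); rewrite ler_pdivrMr// ler_peMr ?(ltW d0)// ler1n.
  have h1 := Hd u ud uT; have h2 := Hd v vd.
  rewrite (le_trans (ler_distD (f x) _ _))// [leRHS](splitr e) lerD//.
    by rewrite distrC; exact: h1.
  by apply: h2; rewrite in_itv.
exists N => u v uT vT uv; apply: (HN N (leqnn N) u _ _ v vT uv); by rewrite /= ?in_itv.
Qed.

Lemma ucont_bounded f : ucont f -> exists K : R, forall t : R, 0 <= t <= T -> `|f t| <= K.
Proof.
move=> uf; have [N HN] := uf 1 ltr01.
(* The modulus is taken at accuracy 1, so each cell crossed changes [f] by at most 1. *)
have H k : (k <= 2 ^ N)%N -> forall t : R, 0 <= t <= grid T N k -> `|f t| <= `|f 0| + k%:R.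
  elim: k => [_ t|k IH kN t /andP[t0 tk]].
    by rewrite grid0 -eq_le => /eqP <-; rewrite addr0.
  have [tk'|kt] := leP t (grid T N k).
    apply: (le_trans (IH (ltnW kN) t _)); first by rewrite t0.
    by rewrite lerD2l ler_nat.
  have gk : 0 <= grid T N k <= T by rewrite grid_ge0// grid_leT// ltnW.
  have tT : 0 <= t <= T by rewrite t0 (le_trans tk)// grid_leT.
  have := HN t (grid T N k) tT gk; rewrite ger0_norm ?subr_ge0 ?(ltW kt)//.
  rewrite lerBlDl -gridS => /(_ tk) ft.
  have := IH (ltnW kN) (grid T N k); rewrite grid_ge0// lexx => /(_ isT) fk.
  rewrite -[f t](subrK (f (grid T N k))) (le_trans (ler_normD _ _))//.
  by rewrite -natr1 [leRHS]addrA [leRHS]addrC lerD.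
exists (`|f 0| + (2 ^ N)%:R) => t tT; apply: H => //.
by rewrite gridT.
Qed.

Lemma grid_dense (t : R) N : 0 <= t <= T -> exists k, (k <= 2 ^ N)%N /\
  `|t - grid T N k| <= T / 2 ^+ N.
Proof.
move=> /andP[t0 tT]; have [->|t'0] := eqVneq t 0.
  by exists 0%N; rewrite grid0 subrr normr0 (ltW (mesh_gt0 T0 _)).
have t00 : 0 < t <= T by rewrite lt_neqAle eq_sym t'0 t0.
have [k [kN /andP[kt tk]]] := grid_cell N t00.
exists k; rewrite (ltnW kN); split=> //.
by rewrite ger0_norm ?subr_ge0 ?(ltW kt)// lerBlDl -gridS.
Qed.

Lemma ucont_grid_le f c : ucont f ->
  (forall N k, (k <= 2 ^ N)%N -> f (grid T N k) <= c) ->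
  forall t : R, 0 <= t <= T -> f t <= c.
Proof.
move=> uf H t tT; apply/ler_addgt0Pr => e e0.
have [N HN] := uf e e0.
have [k [kN tk]] := grid_dense N tT.
have gk : 0 <= grid T N k <= T by rewrite grid_ge0// grid_leT.
have := HN _ _ tT gk tk => /(le_trans (ler_norm _)).
rewrite lerBlDl => /le_trans; apply; rewrite lerD2r; exact: H.
Qed.

Lemma ucontD f g : ucont f -> ucont g -> ucont (fun t => f t + g t).
Proof.
move=> uf ug e e0; have e20 : 0 < e / 2 by rewrite divr_gt0.
have [N HN] := uf _ e20; have [M HM] := ug _ e20.
exists (maxn N M) => u v uT vT uv.
rewrite opprD addrACA (le_trans (ler_normD _ _))// [leRHS]splitr lerD//.
  by apply: HN => //; apply: le_trans uv _; rewrite (mesh_le T0)// leq_maxl.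
by apply: HM => //; apply: le_trans uv _; rewrite (mesh_le T0)// leq_maxr.
Qed.

Lemma ucontZ f a : ucont f -> ucont (fun t => a * f t).
Proof.
move=> uf e e0; have a0 : 0 < `|a| + 1 by rewrite ltr_wpDl.
have [|N HN] := uf (e / (`|a| + 1)); first by rewrite divr_gt0.
exists N => u v uT vT uv; rewrite -mulrBr normrM.
have := HN u v uT vT uv; rewrite ler_pdivlMr// mulrC; apply: le_trans.
by rewrite ler_wpM2r// lerDl.
Qed.

Lemma ucontN f : ucont f -> ucont (fun t => - f t).
Proof. by move=> /(@ucontZ _ (-1)); under eq_fun do rewrite mulN1r. Qed.

Lemma ucontB f g : ucont f -> ucont g -> ucont (fun t => f t - g t).
Proof. by move=> uf ug; apply: ucontD => //; exact: ucontN. Qed.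

Lemma ucont_cst c : ucont (fun=> c).
Proof. by move=> e e0; exists 0%N => u v *; rewrite subrr normr0 ltW. Qed.

Lemma ucont_sum (I : Type) (s : seq I) (F : I -> R -> R) :
  (forall i, ucont (F i)) -> ucont (fun t => \sum_(i <- s) F i t).
Proof.
move=> uF; elim: s => [|i s IH].
  by under eq_fun do rewrite big_nil; exact: ucont_cst.
by under eq_fun do rewrite big_cons; exact: ucontD.
Qed.

Lemma ucont_comp f (g : R -> R) : ucont f ->
  (forall t : R, 0 <= t <= T -> 0 <= g t <= T) ->
  (forall u v : R, `|g u - g v| <= `|u - v|) -> ucont (fun t => f (g t)).
Proof.
move=> uf gT gl e e0; have [N HN] := uf e e0.
by exists N => u v uT vT uv; apply: HN; [exact: gT|exact: gT|exact: le_trans uv].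
Qed.

Lemma ucontM f g : ucont f -> ucont g -> ucont (fun t => f t * g t).
Proof.
move=> uf ug e e0.
have [K HK] := ucont_bounded uf; have [L HL] := ucont_bounded ug.
have K0 : 0 <= K by apply: le_trans (HK 0 _) => //; rewrite lexx ltW.
have L0 : 0 <= L by apply: le_trans (HL 0 _) => //; rewrite lexx ltW.
have KL : 0 < K + L + 1 by rewrite ltr_wpDl// addr_ge0.
have e'0 : 0 < e / (K + L + 1) by rewrite divr_gt0.
have [N HN] := uf _ e'0; have [M HM] := ug _ e'0.
exists (maxn N M) => u v uT vT uv.
have h1 : `|f u - f v| <= e / (K + L + 1).
  by apply: HN => //; apply: le_trans uv _; rewrite (mesh_le T0)// leq_maxl.
have h2 : `|g u - g v| <= e / (K + L + 1).
  by apply: HM => //; apply: le_trans uv _; rewrite (mesh_le T0)// leq_maxr.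
have -> : f u * g u - f v * g v = f u * (g u - g v) + (f u - f v) * g v by ring.
rewrite (le_trans (ler_normD _ _))// !normrM.
apply: (@le_trans _ _ (K * (e / (K + L + 1)) + e / (K + L + 1) * L)).
  by rewrite lerD// ler_pM//; [exact: HK|exact: HL].
rewrite mulrC -mulrDr mulrAC ler_pdivrMr// ler_wpM2l ?(ltW e0)//.
by rewrite lerDl.
Qed.

Lemma lipschitz_min (a u v : R) : `|Num.min a u - Num.min a v| <= `|u - v|.
Proof.
wlog uv : u v / u <= v => [H|].
  have [/H//|/ltW/H] := leP u v; by rewrite distrC (distrC u).
rewrite [leRHS]distrC [leLHS]distrC !ger0_norm ?subr_ge0// ?le_min ?ge_min ?uv ?lexx ?orbT//.
by case: (leP a u); case: (leP a v); lra.
Qed.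

End uniform_continuity.

(** * Events of small probability *)

Section small_events.
Context (R : realType) (d : measure_display) (Om : measurableType d).
Variables (P : probability Om R) (T : R) (T0 : 0 < T).

Lemma measurable_lt (f g : Om -> R) : measurable_fun setT f ->
  measurable_fun setT g -> measurable [set w | f w < g w].
Proof.
move=> mf mg; have -> : [set w | f w < g w] = ~` [set w | g w <= f w].
  by apply/seteqP; split => w /=; rewrite ltNge; move/negP.
apply: measurableC; rewrite -[X in measurable X]setTI.
exact: measurable_fun_le.
Qed.

Lemma prob_leU (A C : set Om) (a b : \bar R) : measurable A -> measurable C ->
  (P A <= a)%E -> (P C <= b)%E -> (P (A `|` C) <= a + b)%E.
Proof. by move=> mA mC Aa Cb; exact: le_trans (measureU2 _ mA mC) (leeD Aa Cb). Qed.

(** Continuity of [P] from above along a sequence with negligible intersection. *)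
Lemma small_of_nonincreasing (E : nat -> set Om) (e : R) : 0 < e ->
  (forall n, measurable (E n)) -> nonincreasing_seq E ->
  P.-negligible (\bigcap_n E n) -> exists n, (P (E n) <= e%:E)%E.
Proof.
move=> e0 mE nE zE.
have mI : measurable (\bigcap_n E n) by exact: bigcapT_measurable.
have := nonincreasing_cvg_mu (mu := P) _ mE mI nE.
rewrite (measure_negligible mI zE) => H.
have {}H : (P \o E @ \oo --> 0%E).
  by apply: H; rewrite (le_lt_trans (probability_le1 _ _))// ltry.
have /fine_cvgP[_ /cvgrPdist_le/(_ e e0)[n _ Hn]] := H.
exists n; have := Hn n (leqnn n); rewrite /= sub0r normrN ger0_norm ?fine_ge0//.
by rewrite -lee_fin fineK// fin_num_measure.
Qed.

(** Each path has its own modulus; off an event of small probability one mesh serves all paths. Bad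
    pairs are tested at dyadic points only, which keeps the exceptional event a countable union. *)
Lemma ucont_modulus (X : R -> Om -> R) :
  (forall t : R, 0 <= t <= T -> measurable_fun setT (X t)) ->
  {ae P, forall w, ucont T (fun t => X t w)} ->
  forall e : R, 0 < e -> exists (N : nat) (E : set Om), [/\ measurable E, (P E <= e%:E)%E &
    forall w, ~ E w -> forall u v : R, 0 <= u <= T -> 0 <= v <= T ->
      `|u - v| <= T / 2 ^+ N -> `|X u w - X v w| <= e].
Proof.
move=> mX [N0 [mN0 PN0 HN0]] e e0.
pose bad N a i j := if [&& (i <= 2 ^ a)%N, (j <= 2 ^ a)%N &
    `|grid T a i - grid T a j| <= T / 2 ^+ N] then
  [set w | e < `|X (grid T a i) w - X (grid T a j) w|] else set0.
have mbad N a i j : measurable (bad N a i j).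
  rewrite /bad; case: ifP => // /and3P[ia ja _].
  apply: measurable_lt => //; apply: measurableT_comp => //; apply: measurable_funB; apply: mX;
    by rewrite grid_ge0// grid_leT.
pose E N := \bigcup_a \bigcup_i \bigcup_j bad N a i j.
have mE N : measurable (E N).
  by apply: bigcupT_measurable => a; apply: bigcupT_measurable => i;
     apply: bigcupT_measurable => j.
have nE : nonincreasing_seq E.
  move=> N M NM; apply/subsetPset => w [a _ [i _ [j _]]].
  rewrite /bad; case: ifP => // /and3P[ia ja ij] H.
  exists a => //; exists i => //; exists j => //; rewrite /bad ia ja.
  by rewrite (le_trans ij)//= (mesh_le T0).
have [|n Pn] := small_of_nonincreasing e0 mE nE.
  exists N0; split=> // w Hw; apply: HN0 => /= uX.
  have [N HN] := uX e e0.
  have [a _ [i _ [j _]]] := Hw N I.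
  rewrite /bad; case: ifP => // /and3P[ia ja ij] /=; apply/negP; rewrite -leNgt.
  by apply: HN => //; rewrite grid_ge0// grid_leT.
(* One level finer than [n]: moving [u] and [v] to grid points at distance at most [T / 2 ^+ n.+2]
   keeps them within [T / 2 ^+ n] of each other. *)
exists n.+1, (E n `|` N0); split.
- exact: measurableU.
- rewrite -[e%:E]adde0; apply: prob_leU => //.
  by rewrite le_eqVlt; apply/orP; left; apply/eqP; exact: PN0.
move=> w /not_orP[nEw nN0] u v uT vT uv.
have uX : ucont T (fun t => X t w).
  by apply: contrapT => nu; apply: nN0; exact: HN0.
apply/ler_addgt0Pr => e' e'0.
have e'2 : 0 < e' / 2 by rewrite divr_gt0.
have [M HM] := uX _ e'2.
pose a := maxn M n.+2.
have [i [ia ui]] := grid_dense T0 a uT.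
have [j [ja vj]] := grid_dense T0 a vT.
have gi : 0 <= grid T a i <= T by rewrite grid_ge0// grid_leT.
have gj : 0 <= grid T a j <= T by rewrite grid_ge0// grid_leT.
have aM : T / 2 ^+ a <= T / 2 ^+ M by rewrite (mesh_le T0)// leq_maxl.
have an : T / 2 ^+ a <= T / 2 ^+ n.+2 by rewrite (mesh_le T0)// leq_maxr.
have h1 := HM _ _ uT gi (le_trans ui aM).
have h2 := HM _ _ vT gj (le_trans vj aM).
have h3 : `|X (grid T a i) w - X (grid T a j) w| <= e.
  rewrite leNgt; apply/negP => h3; apply: nEw.
  exists a => //; exists i => //; exists j => //; rewrite /bad ia ja/= ifT//.
  have hx : T / 2 ^+ n = T / 2 ^+ n.+1 + T / 2 ^+ n.+2 + T / 2 ^+ n.+2.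
    by rewrite !exprS; field; rewrite expf_neq0.
  move: ui vj uv an; rewrite hx !ler_norml => /andP[? ?] /andP[? ?] /andP[? ?] ?.
  apply/andP; split; lra.
move: h1 h2 h3; rewrite !ler_norml => /andP[? ?] /andP[? ?] /andP[? ?].
apply/andP; split; lra.
Qed.

End small_events.

(** * Simple stochastic integrals *)

Section vectors.
Context (R : realType) (n : nat).
Implicit Types u v : 'cV[R]_n.

Lemma dotvDl u1 u2 v : dotv (u1 + u2) v = dotv u1 v + dotv u2 v.
Proof. by rewrite /dotv -big_split; apply: eq_bigr => i _; rewrite mxE mulrDl. Qed.
Lemma dotvZl a u v : dotv (a *: u) v = a * dotv u v.
Proof. by rewrite /dotv mulr_sumr; apply: eq_bigr => i _; rewrite mxE mulrA. Qed.
Lemma dotvC u v : dotv u v = dotv v u.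
Proof. by apply: eq_bigr => i _; rewrite mulrC. Qed.
Lemma dotvDr u v1 v2 : dotv u (v1 + v2) = dotv u v1 + dotv u v2.
Proof. by rewrite dotvC dotvDl !(dotvC u). Qed.
Lemma dotvZr a u v : dotv u (a *: v) = a * dotv u v.
Proof. by rewrite dotvC dotvZl dotvC. Qed.
Lemma dotvNl u v : dotv (- u) v = - dotv u v.
Proof. by rewrite -scaleN1r dotvZl mulN1r. Qed.
Lemma dotvNr u v : dotv u (- v) = - dotv u v.
Proof. by rewrite dotvC dotvNl dotvC. Qed.
Lemma dotvBl u1 u2 v : dotv (u1 - u2) v = dotv u1 v - dotv u2 v.
Proof. by rewrite dotvDl dotvNl. Qed.
Lemma dotvBr u v1 v2 : dotv u (v1 - v2) = dotv u v1 - dotv u v2.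
Proof. by rewrite dotvDr dotvNr. Qed.
Lemma dotv0 u : dotv u 0 = 0.
Proof. by rewrite /dotv big1// => i _; rewrite mxE mulr0. Qed.
Lemma dot0v u : dotv 0 u = 0.
Proof. by rewrite dotvC dotv0. Qed.
Lemma dotvv u : dotv u u = sqnorm u.
Proof. by apply: eq_bigr => i _; rewrite expr2. Qed.
Lemma sqnorm_ge0 u : 0 <= sqnorm u.
Proof. by apply: sumr_ge0 => i _; exact: sqr_ge0. Qed.
Lemma sqnormZ a u : sqnorm (a *: u) = a ^+ 2 * sqnorm u.
Proof. by rewrite -!dotvv dotvZl dotvZr mulrA expr2. Qed.
Lemma sqnormD u v : sqnorm (u + v) = sqnorm u + 2 * dotv u v + sqnorm v.
Proof. by rewrite -!dotvv dotvDl !dotvDr (dotvC v u); ring. Qed.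
Lemma sqnormN u : sqnorm (- u) = sqnorm u.
Proof. by rewrite -scaleN1r sqnormZ sqrrN expr1n mul1r. Qed.
Lemma sqnormB u v : sqnorm (u - v) = sqnorm u - 2 * dotv u v + sqnorm v.
Proof. by rewrite sqnormD dotvNr sqnormN; ring. Qed.
Lemma sqnorm0 : sqnorm (0 : 'cV[R]_n) = 0.
Proof. by rewrite -dotvv dotv0. Qed.
Lemma sqnorm_eq0 u : (sqnorm u == 0) = (u == 0).
Proof.
apply/idP/eqP => [|->]; last by rewrite sqnorm0.
rewrite psumr_eq0 => [/allP H|i _]; last exact: sqr_ge0.
apply/matrixP => i j; rewrite mxE ord1; apply/eqP; rewrite -sqrf_eq0.
by apply: H; rewrite mem_index_enum.
Qed.
Lemma sqnorm_le2 u v : sqnorm (u + v) <= 2 * sqnorm u + 2 * sqnorm v.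
Proof. by have := sqnorm_ge0 (u - v); rewrite sqnormB sqnormD; lra. Qed.
Lemma dotv_le u v : dotv u v <= 2^-1 * sqnorm u + 2^-1 * sqnorm v.
Proof. by have := sqnorm_ge0 (u - v); rewrite sqnormB; lra. Qed.
Lemma normr_dotv_le u v : `|dotv u v| <= 2^-1 * sqnorm u + 2^-1 * sqnorm v.
Proof.
rewrite ler_norml dotv_le andbT lerNl -dotvNl.
by have := dotv_le (- u) v; rewrite sqnormN.
Qed.

End vectors.

Section dyadic.
Context (R : realType) (disp : measure_display) (Omega : measurableType disp).
Context (P : probability Omega R) (T : R) (m : nat).
Variable B : R -> Omega -> 'cV[R]_m.
Hypotheses (T0 : 0 < T) (hP : measure_is_complete P).
Hypothesis hB : brownian_motion P T B.

Local Notation mu := (@lebesgue_measure R).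
Local Notation filt := (filt P B).
Local Notation filt_measurable := (filt_measurable P B).
Local Notation g := (grid T).

Implicit Types (n : nat) (xi : nat -> Omega -> 'cV[R]_m).

Definition dval n xi s w := simple_val (Simple (2 ^ n) (g n) xi) s w.
Definition dint n xi s w := simple_int B (Simple (2 ^ n) (g n) xi) s w.
(** The bracket, that is the time integral of [sqnorm (dval n xi)] up to [s], written as a finite
    sum (see [dqv_int]); [dexp] is then the stochastic exponential of [dint]. *)
Definition dqv n xi s w := \sum_(k < 2 ^ n)
  sqnorm (xi k w) * (Num.min (g n k.+1) s - Num.min (g n k) s).
Definition dexp n xi s w := expR (dint n xi s w - 2^-1 * dqv n xi s w).
Definition dwf n xi :=
  (forall k i, (k < 2 ^ n)%N -> filt_measurable (g n k) (fun w => xi k w i 0)) /\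
  exists K : R, forall k w i, (k < 2 ^ n)%N -> `|xi k w i 0| <= K.

Lemma dwf_simple n xi : dwf n xi -> simple_wf P T B (Simple (2 ^ n) (g n) xi).
Proof.
move=> [mxi [K HK]]; split.
- by rewrite grid0.
- by move=> k _; rewrite grid_le.
- by rewrite gridT.
- by move=> k i; exact: mxi.
- by exists K => k w i; exact: HK.
Qed.

Lemma filt_measurable_B r t i : 0 <= r <= t ->
  filt_measurable t (fun w => B r w i 0).
Proof.
by move=> rt U mU; apply: sub_sigma_algebra; left; exists r, i, U.
Qed.

Lemma dotv_measurable (G : set (set Omega)) (u v : Omega -> 'cV[R]_m) :
  sigma_algebra setT G -> (forall i, gmeas G (fun w => u w i 0)) ->
  (forall i, gmeas G (fun w => v w i 0)) -> gmeas G (fun w => dotv (u w) (v w)).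
Proof. by move=> sG mu' mv; apply: gmeas_sum => // i _; exact: gmeasM. Qed.

Lemma sqnorm_measurable (G : set (set Omega)) (u : Omega -> 'cV[R]_m) :
  sigma_algebra setT G -> (forall i, gmeas G (fun w => u w i 0)) ->
  gmeas G (fun w => sqnorm (u w)).
Proof. by move=> sG mu'; apply: gmeas_sum => // i _; exact: gmeasX. Qed.

Lemma dint_adapted n xi t : dwf n xi -> 0 <= t -> filt_measurable t (dint n xi t).
Proof.
move=> [mxi _] t0; have sF := sigma_filt P B t.
apply: (gmeas_sum sF) => k _.
have [kt|tk] := ltP (g n k) t; last first.
  have -> : (fun w => dotv (xi k w) (B (Num.min (g n k.+1) t) w - B t w)) = (fun=> 0).
    apply/funext => w; rewrite min_r ?subrr ?dotv0//.
    by apply: le_trans tk _; rewrite grid_le.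
  exact: gmeas_cst.
apply: (dotv_measurable sF) => i; first exact: filt_measurable_mono (ltW kt) (mxi k i (ltn_ord k)).
under eq_fun do rewrite !mxE.
apply: (gmeasB sF); apply: filt_measurable_B.
  by rewrite le_min grid_ge0// t0 ge_min lexx orbT.
by rewrite grid_ge0//= ltW.
Qed.

Lemma dqv_adapted n xi t : dwf n xi -> 0 <= t -> filt_measurable t (dqv n xi t).
Proof.
move=> [mxi _] t0; have sF := sigma_filt P B t.
apply: (gmeas_sum sF) => k _.
have [kt|tk] := ltP (g n k) t; last first.
  have -> : (fun w => sqnorm (xi k w) * (Num.min (g n k.+1) t - t)) = (fun=> 0).
    apply/funext => w; rewrite min_r ?subrr ?mulr0//.
    by apply: le_trans tk _; rewrite grid_le.
  exact: gmeas_cst.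
apply: (gmeasM sF); last exact: gmeas_cst.
apply: (sqnorm_measurable sF) => i.
exact: filt_measurable_mono (ltW kt) (mxi k i (ltn_ord k)).
Qed.

Lemma dexp_adapted n xi t : dwf n xi -> 0 <= t -> filt_measurable t (dexp n xi t).
Proof.
move=> wf t0; have sF := sigma_filt P B t.
apply: (gmeas_expR sF); apply: (gmeasB sF); first exact: dint_adapted.
by apply: (gmeasM sF); [exact: gmeas_cst|exact: dqv_adapted].
Qed.

Lemma dexp_ge0 n xi t w : 0 <= dexp n xi t w. Proof. exact: expR_ge0. Qed.

Lemma dint0 n xi w : dint n xi 0 w = 0.
Proof.
rewrite /dint /simple_int big1// => k _.
by rewrite !min_r ?grid_ge0// subrr dotv0.
Qed.

Lemma dqv0 n xi w : dqv n xi 0 w = 0.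
Proof.
by rewrite /dqv big1// => k _; rewrite !min_r ?grid_ge0// subrr mulr0.
Qed.

Let clampE (V : zmodType) (f : R -> V) (s t x : R) : s <= t ->
  f (Num.min x t) - f (Num.min x s) = f (Num.max s (Num.min x t)) - f s.
Proof.
move=> st; have [xs|sx] := leP x s.
  by rewrite (min_l (le_trans xs st)) (max_l xs) !subrr.
by rewrite max_r// le_min (ltW sx).
Qed.

(** Conditioning on [filt s] is replaced by testing against nonnegative weights [Phi] known at [s].
    The grid clamped to [[s, t]] splits the exponential into one factor per cell, and
    [gauss_step_vec] removes the factors starting from the last. *)
Lemma dexp_martingale n xi s t (Phi : Omega -> R) : dwf n xi ->
  0 <= s -> s <= t -> t <= T -> filt_measurable s Phi -> (forall w, 0 <= Phi w) ->
  (\int[P]_w (Phi w * dexp n xi t w)%:E = \int[P]_w (Phi w * dexp n xi s w)%:E)%E.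
Proof.
move=> wf s0 st tT mPhi Phi0; have [mxi _] := wf.
pose u k := Num.max s (Num.min (g n k) t).
have su k : s <= u k by rewrite le_max lexx.
have ut k : u k <= t by rewrite ge_max st ge_min lexx orbT.
have u_mono k j : (k <= j)%N -> u k <= u j.
  move=> kj; rewrite ge_max su/= le_max; apply/orP; right.
  by rewrite le_min !ge_min grid_le// kj lexx orbT.
pose ex k w := dotv (xi k w) (B (u k.+1) w - B (u k) w)
  - 2^-1 * sqnorm (xi k w) * (u k.+1 - u k).
(* A clamped cell that is not degenerate begins at or after its grid point, so [xi k] is known when
   it begins. *)
have gu k : u k < u k.+1 -> g n k <= u k.
  move=> uk; rewrite leNgt; apply/negP => ukg.
  have tk : t <= u k.
    have : Num.min (g n k) t <= u k by rewrite le_max lexx orbT.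
    by rewrite ge_min => /orP[|//]; rewrite leNgt ukg.
  by move: uk; rewrite ltNge (le_trans (ut _)).
have mex k : (k < 2 ^ n)%N -> filt_measurable (u k.+1) (ex k).
  move=> kn; have sF := sigma_filt P B (u k.+1).
  have [uk|uk] := ltP (u k) (u k.+1); last first.
    have -> : ex k = (fun=> 0).
      apply/funext => w; rewrite /ex.
      have -> : u k.+1 = u k by apply/eqP; rewrite eq_le uk u_mono.
      by rewrite !subrr dotv0 mulr0 subrr.
    exact: gmeas_cst.
  have mx i : filt_measurable (u k.+1) (fun w => xi k w i 0).
    by apply: filt_measurable_mono (mxi k i kn); exact: le_trans (gu k uk) (ltW uk).
  apply: (gmeasB sF).
    apply: (dotv_measurable sF) => // i; under eq_fun do rewrite !mxE.
    apply: (gmeasB sF); apply: filt_measurable_B; rewrite ?lexx ?(le_trans s0 (su _))//.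
    exact: ltW.
  apply: (gmeasM sF); last exact: gmeas_cst.
  by apply: (gmeasM sF); [exact: gmeas_cst|exact: sqnorm_measurable].
pose Psi j w := Phi w * dexp n xi s w * \prod_(k < j) expR (ex k w).
have Psi0 j w : 0 <= Psi j w.
  by rewrite !mulr_ge0 ?dexp_ge0// prodr_ge0// => k _; exact: expR_ge0.
have mPsi j : (j <= 2 ^ n)%N -> filt_measurable (u j) (Psi j).
  move=> jn; have sF := sigma_filt P B (u j).
  apply: (gmeasM sF).
    apply: (gmeasM sF); first exact: filt_measurable_mono mPhi.
    by apply: filt_measurable_mono (dexp_adapted wf s0).
  apply: (gmeas_prod sF) => k _; apply: (gmeas_expR sF).
  have kj := ltn_ord k.
  apply: filt_measurable_mono (mex k (leq_trans kj jn)); exact: u_mono.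
suff H j : (j <= 2 ^ n)%N ->
    (\int[P]_w (Psi j w)%:E = \int[P]_w (Phi w * dexp n xi s w)%:E)%E.
  rewrite -(H (2 ^ n)%N (leqnn _)); apply: eq_integral => w _; congr (_%:E).
  rewrite /Psi -mulrA; congr (_ * _); rewrite -expR_sum /dexp -expRD; congr expR.
  rewrite sumrB.
  have -> : \sum_(k < 2 ^ n) dotv (xi k w) (B (u k.+1) w - B (u k) w) =
      dint n xi t w - dint n xi s w.
    rewrite -sumrB; apply: eq_bigr => k _; rewrite -dotvBr; congr dotv.
    have h x := @clampE _ (B ^~ w) s t x st; rewrite /u.
    have -> : B (Num.max s (Num.min (g n k.+1) t)) w =
        B (Num.min (g n k.+1) t) w - B (Num.min (g n k.+1) s) w + B s w.
      by rewrite h subrK.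
    have -> : B (Num.max s (Num.min (g n k) t)) w =
        B (Num.min (g n k) t) w - B (Num.min (g n k) s) w + B s w.
      by rewrite h subrK.
    by rewrite opprD addrACA subrr addr0 !opprB addrACA [RHS]addrACA; congr (_ + _);
       rewrite addrC.
  have -> : \sum_(k < 2 ^ n) 2^-1 * sqnorm (xi k w) * (u k.+1 - u k) =
      2^-1 * dqv n xi t w - 2^-1 * dqv n xi s w.
    rewrite -mulrBr -sumrB mulr_sumr; apply: eq_bigr => k _.
    have h x := @clampE _ (id : R -> R) s t x st; rewrite /u.
    have h1 := h (g n k.+1); have h2 := h (g n k); rewrite /= in h1 h2.
    rewrite -mulrBr -mulrA; congr (_ * (_ * _)); lra.
  ring.
elim: j => [_|j IH jn].
  by apply: eq_integral => w _; rewrite /Psi big_ord0 mulr1.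
rewrite -(IH (ltnW jn)).
have [uj|uj] := ltP (u j) (u j.+1); last first.
  apply: eq_integral => w _; congr (_%:E); rewrite /Psi big_ord_recr/= /ex.
  have -> : u j.+1 = u j by apply/eqP; rewrite eq_le uj u_mono.
  by rewrite !subrr dotv0 mulr0 subrr expR0 mulr1.
rewrite -(@gauss_step_vec _ _ _ P T m B hP hB (u j) (u j.+1) (xi j) (Psi j))//.
- by apply: eq_integral => w _; rewrite /Psi big_ord_recr/= mulrA.
- exact: le_trans s0 (su j).
- exact: le_trans (ut _) tT.
- by move=> i; apply: filt_measurable_mono (mxi j i jn); exact: gu.
- exact: mPsi (ltnW jn).
Qed.

Lemma dexp_measurable n xi t : dwf n xi -> 0 <= t <= T -> measurable_fun setT (dexp n xi t).
Proof.
move=> wf /andP[t0 tT]; exact: (filt_measurableT hP hB tT (dexp_adapted wf t0)).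
Qed.

Lemma integral_dexp n xi t : dwf n xi -> 0 <= t <= T ->
  (\int[P]_w (dexp n xi t w)%:E = 1)%E.
Proof.
move=> wf /andP[t0 tT].
have := @dexp_martingale n xi 0 t (fun=> 1) wf (lexx 0) t0 tT.
move=> /(_ (gmeas_cst (sigma_filt _ _ _) 1)) => /(_ (fun=> ler01)) H.
under eq_integral do rewrite -[dexp _ _ _ _]mul1r.
rewrite H; under eq_integral do rewrite mul1r /dexp dint0 dqv0 mulr0 subr0 expR0.
transitivity (1%E * P setT)%E; first exact: integral_cst.
by rewrite probability_setT mul1e.
Qed.

Let exceed n xi (c : R) N i : set Omega :=
  [set w | exists2 j, (j < i)%N & c < dexp n xi (g N j) w].

Let exceedS n xi c N i :
  exceed n xi c N i.+1 = exceed n xi c N i `|` [set w | c < dexp n xi (g N i) w].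
Proof.
apply/seteqP; split => w /=.
  move=> [j]; rewrite ltnS leq_eqVlt => /orP[/eqP ->|ji] cj; [by right|].
  by left; exists j.
by move=> [[j ji cj]|ci]; [exists j => //; exact: ltnW|exists i].
Qed.

Let exceed_filt n xi c N i : dwf n xi -> filt (g N i) (exceed n xi c N i.+1).
Proof.
move=> wf; elim: i => [|i IH]; rewrite exceedS.
  apply: (gsetU (sigma_filt _ _ _)).
    rewrite (_ : exceed _ _ _ _ _ = set0); last by apply/seteqP; split => w // [].
    exact: (gset0 (sigma_filt _ _ _)).
  apply: (gset_lt (sigma_filt _ _ _)); first exact: (gmeas_cst (sigma_filt _ _ _)).
  by apply: dexp_adapted => //; exact: grid_ge0.
apply: (gsetU (sigma_filt _ _ _)).
  by apply: filt_mono IH; rewrite grid_le.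
apply: (gset_lt (sigma_filt _ _ _)); first exact: (gmeas_cst (sigma_filt _ _ _)).
by apply: dexp_adapted => //; exact: grid_ge0.
Qed.

(** The exponential is replaced by [c] as soon as it has exceeded [c] at a grid time. The mean of
    this stopped quantity stays at most 1 by induction on the index: the martingale property moves
    back one step, and replacing a value above [c] by [c] only decreases it. *)
Let exceed_prob n xi c N : dwf n xi -> 0 < c ->
  (c%:E * P (exceed n xi c N (2 ^ N).+1) <= 1)%E.
Proof.
move=> wf c0; set F := exceed n xi c N; pose X i := dexp n xi (g N i).
have gT i : (i <= 2 ^ N)%N -> 0 <= g N i <= T by move=> iN; rewrite grid_ge0// grid_leT.
have mX i : (i <= 2 ^ N)%N -> measurable_fun setT (X i).
  by move=> iN; apply: dexp_measurable => //; exact: gT.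
have mF i : (i <= (2 ^ N).+1)%N -> measurable (F i).
  case: i => [|i iN].
    by rewrite (_ : F 0%N = set0)//; apply/seteqP; split => w // [].
  have := @exceed_filt n xi c N i wf.
  by apply: (filt_sub_measurable hP hB); exact: grid_leT.
have m1 (A : set Omega) : measurable A -> measurable_fun setT (\1_A : Omega -> R).
  by move=> mA; exact: measurable_indic.
have V i : (i <= 2 ^ N)%N ->
    (\int[P]_w (\1_(~` F i) w * X i w + c * \1_(F i) w)%:E <= 1)%E.
  elim: i => [_|i IH iN].
    rewrite (_ : F 0%N = set0); last by apply/seteqP; split => w // [].
    under eq_integral do rewrite setC0 indicT indic0 mul1r mulr0 addr0.
    by rewrite integral_dexp// gT.
  apply: le_trans (IH (ltnW iN)).
  have mFi1 : measurable (F i.+1) by apply: mF; exact: leqW.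
  have mFi : measurable (F i) by apply: mF; exact: leqW (ltnW iN).
  have mcFi1 := measurableC mFi1.
  rewrite integralD_EFin; last 4 first.
  - by apply: measurable_funM; [exact: m1|exact: mX].
  - by apply: measurable_funM => //; exact: m1.
  - by move=> w; rewrite mulr_ge0// dexp_ge0.
  - by move=> w; rewrite mulr_ge0// ltW.
  have mPhi : filt_measurable (g N i) (\1_(~` F i.+1) : Omega -> R).
    apply: (gmeas_indic (sigma_filt _ _ _)).
    by apply: (gsetC (sigma_filt _ _ _)); exact: exceed_filt.
  have gi : g N i <= g N i.+1 by rewrite grid_le.
  rewrite (dexp_martingale wf (grid_ge0 T0 N i) gi (grid_leT T0 iN) mPhi)//.
  rewrite -integralD_EFin; last 4 first.
  - by apply: measurable_funM; [exact: m1|exact: mX (ltnW iN)].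
  - by apply: measurable_funM => //; exact: m1.
  - by move=> w; rewrite mulr_ge0// dexp_ge0.
  - by move=> w; rewrite mulr_ge0// ltW.
  apply: le_integral_EFin.
  - apply: measurable_funD; apply: measurable_funM => //; try exact: m1.
    exact: mX (ltnW iN).
  - apply: measurable_funD; apply: measurable_funM => //; try exact: m1.
      by apply: m1; exact: measurableC.
    exact: mX (ltnW iN).
  - by move=> w; rewrite addr_ge0// mulr_ge0// ?dexp_ge0// ltW.
  move=> w; rewrite /F exceedS -/F !indicE !in_setC in_setU.
  have [Fw|Fw] := boolP (w \in F i); rewrite /= ?mul1r ?mul0r ?mulr0 ?mulr1 ?addr0 ?add0r//.
  have [Gw|Gw] := boolP (w \in _); rewrite /= ?mul1r ?mul0r ?mulr0 ?mulr1 ?addr0 ?add0r//.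
  by move: Gw; rewrite inE/= => /ltW.
have mFF : measurable (F (2 ^ N).+1) by exact: mF.
have mF' : measurable (F (2 ^ N)%N) by apply: mF; exact: leqnSn.
have mcF' := measurableC mF'.
apply: le_trans (V (2 ^ N)%N (leqnn _)).
have -> : P (F (2 ^ N).+1) = (\int[P]_w (\1_(F (2 ^ N).+1) w)%:E)%E.
  by rewrite integral_indic// setIT.
rewrite -integralZ_EFin; last 3 first.
- exact: m1.
- by [].
- exact: ltW.
apply: le_integral_EFin.
- by apply: measurable_funM => //; exact: m1.
- apply: measurable_funD; apply: measurable_funM => //; try exact: m1.
  exact: mX.
- by move=> w; rewrite mulr_ge0// ltW.
move=> w; rewrite /F exceedS -/F !indicE !in_setC in_setU.
have [Fw|Fw] := boolP (w \in F _); rewrite /= ?mul1r ?mul0r ?mulr0 ?mulr1 ?addr0 ?add0r//.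
have [Gw|Gw] := boolP (w \in _); rewrite /= ?mul1r ?mul0r ?mulr0 ?mulr1 ?addr0 ?add0r//.
  by move: Gw; rewrite inE/= => /ltW.
exact: dexp_ge0.
Qed.

(** Ville's inequality on all dyadic levels at once: the exceedance events increase with the level
    and each has probability at most [1 / c], so their union inherits the bound. *)
Lemma ville n xi c : dwf n xi -> 0 < c -> exists E : set Omega,
  [/\ measurable E, (P E <= (c^-1)%:E)%E &
    forall w, ~ E w -> forall N k, (k <= 2 ^ N)%N -> dexp n xi (g N k) w <= c].
Proof.
move=> wf c0; pose E := \bigcup_N exceed n xi c N (2 ^ N).+1.
have mF N : measurable (exceed n xi c N (2 ^ N).+1).
  have := @exceed_filt n xi c N (2 ^ N)%N wf.
  by apply: (filt_sub_measurable hP hB); exact: grid_leT.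
exists E; split.
- exact: bigcupT_measurable.
- have nd : nondecreasing_seq (fun N => exceed n xi c N (2 ^ N).+1).
    apply/nondecreasing_seqP => N; apply/subsetPset => w [j jN cj].
    exists (j * 2)%N; first by rewrite ltnS expnSr leq_mul2r/= -ltnS.
    by have := grid_refine T N 1 j; rewrite addn1 expn1 => ->.
  have H := nondecreasing_cvg_mu (mu := P) mF (bigcupT_measurable _ mF) nd.
  rewrite -(cvg_lim _ H)//; apply: lime_le; first by apply/cvg_ex; eexists; exact: H.
  apply: nearW => N /=.
  have := @exceed_prob n xi c N wf c0.
  rewrite -(@lee_pmul2l _ (c^-1)%:E) ?lte_fin ?invr_gt0//.
  by rewrite muleA -EFinM mulVf ?gt_eqF// mul1e mule1.
- move=> w nE N k kN; rewrite leNgt; apply/negP => ck; apply: nE.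
  by exists N => //; exists k.
Qed.

Lemma brownian_ucont : {ae P, forall w, forall i, ucont T (fun t => B t w i 0)}.
Proof.
have [_ _ + _] := hB; apply: filterS => w H i.
by apply: (continuous_ucont T0); exact: H.
Qed.

Lemma dint_ucont n xi w : (forall i, ucont T (fun t => B t w i 0)) ->
  ucont T (fun t => dint n xi t w).
Proof.
move=> uB; apply: (ucont_sum T0) => k; apply: (ucont_sum T0) => i.
have h j : ucont T (fun t => B (Num.min (g n j) t) w i 0).
  apply: (@ucont_comp _ _ (fun t => B t w i 0) (Num.min (g n j))) => //.
    by move=> t /andP[t0 tT]; rewrite le_min grid_ge0// t0 ge_min tT orbT.
  by move=> u v; exact: lipschitz_min.
have H : ucont T (fun t => xi k w i 0 * (B (Num.min (g n k.+1) t) w i 0 -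
    B (Num.min (g n k) t) w i 0)).
  by apply: ucontZ; exact: (ucontB T0).
by under eq_fun do rewrite !mxE; exact: H.
Qed.

Lemma dqv_le n xi t w : 0 <= t <= T -> dqv n xi t w <= dqv n xi T w.
Proof.
move=> /andP[t0 tT]; apply: ler_sum => k _; rewrite ler_wpM2l ?sqnorm_ge0//.
have h := grid_le T0 n k k.+1; rewrite leqnSn in h.
case: (leP (g n k.+1) t); case: (leP (g n k) t); case: (leP (g n k.+1) T);
  case: (leP (g n k) T); lra.
Qed.

Lemma dintZ n a xi t w : dint n (fun k w => a *: xi k w) t w = a * dint n xi t w.
Proof. by rewrite /dint/= mulr_sumr; apply: eq_bigr => k _; rewrite dotvZl. Qed.

Lemma dqvZ n a xi t w : dqv n (fun k w => a *: xi k w) t w = a ^+ 2 * dqv n xi t w.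
Proof. by rewrite /dqv mulr_sumr; apply: eq_bigr => k _; rewrite sqnormZ mulrA. Qed.

Lemma dwfZ n a xi : dwf n xi -> dwf n (fun k w => a *: xi k w).
Proof.
move=> [mxi [K HK]]; split.
  move=> k i kn; have sF := sigma_filt P B (g n k).
  have H : filt_measurable (g n k) (fun w => a * xi k w i 0).
    by apply: (gmeasM sF); [exact: gmeas_cst|exact: mxi].
  by under eq_fun do rewrite mxE; exact: H.
exists (`|a| * K) => k w i kn; rewrite mxE normrM ler_wpM2l//; exact: HK.
Qed.

(* Exponential bound: on [dqv <= delta], [dint > e] forces the exponential
   martingale of [(e / delta) xi] above [exp (e ^ 2 / (2 delta))]. *)
Lemma dint_sup_small (e : R) : 0 < e -> exists2 delta : R, 0 < delta &
  forall n xi, dwf n xi -> exists E : set Omega,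
    [/\ measurable E, (P E <= e%:E)%E &
      forall w, ~ E w -> dqv n xi T w <= delta ->
        forall t : R, 0 <= t <= T -> `|dint n xi t w| <= e].
Proof.
(* With this value [exp (e ^ 2 / (2 delta)) = exp (2 / e) >= 2 / e], so that Ville's inequality
   costs at most [e / 2] for each sign of [dint]. *)
move=> e0; pose delta := e ^+ 3 / 4; have d0 : 0 < delta by rewrite divr_gt0// exprn_gt0.
exists delta => // n xi wf.
pose a := e / delta; pose c := expR (e ^+ 2 / (2 * delta)).
have c0 : 0 < c by exact: expR_gt0.
have a0 : 0 < a by rewrite divr_gt0.
have cV : c^-1 <= e / 2.
  rewrite -[leRHS]invrK lef_pV2 ?posrE ?invr_gt0 ?divr_gt0// invf_div.
  have := expR_ge1Dx (e ^+ 2 / (2 * delta)); rewrite -/c.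
  have -> : e ^+ 2 / (2 * delta) = 2 / e by rewrite /delta; field; rewrite gt_eqF.
  lra.
have [E1 [mE1 PE1 HE1]] := ville (dwfZ a wf) c0.
have [E2 [mE2 PE2 HE2]] := ville (dwfZ (- a) wf) c0.
have [N0 [mN0 PN0 HN0]] := brownian_ucont.
exists ((E1 `|` E2) `|` N0); split.
- by do 2?apply: measurableU.
- rewrite -[e%:E]adde0 [e in e%:E](splitr e) EFinD; apply: prob_leU => //.
  + exact: measurableU.
  + by apply: prob_leU => //; [apply: le_trans PE1 _|apply: le_trans PE2 _];
      rewrite lee_fin.
  + by rewrite le_eqVlt; apply/orP; left; apply/eqP; exact: PN0.
move=> w /not_orP[/not_orP[nE1 nE2] nN0] qd t tT.
have uB : forall i, ucont T (fun t => B t w i 0).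
  by apply: contrapT => nu; apply: nN0; exact: HN0.
have uI := dint_ucont n xi uB.
have key N k : (k <= 2 ^ N)%N -> `|dint n xi (g N k) w| <= e.
  move=> kN.
  have gT : 0 <= g N k <= T by rewrite grid_ge0// grid_leT.
  have q : dqv n xi (g N k) w <= delta by exact: le_trans (dqv_le n xi w gT) qd.
  have h1 := HE1 w nE1 N k kN; have h2 := HE2 w nE2 N k kN.
  move: h1 h2; rewrite /dexp !dintZ !dqvZ sqrrN !ler_expR => h1 h2.
  have h3 : 2^-1 * (a ^+ 2 * dqv n xi (g N k) w) <= 2^-1 * (a ^+ 2 * delta).
    by rewrite ler_wpM2l// ler_wpM2l// sqr_ge0.
  have hc : 2^-1 * (a ^+ 2 * delta) = e ^+ 2 / (2 * delta).
    by rewrite /a; field; rewrite gt_eqF.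
  have hc2 : e ^+ 2 / (2 * delta) + e ^+ 2 / (2 * delta) = a * e.
    by rewrite /a; field; rewrite gt_eqF.
  rewrite ler_norml; apply/andP; split.
    rewrite lerNl -(ler_pM2l a0) mulrN -mulNr; lra.
  rewrite -(ler_pM2l a0); lra.
rewrite ler_norml; apply/andP; split.
  rewrite lerNl.
  apply: (@ucont_grid_le _ _ T0 (fun t => - dint n xi t w) e (ucontN uI)) => // N k kN.
  by have := key N k kN; rewrite ler_norml => /andP[]; rewrite lerNl.
apply: (@ucont_grid_le _ _ T0 (fun t => dint n xi t w) e uI) => // N k kN.
by have := key N k kN; rewrite ler_norml => /andP[].
Qed.

End dyadic.

(** * Approximation by dyadic integrands *)

Section approx.
Context (R : realType) (disp : measure_display) (Omega : measurableType disp).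
Context (P : probability Omega R) (T : R) (m : nat).
Variable B : R -> Omega -> 'cV[R]_m.
Hypotheses (T0 : 0 < T) (hP : measure_is_complete P).
Hypothesis hB : brownian_motion P T B.

Local Notation mu := (@lebesgue_measure R).
Local Notation filt_measurable := (filt_measurable P B).
Local Notation g := (grid T).
Local Notation I0T := (`[0, T]%classic : set (measurableTypeR R)).

Implicit Types (n : nat) (xi : nat -> Omega -> 'cV[R]_m).
Implicit Types (H : R -> Omega -> 'cV[R]_m) (I : R -> Omega -> R).

(** Measurability in time along each fixed path, which is what comparing values of [l2d] path by
    path relies on. *)
Definition smeas H := forall w i, measurable_fun I0T (fun s => H s w i 0).

Lemma smeas_sqnorm H w : smeas H -> measurable_fun I0T (fun s => sqnorm (H s w)).
Proof.
by move=> mH; apply: measurable_sum => i; apply: measurable_funX; exact: mH.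
Qed.

Lemma smeasD H H' : smeas H -> smeas H' -> smeas (fun s w => H s w + H' s w).
Proof.
move=> mH mH' w i.
have h : measurable_fun I0T (fun s => H s w i 0 + H' s w i 0).
  by apply: measurable_funD; [exact: mH|exact: mH'].
by rewrite (_ : (fun _ => _) = (fun s => H s w i 0 + H' s w i 0))//; apply/funext => s; rewrite mxE.
Qed.

Lemma smeasM (k : R -> Omega -> R) H : (forall w, measurable_fun I0T (fun s => k s w)) ->
  smeas H -> smeas (fun s w => k s w *: H s w).
Proof.
move=> mk mH w i.
have h : measurable_fun I0T (fun s => k s w * H s w i 0).
  by apply: measurable_funM => //; exact: mH.
by rewrite (_ : (fun _ => _) = (fun s => k s w * H s w i 0))//; apply/funext => s; rewrite mxE.
Qed.

Lemma smeasZ a H : smeas H -> smeas (fun s w => a *: H s w).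
Proof. by apply: smeasM => w. Qed.

Lemma smeasB H H' : smeas H -> smeas H' -> smeas (fun s w => H s w - H' s w).
Proof.
move=> mH /(smeasZ (-1)) mH'; have := smeasD mH mH'.
by rewrite (_ : (fun _ => _) = fun s w => H s w - H' s w)//;
   apply/funext => s; apply/funext => w; rewrite scaleN1r.
Qed.

Lemma measurable_fun_cell (x y a : R) :
  measurable_fun I0T (fun s : measurableTypeR R => if x < s <= y then a else 0).
Proof.
have -> : (fun s : measurableTypeR R => if x < s <= y then a else 0) =
    (fun s => a * \1_(`]x, y]%classic) s).
  apply/funext => s; rewrite indicE mem_setE in_itv/=.
  by case: ifP => _; rewrite ?mulr1 ?mulr0.
by apply: measurable_funM => //; apply: measurable_indic.
Qed.

Lemma dval_smeas n xi : smeas (dval T n xi).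
Proof.
move=> w i.
have h : measurable_fun I0T (fun s : measurableTypeR R =>
    \sum_(k < 2 ^ n) (if g n k < s <= g n k.+1 then xi k w i 0 else 0)).
  by apply: measurable_sum => k; exact: measurable_fun_cell.
rewrite (_ : (fun _ => _) = (fun s : measurableTypeR R =>
    \sum_(k < 2 ^ n) (if g n k < s <= g n k.+1 then xi k w i 0 else 0)))//.
apply/funext => s; rewrite /dval/= summxE; apply: eq_bigr => k _.
by case: ifP => // _; rewrite mxE.
Qed.

Definition l2d H H' (w : Omega) : \bar R :=
  (\int[mu]_(s in `[0%R, T]) (sqnorm (H s w - H' s w))%:E)%E.

Lemma l2_le (f k : measurableTypeR R -> R) : measurable_fun I0T f -> measurable_fun I0T k ->
  (forall s, 0 <= s <= T -> 0 <= f s <= k s) ->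
  (\int[mu]_(s in `[0%R, T]) (f s)%:E <= \int[mu]_(s in `[0%R, T]) (k s)%:E)%E.
Proof.
move=> mf mk fk; apply: ge0_le_integral => //.
- by move=> s /=; rewrite in_itv/= lee_fin => /fk/andP[].
- exact/measurable_EFinP.
- exact/measurable_EFinP.
- by move=> s /=; rewrite in_itv/= lee_fin => /fk/andP[].
Qed.

Lemma l2_linear (a b : R) (f k : measurableTypeR R -> R) :
  measurable_fun I0T f -> measurable_fun I0T k -> 0 <= a -> 0 <= b ->
  (forall s, 0 <= s <= T -> 0 <= f s) -> (forall s, 0 <= s <= T -> 0 <= k s) ->
  (\int[mu]_(s in `[0%R, T]) (a * f s + b * k s)%:E =
   a%:E * \int[mu]_(s in `[0%R, T]) (f s)%:E +
   b%:E * \int[mu]_(s in `[0%R, T]) (k s)%:E)%E.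
Proof.
move=> mf mk a0 b0 f0 k0.
have f0' s : `[0%R, T]%classic s -> 0 <= f s by rewrite /= in_itv/=; exact: f0.
have k0' s : `[0%R, T]%classic s -> 0 <= k s by rewrite /= in_itv/=; exact: k0.
under eq_integral do rewrite EFinD !EFinM.
rewrite ge0_integralD//; last 4 first.
- by move=> s /f0' ?; rewrite mule_ge0.
- by apply: emeasurable_funM => //; exact/measurable_EFinP.
- by move=> s /k0' ?; rewrite mule_ge0.
- by apply: emeasurable_funM => //; exact/measurable_EFinP.
rewrite !ge0_integralZl//.
- exact/measurable_EFinP.
- exact/measurable_EFinP.
Qed.

Lemma l2d_triangle H1 H2 H3 w : smeas H1 -> smeas H2 -> smeas H3 ->
  (l2d H1 H3 w <= 2%:E * l2d H1 H2 w + 2%:E * l2d H2 H3 w)%E.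
Proof.
move=> m1 m2 m3.
have m12 := smeas_sqnorm w (smeasB m1 m2); have m23 := smeas_sqnorm w (smeasB m2 m3).
rewrite /l2d -l2_linear//; last 2 first.
- by move=> s _; exact: sqnorm_ge0.
- by move=> s _; exact: sqnorm_ge0.
apply: l2_le.
- exact: smeas_sqnorm (smeasB m1 m3).
- by apply: measurable_funD; apply: measurable_funM.
move=> s _; rewrite sqnorm_ge0/=.
have -> : H1 s w - H3 s w = (H1 s w - H2 s w) + (H2 s w - H3 s w).
  by rewrite addrA subrK.
exact: sqnorm_le2.
Qed.

Lemma l2dC H H' w : l2d H H' w = l2d H' H w.
Proof. by apply: eq_integral => s _; rewrite -sqnormN opprB. Qed.

(* [approx] is [is_ito_integral] without continuity and adaptedness, with dyadic
   integrands only, and with exceptional events that are measurable supersets,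
   as the sets in the definition need not be known to be measurable. *)
Definition approx_at H I (e : R) n xi := dwf P T B n xi /\ exists E : set Omega,
  [/\ measurable E, (P E <= e%:E)%E & forall w, ~ E w ->
    (l2d (dval T n xi) H w <= e%:E)%E /\
    forall t : R, 0 <= t <= T -> `|dint T B n xi t w - I t w| <= e].

Definition approx H I := forall e : R, 0 < e -> exists n xi, approx_at H I e n xi.

Section lift.
Variable V : zmodType.

Lemma sum_double (F : nat -> V) N :
  \sum_(k < N.*2) F k = \sum_(i < N) (F i.*2 + F i.*2.+1).
Proof.
elim: N => [|N IH]; first by rewrite !big_ord0.
by rewrite doubleS !big_ord_recr/= IH addrA.
Qed.

(** Terms additive in the interval have the same sum after every cell is halved. Values, integrals
    and the sums [kstep] and [ksum] are all of this form, so two dyadic integrands can be put on a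
    common grid. *)
Lemma sum_lift (A : Type) (c : nat -> A) (Phi : A -> R -> R -> V) n :
  (forall a x y z, x <= y -> y <= z -> Phi a x z = Phi a x y + Phi a y z) ->
  \sum_(k < 2 ^ n) Phi (c k) (g n k) (g n k.+1) =
  \sum_(k < 2 ^ n.+1) Phi (c k./2) (g n.+1 k) (g n.+1 k.+1).
Proof.
move=> add; rewrite expnS mul2n.
rewrite (sum_double (fun k => Phi (c k./2) (g n.+1 k) (g n.+1 k.+1))).
apply: eq_bigr => k _; rewrite doubleK (half_bit_double k true).
have e i : g n.+1 i.*2 = g n i.
  by have := grid_refine T n 1 i; rewrite addn1 expn1 muln2.
by rewrite -doubleS e e -add// -?[g n k]e -?[g n k.+1]e grid_le.
Qed.

End lift.

Lemma dint_additive (X : R -> 'cV[R]_m) (t : R) (a : 'cV[R]_m) (x y z : R) :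
  dotv a (X (Num.min z t) - X (Num.min x t)) =
  dotv a (X (Num.min y t) - X (Num.min x t)) + dotv a (X (Num.min z t) - X (Num.min y t)).
Proof.
rewrite -dotvDr; congr dotv; move: (X _) (X _) (X _) => u v y'.
by rewrite [RHS]addrC addrA subrK.
Qed.

Lemma cell_additive (V : zmodType) (a : V) (s x y z : R) : x <= y -> y <= z ->
  (if x < s <= z then a else 0) =
  (if x < s <= y then a else 0) + (if y < s <= z then a else 0).
Proof.
move=> xy yz; have [sy|ys] := leP s y.
  by rewrite (le_trans sy yz)/= addr0 andbT.
by rewrite (le_lt_trans xy ys)/= add0r.
Qed.

Lemma dwf_lift n xi : dwf P T B n xi -> dwf P T B n.+1 (fun k => xi k./2).
Proof.
have half_lt k : (k < 2 ^ n.+1)%N -> (k./2 < 2 ^ n)%N.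
  by rewrite expnS mul2n -[X in (X < _)%N](odd_double_half k) => h;
     rewrite -ltn_double; apply: leq_ltn_trans h; rewrite leq_addl.
move=> [mxi [K HK]]; split.
  move=> k i /half_lt kn; apply: filt_measurable_mono (mxi _ i kn).
  have := grid_refine T n 1 k./2; rewrite addn1 expn1 muln2 => <-.
  by rewrite grid_le// -[leqRHS](odd_double_half k) leq_addl.
by exists K => k w i /half_lt; exact: HK.
Qed.

Lemma dval_lift n xi : dval T n xi = dval T n.+1 (fun k => xi k./2).
Proof.
apply/funext => s; apply/funext => w.
apply: (@sum_lift _ _ (fun k => xi k w) (fun a x y => if x < s <= y then a else 0)).
by move=> *; exact: cell_additive.
Qed.

Lemma dint_lift n xi : dint T B n xi = dint T B n.+1 (fun k => xi k./2).
Proof.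
apply/funext => s; apply/funext => w.
apply: (@sum_lift _ _ (fun k => xi k w)
  (fun a x y => dotv a (B (Num.min y s) w - B (Num.min x s) w))).
by move=> *; exact: (dint_additive (B ^~ w)).
Qed.

(** Index, at level [n], of the cell containing cell [k] of level [n + j]. *)
Fixpoint halfs j k := if j is j'.+1 then halfs j' k./2 else k.

Lemma approx_at_lift H I e n j xi : approx_at H I e n xi ->
  approx_at H I e (n + j) (fun k => xi (halfs j k)) /\
  (dval T n xi = dval T (n + j) (fun k => xi (halfs j k)) /\
   dint T B n xi = dint T B (n + j) (fun k => xi (halfs j k))).
Proof.
elim: j => [|j IH]; first by rewrite addn0.
move=> /IH[[wf [E [mE PE HE]]] [ev ei]]; rewrite addnS.
split; last by rewrite ev ei; split; [exact: dval_lift|exact: dint_lift].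
split; first exact: dwf_lift wf.
exists E; split => // w nE; have := HE w nE.
by rewrite dval_lift dint_lift.
Qed.

Lemma sum_lifts (V : zmodType) (A : Type) (c : nat -> A) (Phi : A -> R -> R -> V) n j :
  (forall a x y z, x <= y -> y <= z -> Phi a x z = Phi a x y + Phi a y z) ->
  \sum_(k < 2 ^ n) Phi (c k) (g n k) (g n k.+1) =
  \sum_(k < 2 ^ (n + j)) Phi (c (halfs j k)) (g (n + j) k) (g (n + j) k.+1).
Proof.
move=> add; elim: j => [|j IH]; first by rewrite addn0.
by rewrite IH addnS (sum_lift (fun k => c (halfs j k)) _ add).
Qed.

Lemma approx_common H I e n xi N : (n <= N)%N -> approx_at H I e n xi ->
  exists xi', approx_at H I e N xi'.
Proof.
move=> nN /(approx_at_lift (N - n))[]; rewrite subnKC// => h _.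
by exists (fun k => xi (halfs (N - n) k)).
Qed.

Lemma dvalD n xi xi' s w :
  dval T n (fun k w => xi k w + xi' k w) s w = dval T n xi s w + dval T n xi' s w.
Proof.
rewrite /dval/= -big_split/=; apply: eq_bigr => k _.
by case: ifP => // _; rewrite addr0.
Qed.

Lemma dintD n xi xi' t w :
  dint T B n (fun k w => xi k w + xi' k w) t w = dint T B n xi t w + dint T B n xi' t w.
Proof. by rewrite /dint/= -big_split; apply: eq_bigr => k _; rewrite dotvDl. Qed.

Lemma dvalZ n a xi s w : dval T n (fun k w => a *: xi k w) s w = a *: dval T n xi s w.
Proof.
rewrite /dval/= scaler_sumr; apply: eq_bigr => k _.
by case: ifP => // _; rewrite scaler0.
Qed.

Lemma dwfD n xi xi' : dwf P T B n xi -> dwf P T B n xi' ->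
  dwf P T B n (fun k w => xi k w + xi' k w).
Proof.
move=> [mx [K HK]] [mx' [K' HK']]; split.
  move=> k i kn; have sF := sigma_filt P B (g n k).
  have h : filt_measurable (g n k) (fun w => xi k w i 0 + xi' k w i 0).
    by apply: (gmeasD sF); [exact: mx|exact: mx'].
  rewrite (_ : (fun w => _) = (fun w => xi k w i 0 + xi' k w i 0)) ; first exact: h.
  by apply/funext => w; rewrite mxE.
exists (K + K') => k w i kn; rewrite mxE (le_trans (ler_normD _ _))// lerD//.
  exact: HK.
exact: HK'.
Qed.

Lemma approx_eq H H' I I' : approx H I ->
  (forall s w, 0 <= s <= T -> H s w = H' s w) ->
  (forall s w, 0 <= s <= T -> I s w = I' s w) -> approx H' I'.
Proof.
move=> aH HH' II' e e0; have [n [xi [wf [E [mE PE HE]]]]] := aH e e0.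
exists n, xi; split => //; exists E; split => // w nE; have [h1 h2] := HE w nE.
split; last by move=> t tT; rewrite -II'//; exact: h2.
apply: le_trans h1; rewrite le_eqVlt; apply/orP; left; apply/eqP.
by apply: eq_integral => s /[!inE]/=; rewrite in_itv/= => sT; rewrite HH'.
Qed.

Lemma approxD H H' I I' : smeas H -> smeas H' -> approx H I -> approx H' I' ->
  approx (fun s w => H s w + H' s w) (fun s w => I s w + I' s w).
Proof.
move=> mH mH' aH aH' e e0; have e4 : 0 < e / 4 by rewrite divr_gt0.
have [n [xi ax]] := aH _ e4; have [n' [xi' ax']] := aH' _ e4.
have [y [wf [E [mE PE HE]]]] := approx_common (leq_maxl n n') ax.
have [y' [wf' [E' [mE' PE' HE']]]] := approx_common (leq_maxr n n') ax'.
exists (maxn n n'), (fun k w => y k w + y' k w); split; first exact: dwfD.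
exists (E `|` E'); split; first exact: measurableU.
  apply: (le_trans (prob_leU mE mE' PE PE')); rewrite -EFinD lee_fin; lra.
move=> w /not_orP[nE nE']; have [h1 h2] := HE w nE; have [h1' h2'] := HE' w nE'.
split.
  set N := maxn n n'.
  have mv := @dval_smeas N y; have mv' := @dval_smeas N y'.
  have m1 := smeas_sqnorm w (smeasB mv mH); have m2 := smeas_sqnorm w (smeasB mv' mH').
  apply: (@le_trans _ _ (2%:E * l2d (dval T N y) H w + 2%:E * l2d (dval T N y') H' w)%E).
    rewrite /l2d -l2_linear//; last 2 first.
    - by move=> s _; exact: sqnorm_ge0.
    - by move=> s _; exact: sqnorm_ge0.
    apply: l2_le.
    - exact: (smeas_sqnorm w (smeasB (@dval_smeas N (fun k w => y k w + y' k w)) (smeasD mH mH'))).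
    - by apply: measurable_funD; apply: measurable_funM.
    move=> s _; rewrite sqnorm_ge0/= dvalD opprD addrACA; exact: sqnorm_le2.
  apply: (@le_trans _ _ (2%:E * (e / 4)%:E + 2%:E * (e / 4)%:E)%E).
    by apply: leeD; apply: lee_wpmul2l => //; rewrite lee_fin.
  rewrite -!EFinM -EFinD lee_fin; lra.
move=> t tT; have := h2 t tT; have := h2' t tT.
rewrite dintD opprD addrACA => ? ?; rewrite (le_trans (ler_normD _ _))//; lra.
Qed.

Lemma approxZ a H I : smeas H -> approx H I ->
  approx (fun s w => a *: H s w) (fun s w => a * I s w).
Proof.
(* The constant [c] dominates both the absolute value of [a], for the integral, and [a ^+ 2], for
   the squared distance. *)
move=> mH aH e e0; pose c := 1 + `|a| + a ^+ 2.
have c1 : 1 <= c by rewrite /c -addrA lerDl addr_ge0// sqr_ge0.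
have c0 : 0 < c by apply: lt_le_trans c1.
have [|n [xi [wf [E [mE PE HE]]]]] := aH (e / c); first by rewrite divr_gt0.
have ec : e / c <= e by rewrite ler_pdivrMr// ler_peMr// ltW.
exists n, (fun k w => a *: xi k w); split; first exact: dwfZ.
exists E; split => //; first by rewrite (le_trans PE)// lee_fin.
move=> w nE; have [h1 h2] := HE w nE; split.
  apply: (@le_trans _ _ ((a ^+ 2)%:E * l2d (dval T n xi) H w)%E).
    have m1 := smeas_sqnorm w (smeasB (@dval_smeas n xi) mH).
    have := l2_linear (a := a ^+ 2) (b := 0) m1 (measurable_cst (0 : R)) (sqr_ge0 _) (lexx 0).
    move=> /(_ (fun _ _ => sqnorm_ge0 _) (fun _ _ => lexx _)); rewrite mul0e adde0 => <-.
    apply: l2_le.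
    - exact: (smeas_sqnorm w (smeasB (@dval_smeas n (fun k w => a *: xi k w)) (smeasZ a mH))).
    - by apply: measurable_funD; apply: measurable_funM => //.
    by move=> s _; rewrite sqnorm_ge0/= dvalZ -scalerBr sqnormZ mul0r addr0.
  apply: (@le_trans _ _ ((a ^+ 2)%:E * (e / c)%:E)%E).
    by apply: lee_wpmul2l => //; rewrite lee_fin sqr_ge0.
  rewrite -EFinM lee_fin mulrA ler_pdivrMr// mulrC ler_wpM2l ?(ltW e0)// /c.
  by rewrite lerDr.
move=> t tT; rewrite dintZ -mulrBr normrM.
apply: (@le_trans _ _ (`|a| * (e / c))); first by rewrite ler_wpM2l// h2.
rewrite mulrA ler_pdivrMr// mulrC ler_wpM2l ?(ltW e0)// /c.
by have := sqr_ge0 a; lra.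
Qed.

Lemma approxB H H' I I' : smeas H -> smeas H' -> approx H I -> approx H' I' ->
  approx (fun s w => H s w - H' s w) (fun s w => I s w - I' s w).
Proof.
move=> mH mH' aH aH'.
apply: (@approx_eq _ _ _ _ (approxD mH (smeasZ (-1) mH') aH (approxZ (-1) mH' aH'))).
  by move=> s w _; rewrite scaleN1r.
by move=> s w _; rewrite mulN1r.
Qed.

(** The relation [approx] is closed under the convergence it describes: errors and exceptional
    events add up, the squared distances with a factor 2. *)
Lemma approx_lim H I : smeas H ->
  (forall e : R, 0 < e -> exists H' I', [/\ smeas H', approx H' I' &
    exists E : set Omega, [/\ measurable E, (P E <= e%:E)%E & forall w, ~ E w ->
      (l2d H' H w <= e%:E)%E /\ forall t : R, 0 <= t <= T -> `|I' t w - I t w| <= e]]) ->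
  approx H I.
Proof.
move=> mH aH e e0; have e4 : 0 < e / 4 by rewrite divr_gt0.
have [H' [I' [mH' aH' [E [mE PE HE]]]]] := aH _ e4.
have [n [xi [wf [E' [mE' PE' HE']]]]] := aH' _ e4.
exists n, xi; split => //; exists (E `|` E'); split; first exact: measurableU.
  apply: (le_trans (prob_leU mE mE' PE PE')); rewrite -EFinD lee_fin; lra.
move=> w /not_orP[nE nE']; have [h1 h2] := HE w nE; have [h1' h2'] := HE' w nE'.
split.
  apply: (le_trans (l2d_triangle w (@dval_smeas n xi) mH' mH)).
  apply: (@le_trans _ _ (2%:E * (e / 4)%:E + 2%:E * (e / 4)%:E)%E).
    by apply: leeD; apply: lee_wpmul2l => //; rewrite lee_fin.
  rewrite -!EFinM -EFinD lee_fin; lra.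
move=> t tT; have h3 := h2 t tT; have h3' := h2' t tT.
rewrite (le_trans (ler_distD (I' t w) _ _))//; lra.
Qed.

(** Adapted step processes used as multipliers: [ksum n k I] is the integral of [kstep n k] against
    [I]. Stopping and multiplication by [h] are both reduced to such multipliers. *)
Definition kstep n (k : nat -> Omega -> R) (s : R) (w : Omega) : R :=
  \sum_(i < 2 ^ n) (if g n i < s <= g n i.+1 then k i w else 0).

Definition ksum n (k : nat -> Omega -> R) I (t : R) (w : Omega) : R :=
  \sum_(i < 2 ^ n) k i w * (I (Num.min (g n i.+1) t) w - I (Num.min (g n i) t) w).

Lemma kstep_smeas n k w : measurable_fun I0T (fun s => kstep n k s w).
Proof. by apply: measurable_sum => i; exact: measurable_fun_cell. Qed.

Lemma cell_or_not n (s : R) : (exists2 i, (i < 2 ^ n)%N & g n i < s <= g n i.+1) \/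
  (forall i, (i < 2 ^ n)%N -> (g n i < s <= g n i.+1) = false).
Proof.
have [[i]|H] := pselect (exists2 i, (i < 2 ^ n)%N & g n i < s <= g n i.+1).
  by move=> i1 i2; left; exists i.
right => i i_n; apply/negP => gi; apply: H; by exists i.
Qed.

Lemma kstep_bound n k K s w : (forall i, (i < 2 ^ n)%N -> `|k i w| <= K) -> 0 <= K ->
  `|kstep n k s w| <= K.
Proof.
move=> kK K0; have [[i i_n si]|H] := cell_or_not n s.
  by rewrite /kstep (grid_cell_sum T0 (fun i => k i w) i_n si) kK.
by rewrite /kstep big1 ?normr0// => i _; rewrite H.
Qed.

Lemma kstep_dval n k xi s w :
  dval T n (fun i w => k i w *: xi i w) s w = kstep n k s w *: dval T n xi s w.
Proof.
rewrite /dval/= /kstep; have [[i i_n si]|H] := cell_or_not n s.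
  rewrite (grid_cell_sum T0 (fun i => k i w *: xi i w) i_n si).
  rewrite (grid_cell_sum T0 (fun i => k i w) i_n si).
  by rewrite (grid_cell_sum T0 (fun i => xi i w) i_n si).
rewrite big1 => [|i _]; last by rewrite H.
rewrite [X in _ *: X]big1 => [|i _]; last by rewrite H.
by rewrite scaler0.
Qed.

Lemma min_min_l (a b t : R) : a <= b -> Num.min a (Num.min b t) = Num.min a t.
Proof. by move=> ab; rewrite minA (min_l ab). Qed.

Lemma min_min_r (a b t : R) : a <= b -> Num.min b (Num.min a t) = Num.min a t.
Proof. by move=> ab; rewrite minA (min_r ab). Qed.

Lemma ksum_dint n k xi t w :
  dint T B n (fun i w => k i w *: xi i w) t w = ksum n k (dint T B n xi) t w.
Proof.
rewrite /dint/= /ksum; apply: eq_bigr => i _; rewrite dotvZl; congr (_ * _).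
rewrite -sumrB (bigD1 i)//= big1 ?addr0 => [|j].
  have gi : g n i <= g n i.+1 by rewrite grid_le.
  rewrite (min_min_l _ (lexx (g n i.+1))) (min_min_l _ gi) (min_min_r _ gi).
  by rewrite (min_min_l _ (lexx (g n i))) subrr dotv0 subr0.
rewrite -val_eqE/= neq_ltn => /orP[ji|ij].
  have g1 : g n j.+1 <= g n i by rewrite grid_le.
  have g2 : g n i <= g n i.+1 by rewrite grid_le.
  have g3 : g n j <= g n j.+1 by rewrite grid_le.
  by rewrite !min_min_l ?subrr//; lra.
have g1 : g n i.+1 <= g n j by rewrite grid_le.
have g2 : g n i <= g n i.+1 by rewrite grid_le.
have g3 : g n j <= g n j.+1 by rewrite grid_le.
by rewrite !min_min_r ?subrr ?dotv0 ?subrr//; lra.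
Qed.

Lemma kstep_lift n j k s w : kstep n k s w = kstep (n + j) (fun i => k (halfs j i)) s w.
Proof.
apply: (@sum_lifts _ _ (fun i => k i w) (fun a x y => if x < s <= y then a else 0)).
by move=> *; exact: cell_additive.
Qed.

Lemma ksum_lift n j k I t w :
  ksum n k I t w = ksum (n + j) (fun i => k (halfs j i)) I t w.
Proof.
apply: (@sum_lifts _ _ (fun i => k i w)
  (fun a x y => a * (I (Num.min y t) w - I (Num.min x t) w))).
by move=> a x y z _ _; ring.
Qed.

Lemma half_ltn_exp n k : (k < 2 ^ n.+1)%N -> (k./2 < 2 ^ n)%N.
Proof.
rewrite expnS mul2n -[X in (X < _)%N](odd_double_half k) => h.
by rewrite -ltn_double; apply: leq_ltn_trans h; rewrite leq_addl.
Qed.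

Lemma halfs_lt n j k : (k < 2 ^ (n + j))%N -> (halfs j k < 2 ^ n)%N.
Proof.
by elim: j k => [k|j IH k]; rewrite ?addn0// addnS => /half_ltn_exp/IH.
Qed.

Lemma grid_half n k : g n k./2 <= g n.+1 k.
Proof.
have := grid_refine T n 1 k./2; rewrite addn1 expn1 muln2 => <-.
by rewrite grid_le// -[leqRHS](odd_double_half k) leq_addl.
Qed.

Lemma grid_halfs n j k : g n (halfs j k) <= g (n + j) k.
Proof.
elim: j k => [k|j IH k]; first by rewrite addn0.
by rewrite addnS (le_trans (IH _))// grid_half.
Qed.

Definition kwf n (K : R) (k : nat -> Omega -> R) :=
  (forall i, (i < 2 ^ n)%N -> filt_measurable (g n i) (k i)) /\
  (forall i w, (i < 2 ^ n)%N -> `|k i w| <= K).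

Lemma approx_step H I n k K : smeas H -> approx H I -> kwf n K k ->
  approx (fun s w => kstep n k s w *: H s w) (ksum n k I).
Proof.
move=> mH aH [mk kK] e e0.
have K0 : 0 <= K by apply: le_trans (kK 0%N point _) => //; rewrite expn_gt0.
(* Each of the [2 ^ n] terms of [ksum] is off by at most [K] times the error of [I] at two times. *)
pose D := 2 * (2 ^ n)%:R * K.
have D0 : 0 <= D by rewrite !mulr_ge0.
pose c := 1 + K ^+ 2 + D.
have c1 : 1 <= c by rewrite /c -addrA lerDl addr_ge0// sqr_ge0.
have c0 : 0 < c by apply: lt_le_trans c1.
have ec0 : 0 < e / c by rewrite divr_gt0.
have ec : e / c <= e by rewrite ler_pdivrMr// ler_peMr// ltW.
have [n0 [xi0 ax]] := aH _ ec0.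
have [xi [wf [E [mE PE HE]]]] := approx_common (leq_addl n n0) ax.
pose N := (n + n0)%N; pose k' i := k (halfs n0 i).
exists N, (fun i w => k' i w *: xi i w); split.
  case: wf => [mx [K' HK']]; split.
    move=> i j iN; have sF := sigma_filt P B (g N i).
    have h : filt_measurable (g N i) (fun w => k' i w * xi i w j 0).
      apply: (gmeasM sF); last exact: mx.
      by apply: (filt_measurable_mono (grid_halfs n n0 i)); apply: mk; exact: halfs_lt.
    rewrite (_ : (fun w => _) = (fun w => k' i w * xi i w j 0)); first exact: h.
    by apply/funext => w; rewrite mxE.
  exists (K * K') => i w j iN; rewrite mxE normrM ler_pM//; last exact: HK'.
  by apply: kK; exact: halfs_lt.
exists E; split => //; first by rewrite (le_trans PE)// lee_fin.
move=> w nE; have [h1 h2] := HE w nE; split.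
  apply: (@le_trans _ _ ((K ^+ 2)%:E * l2d (dval T N xi) H w)%E).
    have m1 := smeas_sqnorm w (smeasB (@dval_smeas N xi) mH).
    have := l2_linear (a := K ^+ 2) (b := 0) m1 (measurable_cst (0 : R)) (sqr_ge0 _) (lexx 0).
    move=> /(_ (fun _ _ => sqnorm_ge0 _) (fun _ _ => lexx _)); rewrite mul0e adde0 => <-.
    apply: l2_le.
    - exact: (smeas_sqnorm w (smeasB (@dval_smeas N (fun i w => k' i w *: xi i w))
        (smeasM (@kstep_smeas n k) mH))).
    - by apply: measurable_funD; apply: measurable_funM => //.
    move=> s _; rewrite sqnorm_ge0/= kstep_dval mul0r addr0 -/N.
    rewrite (kstep_lift n n0 k s w) -/N -/k' -scalerBr sqnormZ.
    rewrite ler_wpM2r ?sqnorm_ge0// -real_normK ?num_real// ler_sqr ?nnegrE//.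
    by apply: kstep_bound => // i iN; apply: kK; exact: halfs_lt.
  apply: (@le_trans _ _ ((K ^+ 2)%:E * (e / c)%:E)%E).
    by apply: lee_wpmul2l => //; rewrite lee_fin sqr_ge0.
  rewrite -EFinM lee_fin mulrA ler_pdivrMr// mulrC ler_wpM2l ?(ltW e0)// /c.
  by have := D0; lra.
move=> t tT; rewrite ksum_dint -(ksum_lift n n0 k) /ksum -sumrB.
apply: (@le_trans _ _ (\sum_(i < 2 ^ n) (K * (2 * (e / c))))); last first.
  rewrite sumr_const card_ord -[_ *+ (2 ^ n)]mulr_natr.
  rewrite (_ : _ * (2 ^ n)%:R = D * e / c); last by rewrite /D; ring.
  rewrite ler_pdivrMr// mulrC ler_wpM2l ?(ltW e0)// /c.
  by have := sqr_ge0 K; lra.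
apply: (le_trans (ler_norm_sum _ _ _)); apply: ler_sum => i _.
rewrite -mulrBr normrM ler_pM//; first exact: kK.
have mT j : (j <= 2 ^ n)%N -> 0 <= Num.min (g n j) t <= T.
  move=> jn; move/andP: tT => [t0 tT'].
  by rewrite le_min t0 grid_ge0//= ge_min tT' orbT.
have := h2 _ (mT i.+1 (ltn_ord i)); have := h2 _ (mT i (ltnW (ltn_ord i))).
rewrite -/N; set u := dint _ _ _ _ _ _; set u' := dint _ _ _ _ _ _.
rewrite !ler_norml; move=> /andP[? ?] /andP[? ?]; apply/andP; split; lra.
Qed.

Lemma negligible_small (A : set Omega) : (forall e : R, 0 < e -> exists E : set Omega,
    [/\ measurable E, (P E <= e%:E)%E & A `<=` E]) -> P.-negligible A.
Proof.
move=> H.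
have /choice[E HE] : forall n : nat, exists E : set Omega,
    [/\ measurable E, (P E <= (n.+1%:R^-1)%:E)%E & A `<=` E].
  by move=> n; apply: H; rewrite invr_gt0.
have mE n : measurable (E n) by case: (HE n).
exists (\bigcap_n E n); split.
- exact: bigcapT_measurable.
- apply/eqP; rewrite eq_le measure_ge0 andbT; apply/lee_addgt0Pr => e e0.
  rewrite add0e.
  have [n ne] : exists n : nat, n.+1%:R^-1 < e.
    have [n _ hn] := near_infty_natSinv_lt (PosNum e0).
    by exists n; apply: hn => /=.
  have [_ h _] := HE n; apply: (@le_trans _ _ (P (E n))).
    apply: le_measure; rewrite ?inE//; first exact: bigcapT_measurable.
    exact: bigcap_inf.
  by apply: (le_trans h); rewrite lee_fin ltW.
by move=> w Aw n _; have [_ _] := HE n; apply.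
Qed.

(** Simple integrals vanish at time 0, so [I 0] is arbitrarily small off events of arbitrarily small
    probability. *)
Lemma approx0 H I : approx H I -> {ae P, forall w, I 0 w = 0}.
Proof.
move=> aH.
have H1 (n : nat) : {ae P, forall w, `|I 0 w| <= n.+1%:R^-1}.
  apply: negligible_small => e e0.
  pose e' := Num.min e n.+1%:R^-1.
  have e'0 : 0 < e' by rewrite lt_min e0/= invr_gt0.
  have [n0 [xi [wf [E [mE PE HE]]]]] := aH _ e'0.
  exists E; split => //; first by rewrite (le_trans PE)// lee_fin ge_min lexx.
  move=> w /= nI; apply: contrapT => nE; apply: nI; have [_ h] := HE w nE.
  have := h 0; rewrite lexx (ltW T0) => /(_ isT); rewrite (dint0 B T0) sub0r normrN => h'.
  by rewrite (le_trans h')// ge_min lexx orbT.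
have := ae_foralln H1; apply: filterS => w hw.
apply/eqP; rewrite -normr_le0; apply/ler_addgt0Pr => e e0; rewrite add0r.
have [n _ hn] := near_infty_natSinv_lt (PosNum e0).
by apply: (le_trans (hw n)); apply: ltW; apply: hn => /=.
Qed.

End approx.

(** * Dyadic approximation of Ito integrals *)

Section ito_approx.
Context (R : realType) (disp : measure_display) (Omega : measurableType disp).
Context (P : probability Omega R) (T : R) (m : nat).
Variable B : R -> Omega -> 'cV[R]_m.
Hypotheses (T0 : 0 < T) (hP : measure_is_complete P).
Hypothesis hB : brownian_motion P T B.

Local Notation mu := (@lebesgue_measure R).
Local Notation filt := (filt P B).
Local Notation filt_measurable := (filt_measurable P B).
Local Notation predictable := (predictable P T B).
Local Notation pred_alg := (pred_alg P T B).
Local Notation g := (grid T).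

Implicit Types (n : nat) (xi : nat -> Omega -> 'cV[R]_m).
Implicit Types (H : R -> Omega -> 'cV[R]_m) (I : R -> Omega -> R).

(** Predictable sets are progressive, as one checks on the generators. Once traces on [[0, t]] are
    measurable for the product of the Borel sets and [filt t], Tonelli's theorem makes time
    integrals up to [t] adapted. *)
Lemma pred_progressive A (t : R) : 0 <= t <= T -> pred_alg A ->
  measurable ((A `&` (`[0, t]%classic `*` setT)) :
     set (measurableTypeR R * g_sigma_algebraType (filt t))).
Proof.
move=> /andP[t0 tT]; rewrite pred_algE.
have mD : measurable (`[0, t]%classic `*` setT :
    set (measurableTypeR R * g_sigma_algebraType (filt t))).
  by apply: measurableX.
pose H := [set A : set (R * Omega) | measurable ((A `&` (`[0, t]%classic `*` setT)) :
  set (measurableTypeR R * g_sigma_algebraType (filt t)))].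
have gF s E : s <= t -> filt s E -> measurable (E : set (g_sigma_algebraType (filt t))).
  by move=> st FE; rewrite (gsetE (sigma_filt P B t)); exact: filt_mono st _ FE.
suff HS : predictable_sets P T B `<=` H.
  move=> /HS; rewrite /H/= -setIA (_ : _ `*` _ `&` _ = `[0, t]%classic `*` setT)//.
  apply/seteqP; split => -[u w]/=; rewrite !in_itv/=; first by case=> _ [].
  by move=> [/andP[u0 ut] _]; rewrite u0 ut (le_trans ut tT).
apply: smallest_sub.
  split; rewrite /H/=.
  - by rewrite set0I; exact: measurable0.
  - move=> E HE; have := measurableD mD HE; congr measurable.
    apply/seteqP; split => -[u w]/=; rewrite !in_itv/=.
      move=> [[/andP[u0 ut] _] nE]; rewrite u0 ut (le_trans ut tT); do ![split => //].
      by move=> Eu; apply: nE; rewrite u0 ut.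
    by move=> [[_ nE] [ut _]]; split => // -[].
  - by move=> F HF; rewrite setI_bigcupl; exact: bigcupT_measurable.
move=> _ [[E FE ->]|[s [u [E [s0 su uT FE ->]]]]]; rewrite /H/=.
  rewrite (_ : _ `&` _ = [set 0] `*` E).
  by apply: measurableX => //; exact: (gF 0).
  apply/seteqP; split => -[v w]/=; first by case.
  by rewrite in_itv/= => -[-> Ew]; rewrite lexx t0.
have [ts|st] := leP t s.
  rewrite (_ : _ `&` _ = set0); first exact: measurable0.
  apply/seteqP; split => -[v w]//=; rewrite !in_itv/= => -[[/andP[sv _] _] [/andP[_ vt] _]].
  by have := lt_le_trans sv (le_trans vt ts); rewrite ltxx.
rewrite (_ : _ `&` _ = (`]s, u]%classic `&` `[0, t]%classic) `*` E).
  apply: measurableX; first exact: measurableI.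
  exact: (gF s _ (ltW st)).
by apply/seteqP; split => -[v w]/=; rewrite !in_itv/=; [move=> [[? ?] [? _]]|move=> [[? ?] ?]].
Qed.

Lemma time_integral_adapted (X : R -> Omega -> R) (t : R) : 0 <= t <= T ->
  predictable X -> (forall s w, 0 <= X s w) ->
  measurable_fun (setT : set (g_sigma_algebraType (filt t)))
    (fun w : g_sigma_algebraType (filt t) => \int[mu]_(s in `[0%R, t]) (X s w)%:E)%E.
Proof.
move=> tT /predictableP pX X0.
pose D : set (measurableTypeR R * g_sigma_algebraType (filt t)) := `[0, t]%classic `*` setT.
have mX : measurable_fun D (fun z : measurableTypeR R * g_sigma_algebraType (filt t) =>
    (X z.1 z.2)%:E).
  apply/measurable_EFinP => _ U mU; rewrite setIC.
  exact: (pred_progressive tT (pX U mU)).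
have mD : measurable D by apply: measurableX.
pose f := ((fun z : measurableTypeR R * g_sigma_algebraType (filt t) =>
    (X z.1 z.2)%:E) \_ D).
have mf : measurable_fun setT f by apply/(measurable_restrictT _ mD).
have f0 z : (0 <= f z)%E by rewrite /f /patch; case: ifP => // _; rewrite lee_fin.
have := measurable_fun_fubini_tonelli_G (m1 := mu) f mf f0.
congr measurable_fun; apply/funext => w; rewrite /fubini_G [RHS]integral_mkcond.
apply: eq_integral => s _; rewrite /f /patch; congr (if _ then _ else _).
by apply/idP/idP; rewrite !inE /D/=; [case|].
Qed.

Lemma time_integral_measurable (X : R -> Omega -> R) :
  predictable X -> (forall s w, 0 <= X s w) ->
  measurable_fun setT (fun w => \int[mu]_(s in `[0%R, T]) (X s w)%:E)%E.
Proof.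
move=> pX X0 _ U mU; have TT : 0 <= T <= T by rewrite ltW//= lexx.
have := time_integral_adapted TT pX X0 measurableT mU.
rewrite !setTI gsetE; last exact: sigma_filt.
exact: (filt_sub_measurable hP hB).
Qed.

Lemma predictable_smeas H : predictable_mx P T B H -> smeas T H.
Proof.
move=> pH w i; have := predictable_measurable T0 hP hB (pH i 0) => mH.
have mD : measurable (`[0, T]%classic `*` setT : set (measurableTypeR R * Omega)).
  by apply: measurableX.
apply: (@measurable_comp _ _ _ (measurableTypeR R) (measurableTypeR R * Omega)%type _
  (`[0, T]%classic `*` setT) _ `[0, T]%classic (fun s => (s, w)) mD _ mH).
  by move=> z /= [s sT <-].
exact: measurable_funTS.
Qed.

Lemma l2d_measurable H H' : predictable_mx P T B H -> predictable_mx P T B H' ->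
  measurable_fun setT (l2d T H H').
Proof.
move=> pH pH'; apply: (@time_integral_measurable (fun s w => sqnorm (H s w - H' s w))).
  by apply: predictable_sqnorm; exact: predictable_mxB.
by move=> s w; exact: sqnorm_ge0.
Qed.

Lemma measurable_negl (A A' : set Omega) : measurable A ->
  P.-negligible (A `\` A') -> P.-negligible (A' `\` A) -> measurable A'.
Proof.
move=> mA n1 n2.
have -> : A' = (A `\` (A `\` A')) `|` (A' `\` A).
  apply/seteqP; split => w /=.
    by move=> A'w; have [Aw|] := pselect (A w); [left|right]; split => // -[].
  by move=> [[Aw /not_andP[//|/contrapT]]|[]].
by apply: measurableU; [apply: measurableD => //|]; apply: hP.
Qed.

(** A continuous path attains its supremum, so reaching [e] means getting above [e - 1 / (n + 1)] at
    some dyadic point for every [n]. This countable description is exact on uniformly continuous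
    paths, and completeness of [P] takes care of the others. *)
Lemma measurable_sup_ge (X : R -> Omega -> R) (e : R) :
  (forall t : R, 0 <= t <= T -> measurable_fun setT (X t)) ->
  {ae P, forall w, ucont T (fun t => X t w)} ->
  measurable [set w | exists2 s : R, 0 <= s <= T & e <= `|X s w|].
Proof.
move=> mX uX.
pose S := \bigcap_n \bigcup_N \bigcup_k (if (k <= 2 ^ N)%N then
  [set w | e - n.+1%:R^-1 < `|X (g N k) w|] else set0).
have mS : measurable S.
  apply: bigcapT_measurable => n; apply: bigcupT_measurable => N.
  apply: bigcupT_measurable => k; case: ifP => // kN.
  apply: measurable_lt => //; apply: measurableT_comp => //; apply: mX.
  by rewrite grid_ge0// grid_leT.
have inv_small (d : R) : 0 < d -> exists n : nat, n.+1%:R^-1 < d.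
  move=> d0; have [n _ hn] := near_infty_natSinv_lt (PosNum d0).
  by exists n; apply: hn => /=.
apply: (measurable_negl mS); (apply: negligibleS uX) => w /= [].
  move=> Sw nA uXw; apply: nA.
  have cX : {within `[0, T], continuous (fun t => `|X t w|)}.
    apply: (ucont_continuous T0) => d d0; have [N HN] := uXw d d0; exists N => u v uT vT uv.
    exact: le_trans (ler_dist_dist _ _) (HN u v uT vT uv).
  have [c /[!in_itv]/= cT Hc] := EVT_max (ltW T0) cX.
  exists c => //; apply/ler_addgt0Pr => d d0.
  have [n nd] := inv_small d d0.
  have [N _ [k _]] := Sw n I; case: ifP => //= kN H1.
  have := Hc (g N k); rewrite in_itv/= grid_ge0// grid_leT// => /(_ isT) h.
  by move: H1; rewrite ltrBlDr => /ltW H1; exact: le_trans H1 (lerD h (ltW nd)).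
move=> [s sT es] nS uXw; apply: nS => n _.
have n0 : 0 < n.+1%:R^-1 / 2 :> R by rewrite divr_gt0// invr_gt0.
have [N HN] := uXw _ n0; have [k [kN sk]] := grid_dense T0 N sT.
exists N => //; exists k => //; rewrite kN /=.
have := HN _ _ sT _ sk; rewrite grid_ge0// grid_leT// => /(_ isT).
have := ler_distD (X (g N k) w) (X s w) 0; rewrite !subr0.
by move: n0; set q := n.+1%:R^-1; lra.
Qed.

Lemma telescope_cells (V : zmodType) (F : nat -> V) a b N : (a <= b)%N -> (b <= N)%N ->
  \sum_(i < N) (if (a <= i < b)%N then F i.+1 - F i else 0) = F b - F a.
Proof.
move=> ab bN.
suff -> : \sum_(i < N) (if (a <= i < b)%N then F i.+1 - F i else 0) =
    F (minn b N) - F (minn a N).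
  by rewrite (minn_idPl bN) (minn_idPl (leq_trans ab bN)).
elim: N {bN} => [|N IH]; first by rewrite big_ord0 !minn0 subrr.
rewrite big_ord_recr/= IH; have [aN|Na] := leqP a N; have [bN|Nb] := leqP b N => /=.
- by rewrite addr0 !(minn_idPl _)// leqW.
- rewrite (minn_idPr Nb) (minn_idPl (leqW aN)).
  by rewrite addrC addrA subrK.
- by have := leq_trans Na ab; rewrite ltnNge bN.
- by rewrite addr0 (minn_idPr Nb) (minn_idPr Na) !subrr.
Qed.

Lemma grid_up n (s : R) : 0 <= s <= T -> exists a, [/\ (a <= 2 ^ n)%N,
  s <= g n a & g n a <= s + T / 2 ^+ n].
Proof.
move=> /andP[s0 sT]; have [s_gt0|s_le0] := ltP 0 s; last first.
  have -> : s = 0 by apply/eqP; rewrite eq_le s_le0.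
  by exists 0%N; rewrite grid0 lexx add0r ltW// (mesh_gt0 T0).
have [|k [kn /andP[ks sk]]] := @grid_cell _ T n s; first by rewrite s_gt0.
by exists k.+1; rewrite kn sk gridS lerD2r (ltW ks).
Qed.

Lemma int_cell_le (x y : R) : x <= y ->
  (\int[mu]_(u in `[0%R, T]) (if (x < u <= y)%R then 1 else 0)%:E <= (y - x)%:E)%E.
Proof.
move=> xy.
apply: (@le_trans _ _ (\int[mu]_(u in `[0%R, T]) (\1_(`]x, y]%classic) u)%:E)%E).
  rewrite le_eqVlt; apply/orP; left; apply/eqP; apply: eq_integral => u _.
  by rewrite indicE mem_setE in_itv/=; case: ifP.
rewrite integral_indic//; apply: (@le_trans _ _ (mu `]x, y]%classic)).
  by apply: le_measure; rewrite ?inE//; exact: measurableI.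
rewrite lebesgue_measure_itv/= lte_fin; case: ifP => // _.
by rewrite lee_fin subr_ge0.
Qed.

Lemma brownian_modulus (e : R) : 0 < e -> exists (N : nat) (E : set Omega),
  [/\ measurable E, (P E <= e%:E)%E & forall w, ~ E w -> forall i (u v : R),
    0 <= u <= T -> 0 <= v <= T -> `|u - v| <= T / 2 ^+ N -> `|B u w i 0 - B v w i 0| <= e].
Proof.
move=> e0.
(* Induction over the coordinates: the accuracy [e] is kept while the probability budget [d] is
   halved for each coordinate. *)
suff H (s : seq 'I_m) (d : R) : 0 < d -> d <= e -> exists (N : nat) (E : set Omega),
  [/\ measurable E, (P E <= d%:E)%E & forall w, ~ E w -> forall i (u v : R), i \in s ->
    0 <= u <= T -> 0 <= v <= T -> `|u - v| <= T / 2 ^+ N -> `|B u w i 0 - B v w i 0| <= e].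
  have [N [E [mE PE HE]]] := H (enum 'I_m) e e0 (lexx e); exists N, E; split => //.
  by move=> w nE i u v; apply: HE => //; rewrite mem_enum.
elim: s d => [|i s IH] d d0 de.
  by exists 0%N, set0; split => //; rewrite measure0 lee_fin ltW.
have d2 : 0 < d / 2 by rewrite divr_gt0.
have [|N [E [mE PE HE]]] := IH _ d2; first lra.
have [mB _ _ _] := hB.
have uB : {ae P, forall w, ucont T (fun t => B t w i 0)}.
  by apply: filterS (brownian_ucont T0 hB) => w.
have [N' [E' [mE' PE' HE']]] := ucont_modulus T0 (fun t => mB t i) uB d2.
exists (maxn N N'), (E `|` E'); split; first exact: measurableU.
  by rewrite (splitr d) EFinD; exact: prob_leU.
move=> w /not_orP[nE nE'] j u v; rewrite inE => /orP[/eqP -> {j}|js] uT vT uv.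
  apply: (@le_trans _ _ (d / 2)); last lra.
  by apply: HE' => //; apply: (le_trans uv); rewrite (mesh_le T0)// leq_maxr.
by apply: HE => //; apply: (le_trans uv); rewrite (mesh_le T0)// leq_maxl.
Qed.

Lemma sqnorm_bound (v : 'cV[R]_m) (K : R) : (forall i, `|v i 0| <= K) ->
  sqnorm v <= m%:R * K ^+ 2.
Proof.
move=> vK; rewrite (_ : m%:R * K ^+ 2 = \sum_(i < m) K ^+ 2).
  apply: ler_sum => i _; rewrite -real_normK ?num_real// ler_sqr ?nnegrE//.
  by apply: le_trans (vK i).
by rewrite sumr_const card_ord mulr_natl.
Qed.

Lemma dotv_bound (u v : 'cV[R]_m) (K d : R) : (forall i, `|u i 0| <= K) ->
  (forall i, `|v i 0| <= d) -> `|dotv u v| <= m%:R * (K * d).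
Proof.
move=> uK vd; rewrite (_ : m%:R * _ = \sum_(i < m) (K * d)).
  apply: (le_trans (ler_norm_sum _ _ _)); apply: ler_sum => i _.
  by rewrite normrM ler_pM.
by rewrite sumr_const card_ord mulr_natl.
Qed.

Lemma cell_diff (v : 'cV[R]_m) (K s t a b u : R) : s <= t -> s <= a -> t <= b -> a <= b ->
  sqnorm v <= K ->
  sqnorm ((if u <= b then v else 0) - (if u <= a then v else 0) - (if s < u <= t then v else 0)) <=
  2 * K * (if t < u <= b then 1 else 0) + 2 * K * (if s < u <= a then 1 else 0).
Proof.
move=> st sa tb ab vK; have v0 := sqnorm_ge0 v.
have [ut|tu] := leP u t; have [us|su] := leP u s; have [ub|bu] := leP u b;
  have [ua|au] := leP u a; rewrite /= ?subr0 ?sub0r ?opprK ?subrr ?sub0r ?subr0 ?sqnorm0 ?sqnormN//; lra.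
Qed.

(** Both ends of []s, t]] are rounded up to the grid: [xi], known at [s], is still known at the
    rounded time, and the integral changes by increments of [B] over at most one mesh. *)
Lemma approx_cell (s t K : R) (xi : Omega -> 'cV[R]_m) : 0 <= s -> s <= t -> t <= T ->
  (forall i, filt_measurable s (fun w => xi w i 0)) ->
  (forall w i, `|xi w i 0| <= K) ->
  approx P T B (fun u w => if s < u <= t then xi w else 0)
    (fun u w => dotv (xi w) (B (Num.min t u) w - B (Num.min s u) w)).
Proof.
move=> s0 st tT mxi xiK0 e e0.
pose K' := Num.max K 0; have K'0 : 0 <= K' by rewrite le_max lexx orbT.
have xiK w i : `|xi w i 0| <= K' by rewrite (le_trans (xiK0 w i))// le_max lexx.
have sT : 0 <= s <= T by rewrite s0 (le_trans st tT).
have tT' : 0 <= t <= T by rewrite tT (le_trans s0 st).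
pose c := 1 + 2 * (m%:R * K').
have c1 : 1 <= c by rewrite lerDl !mulr_ge0.
have c0 : 0 < c by apply: lt_le_trans c1.
have ec0 : 0 < e / c by rewrite divr_gt0.
have ec : e / c <= e by rewrite ler_pdivrMr// ler_peMr// ltW.
have [N0 [E [mE PE HE]]] := brownian_modulus ec0.
pose K2 := m%:R * K' ^+ 2; have K20 : 0 <= K2 by rewrite mulr_ge0// sqr_ge0.
have k1 : 0 < 1 + 4 * K2 by rewrite ltr_pwDl// mulr_ge0.
have [|n1 Hn1] := mesh_small T0 (e := e / (1 + 4 * K2)); first by rewrite divr_gt0.
pose n := maxn N0 n1.
have me : T / 2 ^+ n <= e / (1 + 4 * K2).
  by apply: (le_trans _ (ltW Hn1)); rewrite (mesh_le T0)// leq_maxr.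
have mN : T / 2 ^+ n <= T / 2 ^+ N0 by rewrite (mesh_le T0)// leq_maxl.
have m0 := mesh_gt0 T0 n.
have [a [an sa ga]] := grid_up n sT.
have [b0 [b0n tb0 gb0]] := grid_up n tT'.
(* [grid_up] gives some grid point just above, not necessarily the least, so [a <= b0] may fail. The
   maximum restores the order and stays within a mesh of [t] because [s <= t]. *)
pose b := maxn a b0.
have ab : (a <= b)%N by exact: leq_maxl.
have bn : (b <= 2 ^ n)%N by rewrite geq_max an.
have tb : t <= g n b by apply: (le_trans tb0); rewrite grid_le// leq_maxr.
have gb : g n b <= t + T / 2 ^+ n.
  by rewrite /b; case: (leqP a b0) => // _; lra.
pose y i w := if (a <= i < b)%N then xi w else 0.
have gT i : (i <= 2 ^ n)%N -> 0 <= g n i <= T by move=> ?; rewrite grid_ge0// grid_leT.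
exists n, y; split.
  split; last first.
    exists K' => i w j _; rewrite /y; case: ifP => // _; by rewrite mxE normr0.
  move=> i j _; rewrite /y; case: (boolP (a <= i < b)%N) => [/andP[ai _]|_].
    by apply: filt_measurable_mono (mxi j); apply: (le_trans sa); rewrite grid_le.
  rewrite (_ : (fun w => _) = (fun=> 0)); last by apply/funext => w; rewrite mxE.
  exact: (gmeas_cst (sigma_filt P B (g n i))).
exists E; split => //; first by rewrite (le_trans PE)// lee_fin.
move=> w nE; split.
  have vE u : dval T n y u w = (if u <= g n b then xi w else 0) - (if u <= g n a then xi w else 0).
    rewrite -(telescope_cells (fun i => if u <= g n i then xi w else 0) ab bn).
    rewrite /dval/=; apply: eq_bigr => i _; rewrite /y; case: (boolP (a <= i < b)%N) => _.
      have [ui|iu] := leP u (g n i).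
        by rewrite /= (le_trans ui) ?subrr// grid_le.
      by rewrite subr0.
    by case: ifP.
  apply: (@le_trans _ _ (\int[mu]_(u in `[0%R, T])
      ((2 * K2) * (if (t < u <= g n b)%R then 1 else 0) +
       (2 * K2) * (if (s < u <= g n a)%R then 1 else 0))%:E)%E).
    apply: l2_le.
    - have mc : smeas T (fun u w => if s < u <= t then xi w else 0); last first.
        exact: (smeas_sqnorm w (smeasB (@dval_smeas _ _ _ T m n y) mc)).
      move=> w' i; have h := @measurable_fun_cell _ T s t (xi w' i 0).
      rewrite (_ : (fun _ => _) = (fun u : measurableTypeR R => if s < u <= t then xi w' i 0 else 0))//.
      by apply/funext => u; case: ifP => // _; rewrite mxE.
    - by apply: measurable_funD; apply: measurable_funM => //; exact: measurable_fun_cell.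
    move=> u _; rewrite sqnorm_ge0/= vE.
    apply: cell_diff => //; [by rewrite grid_le|exact: sqnorm_bound].
  rewrite l2_linear; last 6 first.
  - exact: measurable_fun_cell.
  - exact: measurable_fun_cell.
  - exact: mulr_ge0.
  - exact: mulr_ge0.
  - by move=> u _; case: ifP.
  - by move=> u _; case: ifP.
  apply: (@le_trans _ _ ((2 * K2)%:E * (g n b - t)%:E + (2 * K2)%:E * (g n a - s)%:E)%E).
    by apply: leeD; apply: lee_wpmul2l; rewrite ?lee_fin ?mulr_ge0//; exact: int_cell_le.
  rewrite -!EFinM -EFinD lee_fin -mulrDr.
  move: me; rewrite ler_pdivlMr// => me.
  apply: (@le_trans _ _ (2 * K2 * (T / 2 ^+ n + T / 2 ^+ n))).
    by rewrite ler_wpM2l ?mulr_ge0//; lra.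
  apply: le_trans me; set M := T / _ in m0 *; have := mulr_ge0 K20 (ltW m0); lra.
move=> u uT.
have -> : dint T B n y u w =
    dotv (xi w) (B (Num.min (g n b) u) w) - dotv (xi w) (B (Num.min (g n a) u) w).
  rewrite -(telescope_cells (fun i => dotv (xi w) (B (Num.min (g n i) u) w)) ab bn).
  rewrite /dint/=; apply: eq_bigr => i _; rewrite /y; case: ifP => _.
    by rewrite dotvBr.
  by rewrite dot0v.
have hmin x y' : 0 <= x <= T -> 0 <= y' <= T -> `|x - y'| <= T / 2 ^+ n ->
    `|dotv (xi w) (B (Num.min x u) w - B (Num.min y' u) w)| <= m%:R * (K' * (e / c)).
  move=> xT yT xy; apply: dotv_bound => // i; rewrite !mxE; apply: HE => //.
  - move/andP: xT => [x0 xT]; move/andP: uT => [u0 uT].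
    by rewrite le_min x0 u0 ge_min xT.
  - move/andP: yT => [y0 y1]; move/andP: uT => [u0 u1].
    by rewrite le_min y0 u0 ge_min y1.
  - apply: le_trans mN; apply: le_trans xy; rewrite (minC x) (minC y').
    exact: lipschitz_min.
have h1 := hmin _ _ (gT _ bn) tT'; have h2 := hmin _ _ (gT _ an) sT.
have {}h1 := h1 _; have {}h2 := h2 _.
apply: (@le_trans _ _ (m%:R * (K' * (e / c)) + m%:R * (K' * (e / c)))); last first.
  rewrite (_ : _ + _ = (2 * (m%:R * K')) * e / c); last by ring.
  rewrite ler_pdivrMr// mulrC ler_wpM2l ?(ltW e0)// /c; lra.
have b1 : `|g n b - t| <= T / 2 ^+ n by rewrite ger0_norm ?subr_ge0//; lra.
have b2 : `|g n a - s| <= T / 2 ^+ n by rewrite ger0_norm ?subr_ge0//; lra.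
apply: (le_trans _ (lerD (h1 b1) (h2 b2))).
rewrite !dotvBr; set p := dotv _ _; set q := dotv _ _; set p' := dotv _ _; set q' := dotv _ _.
rewrite (_ : p - q - (p' - q') = (p - p') - (q - q')); last by ring.
exact: ler_normB.
Qed.

Lemma approx_cst0 : approx P T B (fun _ _ => 0) (fun _ _ => 0).
Proof.
move=> e e0; exists 0%N, (fun _ _ => 0); split.
  split; last by exists 0 => k w i _; rewrite mxE normr0.
  move=> k i _; rewrite (_ : (fun w => _) = (fun=> 0)); last by apply/funext => w; rewrite mxE.
  exact: (gmeas_cst (sigma_filt P B (g 0 k))).
exists set0; split => //; first by rewrite measure0 lee_fin ltW.
move=> w _; split.
  rewrite /l2d integral0_eq ?lee_fin ?ltW// => s _.
  by rewrite /dval/= big1 ?subrr ?sqnorm0// => k _; case: ifP.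
by move=> t _; rewrite /dint/= big1 ?subrr ?normr0 ?ltW// => k _; rewrite dot0v.
Qed.

Lemma simple_times k (G : simple R Omega m) : simple_wf P T B G ->
  (k <= simple_size G)%N -> 0 <= simple_time G k <= T.
Proof.
case: G => n t xi/= [t0 tS tn _ _] kn.
have mono i j : (i <= j)%N -> (j <= n)%N -> t i <= t j.
  elim: j => [|j IH]; first by rewrite leqn0 => /eqP ->.
  rewrite leq_eqVlt => /orP[/eqP ->//|ij] jn.
  by rewrite (le_trans (IH ij (ltnW jn)))// tS.
by rewrite (le_trans t0 (mono _ _ (leq0n k) kn)) (le_trans (mono _ _ kn (leqnn n)) tn).
Qed.

Lemma approx_simple (G : simple R Omega m) : simple_wf P T B G ->
  approx P T B (simple_val G) (simple_int B G).
Proof.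
move=> wf; have tT k := @simple_times k _ wf.
case: G wf tT => n t xi/= [t0 tS tn mxi [K xiK]] tT.
suff H j : (j <= n)%N -> smeas T (fun s w => \sum_(k < j) (if t k < s <= t k.+1 then xi k w else 0)) /\
    approx P T B (fun s w => \sum_(k < j) (if t k < s <= t k.+1 then xi k w else 0))
     (fun s w => \sum_(k < j) dotv (xi k w) (B (Num.min (t k.+1) s) w - B (Num.min (t k) s) w)).
  by have [_] := H n (leqnn n).
elim: j => [|j IH] jn.
  split.
    move=> w i; rewrite (_ : (fun _ => _) = (fun=> 0))//.
    by apply/funext => s; rewrite big_ord0 mxE.
  by apply: (approx_eq approx_cst0) => s w _; rewrite big_ord0.
have [mj aj] := IH (ltnW jn).
have mc : smeas T (fun s w => if t j < s <= t j.+1 then xi j w else 0).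
  move=> w i; have h := @measurable_fun_cell _ T (t j) (t j.+1) (xi j w i 0).
  rewrite (_ : (fun _ => _) = (fun u : measurableTypeR R => if t j < u <= t j.+1 then xi j w i 0 else 0))//.
  by apply/funext => u; case: ifP => // _; rewrite mxE.
split.
  rewrite (_ : (fun s w => _) = (fun s w =>
    \sum_(k < j) (if t k < s <= t k.+1 then xi k w else 0) +
    (if t j < s <= t j.+1 then xi j w else 0))); first exact: smeasD.
  by apply/funext => s; apply/funext => w; rewrite big_ord_recr.
apply: (approx_eq (approxD T0 mj mc aj (@approx_cell (t j) (t j.+1) K (xi j) _ _ _ _ _))).
- by have /andP[] := tT j (ltnW jn).
- exact: tS.
- by have /andP[] := tT _ jn.
- by move=> i; exact: mxi.
- by move=> w i; exact: xiK.
- by move=> s w _; rewrite big_ord_recr.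
- by move=> s w _; rewrite big_ord_recr.
Qed.

Lemma predictable_simple (G : simple R Omega m) : simple_wf P T B G ->
  predictable_mx P T B (simple_val G).
Proof.
move=> wf i j; have tT k := @simple_times k _ wf.
case: G wf tT => n t xi/= [t0 tS tn mxi _] tT.
apply/predictableP; rewrite (_ : (fun z => _) = (fun z =>
  \sum_(k < n) (if t k < z.1 <= t k.+1 then xi k z.2 i 0 else 0))).
  apply: (gmeas_sum (sigma_pred P T B)) => k _.
  apply: (iffLR (predictableP _ _ _ (fun s w => if t k < s <= t k.+1 then xi k w i 0 else 0))).
  apply: predictable_rect.
  - by have /andP[] := tT k (ltnW (ltn_ord k)).
  - exact: tS.
  - by have /andP[] := tT _ (ltn_ord k).
  - exact: mxi.
apply/funext => z; rewrite summxE; apply: eq_bigr => k _.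
by case: ifP => _; rewrite ?mxE// ord1.
Qed.

Lemma simple_int_measurable (G : simple R Omega m) (s : R) : simple_wf P T B G ->
  0 <= s <= T -> measurable_fun setT (simple_int B G s).
Proof.
move=> wf /andP[s0 sT]; have tT k := @simple_times k _ wf; have [mB _ _ _] := hB.
case: G wf tT => n t xi/= [t0 tS tn mxi _] tT.
apply: measurable_sum => k; apply: measurable_sum => i.
have h : measurable_fun setT (fun w => xi k w i 0 *
    (B (Num.min (t k.+1) s) w i 0 - B (Num.min (t k) s) w i 0)).
  have mT j : (j <= n)%N -> 0 <= Num.min (t j) s <= T.
    by move=> jn; rewrite le_min s0 ge_min sT orbT; case/andP: (tT j jn) => ->.
  apply: measurable_funM.
    apply: (filt_measurableT hP hB _ (mxi k i (ltn_ord k))).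
    by case/andP: (tT k (ltnW (ltn_ord k))).
  by apply: measurable_funB; apply: mB; apply: mT => //; exact: ltnW.
rewrite (_ : (fun w => _) = (fun w => xi k w i 0 *
    (B (Num.min (t k.+1) s) w i 0 - B (Num.min (t k) s) w i 0)))//.
by apply/funext => w; rewrite !mxE.
Qed.

Lemma simple_int_ucont (G : simple R Omega m) (w : Omega) : simple_wf P T B G ->
  (forall i, ucont T (fun t => B t w i 0)) -> ucont T (fun s => simple_int B G s w).
Proof.
move=> wf uB; have tT k := @simple_times k _ wf.
case: G wf tT => n t xi/= _ tT.
apply: (ucont_sum T0) => k; apply: (ucont_sum T0) => i.
have h j : (j <= n)%N -> ucont T (fun s => B (Num.min (t j) s) w i 0).
  move=> jn; apply: (@ucont_comp _ _ (fun t => B t w i 0) (Num.min (t j))) => //.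
    move=> s /andP[s0 sT]; have /andP[tj _] := tT j jn.
    by rewrite le_min tj s0 ge_min sT orbT.
  by move=> u v; exact: lipschitz_min.
have H : ucont T (fun s => xi k w i 0 * (B (Num.min (t k.+1) s) w i 0 -
    B (Num.min (t k) s) w i 0)).
  by apply: ucontZ; apply: (ucontB T0); apply: h => //; exact: ltnW.
rewrite (_ : (fun s => _) = (fun s => xi k w i 0 * (B (Num.min (t k.+1) s) w i 0 -
    B (Num.min (t k) s) w i 0)))//.
by apply/funext => s; rewrite !mxE.
Qed.

Lemma ito_sets_measurable (G : simple R Omega m) H I (e : R) : simple_wf P T B G ->
  predictable_mx P T B H ->
  (forall w, {within `[0, T], continuous (fun t : R => I t w)}) ->
  (forall t : R, 0 <= t <= T -> filt_measurable t (I t)) ->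
  measurable [set w | (e%:E <= l2d T (simple_val G) H w)%E] /\
  measurable [set w | exists2 s : R, 0 <= s <= T & e <= `|simple_int B G s w - I s w|].
Proof.
move=> wf pH cI aI; split.
  rewrite -[X in measurable X]setTI.
  apply: (@measurable_lee _ _ _ _ measurableT (fun=> e%:E) (l2d T (simple_val G) H)) => //.
  by apply: l2d_measurable => //; exact: predictable_simple.
apply: (@measurable_sup_ge (fun s w => simple_int B G s w - I s w)).
  move=> t tT; apply: measurable_funB; first exact: simple_int_measurable.
  by apply: (filt_measurableT hP hB _ (aI t tT)); case/andP: tT.
apply: filterS (brownian_ucont T0 hB) => w uB.
apply: (ucontB T0); first exact: simple_int_ucont.
exact: (continuous_ucont T0).
Qed.

(** The definition gives a limit of arbitrary simple integrals, and each of these is a limit of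
    dyadic ones. For a predictable [H] the events in the definition are measurable and serve as
    exceptional events. *)
Lemma ito_approx H I : predictable_mx P T B H -> is_ito_integral P T B H I ->
  approx P T B H I.
Proof.
move=> pH [cI aI [G [wf HG1 HG2]]].
apply: (approx_lim (predictable_smeas pH)) => e e0.
have e2 : 0 < e / 2 by rewrite divr_gt0.
have nb : nbhs (0%E : \bar R) [set y | (y < (e / 2)%:E)%E].
  by apply: open_nbhs_nbhs; split; [exact: open_ereal_lt_ereal|rewrite /= lte_fin].
have [n1 _ hn1] := HG1 e e0 _ nb; have [n2 _ hn2] := HG2 e e0 _ nb.
pose n := maxn n1 n2.
have h1 := ltW (hn1 n (leq_maxl n1 n2)); have h2 := ltW (hn2 n (leq_maxr n1 n2)).
exists (simple_val (G n)), (simple_int B (G n)).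
have [m1 m2] := ito_sets_measurable e (wf n) pH cI aI.
split; [by apply: predictable_smeas; exact: predictable_simple|exact: approx_simple|].
exists ([set w | (e%:E <= l2d T (simple_val (G n)) H w)%E] `|`
  [set w | exists2 s : R, 0 <= s <= T & e <= `|simple_int B (G n) s w - I s w|]).
split; first exact: measurableU.
  by rewrite [X in (_ <= X%:E)%E](splitr e) EFinD; exact: prob_leU.
move=> w /not_orP[/= k1 k2]; split.
  by apply: ltW; rewrite ltNge; apply/negP.
by move=> t tT; apply: ltW; rewrite ltNge; apply/negP => h; apply: k2; exists t.
Qed.

Lemma approx_ito H I : predictable_mx P T B H ->
  (forall w, {within `[0, T], continuous (fun t : R => I t w)}) ->
  (forall t : R, 0 <= t <= T -> filt_measurable t (I t)) ->
  approx P T B H I -> is_ito_integral P T B H I.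
Proof.
move=> pH cI aI aHI; split => //.
have /choice[f Hf] : forall j : nat, exists p : nat * (nat -> Omega -> 'cV[R]_m),
    approx_at P T B H I j.+1%:R^-1 p.1 p.2.
  move=> j; have [|n [xi h]] := aHI j.+1%:R^-1; first by rewrite invr_gt0.
  by exists (n, xi).
pose G j := Simple (2 ^ (f j).1) (g (f j).1) (f j).2.
have wf j : simple_wf P T B (G j).
  by have [wf _] := Hf j; exact: dwf_simple.
(* Common pattern of both convergences in probability: once [1 / (j + 1) < e], the event of the
   definition lies in the exceptional event of [approx_at]. *)
have small (A : R -> nat -> set Omega) : (forall e j, measurable (A e j)) ->
    (forall (e : R) j w, j.+1%:R^-1 < e -> A e j w -> forall E : set Omega,
       (forall w, ~ E w -> (l2d T (dval T (f j).1 (f j).2) H w <= (j.+1%:R^-1)%:E)%E /\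
    forall t : R, 0 <= t <= T -> `|dint T B (f j).1 (f j).2 t w - I t w| <= j.+1%:R^-1) -> E w) ->
    forall e : R, 0 < e -> P (A e j) @[j --> \oo] --> 0%E.
  move=> mA HA e e0.
  apply: (@squeeze_cvge _ _ _ _ (fun=> 0%E) _ (fun j : nat => (j.+1%:R^-1)%:E)).
  - have [N _ HN] := near_infty_natSinv_lt (PosNum e0).
    exists N => // j /HN/= je; rewrite measure_ge0/=.
    have [_ [E [mE PE HE]]] := Hf j.
    apply: le_trans PE; apply: le_measure; rewrite ?inE//.
    by move=> w Aw; exact: (HA e j w je Aw E HE).
  - exact: cvg_cst.
  - apply/fine_cvgP; split; first by apply: nearW.
    exact: cvg_harmonic.
exists G; split => //.
  apply: small => [e j|e j w je Aw E HE].
    by have [] := ito_sets_measurable e (wf j) pH cI aI.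
  apply: contrapT => /HE[h _]; have := le_trans Aw h.
  by rewrite lee_fin leNgt je.
apply: small => [e j|e j w je [s sT es] E HE].
  by have [] := ito_sets_measurable e (wf j) pH cI aI.
apply: contrapT => /HE[_ h]; have := le_trans es (h s sT).
by rewrite leNgt je.
Qed.

End ito_approx.

(** Summing the geometric bounds from [k] on gives [2^-k], which therefore also bounds the distance
    to the limit. *)
Lemma geometric_limit (R : realType) (x : nat -> R) (K : nat) :
  (forall k, (K <= k)%N -> `|x k - x k.+1| <= (2^-1) ^+ k.+1) ->
  exists l : R, x k @[k --> \oo] --> l /\
    forall k, (K <= k)%N -> `|x k - l| <= (2^-1) ^+ k.
Proof.
move=> xK.
have step k j : (K <= k)%N -> `|x k - x (k + j)%N| <= (2^-1) ^+ k - (2^-1) ^+ (k + j).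
  move=> Kk; elim: j => [|j IH]; first by rewrite addn0 !subrr normr0.
  have := xK (k + j)%N (leq_trans Kk (leq_addr _ _)); rewrite addnS => h.
  apply: (le_trans (ler_distD (x (k + j)%N) _ _)); apply: (le_trans (lerD IH h)).
  by rewrite exprS; lra.
have step' k j : (K <= k)%N -> (k <= j)%N -> `|x k - x j| <= (2^-1) ^+ k.
  move=> Kk kj; rewrite -(subnKC kj); apply: (le_trans (step k _ Kk)).
  by rewrite gerBl exprn_ge0.
have small (e : R) : 0 < e -> exists k, (K <= k)%N /\ (2^-1) ^+ k < e.
  move=> e0; have [k hk] := mesh_small ltr01 e0.
  exists (maxn K k); split; first exact: leq_maxl.
  apply: le_lt_trans hk; rewrite div1r -exprVn ler_wiXn2l// ?invf_le1 ?ler1n//.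
  exact: leq_maxr.
have cx : cvg (x k @[k --> \oo]).
  apply: cauchy_cvg; apply: cauchy_exP => e e0.
  have [k [Kk ke]] := small e e0; exists (x k); exists k => // j /= kj.
  rewrite /ball/=; exact: le_lt_trans (step' k j Kk kj) ke.
exists (lim (x k @[k --> \oo])); split => // k Kk.
have hc : `|x k - x j| @[j --> \oo] --> `|x k - lim (x k @[k --> \oo])|.
  by apply: cvg_norm; apply: cvgB => //; exact: cvg_cst.
rewrite -(cvg_lim _ hc)//; apply: limr_le; first by apply/cvg_ex; eexists; exact: hc.
by exists k => // j /= kj; exact: step'.
Qed.

(** * Existence of the stochastic integral *)

Section dyadic_density.
Context (R : realType) (disp : measure_display) (Omega : measurableType disp).
Context (P : probability Omega R) (T : R) (m : nat).
Variable B : R -> Omega -> 'cV[R]_m.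
Hypotheses (T0 : 0 < T) (hP : measure_is_complete P).
Hypothesis hB : brownian_motion P T B.

Local Notation mu := (@lebesgue_measure R).
Local Notation filt := (filt P B).
Local Notation filt_measurable := (filt_measurable P B).
Local Notation approx := (approx P T B).
Local Notation dwf := (dwf P T B).
Local Notation g := (grid T).

Implicit Types (n : nat) (xi : nat -> Omega -> 'cV[R]_m).
Implicit Types (H : R -> Omega -> 'cV[R]_m) (I : R -> Omega -> R).

Lemma int_cell_eq (x y t c : R) : 0 <= x -> x <= y -> 0 <= t -> 0 <= c ->
  (\int[mu]_(s in `[0%R, t]) (if (x < s <= y)%R then c else 0)%:E =
   (c * (Num.min y t - Num.min x t))%:E)%E.
Proof.
move=> x0 xy t0 c0.
transitivity (\int[mu]_(s in `[0%R, t]) (c%:E * (\1_(`]x, y]%classic) s)%:E))%E.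
  apply: eq_integral => s _; rewrite indicE mem_setE in_itv/= -EFinM.
  by case: ifP => _; rewrite ?mulr1 ?mulr0.
rewrite ge0_integralZl//; last by apply/measurable_EFinP; exact: measurable_indic.
rewrite integral_indic// EFinM; congr (_ * _)%E.
have -> : `]x, y]%classic `&` `[0, t]%classic = `]Num.min x t, Num.min y t]%classic.
  apply/seteqP; split => s /=; rewrite !in_itv/= gt_min le_min.
    by move=> [/andP[-> ->] /andP[_ ->]].
  move=> /andP[/orP[xs|ts] /andP[-> st]]; last by rewrite leNgt ts in st.
  by rewrite xs st (le_trans x0 (ltW xs)).
etransitivity; first exact: lebesgue_measure_itv.
rewrite /= lte_fin; case: ltP => [|h]; first by rewrite EFinB.
congr EFin; apply/esym/eqP; rewrite subr_eq0 eq_le h/=.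
by rewrite !le_min !ge_min lexx orbT xy.
Qed.

Lemma dqv_int n xi (t : R) w : 0 <= t ->
  (\int[mu]_(s in `[0%R, t]) (sqnorm (dval T n xi s w))%:E = (dqv T n xi t w)%:E)%E.
Proof.
move=> t0.
transitivity (\int[mu]_(s in `[0%R, t]) \sum_(k < 2 ^ n)
    (if (g n k < s <= g n k.+1)%R then sqnorm (xi k w) else 0)%:E)%E.
  apply: eq_integral => s _; rewrite sumEFin; congr EFin.
  rewrite /dval/=; have [[i i_n si]|H] := cell_or_not T n s.
    rewrite (grid_cell_sum T0 (fun i => xi i w) i_n si).
    by rewrite (grid_cell_sum T0 (fun i => sqnorm (xi i w)) i_n si).
  rewrite big1 => [|i _]; last by rewrite H.
  by rewrite big1 ?sqnorm0// => i _; rewrite H.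
rewrite ge0_integral_sum//; last 2 first.
- move=> k; apply/measurable_EFinP.
  exact: (@measurable_fun_cell _ t (g n k) (g n k.+1) (sqnorm (xi k w))).
- by move=> k s _; rewrite lee_fin; case: ifP => // _; exact: sqnorm_ge0.
rewrite /dqv -sumEFin; apply: eq_bigr => k _.
by rewrite int_cell_eq ?grid_ge0 ?sqnorm_ge0// grid_le.
Qed.

Lemma dval_lifts n j xi : dwf n xi ->
  [/\ dwf (n + j) (fun k => xi (halfs j k)),
      dval T n xi = dval T (n + j) (fun k => xi (halfs j k)) &
      dint T B n xi = dint T B (n + j) (fun k => xi (halfs j k))].
Proof.
move=> wf; have ax : approx_at P T B (dval T n xi) (dint T B n xi) 0 n xi.
  split => //; exists set0; split; rewrite ?measure0// => w _; split; last by move=> t _; rewrite subrr normr0.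
  by rewrite /l2d integral0_eq// => s _; rewrite subrr sqnorm0.
by have [[wf' _] [-> ->]] := approx_at_lift T0 j ax.
Qed.

(** On a common grid the difference of two dyadic integrals is a dyadic integral, whose bracket at
    [T] is the squared distance of the integrands; [dint_sup_small] applies to it. *)
Lemma dint_cauchy (e : R) : 0 < e -> exists2 delta : R, 0 < delta &
  forall n xi n' xi', dwf n xi -> dwf n' xi' -> exists E : set Omega,
    [/\ measurable E, (P E <= e%:E)%E & forall w, ~ E w ->
      (l2d T (dval T n xi) (dval T n' xi') w <= delta%:E)%E ->
      forall t : R, 0 <= t <= T -> `|dint T B n xi t w - dint T B n' xi' t w| <= e].
Proof.
move=> e0; have [delta d0 Hd] := dint_sup_small T0 hP hB e0.
exists delta => // n xi n' xi' wf wf'; pose N := (n + n')%N.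
have [wf1 -> ->] := dval_lifts n' wf; have [] := dval_lifts n wf'.
rewrite [(n' + n)%N]addnC -/N => wf2 -> ->.
set y := (fun k => xi _) in wf1 *; set y' := (fun k => xi' _) in wf2 *.
have wfB := dwfD wf1 (dwfZ (-1) wf2).
have [E [mE PE HE]] := Hd _ _ wfB; exists E; split => // w nE ld t tT.
have := HE w nE _ t tT; rewrite dintD dintZ mulN1r; apply.
rewrite -lee_fin -(dqv_int _ _ _ (ltW T0)); apply: le_trans ld; rewrite le_eqVlt; apply/orP; left.
apply/eqP/eq_integral => s _; rewrite dvalD dvalZ scaleN1r//.
Qed.

(** Approximability of the integrand alone, with no candidate for the integral, which [dense_ito]
    supplies. *)
Definition dense H := forall e : R, 0 < e -> exists n xi, dwf n xi /\
  exists E : set Omega, [/\ measurable E, (P E <= e%:E)%E &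
    forall w, ~ E w -> (l2d T (dval T n xi) H w <= e%:E)%E].

Lemma dense_ito H : smeas T H -> dense H -> exists I,
  [/\ approx H I, forall w, {within `[0, T], continuous (fun t : R => I t w)} &
      forall t : R, 0 <= t <= T -> filt_measurable t (I t)].
Proof.
move=> mH dH.
have h0 k : 0 < (2^-1) ^+ k :> R by rewrite exprn_gt0.
have /choice[delta Hdelta] k : exists d : R, 0 < d /\ forall n xi n' xi', dwf n xi ->
  dwf n' xi' -> exists E : set Omega,
    [/\ measurable E, (P E <= ((2^-1) ^+ k.+1)%:E)%E & forall w, ~ E w ->
      (l2d T (dval T n xi) (dval T n' xi') w <= d%:E)%E ->
      forall t : R, 0 <= t <= T ->
        `|dint T B n xi t w - dint T B n' xi' t w| <= (2^-1) ^+ k.+1].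
  by have [d d0 Hd] := dint_cauchy (h0 k.+1); exists d.
(* Neighbours [k] and [k.+1] are both within [delta k / 4] of [H], the second because [delta k.-1]
   enters at the next index; with the factors 2 of [l2d_triangle] their distance is at most
   [delta k]. *)
pose ep k := Num.min ((2^-1) ^+ k.+1) (Num.min (delta k) (delta k.-1) / 4).
have ep0 k : 0 < ep k.
  rewrite lt_min h0/= divr_gt0// lt_min.
  by case: (Hdelta k) => -> _; case: (Hdelta k.-1) => -> _.
have /choice[p Hp] k : exists p : nat * (nat -> Omega -> 'cV[R]_m) * set Omega,
    [/\ dwf p.1.1 p.1.2, measurable p.2, (P p.2 <= (ep k)%:E)%E &
      forall w, ~ p.2 w -> (l2d T (dval T p.1.1 p.1.2) H w <= (ep k)%:E)%E].
  by have [n [xi [wf [E [mE PE HE]]]]] := dH _ (ep0 k); exists (n, xi, E).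
pose X k := dint T B (p k).1.1 (p k).1.2.
have wf k : dwf (p k).1.1 (p k).1.2 by case: (Hp k).
have /choice[F HF] k : exists F : set Omega, [/\ measurable F,
    (P F <= ((2^-1) ^+ k.+1)%:E)%E & forall w, ~ F w ->
    (l2d T (dval T (p k).1.1 (p k).1.2) (dval T (p k.+1).1.1 (p k.+1).1.2) w <= (delta k)%:E)%E ->
    forall t : R, 0 <= t <= T -> `|X k t w - X k.+1 t w| <= (2^-1) ^+ k.+1].
  by have [_ H1] := Hdelta k; exact: H1 (wf k) (wf k.+1).
pose D k := ((p k).2 `|` (p k.+1).2) `|` F k.
have mD k : measurable (D k).
  by case: (Hp k) => _ ? _ _; case: (Hp k.+1) => _ ? _ _; case: (HF k) => ? _ _;
     do 2?apply: measurableU.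
have PD k : (P (D k) <= (3 * (2^-1) ^+ k.+1)%:E)%E.
  have -> : 3 * (2^-1) ^+ k.+1 = ((2^-1) ^+ k.+1 + (2^-1) ^+ k.+1) + (2^-1) ^+ k.+1 :> R by ring.
  have [_ m1 P1 _] := Hp k; have [_ m2 P2 _] := Hp k.+1; have [m3 P3 _] := HF k.
  rewrite 2!EFinD; apply: prob_leU => //; first exact: measurableU.
  apply: prob_leU => //; [apply: (le_trans P1)|apply: (le_trans P2)]; rewrite lee_fin /ep ge_min.
    by rewrite lexx.
  by apply/orP; left; rewrite ler_wiXn2l// ?invf_le1 ?ler1n.
have XD k w : ~ D k w -> forall t : R, 0 <= t <= T -> `|X k t w - X k.+1 t w| <= (2^-1) ^+ k.+1.
  move=> /not_orP[/not_orP[n1 n2] n3] t tT.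
  have [_ _ {}HF3] := HF k; apply: HF3 => //.
  have [_ _ _ h1] := Hp k; have [_ _ _ h2] := Hp k.+1.
  have {}h1 := h1 w n1; have {}h2 := h2 w n2; rewrite l2dC in h2.
  apply: (le_trans (l2d_triangle w (@dval_smeas _ _ _ _ _ _ _) mH (@dval_smeas _ _ _ _ _ _ _))).
  apply: (@le_trans _ _ (2%:E * (delta k / 4)%:E + 2%:E * (delta k / 4)%:E)%E).
    apply: leeD; apply: lee_wpmul2l => //.
      by apply: (le_trans h1); rewrite lee_fin /ep !ge_min !ler_pM2r ?invr_gt0// ge_min lexx /= orbT.
    by apply: (le_trans h2); rewrite lee_fin /ep !ge_min !ler_pM2r ?invr_gt0//= ge_min lexx !orbT.
  by rewrite -!EFinM -EFinD lee_fin; lra.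
have [N0 [mN0 PN0 HN0]] := brownian_ucont T0 hB.
pose U K := \bigcup_(j in [set j | (K <= j)%N]) D j.
have mU K : measurable (U K) by apply: bigcup_measurable.
have Plim : P (lim_sup_set D) = 0%E.
  apply: lim_sup_set_cvg0 => //.
  apply: (@le_lt_trans _ _ (\sum_(n <oo) (3%:E * ((2^-1) ^+ n.+1)%:E))%E).
    by apply: lee_nneseries => // n *; rewrite -EFinM; exact: PD.
  rewrite nneseriesZl; last by move=> n _; rewrite lee_fin ltW.
  have e1 : (\sum_(n <oo) ((2^-1) ^+ n.+1)%:E <= 1%:E :> \bar R)%E.
    apply: (le_trans _ (@epsilon_trick0 R 1 xpredT ler01)).
    apply: lee_nneseries => [n *|n *]; first by rewrite lee_fin ltW.
    by rewrite lee_fin div1r natrX exprVn lexx.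
  by apply: (@le_lt_trans _ _ (3%:E * 1%:E)%E); [exact: lee_wpmul2l|rewrite -EFinM ltry].
pose N := lim_sup_set D `|` N0.
have mlim : measurable (lim_sup_set D) by apply: bigcapT_measurable.
have mN : measurable N by apply: measurableU.
have PN : (P N <= 0)%E.
  rewrite -[leRHS]adde0; apply: prob_leU => //; first by rewrite Plim.
  by rewrite le_eqVlt; apply/orP; left; apply/eqP; exact: PN0.
have nN : P.-negligible N.
  by exists N; split => //; apply/eqP; rewrite eq_le PN measure_ge0.
have good w : ~ N w -> exists K, forall k, (K <= k)%N -> ~ D k w.
  move=> /not_orP[nl _]; apply: contrapT => nK; apply: nl => K _; apply: contrapT => nD.
  by apply: nK; exists K => k Kk Dk; apply: nD; exists k.
(* Setting the limit to 0 on the null set [N] makes every path continuous, and adaptedness survives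
   because [N] belongs to every [filt t]. *)
pose I t w : R := if w \in N then 0 else lim (X k t w @[k --> \oo]).
have lim_ok w K : ~ N w -> (forall k, (K <= k)%N -> ~ D k w) -> forall t : R, 0 <= t <= T ->
    X k t w @[k --> \oo] --> I t w /\ forall k, (K <= k)%N -> `|X k t w - I t w| <= (2^-1) ^+ k.
  move=> nNw HK t tT; rewrite /I ifF; last by apply/negP; rewrite inE.
  have [|l [cl Hl]] := @geometric_limit R (fun k => X k t w) K.
    by move=> k Kk; apply: XD => //; exact: HK.
  by rewrite (cvg_lim _ cl).
have uX k w : ~ N w -> ucont T (fun t => X k t w).
  move=> /not_orP[_ nN0]; apply: (dint_ucont T0) => i.
  by apply: contrapT => nu; apply: nN0; apply: HN0 => /(_ i).
exists I; split.
- move=> e e0; have e2 : 0 < e / 2 by rewrite divr_gt0.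
  have [] := @small_of_nonincreasing _ _ _ P U _ e2 mU.
  + by move=> a b ab; apply/subsetPset => w [j /= bj Dj]; exists j => //=; exact: leq_trans bj.
  + by exists (lim_sup_set D); split.
  move=> K PU; have [k1 hk1] := mesh_small ltr01 e2.
  pose k := maxn K k1.
  have ke : (2^-1) ^+ k <= e / 2.
    apply: le_trans (ltW hk1); rewrite div1r -exprVn ler_wiXn2l// ?invf_le1 ?ler1n//.
    exact: leq_maxr.
  have epk : ep k <= e / 2.
    apply: le_trans ke; rewrite /ep ge_min; apply/orP; left.
    by rewrite ler_wiXn2l// ?invf_le1 ?ler1n.
  have [_ mp Pp HEp] := Hp k.
  exists (p k).1.1, (p k).1.2; split => //; exists (((p k).2 `|` U K) `|` N); split.
  + by do 2?apply: measurableU.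
  + rewrite -[leRHS]adde0; apply: prob_leU => //; first exact: measurableU.
    rewrite [X in (_ <= X%:E)%E](splitr e) EFinD; apply: prob_leU => //.
    by apply: (le_trans Pp); rewrite lee_fin.
  move=> w /not_orP[/not_orP[np nU] nNw]; split.
    by apply: (le_trans (HEp w np)); rewrite lee_fin (le_trans epk)//; lra.
  move=> t tT; have [|_ /(_ k (leq_maxl _ _)) h] := lim_ok w K nNw _ t tT.
    by move=> j Kj Dj; apply: nU; exists j.
  by apply: (le_trans h); apply: (le_trans ke); lra.
- move=> w; have [Nw|nNw] := pselect (N w).
    rewrite (_ : (fun t => I t w) = fun=> 0); last first.
      by apply/funext => t; rewrite /I ifT// inE.
    by move=> t; exact: cvg_cst.
  apply: (ucont_continuous T0) => e e0.
  have e3 : 0 < e / 3 by rewrite divr_gt0.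
  have [K HK] := good w nNw; have [k1 hk1] := mesh_small ltr01 e3.
  pose k := maxn K k1.
  have ke : (2^-1) ^+ k <= e / 3.
    apply: le_trans (ltW hk1); rewrite div1r -exprVn ler_wiXn2l// ?invf_le1 ?ler1n//.
    exact: leq_maxr.
  have [M HM] := uX k w nNw _ e3; exists M => u v uT vT uv.
  have [_ /(_ k (leq_maxl _ _)) h1] := lim_ok w K nNw HK u uT.
  have [_ /(_ k (leq_maxl _ _)) h2] := lim_ok w K nNw HK v vT.
  have h3 := HM u v uT vT uv; move: (le_trans h1 ke) (le_trans h2 ke) h3.
  by rewrite !ler_norml => /andP[? ?] /andP[? ?] /andP[? ?]; apply/andP; split; lra.
move=> t tT; have sF := sigma_filt P B t; case/andP: (tT) => t0 _.
have FN : filt t N by exact: filt_negligible.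
apply: (gmeas_cvg sF (X_ := fun k w => if w \in N then 0 else X k t w)).
  move=> k; apply: (gmeas_if sF) => //; first exact: (gmeas_cst sF).
  exact: dint_adapted.
move=> w; case: (boolP (w \in N)) => [wN|/negP].
  by rewrite /I wN; exact: cvg_cst.
rewrite inE => nNw; have [K HK] := good w nNw.
by have [] := lim_ok w K nNw HK t tT.
Qed.

End dyadic_density.

(** * From rectangles to all square-integrable predictable integrands *)

Section existence.
Context (R : realType) (disp : measure_display) (Omega : measurableType disp).
Context (P : probability Omega R) (T : R) (m : nat).
Variable B : R -> Omega -> 'cV[R]_m.
Hypotheses (T0 : 0 < T) (hP : measure_is_complete P).
Hypothesis hB : brownian_motion P T B.

Local Notation mu := (@lebesgue_measure R).
Local Notation filt := (filt P B).
Local Notation filt_measurable := (filt_measurable P B).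
Local Notation predictable := (predictable P T B).
Local Notation predictable_mx := (predictable_mx P T B).
Local Notation pred_alg := (pred_alg P T B).
Local Notation approx := (approx P T B).
Local Notation dense := (dense P T B).
Local Notation I0T := (`[0, T]%classic : set (measurableTypeR R)).
Local Notation sP := (sigma_pred P T B).

Implicit Types (n : nat) (xi : nat -> Omega -> 'cV[R]_m).
Implicit Types (H : R -> Omega -> 'cV[R]_m) (I : R -> Omega -> R).

(** The class enlarged step by step by a monotone class argument: it is a vector space closed under
    dominated pointwise limits. *)
Definition integ H := predictable_mx H /\ dense H.

Lemma approx_dense H I : approx H I -> dense H.
Proof.
move=> aH e e0; have [n [xi [wf [E [mE PE HE]]]]] := aH e e0.
by exists n, xi; split => //; exists E; split => // w /HE[].
Qed.

Lemma integ_approx H : integ H -> exists I, approx H I.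
Proof.
by move=> [pH dH]; have [I [aH _ _]] := dense_ito T0 hP hB (predictable_smeas T0 hP hB pH) dH; exists I.
Qed.

Lemma predictable_mx_eq a b (X X' : R -> Omega -> 'M[R]_(a, b)) :
  Defs.predictable_mx P T B X ->
  (forall s w, 0 <= s <= T -> X s w = X' s w) -> Defs.predictable_mx P T B X'.
Proof. by move=> pX XX' i j; apply: (predictable_eq (pX i j)) => s w sT; rewrite XX'. Qed.

Lemma predictable_entry a b (X : R -> Omega -> 'M[R]_(a, b)) i j :
  Defs.predictable_mx P T B X -> gmeas pred_alg (fun z => X z.1 z.2 i j).
Proof. by move=> pX; exact: (iffLR (predictableP _ _ _ (fun s w => X s w i j)) (pX i j)). Qed.

Lemma predictable_cst c : predictable (fun _ _ => c).
Proof. by apply/predictableP; exact: (gmeas_cst sP). Qed.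

Lemma predictable_mx_cst a b (v : 'M[R]_(a, b)) : Defs.predictable_mx P T B (fun _ _ => v).
Proof. by move=> i j; exact: predictable_cst. Qed.

Lemma integ_eq H H' : integ H -> (forall s w, 0 <= s <= T -> H s w = H' s w) -> integ H'.
Proof.
move=> iH HH'; split; first by apply: (predictable_mx_eq (proj1 iH)).
by have [I aH] := integ_approx iH; exact: approx_dense (approx_eq aH HH' (fun _ _ _ => erefl)).
Qed.

Lemma integD H H' : integ H -> integ H' -> integ (fun s w => H s w + H' s w).
Proof.
move=> iH iH'; split; first exact: predictable_mxD (proj1 iH) (proj1 iH').
have [I aH] := integ_approx iH; have [I' aH'] := integ_approx iH'.
by apply: (approx_dense (approxD T0 _ _ aH aH')); apply: (predictable_smeas T0 hP hB);
   [exact: (proj1 iH)|exact: (proj1 iH')].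
Qed.

Lemma integZ a H : integ H -> integ (fun s w => a *: H s w).
Proof.
move=> iH; split; first exact: predictable_mxZ (predictable_cst a) (proj1 iH).
have [I aH] := integ_approx iH.
by apply: (approx_dense (approxZ a _ aH)); apply: (predictable_smeas T0 hP hB); exact: (proj1 iH).
Qed.

Lemma integB H H' : integ H -> integ H' -> integ (fun s w => H s w - H' s w).
Proof.
move=> iH iH'; apply: (integ_eq (integD iH (integZ (-1) iH'))) => s w _.
by rewrite scaleN1r.
Qed.

Lemma integ0 : integ (fun _ _ => 0).
Proof. by split; [exact: predictable_mx_cst|exact: (approx_dense (approx_cst0 P T B))]. Qed.

Lemma integ_sum (J : Type) (r : seq J) (F : J -> R -> Omega -> 'cV[R]_m) :
  (forall j, integ (F j)) -> integ (fun s w => \sum_(j <- r) F j s w).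
Proof.
move=> iF; elim: r => [|j r IH].
  by apply: (integ_eq integ0) => s w _; rewrite big_nil.
by apply: (integ_eq (integD (iF j) IH)) => s w _; rewrite big_cons.
Qed.

(** Dominated convergence in time makes the distance tend to 0 along almost every path. The events
    where it is still large at some later index shrink to a null set, so a single index is good off
    a small event. *)
Lemma integ_dominated (Hk : nat -> R -> Omega -> 'cV[R]_m) H (G : R -> Omega -> R) :
  (forall k, integ (Hk k)) -> predictable_mx H ->
  (forall w, measurable_fun I0T (fun s : measurableTypeR R => G s w)) ->
  (forall k s w, 0 <= s <= T -> sqnorm (Hk k s w - H s w) <= G s w) ->
  {ae P, forall w, (\int[mu]_(s in `[0%R, T]) (G s w)%:E < +oo)%E} ->
  (forall s w, 0 <= s <= T -> sqnorm (Hk k s w - H s w) @[k --> \oo] --> (0 : R)) ->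
  integ H.
Proof.
move=> iH pH mG HG iG cH; split => // e e0.
have e4 : 0 < e / 4 by rewrite divr_gt0.
pose bad k := [set w | ((e / 4)%:E < l2d T (Hk k) H w)%E].
have ml k : measurable_fun setT (l2d T (Hk k) H).
  by apply: (l2d_measurable T0 hP hB) => //; exact: (proj1 (iH k)).
have mbad k : measurable (bad k).
  rewrite -[X in measurable X]setTI.
  exact: (@measurable_lte _ _ _ _ measurableT (fun=> (e / 4)%:E) (l2d T (Hk k) H)).
pose U K := \bigcup_(j in [set j | (K <= j)%N]) bad j.
have mU K : measurable (U K) by apply: bigcup_measurable.
have [] := @small_of_nonincreasing _ _ _ P U _ e4 mU.
- by move=> a b ab; apply/subsetPset => w [j /= bj Dj]; exists j => //=; exact: leq_trans bj.
- apply: negligibleS iG => w Uw iGw.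
  have m0 k : measurable_fun I0T (fun s : measurableTypeR R => (sqnorm (Hk k s w - H s w))%:E).
    apply/measurable_EFinP; apply: (smeas_sqnorm w (smeasB (predictable_smeas T0 hP hB (proj1 (iH k)))
      (predictable_smeas T0 hP hB pH))).
  have iG' : mu.-integrable `[0, T]%classic (fun s => (G s w)%:E).
    apply/integrableP; split; first exact/measurable_EFinP.
    apply: le_lt_trans iGw; rewrite le_eqVlt; apply/orP; left; apply/eqP.
    apply: eq_integral => s /[!inE]/=; rewrite in_itv/= => sT.
    by rewrite ger0_norm// (le_trans (sqnorm_ge0 _) (HG 0%N s w sT)).
  have [||_ _] := @dominated_convergence _ _ _ mu `[0, T]%classic (measurable_itv _)
    (fun k s => (sqnorm (Hk k s w - H s w))%:E) (fun=> 0%E) (fun s => (G s w)%:E) m0 (measurable_cst _) _ iG'.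
  + apply: aeW => s /=; rewrite in_itv/= => sT; apply/fine_cvgP; split; first exact: nearW.
    exact: cH.
  + apply: aeW => s k /=; rewrite in_itv/= => sT; rewrite lee_fin ger0_norm ?sqnorm_ge0//.
    exact: HG.
  rewrite integral0 => hc.
  have nb : nbhs (0%E : \bar R) [set y | (y < (e / 4)%:E)%E].
    by apply: open_nbhs_nbhs; split; [exact: open_ereal_lt_ereal|rewrite /= lte_fin].
  have [K _ HK] := hc _ nb; have [j /= Kj] := Uw K Logic.I.
  have := HK j Kj => /= /ltW; rewrite leNgt => /negP; exact.
move=> K PU; have [_ dK] := iH K; have [n [xi [wf [E [mE PE HE]]]]] := dK _ e4.
exists n, xi; split => //; exists (E `|` U K); split; first exact: measurableU.
  apply: (@le_trans _ _ ((e / 4)%:E + (e / 4)%:E)%E); first exact: prob_leU.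
  by rewrite -EFinD lee_fin; lra.
move=> w /not_orP[nE nU].
apply: (le_trans (l2d_triangle w (@dval_smeas _ _ _ _ _ n xi) (predictable_smeas T0 hP hB (proj1 (iH K)))
  (predictable_smeas T0 hP hB pH))).
apply: (@le_trans _ _ (2%:E * (e / 4)%:E + 2%:E * (e / 4)%:E)%E).
  apply: leeD; apply: lee_wpmul2l => //; first exact: HE.
  by rewrite leNgt; apply/negP => h; apply: nU; exists K => /=.
by rewrite -!EFinM -EFinD lee_fin; lra.
Qed.

Local Notation del i := (delta_mx i 0 : 'cV[R]_m).

Lemma sqnorm_delta a (i : 'I_m) : sqnorm (a *: del i) = a ^+ 2.
Proof.
rewrite sqnormZ /sqnorm (bigD1 i)//= !mxE !eqxx expr1n big1 ?addr0 ?mulr1// => j ji.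
by rewrite mxE (negbTE ji) /= expr0n.
Qed.

Lemma predictable_indic A : pred_alg A -> predictable (fun s w => \1_A (s, w)).
Proof.
move=> pA; apply/predictableP; have h : gmeas pred_alg (\1_A) := gmeas_indic sP pA.
by rewrite (_ : (fun z => _) = \1_A)//; apply/funext => -[].
Qed.

Definition ind (A : set (R * Omega)) (i : 'I_m) (s : R) (w : Omega) : 'cV[R]_m := \1_A (s, w) *: del i.

Lemma integ_rect s t E i : 0 <= s -> s < t -> t <= T -> filt s E ->
  integ (ind (`]s, t]%classic `*` E) i).
Proof.
move=> s0 st tT FE; pose xi w := (\1_E w : R) *: del i.
have mxi j : filt_measurable s (fun w => xi w j 0).
  rewrite (_ : (fun w => _) = (fun w => (\1_E w : R) * del i j 0)).
    by apply: (gmeasM (sigma_filt P B s)); [exact: (gmeas_indic (sigma_filt P B s))|exact: (gmeas_cst (sigma_filt P B s))].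
  by apply/funext => w; rewrite mxE.
have bxi w j : `|xi w j 0| <= 1.
  rewrite !mxE normrM indicE; case: (w \in E); case: (_ && _);
   by rewrite /= ?normr0 ?normr1 ?mulr0 ?mul0r ?mulr1.
have ac := approx_cell T0 hB s0 (ltW st) tT mxi bxi.
have e1 u w : (if s < u <= t then xi w else 0) = ind (`]s, t]%classic `*` E) i u w.
  rewrite /ind /xi !indicE; have -> : ((u, w) \in `]s, t]%classic `*` E) = (s < u <= t) && (w \in E).
    by apply/idP/idP; rewrite !inE/= in_itv/=; [move=> [-> /= ?]; exact/mem_set|move=> /andP[-> /set_mem]].
  by case: ifP => //= _; rewrite scale0r.
split; last by apply: (approx_dense (I := fun u w => dotv (xi w) (B (Num.min t u) w - B (Num.min s u) w)));
  apply: (approx_eq ac) => // u w _.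
move=> a b; apply: (@predictable_eq _ _ _ _ _ _ _ (fun u w => if s < u <= t then xi w a 0 else 0)).
  by apply: predictable_rect => //; exact: ltW.
by move=> u w _; rewrite -e1; case: ifP => _; rewrite ?mxE// ord1.
Qed.

(** The rectangle is carried by a Lebesgue-null set of times, so approximations of the zero
    integrand serve it as well. *)
Lemma integ_zero_time E i : filt 0 E -> integ (ind ([set 0] `*` E) i).
Proof.
move=> FE; have pA : pred_alg ([set 0] `*` E).
  rewrite pred_algE (_ : _ `&` _ = [set 0] `*` E).
    by apply: sub_sigma_algebra; left; exists E.
  apply/seteqP; split => -[t w]/=; first by case.
  by rewrite in_itv/= => -[-> ?]; rewrite lexx (ltW T0).
have pI : predictable_mx (ind ([set 0] `*` E) i).
  by apply: predictable_mxZ; [exact: predictable_indic|exact: predictable_mx_cst].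
split=> // e e0; have [_ d0] := integ0; have [n [xi [wf [E' [mE PE HE]]]]] := d0 e e0.
exists n, xi; split => //; exists E'; split => // w /HE h; apply: le_trans h.
rewrite le_eqVlt; apply/orP; left; apply/eqP; apply: ae_eq_integral => //.
- apply/measurable_EFinP; apply: (smeas_sqnorm w (smeasB (@dval_smeas _ _ _ _ _ n xi) (predictable_smeas T0 hP hB pI))).
- apply/measurable_EFinP; apply: (smeas_sqnorm w (smeasB (@dval_smeas _ _ _ _ _ n xi)
    (predictable_smeas T0 hP hB (predictable_mx_cst 0)))).
exists [set 0]; split => //; first exact: lebesgue_measure_set1.
move=> s /= /not_implyP[_ h]; apply: contrapT => s0; apply: h; congr (sqnorm (_ - _))%:E.
by rewrite /ind indicE (_ : (_ \in _) = false) ?scale0r//; apply/negbTE/negP; rewrite inE/= => -[/s0].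
Qed.

(** Dynkin's theorem on the strip: sets with integrable indicators form a lambda-system, and the
    intersection of two generators is again a generator. *)
Lemma integ_ind A i : pred_alg A -> integ (ind (A `&` (`[0, T]%classic `*` setT)) i).
Proof.
rewrite pred_algE; set A' := _ `&` _; move: A' => {}A.
pose D := `[0, T]%classic `*` setT : set (R * Omega).
pose L := [set A : set (R * Omega) | A `<=` D /\ forall i, integ (ind A i)].
suff : predictable_sets P T B `<=` L by move=> h /h[].
apply: lambda_system_subset.
- move=> _ _ [[E FE ->]|[s [t [E [s0 st tT FE ->]]]]] [[E' FE' ->]|[s' [t' [E' [s'0 st' tT' FE' ->]]]]].
  + left; exists (E `&` E'); first exact: (gsetI (sigma_filt P B 0)).
    by apply/seteqP; split => -[u w]/=; [move=> [[-> ?] [_ ?]]|move=> [-> []]].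
  + left; exists set0; first exact: (gset0 (sigma_filt P B 0)).
    apply/seteqP; split => -[u w]/= => [|[]//]; rewrite in_itv/= => -[[-> ?] [/andP[]]].
    by rewrite ltNge s'0.
  + left; exists set0; first exact: (gset0 (sigma_filt P B 0)).
    apply/seteqP; split => -[u w]/= => [|[]//]; rewrite in_itv/= => -[[+ ?] [u0 _]].
    by rewrite u0 ltNge s0.
  + have [h|h] := ltP (Num.max s s') (Num.min t t'); last first.
      left; exists set0; first exact: (gset0 (sigma_filt P B 0)).
      apply/seteqP; split => -[u w]/= => [|[]//]; rewrite !in_itv/= => -[[/andP[a b] ?] [/andP[c d] _]].
      have : Num.max s s' < Num.min t t'.
        by apply: (@lt_le_trans _ _ u); rewrite ?gt_max ?a ?c// le_min b d.
      by rewrite ltNge h.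
    right; exists (Num.max s s'), (Num.min t t'), (E `&` E'); split => //.
    * by rewrite le_max s0.
    * by rewrite ge_min tT.
    * apply: (gsetI (sigma_filt P B _)).
        by apply: filt_mono FE; rewrite le_max lexx.
      by apply: filt_mono FE'; rewrite le_max lexx orbT.
    * apply/seteqP; split => -[u w]/=; rewrite !in_itv/= gt_max le_min.
        by move=> [[/andP[-> ->] ?] [/andP[-> ->] ?]].
      by move=> [/andP[/andP[-> ->] /andP[-> ->]] [? ?]].
- split.
  + by move=> X [].
  + split=> // j.
    have F0 : filt 0 setT by exact: (gsetT (sigma_filt P B 0)).
    apply: (integ_eq (integD (integ_zero_time j F0) (integ_rect j (lexx 0) T0 (lexx T) F0))).
    move=> s w sT; rewrite /ind -scalerDl; congr (_ *: _); rewrite !indicE.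
    have [->|s0] := eqVneq s 0.
      rewrite mem_set// memNset ?addr0 ?mem_set//=; last by rewrite in_itv/= ltxx => -[].
      by split => //; rewrite in_itv/= lexx ltW.
    rewrite memNset; last by move=> [/= h _]; move/eqP: s0.
    have s0' : 0 < s by rewrite lt_neqAle eq_sym s0; case/andP: sT.
    by rewrite !mem_set ?add0r//=; split => //; rewrite in_itv/= ?s0'//; case/andP: sT.
  + move=> X Y XY [XD iX] [YD iY]; split; first by move=> z [/XD].
    move=> j; apply: (integ_eq (integB (iX j) (iY j))) => s w _.
    rewrite /ind -scalerBl; congr (_ *: _); rewrite !indicE in_setD.
    case: (boolP (_ \in Y)) => [|_]; last by rewrite subr0 andbT.
    by rewrite inE => /XY Xz; rewrite mem_set// subrr.
  + move=> F ndF LF; split; first by move=> z [k _ Fz]; case: (LF k) => + _; exact.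
    move=> j; apply: (@integ_dominated (fun k => ind (F k) j) _ (fun _ _ => 1)).
    * by move=> k; case: (LF k).
    * have pF k : predictable (fun s w => \1_(F k) (s, w)).
        have [_ /(_ j)[pj _]] := LF k; apply: (predictable_eq (pj j 0)) => s w _.
        by rewrite /ind !mxE !eqxx mulr1.
      apply: predictable_mxZ; last exact: predictable_mx_cst.
      apply/predictableP; apply: (gmeas_cvg sP (X_ := fun k z => \1_(F k) (z.1, z.2))).
        by move=> k; exact: (iffLR (predictableP _ _ _ (fun s w => \1_(F k) (s, w))) (pF k)).
      move=> [s w]/=; rewrite indicE; case: (boolP (_ \in _)) => [|nF].
        rewrite inE => -[k0 _ Fk0]; apply: cvg_near_cst; exists k0 => // k /= kk.
        by rewrite indicE mem_set//; move/subsetPset: (ndF _ _ kk); exact.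
      apply: cvg_near_cst; apply: nearW => k; rewrite indicE memNset// => Fk.
      by move/negP: nF; apply; rewrite inE; exists k.
    * by move=> w; exact: measurable_cst.
    * move=> k s w _; rewrite /ind -scalerBl sqnorm_delta !indicE.
      by case: (_ \in _); case: (_ \in _); rewrite ?subrr ?subr0 ?sub0r ?sqrrN ?expr0n ?expr1n.
    * apply: aeW => w; rewrite integral_cst// mul1e.
      by rewrite [ltLHS](_ : _ = T%:E) ?ltry//; etransitivity;
        [exact: lebesgue_measure_itv|rewrite /= lte_fin T0 sube0].
    * move=> s w _; apply: cvg_near_cst; have [[k0 _ Fk0]|nF] := pselect ((\bigcup_k F k) (s, w)).
        exists k0 => // k /= kk; rewrite /ind !indicE !mem_set//; first by rewrite subrr sqnorm0.
          by exists k0.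
        by move/subsetPset: (ndF _ _ kk); exact.
      apply: nearW => k; rewrite /ind !indicE !memNset ?subrr ?sqnorm0// => Fk.
      by apply: nF; exists k.
- move=> _ [[E FE ->]|[s [t [E [s0 st tT FE ->]]]]].
  + split; last by move=> j; exact: integ_zero_time.
    by move=> [u w]/= [-> _]; rewrite /D/=; split => //; rewrite in_itv/= lexx ltW.
  + split; last by move=> j; exact: integ_rect.
    move=> [u w]/=; rewrite /D/= !in_itv/= => -[/andP[su ut] _]; split => //.
    by rewrite (le_trans s0 (ltW su)) (le_trans ut tT).
- move=> X; apply: (smallest_sub (G := _) (X := [set A | A `<=` D])).
    split; rewrite /=; [by []|by move=> A0 _ z []|by move=> F HF z [k _ /HF]].
  move=> _ [[E FE ->]|[s [t [E [s0 st tT FE ->]]]]].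
    by move=> [u w]/= [-> _]; rewrite /D/=; split => //; rewrite in_itv/= lexx ltW.
  move=> [u w]/=; rewrite /D/= !in_itv/= => -[/andP[su ut] _]; split => //.
  by rewrite (le_trans s0 (ltW su)) (le_trans ut tT).
Qed.

Definition sv (X : R -> Omega -> R) (i : 'I_m) (s : R) (w : Omega) : 'cV[R]_m := X s w *: del i.

Lemma level_sum (a x : R) n : 0 <= x -> 0 < a ->
  (a * n%:R <= x -> \sum_(j < n) (if a * j.+1%:R <= x then a else 0) = a * n%:R) /\
  (x <= a * n%:R -> `|\sum_(j < n) (if a * j.+1%:R <= x then a else 0) - x| <= a).
Proof.
move=> x0 a0; elim: n => [|n [IH1 IH2]].
  rewrite big_ord0 mulr0; split => // x0'; have -> : x = 0 by apply/eqP; rewrite eq_le x0 x0'.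
  by rewrite subrr normr0 ltW.
have aS : a * n.+1%:R = a * n%:R + a by rewrite -natr1 mulrDr mulr1.
rewrite big_ord_recr/=; have [h|h] := leP (a * n.+1%:R) x.
  have h' : a * n%:R <= x by rewrite (le_trans _ h)// aS lerDl ltW.
  rewrite IH1// -aS; split => // h2; have -> : x = a * n.+1%:R by apply/eqP; rewrite eq_le h h2.
  by rewrite subrr normr0 ltW.
rewrite addr0; split => // _; have [h'|/ltW/IH2//] := leP (a * n%:R) x.
by rewrite IH1// ler_norml; apply/andP; split; lra.
Qed.

(** Layer-cake approximation by indicators of the predictable level sets of [X], with [n + 1] levels
    of height [K' / (n + 1)]. *)
Lemma integ_bounded X i (K : R) : predictable X -> (forall s w, 0 <= X s w <= K) ->
  integ (sv X i).
Proof.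
move=> pX XK; pose K' := 1 + `|K|.
have K'0 : 0 < K' by rewrite ltr_pwDl.
have XK' s w : 0 <= X s w <= K'.
  have /andP[-> h] := XK s w; rewrite (le_trans h)// /K'; have := ler_norm K; lra.
pose a n : R := K' / n.+1%:R.
have a0 n : 0 < a n by rewrite divr_gt0.
pose A n j := [set z : R * Omega | a n * j.+1%:R <= X z.1 z.2].
have pA n j : pred_alg (A n j).
  apply: (gset_le sP); first exact: (gmeas_cst sP).
  exact/predictableP.
pose Hk n s w := \sum_(j < n.+1) (a n *: ind (A n j `&` (`[0, T]%classic `*` setT)) i s w).
have HkE n s w : 0 <= s <= T ->
    Hk n s w = (\sum_(j < n.+1) (if a n * j.+1%:R <= X s w then a n else 0)) *: del i.
  move=> sT; rewrite /Hk scaler_suml; apply: eq_bigr => j _; rewrite /ind scalerA; congr (_ *: _).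
  rewrite indicE; case: ifPn => [h|/negP h].
    by rewrite mem_set ?mulr1//; split => //=; rewrite in_itv.
  by rewrite memNset ?mulr0// => -[].
have Hd n s w : 0 <= s <= T -> sqnorm (Hk n s w - sv X i s w) <= a n ^+ 2.
  move=> sT; rewrite HkE// -scalerBl sqnorm_delta -real_normK ?num_real// ler_sqr ?nnegrE ?(ltW (a0 n))//.
  have /andP[X0 X1] := XK' s w; have [_] := level_sum n.+1 X0 (a0 n); apply.
  by rewrite /a mulfVK.
have aK n : a n <= K' by rewrite /a ler_pdivrMr// ler_peMr ?ler1n// ltW.
apply: (@integ_dominated Hk _ (fun _ _ => K' ^+ 2)).
- by move=> n; apply: integ_sum => j; apply: integZ; exact: integ_ind.
- by apply: predictable_mxZ => //; exact: predictable_mx_cst.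
- by move=> w; exact: measurable_cst.
- move=> n s w sT; apply: (le_trans (Hd n s w sT)); rewrite ler_sqr ?nnegrE//; exact: ltW.
- apply: aeW => w; rewrite integral_cst//.
  rewrite [X in (_ * X)%E](_ : _ = T%:E) -?EFinM ?ltry//; etransitivity;
    [exact: lebesgue_measure_itv|by rewrite /= lte_fin T0 sube0].
move=> s w sT; apply: (@squeeze_cvgr _ _ _ _ (fun=> 0) (fun n => a n ^+ 2)).
- by apply: nearW => n; rewrite sqnorm_ge0 Hd.
- exact: cvg_cst.
- have ha : a n @[n --> \oo] --> (0 : R).
    rewrite -(mulr0 K'); apply: cvgM; first exact: cvg_cst.
    exact: cvg_harmonic.
  have h2 : a n * a n @[n --> \oo] --> (0 : R) by rewrite -(mulr0 (0 : R)); exact: cvgM.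
  exact: h2.
Qed.

Lemma integ_nonneg X i : predictable X -> (forall s w, 0 <= X s w) ->
  {ae P, forall w, (\int[mu]_(s in `[0%R, T]) (X s w ^+ 2)%:E < +oo)%E} -> integ (sv X i).
Proof.
move=> pX X0 iX; pose Xk (k : nat) s w := Num.min (X s w) k%:R.
have pXk k : predictable (Xk k).
  apply/predictableP; rewrite (_ : (fun z => _) = (fun z => - Num.max (- X z.1 z.2) (- k%:R))).
    apply: (gmeasN sP); apply: (gmeas_max sP); last exact: (gmeas_cst sP).
    by apply: (gmeasN sP); exact/predictableP.
  by apply/funext => z; rewrite /Xk -oppr_min opprK.
apply: (@integ_dominated (fun k => sv (Xk k) i) _ (fun s w => X s w ^+ 2)).
- move=> k; apply: (@integ_bounded _ _ k%:R) => // s w.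
  by rewrite le_min X0 ler0n ge_min lexx orbT.
- by apply: predictable_mxZ => //; exact: predictable_mx_cst.
- move=> w; have := predictable_smeas T0 hP hB (predictable_mxZ pX (predictable_mx_cst (del i))) w i.
  move=> h; apply: measurable_funX; move: h; congr measurable_fun; apply/funext => s.
  by rewrite !mxE !eqxx mulr1.
- move=> k s w _; rewrite /sv -scalerBl sqnorm_delta -sqrrN opprB ler_sqr ?nnegrE// /Xk.
    by rewrite gerBl le_min X0 ler0n.
  by rewrite subr_ge0 ge_min lexx.
- exact: iX.
move=> s w _; apply: cvg_near_cst; have [k hk] : exists k : nat, X s w <= k%:R.
  by exists (Num.bound (X s w)); apply: ltW; exact: archi_boundP.
exists k => // j /= kj; rewrite /sv /Xk min_l ?subrr ?sqnorm0//.
by rewrite (le_trans hk)// ler_nat.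
Qed.

(** The integrand is split into coordinates, and each coordinate into positive and negative parts,
    to which truncation and staircases apply. *)
Theorem ito_exists H : predictable_mx H ->
  {ae P, forall w, (\int[mu]_(s in `[0%R, T]) (sqnorm (H s w))%:E < +oo)%E} ->
  exists I, is_ito_integral P T B H I.
Proof.
move=> pH iH.
have pM i (c : R) : predictable (fun s w => Num.max (c * H s w i 0) 0).
  apply/predictableP; apply: (gmeas_max sP); last exact: (gmeas_cst sP).
  by apply: (gmeasM sP); [exact: (gmeas_cst sP)|exact: predictable_entry].
have part i c : c ^+ 2 = 1 -> integ (sv (fun s w => Num.max (c * H s w i 0) 0) i).
  move=> c2; apply: integ_nonneg => //; first by move=> s w; rewrite le_max lexx orbT.
  apply: filterS iH => w; apply: le_lt_trans.
  apply: ge0_le_integral => //.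
  - by move=> s _; rewrite lee_fin sqr_ge0.
  - have h := predictable_smeas T0 hP hB (predictable_mxZ (pM i c) (predictable_mx_cst (del i))) w i.
    apply/measurable_EFinP; apply: measurable_funX; move: h; congr measurable_fun; apply/funext => s.
    by rewrite !mxE !eqxx mulr1.
  - by apply/measurable_EFinP; exact: (smeas_sqnorm w (predictable_smeas T0 hP hB pH)).
  - move=> s _; rewrite lee_fin /sqnorm (bigD1 i)//=.
    apply: (@le_trans _ _ (H s w i 0 ^+ 2)); last by rewrite lerDl sumr_ge0// => j _; exact: sqr_ge0.
    have -> : H s w i 0 ^+ 2 = (c * H s w i 0) ^+ 2 by rewrite exprMn c2 mul1r.
    by case: (leP (c * H s w i 0) 0) => // _; rewrite expr0n sqr_ge0.
have N1 : (-1 : R) ^+ 2 = 1 by rewrite sqrrN expr1n.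
have iH' : integ H.
  apply: (integ_eq (integ_sum (index_enum 'I_m) (fun i => integB (part i 1 (expr1n _ _)) (part i (-1) N1)))).
  move=> s w _; apply/matrixP => i j; rewrite summxE (bigD1 i)//= big1 ?addr0 => [|k ki].
    rewrite !mxE !eqxx ord1 eqxx !mulr1 mul1r mulN1r.
    by move: (H s w i 0) => z; case: (leP z 0) => h1; case: (leP (- z) 0) => h2; lra.
  by rewrite !mxE eq_sym (negbTE ki) !mulr0 subrr.
have [I [aI cI fI]] := dense_ito T0 hP hB (predictable_smeas T0 hP hB pH) (proj2 iH').
by exists I; exact: approx_ito.
Qed.

(** [ito] is a choice with a default; existence of an integral ensures that the chosen process is
    one. *)
Lemma ito_spec H : predictable_mx H ->
  {ae P, forall w, (\int[mu]_(s in `[0%R, T]) (sqnorm (H s w))%:E < +oo)%E} ->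
  [/\ forall w, {within `[0, T], continuous (fun t : R => ito P T B H t w)},
      forall t : R, 0 <= t <= T -> filt_measurable t (ito P T B H t) &
      approx H (ito P T B H)].
Proof.
move=> pH iH; have [I iI] := ito_exists pH iH.
have h : is_ito_integral P T B H (ito P T B H).
  rewrite /ito; case: xgetP => [J _ //|/(_ I)]; by [].
by case: (h) => cI aI _; split => //; exact: ito_approx.
Qed.

End existence.

(** * Exponential martingales *)

Section time_integral.
Context (R : realType) (T : R) (T0 : 0 < T).
Local Notation mu := (@lebesgue_measure R).
Local Notation I0T := (`[0, T]%classic : set (measurableTypeR R)).
Implicit Types f k : R -> R.

(** Integrability over the whole interval. It accompanies [ti], which is a real number even for a
    divergent integral and then takes the junk value 0. *)
Definition tint f := mu.-integrable I0T (EFin \o f).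
Definition ti f (t : R) : R := \int[mu]_(s in `[0, t]) f s.

Lemma tint_measurable f : tint f -> measurable_fun I0T f.
Proof. by move=> /integrableP[/measurable_EFinP]. Qed.

Lemma tint_le f k : measurable_fun I0T f -> tint k ->
  (forall s : R, 0 <= s <= T -> `|f s| <= k s) -> tint f.
Proof.
move=> mf ik fk; apply: (le_integrable _ _ _ ik) => //; first exact/measurable_EFinP.
move=> s /=; rewrite in_itv/= => sT; rewrite lee_fin (le_trans (fk s sT))//.
exact: ler_norm.
Qed.

Lemma tint_cst c : tint (fun=> c).
Proof.
apply/integrableP; split; first exact: measurable_cst.
under eq_integral do rewrite /=; rewrite integral_cst//.
rewrite [X in (_ * X)%E](_ : _ = T%:E) -?EFinM ?ltry//.
by etransitivity; [exact: lebesgue_measure_itv|rewrite /= lte_fin T0 sube0].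
Qed.

Lemma tintD f k : tint f -> tint k -> tint (fun s => f s + k s).
Proof. by move=> i1 i2; exact: (integrableD _ i1 i2). Qed.

Lemma tintZ c f : tint f -> tint (fun s => c * f s).
Proof. by move=> i1; exact: (integrableZl _ c i1). Qed.

Lemma tintB f k : tint f -> tint k -> tint (fun s => f s - k s).
Proof. by move=> i1 i2; exact: (integrableB _ i1 i2). Qed.

Lemma tint_bounded f (K : R) : measurable_fun I0T f ->
  (forall s : R, 0 <= s <= T -> `|f s| <= K) -> tint f.
Proof. by move=> mf fK; exact: tint_le mf (tint_cst K) fK. Qed.

Lemma ucont_measurable f : ucont T f -> measurable_fun I0T f.
Proof.
by move=> uf; apply: subspace_continuous_measurable_fun => //; exact: ucont_continuous.
Qed.

Lemma tint_ucont f : ucont T f -> tint f.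
Proof.
move=> uf; have [K fK] := ucont_bounded T0 uf.
by apply: (tint_bounded _ fK); exact: ucont_measurable.
Qed.

Lemma tintM f k (K : R) : measurable_fun I0T f ->
  (forall s : R, 0 <= s <= T -> `|f s| <= K) -> tint k -> tint (fun s => f s * k s).
Proof.
move=> mf fK ik; have mk := tint_measurable ik.
have iK : tint (fun s => K * `|k s|).
  by apply: tintZ; have := integrable_abse ik.
apply: (tint_le _ iK); first exact: measurable_funM.
by move=> s sT; rewrite normrM ler_wpM2r// fK.
Qed.

Lemma tintM_ucont f k : ucont T f -> tint k -> tint (fun s => f s * k s).
Proof.
move=> uf; have [K fK] := ucont_bounded T0 uf.
by apply: (tintM _ fK); exact: ucont_measurable.
Qed.

Lemma tint_lty f : measurable_fun I0T f -> (forall s : R, 0 <= s <= T -> 0 <= f s) ->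
  (\int[mu]_(s in `[0%R, T]) (f s)%:E < +oo)%E -> tint f.
Proof.
move=> mf f0 fy; apply/integrableP; split; first exact/measurable_EFinP.
apply: le_lt_trans fy; rewrite le_eqVlt; apply/orP; left; apply/eqP.
by apply: eq_integral => s /[!inE]/=; rewrite in_itv/= => sT; rewrite ger0_norm// f0.
Qed.

Lemma tint_sub f (u v : R) b : 0 <= u -> v <= T -> tint f ->
  mu.-integrable [set` Interval (BSide b u) (BRight v)] (EFin \o f).
Proof.
move=> u0 vT; apply: integrableS => //.
move=> s /=; rewrite !in_itv/= => /andP[us sv]; rewrite (le_trans sv vT) andbT.
by apply: (le_trans u0); case: b us => //= /ltW.
Qed.

Lemma ti_EFin f (t : R) : tint f -> t <= T ->
  (\int[mu]_(s in `[0%R, t]) (f s)%:E = (ti f t)%:E)%E.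
Proof.
move=> fi tT; rewrite /ti /Rintegral fineK//.
by apply: integrable_fin_num => //; exact: tint_sub.
Qed.

Lemma ti0 f : ti f 0 = 0.
Proof. by rewrite /ti set_itv1 Rintegral_set1. Qed.

Lemma ti_ge0 f (t : R) : (forall s : R, 0 <= s <= t -> 0 <= f s) -> 0 <= ti f t.
Proof. by move=> f0; apply: Rintegral_ge0 => s /=; rewrite in_itv/=; exact: f0. Qed.

Lemma ti_diff f (u v : R) : tint f -> 0 <= u -> u <= v -> v <= T ->
  ti f v - ti f u = \int[mu]_(s in `]u, v]) f s.
Proof.
move=> fi u0 uv vT; rewrite /ti.
apply: (@Rintegral_itvB _ f (BLeft 0) (BRight v) u); first exact: tint_sub.
  by rewrite bnd_simp.
by rewrite bnd_simp.
Qed.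

Lemma ti_inc_le f k (u v : R) : tint f -> tint k -> 0 <= u -> u <= v -> v <= T ->
  (forall s : R, u <= s <= v -> f s <= k s) -> ti f v - ti f u <= ti k v - ti k u.
Proof.
move=> fi ki u0 uv vT fk; rewrite !ti_diff//; apply: le_Rintegral => //.
- exact: tint_sub.
- exact: tint_sub.
by move=> s /=; rewrite in_itv/= => /andP[us sv]; rewrite fk// sv ltW.
Qed.

Lemma ti_cst c (t : R) : 0 <= t -> ti (fun=> c) t = c * t.
Proof.
move=> t0; rewrite /ti Rintegral_cst//; congr (_ * _).
rewrite [X in fine X](_ : _ = t%:E)//.
by etransitivity; [exact: lebesgue_measure_itv|rewrite /= lte_fin; case: ltgtP t0 => // [_|<-] _; rewrite ?sube0].
Qed.

Lemma ti_inc_bound f (K u v : R) : tint f -> 0 <= u -> u <= v -> v <= T ->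
  (forall s : R, u <= s <= v -> `|f s| <= K) -> `|ti f v - ti f u| <= K * (v - u).
Proof.
move=> fi u0 uv vT fK; have v0 : 0 <= v by exact: le_trans uv.
rewrite ler_norml; apply/andP; split.
  rewrite -mulNr mulrBr -!ti_cst//; apply: ti_inc_le => //; first exact: tint_cst.
  by move=> s /fK; rewrite ler_norml => /andP[].
rewrite mulrBr -!ti_cst//; apply: ti_inc_le => //; first exact: tint_cst.
by move=> s /fK; rewrite ler_norml => /andP[].
Qed.

Lemma ti_homo f (u v : R) : tint f -> (forall s : R, 0 <= s <= T -> 0 <= f s) ->
  0 <= u -> u <= v -> v <= T -> ti f u <= ti f v.
Proof.
move=> fi f0 u0 uv vT; rewrite -subr_ge0 ti_diff//; apply: Rintegral_ge0 => s /=.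
rewrite in_itv/= => /andP[us sv]; apply: f0.
by rewrite (le_trans u0 (ltW us)) (le_trans sv).
Qed.

Lemma tiD f k (t : R) : tint f -> tint k -> t <= T ->
  ti (fun s => f s + k s) t = ti f t + ti k t.
Proof. by move=> fi ki tT; rewrite /ti RintegralD//; exact: tint_sub. Qed.

Lemma tiZ c f (t : R) : tint f -> t <= T -> ti (fun s => c * f s) t = c * ti f t.
Proof. by move=> fi tT; rewrite /ti RintegralZl//; exact: tint_sub. Qed.

Lemma tiB f k (t : R) : tint f -> tint k -> t <= T ->
  ti (fun s => f s - k s) t = ti f t - ti k t.
Proof. by move=> fi ki tT; rewrite /ti RintegralB//; exact: tint_sub. Qed.

Lemma ti_ucont f : tint f -> ucont T (ti f).
Proof.
move=> fi; apply: (continuous_ucont T0).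
exact: (parameterized_integral_continuous (ltW T0) fi).
Qed.

Lemma ti_eq f k (t : R) : (forall s : R, 0 <= s <= t -> f s = k s) -> ti f t = ti k t.
Proof. by move=> fk; apply: eq_Rintegral => s /[!inE]/=; rewrite in_itv/=; exact: fk. Qed.

End time_integral.

(** * Stochastic exponentials with bounded bracket *)

Section adapted.
Context (R : realType) (disp : measure_display) (Omega : measurableType disp).
Context (P : probability Omega R) (T : R) (m : nat).
Variable B : R -> Omega -> 'cV[R]_m.
Hypotheses (T0 : 0 < T) (hP : measure_is_complete P).
Hypothesis hB : brownian_motion P T B.

Local Notation mu := (@lebesgue_measure R).
Local Notation filt := (filt P B).
Local Notation filt_measurable := (filt_measurable P B).
Local Notation predictable := (predictable P T B).
Local Notation predictable_mx := (predictable_mx P T B).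
Local Notation approx := (approx P T B).
Local Notation dwf := (dwf P T B).
Local Notation g := (grid T).
Local Notation sP := (sigma_pred P T B).

Implicit Types (n : nat) (xi : nat -> Omega -> 'cV[R]_m).

Lemma predictable_max0 (X : R -> Omega -> R) : predictable X ->
  predictable (fun s w => Num.max (X s w) 0).
Proof.
move=> pX; apply/predictableP; apply: (gmeas_max sP); last exact: (gmeas_cst sP).
exact/predictableP.
Qed.

Lemma predictableN (X : R -> Omega -> R) : predictable X -> predictable (fun s w => - X s w).
Proof. by move=> pX; apply/predictableP; apply: (gmeasN sP); exact/predictableP. Qed.

(** Positive and negative parts are integrated separately, adaptedness being known for nonnegative
    integrands; [fine] of the difference covers the divergent paths too. *)
Lemma ti_adapted (X : R -> Omega -> R) (t : R) : 0 <= t <= T -> predictable X ->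
  filt_measurable t (fun w => ti (X ^~ w) t).
Proof.
move=> tT pX; apply/(gmeasP (sigma_filt P B t)).
have H (Z : R -> Omega -> R) : predictable Z -> (forall s w, 0 <= Z s w) ->
  measurable_fun (setT : set (g_sigma_algebraType (filt t)))
    (fun w : g_sigma_algebraType (filt t) => \int[mu]_(s in `[0%R, t]) (Z s w)%:E)%E.
  by move=> pZ Z0; exact: (time_integral_adapted tT pZ Z0).
have h1 := H _ (predictable_max0 pX) (fun s w => ltac:(by rewrite le_max lexx orbT)).
have h2 := H _ (predictable_max0 (predictableN pX)) (fun s w => ltac:(by rewrite le_max lexx orbT)).
have := measurableT_comp (fine_measurable (R := R) measurableT) (emeasurable_funB h1 h2).
congr measurable_fun; apply/funext => w; rewrite /ti /Rintegral /=; congr fine.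
rewrite [RHS]integralE; congr (_ - _)%E; apply: eq_integral => s _.
  by rewrite funeposE /= -EFin_max.
by rewrite funenegE /= -EFin_max.
Qed.

Definition qvar (L : R -> Omega -> 'cV[R]_m) (t : R) (w : Omega) : R :=
  ti (fun s => sqnorm (L s w)) t.

Lemma qvar_adapted (L : R -> Omega -> 'cV[R]_m) (t : R) : 0 <= t <= T -> predictable_mx L ->
  filt_measurable t (qvar L t).
Proof. by move=> tT pL; apply: (@ti_adapted (fun s w => sqnorm (L s w))) => //; exact: predictable_sqnorm. Qed.

Lemma qvar_tint (L : R -> Omega -> 'cV[R]_m) w : predictable_mx L ->
  (\int[mu]_(s in `[0%R, T]) (sqnorm (L s w))%:E < +oo)%E ->
  tint T (fun s => sqnorm (L s w)).
Proof.
move=> pL; apply: tint_lty => [|s _]; last exact: sqnorm_ge0.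
exact: (smeas_sqnorm w (predictable_smeas T0 hP hB pL)).
Qed.

Lemma trunc_sum (a : nat -> R) (C : R) N : 0 <= C -> (forall k, 0 <= a k) ->
  \sum_(k < N) (if \sum_(i < k.+1) a i <= C then a k else 0) <= Num.min C (\sum_(k < N) a k).
Proof.
move=> C0 a0; elim: N => [|N IH]; first by rewrite !big_ord0 min_r.
rewrite big_ord_recr/=; move: IH; rewrite !le_min => /andP[h1 h2].
have [h|h] := boolP (\sum_(i < N.+1) a i <= C); rewrite big_ord_recr/= in h.
  by rewrite [X in _ && (_ <= X)]big_ord_recr/= lerD2r h2 andbT (le_trans _ h)// lerD2r.
by rewrite addr0 h1/= big_ord_recr/= (le_trans h2)// lerDl.
Qed.

(* Cell [k] is kept only if the bracket up to its right end is at most [C], so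
   the bracket of the truncated integrand never exceeds [C]. *)
Definition dtrunc n (C : R) (xi : nat -> Omega -> 'cV[R]_m) (k : nat) (w : Omega) : 'cV[R]_m :=
  if \sum_(i < k.+1) sqnorm (xi i w) * (g n i.+1 - g n i) <= C then xi k w else 0.

(** The test for cell [k] involves only the coefficients of index up to [k], all known at its left
    end, and the deterministic lengths of the cells. *)
Lemma dtrunc_wf n C xi : dwf n xi -> dwf n (dtrunc n C xi).
Proof.
move=> [mx [K HK]]; split; last first.
  exists `|K| => k w i kn; rewrite /dtrunc; case: ifP => _; last by rewrite mxE normr0.
  by rewrite (le_trans (HK k w i kn))// ler_norm.
move=> k i kn; have sF := sigma_filt P B (g n k).
have FA : filt (g n k) [set w | \sum_(j < k.+1) sqnorm (xi j w) * (g n j.+1 - g n j) <= C].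
  apply: (gset_le sF); last exact: (gmeas_cst sF).
  apply: (gmeas_sum sF) => j _; apply: (gmeasM sF); last exact: (gmeas_cst sF).
  apply: (sqnorm_measurable sF) => i'; apply: filt_measurable_mono (mx j i' _).
    by rewrite grid_le// -ltnS.
  by rewrite (leq_ltn_trans _ kn)// -ltnS.
have := gmeas_if sF FA (mx k i kn) (gmeas_cst sF 0).
rewrite (_ : (fun w => _) = (fun w => dtrunc n C xi k w i 0))//.
apply/funext => w; rewrite /dtrunc; case: ifP => h.
  by move/set_mem : h => /= ->.
by case: ifP => h'; [rewrite mem_set in h|rewrite mxE].
Qed.

Lemma dqvT n xi w : dqv T n xi T w = \sum_(k < 2 ^ n) sqnorm (xi k w) * (g n k.+1 - g n k).
Proof. by apply: eq_bigr => k _; rewrite !min_l// grid_leT// ltnW. Qed.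

Lemma grid_inc_ge0 n k : 0 <= g n k.+1 - g n k.
Proof. by rewrite subr_ge0 grid_le. Qed.

Lemma dtrunc_qv n C xi w : 0 <= C -> dqv T n (dtrunc n C xi) T w <= C.
Proof.
move=> C0; rewrite dqvT.
have := @trunc_sum (fun i => sqnorm (xi i w) * (g n i.+1 - g n i)) C (2 ^ n) C0 _.
move=> /(_ (fun k => mulr_ge0 (sqnorm_ge0 _) (grid_inc_ge0 n k))).
rewrite le_min => /andP[+ _]; congr (_ <= _); apply: eq_bigr => k _.
by rewrite /dtrunc; case: ifP => // _; rewrite sqnorm0 mul0r.
Qed.

Lemma dtrunc_id n C xi w k : dqv T n xi T w <= C -> (k < 2 ^ n)%N -> dtrunc n C xi k w = xi k w.
Proof.
move=> qC kn; rewrite /dtrunc ifT//; apply: le_trans qC; rewrite dqvT.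
have h0 i : 0 <= sqnorm (xi i w) * (g n i.+1 - g n i) by rewrite mulr_ge0 ?sqnorm_ge0// grid_inc_ge0.
rewrite -(subnKC kn) -!(big_mkord xpredT (fun i => sqnorm (xi i w) * (g n i.+1 - g n i))).
by rewrite [leRHS](@big_cat_nat _ _ _ k.+1)//= ?leq_addr// lerDl sumr_ge0.
Qed.

(** Up to the exponential of the bracket, the square is the exponential of the doubled integrand,
    which has mean 1. A bounded bracket therefore gives a bound in L2. *)
Lemma dexp_sq n xi (t : R) w : dexp T B n xi t w ^+ 2 =
  expR (dqv T n xi t w) * dexp T B n (fun k w => 2 *: xi k w) t w.
Proof.
rewrite /dexp -expRM_natl -expRD dintZ dqvZ; congr expR.
by field.
Qed.

Lemma uint_sq (f_ : nat -> Omega -> R) (c : R) : (forall n, measurable_fun setT (f_ n)) ->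
  (forall n w, 0 <= f_ n w) -> (forall n, (\int[P]_w (f_ n w ^+ 2)%:E <= c%:E)%E) -> uint P f_.
Proof.
move=> mf f0 fc e e0; pose K := 1 + `|c| / e.
have K0 : 0 < K by rewrite ltr_pwDl// divr_ge0// ltW.
exists K => n.
have mA : measurable [set w | K <= f_ n w].
  by rewrite -[X in measurable X]setTI; exact: measurable_fun_le.
rewrite integral_EFin_setI//.
apply: (@le_trans _ _ (\int[P]_w (K^-1 * (f_ n w ^+ 2))%:E)%E).
  apply: le_integral_EFin.
  - by apply: measurable_funM => //; exact: measurable_indic.
  - by apply: measurable_funM => //; exact: measurable_funX.
  - by move=> w; rewrite mulr_ge0.
  move=> w; rewrite indicE; case: (boolP (w \in _)) => [|_].
    rewrite inE/= => Kf; rewrite mul1r mulrC ler_pdivlMr// expr2.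
    exact: ler_wpM2l.
  by rewrite mul0r mulr_ge0 ?invr_ge0 ?sqr_ge0// ltW.
rewrite integralZ_EFin//; last 3 first.
- exact: measurable_funX.
- by move=> w; exact: sqr_ge0.
- by rewrite invr_ge0 ltW.
apply: (@le_trans _ _ (K^-1%:E * c%:E)%E).
  by apply: lee_wpmul2l => //; rewrite lee_fin invr_ge0 ltW.
rewrite -EFinM lee_fin mulrC ler_pdivrMr// /K mulrDr mulr1 mulrCA divff ?gt_eqF// mulr1.
by have := ler_norm c; lra.
Qed.

Lemma sqnorm_perturb (u v : 'cV[R]_m) (eta : R) : 0 < eta ->
  sqnorm u <= (1 + eta) * sqnorm v + (1 + eta^-1) * sqnorm (u - v).
Proof.
move=> eta0; set d := u - v; have -> : u = v + d by rewrite /d addrC subrK.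
have h := sqnorm_ge0 (Num.sqrt eta *: v - Num.sqrt eta^-1 *: d).
have hs : Num.sqrt eta * Num.sqrt eta^-1 = 1.
  by rewrite -sqrtrM ?ltW// divff ?gt_eqF// sqrtr1.
have eV : 0 <= eta^-1 by rewrite invr_ge0 ltW.
rewrite sqnormB !sqnormZ dotvZl dotvZr (sqr_sqrtr (ltW eta0)) (sqr_sqrtr eV) in h.
rewrite [Num.sqrt eta * (_ * _)]mulrA hs mul1r in h.
rewrite sqnormD; lra.
Qed.

Lemma emart_approx L N (c : R) : 0 <= c -> predictable_mx L -> approx L N ->
  {ae P, forall w, (\int[mu]_(s in `[0%R, T]) (sqnorm (L s w))%:E <= c%:E)%E} ->
  forall e : R, 0 < e -> exists n xi, [/\ dwf n xi, forall w, dqv T n xi T w <= c + 1 &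
    exists E : set Omega, [/\ measurable E, (P E <= e%:E)%E & forall w, ~ E w ->
      forall t : R, 0 <= t <= T ->
        `|(dint T B n xi t w - 2^-1 * dqv T n xi t w) - (N t w - 2^-1 * qvar L t w)| <= e]].
Proof.
move=> c0 pL aL [N0 [mN0 PN0 HN0]] e e0.
(* The two brackets will differ by at most [eta * (2 * c + 4)]. This must be at most [e], and at
   most 1 so that the dyadic bracket stays below [c + 1], where the truncation is inactive. *)
pose eta := Num.min 1 e / (2 * c + 4).
have c4 : 0 < 2 * c + 4 by rewrite ltr_wpDl// mulr_ge0.
have eta0 : 0 < eta by rewrite divr_gt0// lt_min ltr01.
have etae : eta * (2 * c + 4) <= e by rewrite mulfVK ?gt_eqF// ge_min lexx orbT.
have eta1 : eta * (2 * c + 4) <= 1 by rewrite mulfVK ?gt_eqF// ge_min lexx.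
have eta14 : eta <= 1 / 4.
  have := mulr_ge0 (ltW eta0) c0; lra.
(* A squared distance of [eta ^+ 2] compensates the factor [1 + eta^-1] of [sqnorm_perturb]. *)
pose e' := Num.min (eta ^+ 2) (e / 2).
have e'0 : 0 < e' by rewrite lt_min exprn_gt0// divr_gt0.
have [n [xi [wf [E [mE PE HE]]]]] := aL _ e'0.
exists n, (dtrunc n (c + 1) xi); split.
- exact: dtrunc_wf.
- by move=> w; apply: dtrunc_qv; rewrite addr_ge0.
exists (E `|` N0); split; first exact: measurableU.
  rewrite -[leRHS]adde0; apply: prob_leU => //.
    by apply: (le_trans PE); rewrite lee_fin ge_min; apply/orP; right; lra.
  by rewrite le_eqVlt; apply/orP; left; apply/eqP; exact: PN0.
move=> w /not_orP[nE nN0]; have [h1 h2] := HE w nE.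
have hc : (\int[mu]_(s in `[0%R, T]) (sqnorm (L s w))%:E <= c%:E)%E.
  by apply: contrapT => h; apply: nN0; exact: HN0.
have iL : tint T (fun s => sqnorm (L s w)).
  by apply: qvar_tint => //; exact: le_lt_trans hc (ltry _).
have mv : smeas T (dval T n xi) := @dval_smeas _ _ _ _ _ n xi.
have mL := predictable_smeas T0 hP hB pL.
have id_ : tint T (fun s => sqnorm (dval T n xi s w - L s w)).
  apply: tint_lty; [exact: (smeas_sqnorm w (smeasB mv mL))|by move=> s _; exact: sqnorm_ge0|].
  exact: le_lt_trans h1 (ltry _).
have iv : tint T (fun s => sqnorm (dval T n xi s w)).
  apply: tint_lty; [exact: (smeas_sqnorm w mv)|by move=> s _; exact: sqnorm_ge0|].
  by rewrite dqv_int ?ltry// ltW.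
have qE (t : R) : 0 <= t <= T -> dqv T n xi t w = ti (fun s => sqnorm (dval T n xi s w)) t.
  move=> /andP[t0 tT]; apply: EFin_inj; rewrite -(ti_EFin iv tT); apply/esym; exact: dqv_int.
have d0 (t : R) : 0 <= t <= T -> 0 <= ti (fun s => sqnorm (dval T n xi s w - L s w)) t <= eta ^+ 2.
  move=> /andP[t0 tT]; rewrite ti_ge0//=; last by move=> s _; exact: sqnorm_ge0.
  apply: (@le_trans _ _ (ti (fun s => sqnorm (dval T n xi s w - L s w)) T)).
    by apply: (ti_homo id_) => // s _; exact: sqnorm_ge0.
  rewrite -lee_fin -(ti_EFin id_)//; apply: (le_trans h1).
  by rewrite lee_fin ge_min lexx.
have A0 (t : R) : 0 <= t <= T -> 0 <= qvar L t w <= c.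
  move=> /andP[t0 tT]; rewrite /qvar ti_ge0//=; last by move=> s _; exact: sqnorm_ge0.
  apply: (@le_trans _ _ (ti (fun s => sqnorm (L s w)) T)).
    by apply: (ti_homo iL) => // s _; exact: sqnorm_ge0.
  by rewrite -lee_fin -(ti_EFin iL).
have ti_comb f k d (t : R) : tint T f -> tint T k -> tint T d -> 0 <= t <= T ->
   (forall s, f s <= (1 + eta) * k s + (1 + eta^-1) * d s) ->
   ti f t <= (1 + eta) * ti k t + (1 + eta^-1) * ti d t.
  move=> fi ki di /andP[t0 tT] H; rewrite -(tiZ (1 + eta) ki tT) -(tiZ (1 + eta^-1) di tT) -(tiD (tintZ _ ki) (tintZ _ di) tT).
  have := ti_inc_le fi (tintD (tintZ (1 + eta) ki) (tintZ (1 + eta^-1) di)) (lexx 0) t0 tT (fun s _ => H s).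
  by rewrite !ti0 !subr0.
have eta_d x : 0 <= x <= eta ^+ 2 -> (1 + eta^-1) * x <= eta ^+ 2 + eta.
  move=> /andP[x0 x1]; apply: (@le_trans _ _ ((1 + eta^-1) * eta ^+ 2)).
    by rewrite ler_wpM2l// addr_ge0// invr_ge0 ltW.
  have -> : (1 + eta^-1) * eta ^+ 2 = eta ^+ 2 + eta by field; rewrite gt_eqF.
  exact: lexx.
have qA (t : R) : 0 <= t <= T -> `|dqv T n xi t w - qvar L t w| <= eta * (2 * c + 4).
  move=> tT; rewrite (qE t tT) /qvar.
  have k1 := ti_comb _ _ _ t iv iL id_ tT (fun s => sqnorm_perturb _ _ eta0).
  have k2 := ti_comb _ _ _ t iL iv id_ tT _.
  have {}k2 := k2 (fun s => ltac:(by have := sqnorm_perturb (L s w) (dval T n xi s w) eta0;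
    rewrite -[sqnorm (L s w - _)]sqnormN opprB)).
  have kd := eta_d _ (d0 t tT).
  have /andP[a1 a2] := A0 t tT; rewrite /qvar in a1 a2.
  move: k1 k2 kd a1 a2; move: (ti _ t) (ti _ t) (ti _ t) => dd A q k1 k2 kd a1 a2.
  have e2 : eta ^+ 2 <= eta.
    by rewrite expr2 ler_piMl ?ltW//; lra.
  have l1 : eta * A <= eta * c by rewrite ler_wpM2l// ltW.
  have q1 : q <= A + eta * (c + 2) by lra.
  have ec0 := mulr_ge0 (ltW eta0) c0.
  have q2 : q <= c + 1 by lra.
  have l2 : eta * q <= eta * (c + 1) by rewrite ler_wpM2l// ltW.
  rewrite ler_norml; apply/andP; split; lra.
have qT : dqv T n xi T w <= c + 1.
  have TT : 0 <= T <= T by rewrite ltW//= lexx.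
  have := qA T TT; have /andP[_ ?] := A0 T TT; rewrite ler_norml => /andP[_ ?]; lra.
have eqxi k : (k < 2 ^ n)%N -> dtrunc n (c + 1) xi k w = xi k w by exact: dtrunc_id.
move=> t tT.
have -> : dint T B n (dtrunc n (c + 1) xi) t w = dint T B n xi t w.
  by apply: eq_bigr => k _; rewrite eqxi.
have -> : dqv T n (dtrunc n (c + 1) xi) t w = dqv T n xi t w.
  by apply: eq_bigr => k _; rewrite eqxi.
have k1 := h2 t tT; have k2 := qA t tT.
have k3 : e' <= e / 2 by rewrite ge_min lexx orbT.
move: (le_trans k1 k3) (le_trans k2 etae).
rewrite !ler_norml => /andP[? ?] /andP[? ?]; apply/andP; split; lra.
Qed.

(* Exponential martingale with bounded bracket: the dyadic exponentials, cut off
   when their bracket exceeds [c + 1], are bounded in L2, hence Vitali applies. *)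
Theorem exp_martingale L N (c s : R) (Phi : Omega -> R) : 0 <= c -> predictable_mx L ->
  approx L N -> (forall t : R, 0 <= t <= T -> filt_measurable t (N t)) ->
  {ae P, forall w, (\int[mu]_(s in `[0%R, T]) (sqnorm (L s w))%:E <= c%:E)%E} ->
  0 <= s <= T -> filt_measurable s Phi -> (forall w, 0 <= Phi w) ->
  (\int[P]_w (Phi w * expR (N T w - 2^-1 * qvar L T w))%:E =
   \int[P]_w (Phi w * expR (N s w - 2^-1 * qvar L s w))%:E)%E.
Proof.
move=> c0 pL aL aN Lc sT mPhi Phi0.
have TT : 0 <= T <= T by rewrite ltW//= lexx.
have mPhi' : measurable_fun setT Phi.
  by apply: (filt_measurableT hP hB _ mPhi); case/andP: sT.
pose M (t : R) w := expR (N t w - 2^-1 * qvar L t w).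
have mM (t : R) : 0 <= t <= T -> measurable_fun setT (M t).
  move=> tT; have sF := sigma_filt P B t.
  have h : filt_measurable t (M t).
    apply: (gmeas_expR sF); apply: (gmeasB sF); first exact: aN.
    by apply: (gmeasM sF); [exact: (gmeas_cst sF)|exact: qvar_adapted].
  by apply: (filt_measurableT hP hB _ h); case/andP: tT.
have /choice[p Hp] k := emart_approx c0 pL aL Lc (e := (2^-1) ^+ k.+1) ltac:(by rewrite exprn_gt0).
have /choice[xi Hxi] k : exists xi : nat * (nat -> Omega -> 'cV[R]_m), [/\ dwf xi.1 xi.2,
    forall w, dqv T xi.1 xi.2 T w <= c + 1 &
    exists E : set Omega, [/\ measurable E, (P E <= ((2^-1) ^+ k.+1)%:E)%E & forall w, ~ E w ->
      forall t : R, 0 <= t <= T -> `|(dint T B xi.1 xi.2 t w - 2^-1 * dqv T xi.1 xi.2 t w) -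
        (N t w - 2^-1 * qvar L t w)| <= (2^-1) ^+ k.+1]].
  by have [x h] := Hp k; exists (p k, x).
have /choice[E HE] k : exists E : set Omega, [/\ measurable E, (P E <= ((2^-1) ^+ k.+1)%:E)%E &
    forall w, ~ E w -> forall t : R, 0 <= t <= T ->
     `|(dint T B (xi k).1 (xi k).2 t w - 2^-1 * dqv T (xi k).1 (xi k).2 t w) -
        (N t w - 2^-1 * qvar L t w)| <= (2^-1) ^+ k.+1].
  by have [_ _] := Hxi k.
pose X k (t : R) w := dexp T B (xi k).1 (xi k).2 t w.
have wf k : dwf (xi k).1 (xi k).2 by have [] := Hxi k.
have mX k (t : R) : 0 <= t <= T -> measurable_fun setT (X k t).
  by move=> tT; apply: (dexp_measurable T0 hP hB).
have cX (t : R) : 0 <= t <= T -> {ae P, forall w, X k t w @[k --> \oo] --> M t w}.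
  move=> tT.
  have := @ae_cvg_of_small_sets _ _ _ P
    (fun k w => dint T B (xi k).1 (xi k).2 t w - 2^-1 * dqv T (xi k).1 (xi k).2 t w)
    (fun w => N t w - 2^-1 * qvar L t w) E.
  move=> h; have {}h := h (fun k => let: And3 a _ _ := HE k in a)
    (fun k => let: And3 _ a _ := HE k in a) (fun k w nE => let: And3 _ _ a := HE k in a w nE t tT).
  apply: filterS h => w h; exact: (continuous_cvg _ (@continuous_expR R _) h).
(* Bounded weights suffice, since monotone convergence along [min Phi k] gives the general case; a
   bound on the weight is what makes the L2 estimate available. *)
suff H (Psi : Omega -> R) (b : R) : filt_measurable s Psi -> (forall w, 0 <= Psi w) ->
    (forall w, Psi w <= b) ->
    (\int[P]_w (Psi w * M T w)%:E = \int[P]_w (Psi w * M s w)%:E)%E.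
  pose Phk (k : nat) w := Num.min (Phi w) k%:R.
  have mk k : filt_measurable s (Phk k).
    have sF := sigma_filt P B s.
    rewrite (_ : Phk k = (fun w => - Num.max (- Phi w) (- k%:R))).
      apply: (gmeasN sF); apply: (gmeas_max sF); last exact: (gmeas_cst sF).
      exact: (gmeasN sF).
    by apply/funext => w; rewrite /Phk -oppr_min opprK.
  have Hk k := H (Phk k) k%:R (mk k) (fun w => ltac:(by rewrite le_min Phi0 ler0n))
    (fun w => ltac:(by rewrite ge_min lexx orbT)).
  have lim_ (t : R) : 0 <= t <= T ->
      (\int[P]_w (Phk k w * M t w)%:E @[k --> \oo] --> \int[P]_w (Phi w * M t w)%:E)%E.
    move=> tT; have := @cvg_monotone_convergence _ _ _ P setT measurableT (fun k w => (Phk k w * M t w)%:E).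
    have -> : (fun x : Omega => limn (fun n => (Phk n x * M t x)%:E)) = (fun w => (Phi w * M t w)%:E).
      apply/funext => w; apply/cvg_lim => //; apply: cvg_near_cst.
      exists (Num.bound (Phi w)) => // k /= kk; rewrite /Phk min_l//.
      by rewrite (le_trans (ltW (archi_boundP (Phi0 w))))// ler_nat.
    apply.
    - move=> k; apply/measurable_EFinP; apply: measurable_funM; last exact: mM.
      by apply: measurable_minr.
    - by move=> k w _; rewrite lee_fin mulr_ge0 ?expR_ge0// le_min Phi0 ler0n.
    - move=> w _ a b ab; rewrite lee_fin ler_wpM2r ?expR_ge0// /Phk le_min !ge_min lexx/=.
      by rewrite ler_nat ab orbT.
  have l1 := lim_ T TT; have l2 := lim_ s sT.
  have e1 : (fun k => \int[P]_w (Phk k w * M s w)%:E)%E = (fun k => \int[P]_w (Phk k w * M T w)%:E)%E.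
    by apply/funext => k; exact: (esym (Hk k)).
  rewrite e1 in l2; exact: (cvg_unique _ l1 l2).
move=> mPsi Psi0 Psib.
have mPsi' : measurable_fun setT Psi.
  by apply: (filt_measurableT hP hB _ mPsi); case/andP: sT.
have uX (t : R) : 0 <= t <= T -> uint P (fun k w => Psi w * X k t w).
  move=> tT; apply: (@uint_sq _ (b ^+ 2 * expR (c + 1))).
  - by move=> k; apply: measurable_funM => //; exact: mX.
  - by move=> k w; rewrite mulr_ge0// expR_ge0.
  move=> k; apply: (@le_trans _ _ (\int[P]_w (b ^+ 2 * expR (c + 1) *
      dexp T B (xi k).1 (fun j w => 2 *: (xi k).2 j w) t w)%:E)%E).
    apply: le_integral_EFin.
    - by apply: measurable_funX; apply: measurable_funM => //; exact: mX.
    - apply: measurable_funM => //; apply: (dexp_measurable T0 hP hB) => //; exact: dwfZ.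
    - by move=> w; exact: sqr_ge0.
    move=> w; rewrite exprMn /X dexp_sq mulrA ler_wpM2r ?dexp_ge0//.
    have b2 : Psi w ^+ 2 <= b ^+ 2 by rewrite ler_sqr ?nnegrE ?(le_trans (Psi0 w) (Psib w)).
    apply: ler_pM; rewrite ?sqr_ge0 ?expR_ge0// ler_expR.
    by have [_ q _] := Hxi k; apply: le_trans (q w); exact: dqv_le.
  rewrite integralZ_EFin.
  - by rewrite integral_dexp ?mule1//; exact: dwfZ.
  - by apply: (dexp_measurable T0 hP hB) => //; exact: dwfZ.
  - by move=> w; exact: dexp_ge0.
  - by rewrite mulr_ge0 ?sqr_ge0 ?expR_ge0.
have eqX k : (\int[P]_w (Psi w * X k T w)%:E = \int[P]_w (Psi w * X k s w)%:E)%E.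
  by case/andP: sT => s0 s1; exact: (dexp_martingale T0 hP hB (wf k) s0 s1 (lexx T) mPsi Psi0).
have cPX (t : R) : 0 <= t <= T -> {ae P, forall w, Psi w * X k t w @[k --> \oo] --> Psi w * M t w}.
  by move=> tT; apply: filterS (cX t tT) => w h; apply: cvgM => //; exact: cvg_cst.
have mPX k (t : R) : 0 <= t <= T -> measurable_fun setT (fun w => Psi w * X k t w).
  by move=> tT; apply: measurable_funM => //; exact: mX.
have mPM (t : R) : 0 <= t <= T -> measurable_fun setT (fun w => Psi w * M t w).
  by move=> tT; apply: measurable_funM => //; exact: mM.
have gX k (t : R) w : 0 <= Psi w * X k t w by rewrite mulr_ge0// dexp_ge0.
have gM (t : R) w : 0 <= Psi w * M t w by rewrite mulr_ge0// expR_ge0.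
have le1 k : (\int[P]_w (Psi w * X k T w)%:E <= \int[P]_w (Psi w * X k s w)%:E)%E by rewrite eqX.
have le2 k : (\int[P]_w (Psi w * X k s w)%:E <= \int[P]_w (Psi w * X k T w)%:E)%E by rewrite eqX.
(* The dyadic integrals at [s] and [T] are equal, so the comparison lemma applies in both
   directions. *)
clearbody X M; apply/eqP; rewrite eq_le; apply/andP; split.
  exact: (le_integral_vitali (fun k => mPX k T TT) (mPM T TT) (fun k => mPX k s sT) (mPM s sT)
    (fun k => gX k T) (gM T) (fun k => gX k s) (gM s) (cPX T TT) (cPX s sT) (uX s sT) le1).
exact: (le_integral_vitali (fun k => mPX k s sT) (mPM s sT) (fun k => mPX k T TT) (mPM T TT)
  (fun k => gX k s) (gM s) (fun k => gX k T) (gM T) (cPX s sT) (cPX T TT) (uX T TT) le2).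
Qed.

End adapted.

(** * Stopping *)

Section stopping.
Context (R : realType) (disp : measure_display) (Omega : measurableType disp).
Context (P : probability Omega R) (T : R) (m : nat).
Variable B : R -> Omega -> 'cV[R]_m.
Hypotheses (T0 : 0 < T) (hP : measure_is_complete P).
Hypothesis hB : brownian_motion P T B.

Local Notation mu := (@lebesgue_measure R).
Local Notation filt := (filt P B).
Local Notation filt_measurable := (filt_measurable P B).
Local Notation predictable := (predictable P T B).
Local Notation predictable_mx := (predictable_mx P T B).
Local Notation pred_alg := (pred_alg P T B).
Local Notation approx := (approx P T B).
Local Notation stopping := (stopping_time P T B).
Local Notation g := (grid T).
Local Notation I0T := (`[0, T]%classic : set (measurableTypeR R)).
Local Notation sP := (sigma_pred P T B).

Implicit Types (n : nat) (tau : Omega -> R).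
Implicit Types (H L : R -> Omega -> 'cV[R]_m) (I N X : R -> Omega -> R).

Lemma tail_small (f : Omega -> \bar R) (e : R) : 0 < e -> measurable_fun setT f ->
  (forall w, (0 <= f w)%E) -> {ae P, forall w, (f w < +oo)%E} ->
  exists (C : R) (E : set Omega), [/\ 0 <= C, measurable E, (P E <= e%:E)%E &
    forall w, ~ E w -> (f w <= C%:E)%E].
Proof.
move=> e0 mf f0 fy; pose E (n : nat) := [set w | (n%:R%:E < f w)%E].
have mE n : measurable (E n).
  rewrite -[X in measurable X]setTI.
  exact: (@measurable_lte _ _ _ _ measurableT (fun=> n%:R%:E) f).
have [||n Pn] := @small_of_nonincreasing _ _ _ P E _ e0 mE.
- move=> a b ab; apply/subsetPset => w /=; apply: le_lt_trans.
  by rewrite lee_fin ler_nat.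
- apply: negligibleS fy => w Ew fw.
  have := Ew (Num.bound (fine (f w))) Logic.I; rewrite /E/= -[f w]fineK; last first.
    by rewrite fin_numE gt_eqF ?(lt_le_trans _ (f0 w)) ?ltNyr//= lt_eqF.
  by rewrite lte_fin ltNge ltW// archi_boundP// fine_ge0.
by exists n%:R, (E n); split => // w nE; rewrite leNgt; apply/negP.
Qed.

Lemma sup_small X (e : R) : 0 < e ->
  (forall t : R, 0 <= t <= T -> measurable_fun setT (X t)) ->
  {ae P, forall w, ucont T (fun t => X t w)} ->
  exists (C : R) (E : set Omega), [/\ 0 <= C, measurable E, (P E <= e%:E)%E &
    forall w, ~ E w -> forall t : R, 0 <= t <= T -> `|X t w| <= C].
Proof.
move=> e0 mX uX; pose E (n : nat) := [set w | exists2 s : R, 0 <= s <= T & n%:R <= `|X s w|].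
have mE n : measurable (E n) by exact: (measurable_sup_ge T0 hP).
have [||n Pn] := @small_of_nonincreasing _ _ _ P E _ e0 mE.
- move=> a b ab; apply/subsetPset => w /= [s sT h]; exists s => //; apply: le_trans h.
  by rewrite ler_nat.
- apply: negligibleS uX => w Ew uXw; have [K HK] := ucont_bounded T0 uXw.
  have [s sT] := Ew (Num.bound K) Logic.I.
  have K0 : 0 <= K by apply: le_trans (HK s sT).
  have := HK s sT; have := archi_boundP K0 => h1 h2 h3.
  by have := lt_le_trans h1 (le_trans h3 h2); rewrite ltxx.
exists n%:R, (E n); split => // w nE t tT; apply: ltW; rewrite ltNge; apply/negP => h.
by apply: nE; exists t.
Qed.

(** Time 0, which the dyadic cells do not cover, is Lebesgue-null. *)
Lemma l2_le_pos (f k : measurableTypeR R -> R) : measurable_fun I0T f -> measurable_fun I0T k ->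
  (forall s, 0 <= f s) -> (forall s, 0 <= k s) ->
  (forall s : R, 0 < s <= T -> f s <= k s) ->
  (\int[mu]_(s in `[0%R, T]) (f s)%:E <= \int[mu]_(s in `[0%R, T]) (k s)%:E)%E.
Proof.
move=> mf mk f0 k0 fk; apply: ae_ge0_le_integral => //.
- by move=> s _; rewrite lee_fin.
- exact/measurable_EFinP.
- by move=> s _; rewrite lee_fin.
- exact/measurable_EFinP.
exists [set 0]; split => //; first exact: lebesgue_measure_set1.
move=> s /= /not_implyP[sT h]; apply: contrapT => s0; apply: h.
rewrite lee_fin fk// lt_neqAle eq_sym; move: sT; rewrite /= in_itv/= => /andP[-> ->].
by rewrite !andbT; apply/eqP.
Qed.

Lemma grid_ceil n (t : R) : 0 <= t <= T -> exists b, [/\ (b <= 2 ^ n)%N, t <= g n b,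
  g n b <= t + T / 2 ^+ n & forall k, (g n k < t) = (k < b)%N].
Proof.
move=> /andP[t0 tT]; have [t_gt0|t_le0] := ltP 0 t; last first.
  have -> : t = 0 by apply/eqP; rewrite eq_le t_le0.
  exists 0%N; rewrite grid0 lexx add0r (ltW (mesh_gt0 T0 _)); split => // k.
  by rewrite ltNge grid_ge0.
have [|k [kn /andP[kt tk]]] := @grid_cell _ T n t; first by rewrite t_gt0.
exists k.+1; split => //; first by rewrite gridS lerD2r ltW.
move=> j; apply/idP/idP => [jt|jk].
  by rewrite -(grid_lt T0 n) (lt_le_trans jt).
by apply: le_lt_trans kt; rewrite grid_le// -ltnS.
Qed.

(** Cell [k] is kept when [tau] lies strictly beyond its left end, an event known there. The
    resulting step process is the indicator of the times up to [tau] rounded up to the grid. *)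
Definition stop_coef n tau (k : nat) (w : Omega) : R := if g n k < tau w then 1 else 0.

Lemma stopping_lt tau (t : R) : stopping tau -> 0 <= t <= T -> filt t [set w | t < tau w].
Proof.
move=> [_ st] tT; rewrite (_ : [set w | _] = ~` [set w | tau w <= t]).
  by apply: (gsetC (sigma_filt P B t)); exact: st.
by apply/seteqP; split => w /=; rewrite ltNge => /negP.
Qed.

Lemma stop_coef_wf n tau : stopping tau -> kwf P T B n 1 (stop_coef n tau).
Proof.
move=> st; split; last first.
  by move=> i w _; rewrite /stop_coef; case: ifP; rewrite ?normr0 ?normr1.
move=> i i_n; have sF := sigma_filt P B (g n i).
have FA : filt (g n i) [set w | g n i < tau w].
  by apply: stopping_lt => //; rewrite grid_ge0// grid_leT// ltnW.
have h := gmeas_if sF FA (gmeas_cst sF (1 : R)) (gmeas_cst sF (0 : R)).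
rewrite (_ : stop_coef n tau i = (fun w => if w \in [set w | g n i < tau w] then 1 else 0)); first exact: h.
by apply/funext => w; rewrite /stop_coef mem_setE.
Qed.

Lemma kstep_stop n tau (s : R) w b : (forall k, (g n k < tau w) = (k < b)%N) ->
  (b <= 2 ^ n)%N -> 0 < s <= T -> kstep T n (stop_coef n tau) s w = if s <= g n b then 1 else 0.
Proof.
move=> Hb bn sT; have [k [kn ks]] := grid_cell n sT.
rewrite /kstep (grid_cell_sum T0 (fun i => stop_coef n tau i w) kn ks) /stop_coef Hb.
case/andP: ks => ks sk; have [kb|bk] := ltnP k b.
  by rewrite ifT// (le_trans sk)// grid_le.
by rewrite ifF//; apply/negbTE; rewrite -ltNge (le_lt_trans _ ks)// grid_le.
Qed.

Lemma ksum_stop n tau X (t : R) w b : (forall k, (g n k < tau w) = (k < b)%N) ->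
  (b <= 2 ^ n)%N -> 0 <= t -> ksum T n (stop_coef n tau) X t w = X (Num.min (g n b) t) w - X 0 w.
Proof.
move=> Hb bn t0; rewrite -[X 0 w](_ : X (Num.min (g n 0) t) w = _); last by rewrite grid0 min_l.
rewrite -(telescope_cells (fun i => X (Num.min (g n i) t) w) (leq0n b) bn).
rewrite /ksum; apply: eq_bigr => i _; rewrite /stop_coef Hb /=.
by case: ifP; rewrite ?mul1r ?mul0r.
Qed.

(** Within the strip the complement is a countable union of rectangles: times after a dyadic [g], on
    the event [tau <= g]. *)
Lemma stopped_set_pred tau : stopping tau -> pred_alg [set z | z.1 <= tau z.2].
Proof.
move=> st; pose S := \bigcup_n \bigcup_k (if (k < 2 ^ n)%N then
  `]g n k, T]%classic `*` [set w | tau w <= g n k] else set0).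
have pS : pred_alg S.
  apply: (gset_bigcup sP) => n; apply: (gset_bigcup sP) => k.
  case: ifP => kn; last exact: (gset0 sP).
  rewrite pred_algE (_ : _ `&` _ = `]g n k, T]%classic `*` [set w | tau w <= g n k]).
    apply: sub_sigma_algebra; right; exists (g n k), T, [set w | tau w <= g n k].
    split => //; first exact: grid_ge0.
      by rewrite -[X in _ < X](gridT T n) (grid_lt T0).
    by case: st => _; apply; rewrite grid_ge0// grid_leT// ltnW.
  apply/seteqP; split => -[u w]/=; first by case.
  rewrite !in_itv/= => -[/andP[gu uT] ?]; do ![split => //]; first by rewrite gu.
  by rewrite uT (le_trans (grid_ge0 T0 n k) (ltW gu)).
apply: (pred_alg_eq (gsetC sP pS)) => u w uT; split => /= [nS|ut [n _ [k _]]]; last first.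
  case: ifP => // kn [/=]; rewrite in_itv/= => /andP[gu _] tg.
  by have := lt_le_trans gu (le_trans ut tg); rewrite ltxx.
rewrite leNgt; apply/negP => tu; apply: nS.
have [n hn] : exists n, T / 2 ^+ n < u - tau w by apply: mesh_small => //; rewrite subr_gt0.
have [tauT _] := st; have [b [bn tb bt Hb]] := grid_ceil n (tauT w).
have bu : g n b < u by lra.
have b2 : (b < 2 ^ n)%N by rewrite -(grid_lt T0 n) gridT (lt_le_trans bu)//; case/andP: uT.
exists n => //; exists b => //; rewrite b2; split => //=; rewrite in_itv/= bu.
by case/andP: uT.
Qed.

Lemma predictable_cut tau (k : R -> Omega -> R) : stopping tau -> predictable k ->
  predictable (fun s w => if s <= tau w then k s w else 0).
Proof.
move=> st pk; apply: gmeas_predictable.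
have H := gmeas_if sP (stopped_set_pred st) (predictable_gmeas pk) (gmeas_cst sP 0).
apply: (eq_ind _ (gmeas pred_alg) H); apply/funext => z.
by case: ifPn => [/set_mem/= ->//|/negP h]; case: ifPn => // h'; exfalso; apply: h; exact/mem_set.
Qed.

Definition stop_mx tau L (s : R) (w : Omega) := if s <= tau w then L s w else 0.

Lemma stop_mx_pred tau L : stopping tau -> predictable_mx L -> predictable_mx (stop_mx tau L).
Proof.
move=> st pL i j; apply: predictable_eq (predictable_cut st (pL i j)) _ => s w _.
by rewrite /stop_mx; case: ifP => //; rewrite mxE.
Qed.

(** [X] stopped at [tau] rounded up to the grid is a sum of adapted terms, and it converges by
    continuity of the path. *)
Lemma stopped_adapted tau X (t : R) : stopping tau ->
  (forall w, {within `[0, T], continuous (fun t : R => X t w)}) ->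
  (forall t : R, 0 <= t <= T -> filt_measurable t (X t)) ->
  0 <= t <= T -> filt_measurable t (fun w => X (Num.min t (tau w)) w).
Proof.
move=> st cX aX tT; have sF := sigma_filt P B t; case/andP: (tT) => t0 t1; case: (st) => tauT _.
apply: (gmeas_cvg sF (X_ := fun n w => ksum T n (stop_coef n tau) X t w + X 0 w)).
  move=> n; apply: (gmeasD sF); last first.
    by apply: filt_measurable_mono t0 _; apply: aX; rewrite lexx ltW.
  apply: (gmeas_sum sF) => i _; have [it|ti_] := ltP (g n i) t; last first.
    have -> : (fun w => stop_coef n tau i w * (X (Num.min (g n i.+1) t) w - X t w)) = fun=> 0.
      apply/funext => w; rewrite min_r ?subrr ?mulr0//; apply: le_trans ti_ _.
      by rewrite grid_le.
    exact: (gmeas_cst sF).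
  apply: (gmeasM sF).
    by apply: filt_measurable_mono (ltW it) _; have [h _] := stop_coef_wf n st; exact: h.
  apply: (gmeasB sF).
    apply: (@filt_measurable_mono _ _ _ _ _ _ (Num.min (g n i.+1) t)); first by rewrite ge_min lexx orbT.
    by apply: aX; rewrite le_min grid_ge0// t0 ge_min t1 orbT.
  by apply: filt_measurable_mono (ltW it) _; apply: aX; rewrite grid_ge0// (le_trans (ltW it)).
move=> w; apply/cvgrPdist_le => e e0.
have [M HM] := continuous_ucont T0 (cX w) e0.
exists M => // n /= Mn; have [b [bn tb bt Hb]] := grid_ceil n (tauT w).
rewrite (ksum_stop X Hb bn t0) subrK; apply: HM.
- by rewrite le_min t0 ge_min t1 /=; case/andP: (tauT w) => ->.
- by rewrite le_min t0 ge_min t1 orbT grid_ge0.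
apply: (@le_trans _ _ (`|tau w - g n b|)).
  by rewrite [Num.min (g n b) t]minC; exact: lipschitz_min.
rewrite ler0_norm ?subr_le0// opprB lerBlDl (le_trans bt)// lerD2l.
exact: (mesh_le T0).
Qed.

Lemma ti_stop f (t c : R) : 0 <= c -> ti (fun s => if s <= c then f s else 0) t = ti f (Num.min t c) :> R.
Proof.
move=> c0; rewrite /ti Rintegral_mkcond [RHS]Rintegral_mkcond; apply: eq_Rintegral => s _.
rewrite /patch !mem_setE !in_itv/= le_min.
by case: (0 <= s) => //=; case: (s <= t) => //=; case: (s <= c).
Qed.

Lemma adapted_measurable X (t : R) : (forall t : R, 0 <= t <= T -> filt_measurable t (X t)) ->
  0 <= t <= T -> measurable_fun setT (X t).
Proof. by move=> aX tT; apply: (filt_measurableT hP hB _ (aX t tT)); case/andP: tT. Qed.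

Lemma qvar_ucont L : predictable_mx L ->
  {ae P, forall w, (\int[mu]_(s in `[0%R, T]) (sqnorm (L s w))%:E < +oo)%E} ->
  {ae P, forall w, ucont T (fun t => qvar L t w)}.
Proof.
move=> pL; apply: filterS => w Lw; apply: (ti_ucont T0).
exact: (qvar_tint T0 hP hB).
Qed.

Lemma measurable_cut (f : R -> R) (c : R) : measurable_fun I0T f ->
  measurable_fun I0T (fun s : measurableTypeR R => if s <= c then f s else 0).
Proof.
move=> mf; rewrite (_ : (fun _ => _) = (fun s => \1_(`]-oo, c]%classic) s * f s)).
  by apply: measurable_funM => //; exact: measurable_indic.
apply/funext => s; rewrite indicE mem_setE in_itv/=.
by case: ifP => _; rewrite ?mul1r ?mul0r.
Qed.

Lemma tint_cut f (c : R) : tint T f -> tint T (fun s => if s <= c then f s else 0).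
Proof.
move=> fi; apply: (@tint_le _ _ _ (fun s => `|f s|)).
- exact: measurable_cut (tint_measurable fi).
- exact: (integrable_abse fi).
- by move=> s _; case: ifP; rewrite ?normr0.
Qed.

(** Rounding [tau] up to the grid turns stopping into multiplication by an adapted step process. The
    error is an increment of [N], or of the bracket, over at most one mesh, small off a small event
    by the common modulus. *)
Lemma approx_stop L N tau : predictable_mx L -> approx L N ->
  (forall w, {within `[0, T], continuous (fun t : R => N t w)}) ->
  (forall t : R, 0 <= t <= T -> filt_measurable t (N t)) ->
  {ae P, forall w, (\int[mu]_(s in `[0%R, T]) (sqnorm (L s w))%:E < +oo)%E} ->
  stopping tau -> approx (stop_mx tau L) (fun t w => N (Num.min t (tau w)) w).
Proof.
move=> pL aL cN aN Ly st; have tauT := proj1 st.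
apply: approx_lim; first exact: (predictable_smeas T0 hP hB (stop_mx_pred st pL)).
move=> e e0; have e4 : 0 < e / 4 by rewrite divr_gt0.
have uN : {ae P, forall w, ucont T (fun t => N t w)}.
  by apply: aeW => w; exact: (continuous_ucont T0).
have mN := fun t => adapted_measurable (t := t) aN.
have [n1 [E1 [mE1 PE1 HE1]]] := ucont_modulus T0 mN uN e4.
have mA (t : R) : 0 <= t <= T -> measurable_fun setT (qvar L t).
  by move=> tT; apply: (adapted_measurable (X := qvar L)) => // s sT; exact: (qvar_adapted sT pL).
have [n2 [E2 [mE2 PE2 HE2]]] := ucont_modulus T0 mA (qvar_ucont pL Ly) e4.
have [E3 [mE3 PE3 HE3]] := Ly; have [E4 [mE4 PE4 HE4]] := approx0 T0 aL.
pose n := maxn n1 n2.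
have sL := predictable_smeas T0 hP hB pL.
exists (fun s w => kstep T n (stop_coef n tau) s w *: L s w), (ksum T n (stop_coef n tau) N).
split; [exact: (smeasM (kstep_smeas n (stop_coef n tau)) sL)|exact: (approx_step T0 sL aL (stop_coef_wf n st))|].
exists ((E1 `|` E2) `|` (E3 `|` E4)); split; first by do 2?apply: measurableU.
  apply: (@le_trans _ _ (((e / 4)%:E + (e / 4)%:E) + (0 + 0))%E).
    apply: prob_leU; [exact: measurableU|exact: measurableU|exact: prob_leU|].
    by apply: prob_leU => //; rewrite le_eqVlt; apply/orP; left; apply/eqP; [exact: PE3|exact: PE4].
  by rewrite !adde0 -EFinD lee_fin; lra.
move=> w /not_orP[/not_orP[k1 k2] /not_orP[k3 k4]].
have Lw : (\int[mu]_(s in `[0%R, T]) (sqnorm (L s w))%:E < +oo)%E.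
  by apply: contrapT => h; apply: k3; exact: HE3.
have N0 : N 0 w = 0 by apply: contrapT => h; apply: k4; exact: HE4.
have iL := qvar_tint T0 hP hB pL Lw.
have [b [bn tb bt Hb]] := grid_ceil n (tauT w).
have gT : 0 <= g n b <= T by rewrite grid_ge0// grid_leT.
have dist : `|g n b - tau w| <= T / 2 ^+ n by rewrite ger0_norm ?subr_ge0// lerBlDl.
split.
  pose f s := sqnorm (L s w); pose cut (c : R) s := if s <= c then f s else 0.
  have ic c : tint T (cut c) by exact: tint_cut.
  apply: (@le_trans _ _ (\int[mu]_(s in `[0%R, T]) (cut (g n b) s - cut (tau w) s)%:E)%E).
    have c0 s : 0 <= cut (g n b) s - cut (tau w) s.
      rewrite /cut; have [st'|ts] := leP s (tau w).
        by rewrite (le_trans st' tb) subrr.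
      by rewrite subr0; case: ifP => // _; exact: sqnorm_ge0.
    apply: l2_le_pos => //.
    - exact: (smeas_sqnorm w (smeasB (smeasM (kstep_smeas n (stop_coef n tau)) sL)
        (predictable_smeas T0 hP hB (stop_mx_pred st pL)))).
    - exact: tint_measurable (tintB (ic _) (ic _)).
    - by move=> s; exact: sqnorm_ge0.
    move=> s sT; rewrite (kstep_stop Hb bn sT) /stop_mx /cut /f.
    have [sb|bs] := leP s (g n b); have [st'|ts] := leP s (tau w).
    + by rewrite scale1r !subrr sqnorm0.
    + by rewrite scale1r !subr0.
    + by have := lt_le_trans bs (le_trans st' tb); rewrite ltxx.
    + by rewrite scale0r !subr0 sqnorm0.
  rewrite (ti_EFin (tintB (ic _) (ic _)) (lexx T)) lee_fin (tiB (ic _) (ic _) (lexx T)).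
  have /andP[tau0 tau1] := tauT w; case/andP: (gT) => gT0 gT1.
  rewrite /cut !ti_stop// !min_r//.
  apply: (@le_trans _ _ (e / 4)); last lra.
  apply: le_trans (ler_norm _) _; apply: HE2 => //.
  by apply: (le_trans dist); apply: (mesh_le T0); exact: leq_maxr.
move=> t tT; case/andP: (tT) => t0 t1; rewrite (ksum_stop N Hb bn t0) N0 subr0.
apply: (@le_trans _ _ (e / 4)); last lra.
apply: HE1 => //.
- by rewrite le_min t0 ge_min t1 orbT grid_ge0.
- by rewrite le_min t0 ge_min t1 /=; case/andP: (tauT w) => ->.
apply: (@le_trans _ _ (`|g n b - tau w|)).
  by rewrite [Num.min (g n b) t]minC; exact: lipschitz_min.
by apply: (le_trans dist); apply: (mesh_le T0); exact: leq_maxl.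
Qed.

(** Including [T] in the set keeps the infimum in [[0, T]] and gives the value [T] when the level is
    not reached. *)
Definition hitting (A : R -> Omega -> R) (c : R) (w : Omega) : R :=
  inf [set s | 0 <= s <= T /\ (c <= A s w \/ s = T)].

Lemma hitting_spec (A : R -> Omega -> R) (c : R) : 0 <= c ->
  (forall w, ucont T (fun t => A t w)) ->
  (forall w (s t : R), 0 <= s -> s <= t -> t <= T -> A s w <= A t w) ->
  (forall w, A 0 w = 0) ->
  (forall t : R, 0 <= t <= T -> filt_measurable t (A t)) ->
  [/\ stopping (hitting A c), forall w, A (hitting A c w) w <= c &
      forall w, A T w < c -> hitting A c w = T].
Proof.
move=> c0 uA mA A0 aA.
have SE w : [set s | 0 <= s <= T /\ (c <= A s w \/ s = T)] T by split; [rewrite lexx ltW|right].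
have lb w s : 0 <= s <= T -> (c <= A s w \/ s = T) -> hitting A c w <= s.
  by move=> sT h; apply: ge_inf => //; exists 0 => x [/andP[]].
have ge w x : (forall s, 0 <= s <= T -> (c <= A s w \/ s = T) -> x <= s) -> x <= hitting A c w.
  by move=> h; apply: lb_le_inf; [exists T|move=> s [sT]; exact: h].
have hT w : 0 <= hitting A c w <= T.
  rewrite lb ?lexx ?(ltW T0)//; last by right.
  by rewrite andbT; apply: ge => s /andP[].
(* For a continuous nondecreasing clock, being hit by time [t < T] is the same as [c <= A t], an
   event of [filt t] itself and not merely of all later sigma-algebras. *)
have hit w (t : R) : 0 <= t -> t < T -> (hitting A c w <= t) = (c <= A t w).
  move=> t0 tT; apply/idP/idP => h; last by apply: lb; [rewrite t0 ltW|left].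
  rewrite leNgt; apply/negP => At.
  have d0 : 0 < (c - A t w) / 2 by rewrite divr_gt0// subr_gt0.
  have [M HM] := uA w _ d0.
  pose t' := Num.min T (t + T / 2 ^+ M).
  have tt' : t < t' by rewrite lt_min tT ltrDl (mesh_gt0 T0).
  have t'T : t' <= T by rewrite ge_min lexx.
  have At' : A t' w < c.
    have t'0 : 0 <= t' <= T by rewrite t'T (le_trans t0 (ltW tt')).
    have := HM t' t t'0; rewrite t0 (ltW tT) => /(_ isT).
    rewrite ger0_norm ?subr_ge0 ?(ltW tt')// lerBlDl ge_min lexx orbT => /(_ isT).
    by rewrite ler_norml => /andP[_]; lra.
  have : t' <= hitting A c w.
    apply: ge => s /andP[s0 sT] [cA|->//]; rewrite leNgt; apply/negP => st'.
    by have := mA w s t' s0 (ltW st') t'T; lra.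
  by move/(lt_le_trans tt'); rewrite ltNge h.
split.
- split=> // t /andP[t0 tT]; have [tT'|Tt] := ltP t T.
    rewrite (_ : [set w | _] = [set w | c <= A t w]).
      by apply: (gset_le (sigma_filt P B t)); [exact: (gmeas_cst (sigma_filt P B t))|apply: aA; rewrite t0].
    by apply/seteqP; split => w /=; rewrite hit.
  rewrite (_ : [set w | _] = setT); first exact: (gsetT (sigma_filt P B t)).
  by apply/seteqP; split => // w _ /=; apply: le_trans Tt; case/andP: (hT w).
- move=> w; rewrite leNgt; apply/negP => cA; case/andP: (hT w) => r0 rT.
  have r_gt0 : 0 < hitting A c w.
    by rewrite lt_neqAle r0 andbT; apply/eqP => h0; move: cA; rewrite -h0 A0 ltNge c0.
  have d0 : 0 < (A (hitting A c w) w - c) / 2 by rewrite divr_gt0// subr_gt0.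
  have [M HM] := uA w _ d0.
  pose u := Num.max 0 (hitting A c w - T / 2 ^+ M).
  have u0 : 0 <= u by rewrite le_max lexx.
  have ur : u < hitting A c w by rewrite gt_max r_gt0 gtrDl oppr_lt0 (mesh_gt0 T0).
  have uT : 0 <= u <= T by rewrite u0 (le_trans (ltW ur)).
  have := HM _ _ (hT w) uT; rewrite ger0_norm ?subr_ge0 ?(ltW ur)//.
  rewrite lerBlDr -lerBlDl le_max lexx orbT => /(_ isT); rewrite ler_norml => /andP[_ h].
  have : hitting A c w <= u by apply: lb => //; left; lra.
  by rewrite leNgt ur.
- move=> w AT; apply/eqP; rewrite eq_le; case/andP: (hT w) => r0 rT; rewrite rT /=.
  rewrite leNgt; apply/negP => rT'.
  have h : c <= A (hitting A c w) w by rewrite -hit.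
  by have := mA w _ T r0 rT (lexx T); lra.
Qed.

(** Integration by parts of the deterministic [h], with [h' = beta h ^ 2], against the integral.
    Freezing [h] at the left end of each cell and using its exact increment formula, the remainder
    on a cell is the integral of [h ^ 2 I] minus a frozen value. *)
Lemma approx_mul (h : R -> R) (beta : R) H I : 0 < beta ->
  (forall t : R, 0 <= t <= T -> 0 < h t <= 1) ->
  (forall u v : R, 0 <= u <= T -> 0 <= v <= T -> h v - h u = beta * (h u * h v) * (v - u)) ->
  predictable_mx H -> approx H I ->
  (forall w, {within `[0, T], continuous (fun t : R => I t w)}) ->
  (forall t : R, 0 <= t <= T -> filt_measurable t (I t)) ->
  {ae P, forall w, (\int[mu]_(s in `[0%R, T]) (sqnorm (H s w))%:E < +oo)%E} ->
  approx (fun s w => h s *: H s w) (fun t w => h t * I t w - beta * ti (fun s => h s ^+ 2 * I s w) t).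
Proof.
move=> b0 h01 hlip pH aH cI aI Hy.
have hd (u v : R) : 0 <= u <= T -> 0 <= v <= T -> `|h v - h u| <= beta * `|v - u|.
  move=> uT vT; rewrite (hlip u v uT vT) normrM ler_wpM2r// normrM gtr0_norm//.
  rewrite ger_pMr//; case/andP: (h01 u uT) => u0 u1; case/andP: (h01 v vT) => v0 v1.
  by rewrite ger0_norm; [apply: mulr_ile1 => //; exact: ltW|rewrite mulr_ge0// ltW].
have uh : ucont T h.
  move=> e e0; have [M HM] := mesh_small T0 (divr_gt0 e0 b0); exists M => u v uT vT uv.
  apply: (le_trans (hd v u vT uT)); rewrite mulrC -ler_pdivlMr//.
  exact: le_trans uv (ltW HM).
have uI w : ucont T (fun t => I t w) by exact: (continuous_ucont T0).
have uf w : ucont T (fun s => h s ^+ 2 * I s w).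
  by apply: (ucontM T0) => //; exact: (ucontM T0 uh uh).
have sH := predictable_smeas T0 hP hB pH.
have mh : measurable_fun I0T h := ucont_measurable T0 uh.
have shH : smeas T (fun s w => h s *: H s w) by apply: (smeasM (k := fun s _ => h s)).
apply: approx_lim => // e e0; have e6 : 0 < e / 6 by rewrite divr_gt0.
have mI := fun t => adapted_measurable (t := t) aI.
have [C1 [E1 [C10 mE1 PE1 HE1]]] := sup_small e6 mI (aeW _ uI).
have lH : measurable_fun setT (fun w => \int[mu]_(s in `[0%R, T]) (sqnorm (H s w))%:E)%E.
  by apply: (time_integral_measurable T0 hP hB);
    [exact: predictable_sqnorm|move=> s w; exact: sqnorm_ge0].
have lH0 w : (0 <= \int[mu]_(s in `[0%R, T]) (sqnorm (H s w))%:E)%E.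
  by apply: integral_ge0 => s _; rewrite lee_fin sqnorm_ge0.
have [C2 [E2 [C20 mE2 PE2 HE2]]] := tail_small e6 lH lH0 Hy.
(* Summing [beta * (2 * d)] times the mesh over the [2 ^ n] cells gives [2 d T beta = e / 3]. *)
pose d := e / (6 * (T * beta)).
have Tb : 0 < T * beta by rewrite mulr_gt0.
have d0 : 0 < d by rewrite divr_gt0// mulr_gt0.
have mf (t : R) : 0 <= t <= T -> measurable_fun setT (fun w => h t ^+ 2 * I t w).
  by move=> tT; apply: measurable_funM => //; exact: mI.
have de0 : 0 < Num.min d (e / 6) by rewrite lt_min d0.
have uf' : {ae P, forall w, ucont T (fun s => h s ^+ 2 * I s w)} by apply: aeW => w; exact: uf.
have [n1 [E3 [mE3 PE3 HE3]]] := ucont_modulus T0 mf uf' de0.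
have [E4 [mE4 PE4 HE4]] := approx0 T0 aH.
(* Bounds on the mesh: the middle one serves the distance of the integrands, as [h] varies by at
   most [beta * q] in a cell; the last one serves that variation of [h] times the bounded path
   [I]. *)
pose q := Num.min 1 (Num.min (e / (beta ^+ 2 * (1 + C2))) (d / (beta * (1 + C1)))).
have q0 : 0 < q.
  by rewrite !lt_min ltr01 !divr_gt0 ?mulr_gt0 ?exprn_gt0 ?ltr_pwDl.
have [n2 Hn2] := mesh_small T0 q0.
pose n := maxn n1 n2; have mesh0 := mesh_gt0 T0 n.
have mq : T / 2 ^+ n <= q by apply: (le_trans _ (ltW Hn2)); apply: (mesh_le T0); exact: leq_maxr.
have mn1 : T / 2 ^+ n <= T / 2 ^+ n1 by apply: (mesh_le T0); exact: leq_maxl.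
have q1 : q <= 1 by rewrite /q ge_min lexx.
have q2 : beta ^+ 2 * (1 + C2) * q <= e.
  rewrite mulrC -ler_pdivlMr ?mulr_gt0 ?exprn_gt0 ?ltr_pwDl//.
  by rewrite /q !ge_min lexx orbT.
have q3 : beta * (1 + C1) * q <= d.
  by rewrite mulrC -ler_pdivlMr ?mulr_gt0 ?ltr_pwDl// /q !ge_min lexx !orbT.
clearbody q.
pose k (i : nat) (w : Omega) := h (g n i).
have gT i : (i <= 2 ^ n)%N -> 0 <= g n i <= T by move=> ?; rewrite grid_ge0// grid_leT.
have wk : kwf P T B n 1 k.
  split => [i i_n|i w i_n]; first exact: (gmeas_cst (sigma_filt P B (g n i))).
  by have /andP[a b] := h01 _ (gT i (ltnW i_n)); rewrite ger0_norm// ltW.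
exists (fun s w => kstep T n k s w *: H s w), (ksum T n k I).
split; [exact: (smeasM (kstep_smeas n k) sH)|exact: (approx_step T0 sH aH wk)|].
exists ((E1 `|` E2) `|` (E3 `|` E4)); split; first by do 2?apply: measurableU.
  apply: (@le_trans _ _ (((e / 6)%:E + (e / 6)%:E) + ((e / 6)%:E + 0))%E).
    apply: prob_leU; [exact: measurableU|exact: measurableU|exact: prob_leU|].
    apply: prob_leU => //; last by rewrite le_eqVlt; apply/orP; left; apply/eqP; exact: PE4.
    by apply: (le_trans PE3); rewrite lee_fin ge_min lexx orbT.
  by rewrite adde0 -!EFinD lee_fin; lra.
move=> w /not_orP[/not_orP[k1 k2] /not_orP[k3 k4]].
have I0 : I 0 w = 0 by apply: contrapT => hh; apply: k4; exact: HE4.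
have hI1 := HE1 w k1; have hH := HE2 w k2; have hf := HE3 w k3.
split.
  apply: (@le_trans _ _ (\int[mu]_(s in `[0%R, T]) ((beta * q) ^+ 2 * sqnorm (H s w))%:E)%E).
    apply: l2_le_pos.
    - exact: (smeas_sqnorm w (smeasB (smeasM (kstep_smeas n k) sH) shH)).
    - by apply: measurable_funM => //; exact: smeas_sqnorm.
    - by move=> s; exact: sqnorm_ge0.
    - by move=> s; rewrite mulr_ge0 ?sqr_ge0 ?sqnorm_ge0.
    move=> s sT; have [i [i_n /andP[gs sg]]] := grid_cell n sT.
    rewrite /kstep (grid_cell_sum T0 (fun i => k i w) i_n) ?gs// -scalerBl sqnormZ.
    rewrite ler_wpM2r ?sqnorm_ge0// -real_normK ?num_real// ler_sqr ?nnegrE ?mulr_ge0 ?(ltW b0) ?(ltW q0)//.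
    have sT' : 0 <= s <= T by case/andP: sT => /ltW -> ->.
    apply: (le_trans (hd _ _ sT' (gT i (ltnW i_n)))); rewrite ler_wpM2l ?(ltW b0)//.
    apply: le_trans mq; rewrite ler0_norm ?subr_le0 ?(ltW gs)// opprB lerBlDl.
    by rewrite -gridS.
  under eq_integral do rewrite EFinM.
  rewrite ge0_integralZl//; last 3 first.
  - by apply/measurable_EFinP; exact: (smeas_sqnorm w sH).
  - by move=> s _; rewrite lee_fin sqnorm_ge0.
  - by rewrite lee_fin sqr_ge0.
  apply: (@le_trans _ _ (((beta * q) ^+ 2)%:E * C2%:E)%E).
    by apply: lee_wpmul2l => //; rewrite lee_fin sqr_ge0.
  rewrite -EFinM lee_fin; apply: le_trans q2.
  have -> : (beta * q) ^+ 2 * C2 = beta ^+ 2 * C2 * (q * q) by ring.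
  have p1 : 0 <= beta ^+ 2 * C2 by apply: mulr_ge0 => //; exact: sqr_ge0.
  have p2 : 0 <= q * q by apply: mulr_ge0; exact: ltW.
  apply: ler_pM => //; last by rewrite ger_pMr.
  by apply: ler_wpM2l; [exact: sqr_ge0|rewrite lerDr].
move=> t tT; case/andP: (tT) => t0 t1.
pose f s := h s ^+ 2 * I s w; have fi : tint T f by exact: (tint_ucont T0 (uf w)).
pose Rr s := h s * I s w - beta * ti f s.
have -> : h t * I t w - beta * ti f t = \sum_(i < 2 ^ n) (Rr (Num.min (g n i.+1) t) - Rr (Num.min (g n i) t)).
  rewrite -(big_mkord xpredT (fun i => Rr (Num.min (g n i.+1) t) - Rr (Num.min (g n i) t))).
  rewrite telescope_sumr// gridT grid0 min_r// min_l//.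
  by rewrite /Rr [h 0 * _]mulrC I0 mul0r ti0 mulr0 subr0 subr0.
rewrite /ksum -sumrB; apply: (le_trans (ler_norm_sum _ _ _)).
apply: (@le_trans _ _ (\sum_(i < 2 ^ n) (beta * (2 * d) * (T / 2 ^+ n)))); last first.
  rewrite sumr_const card_ord -[_ *+ (2 ^ n)]mulr_natr natrX.
  rewrite (_ : _ * 2 ^+ n = 2 * d * (T * beta)); last by field; rewrite expf_neq0.
  rewrite /d (_ : 2 * _ * _ = e / 3); first lra.
  by field; rewrite !gt_eqF.
apply: ler_sum => i _; set u := Num.min (g n i) t; set v := Num.min (g n i.+1) t.
have [ti_|it] := leP t (g n i).
  rewrite /u /v !min_r//; last by rewrite (le_trans ti_)// grid_le.
  rewrite !subrr mulr0 subr0 normr0; apply: mulr_ge0; last exact: ltW.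
  by apply: mulr_ge0; [exact: ltW|apply: mulr_ge0 => //; exact: ltW].
have uE : u = g n i by rewrite /u min_l// ltW.
have uv : u <= v by rewrite uE le_min grid_le// leqnSn ltW.
have u0 : 0 <= u by rewrite uE grid_ge0.
have vT : v <= T by rewrite ge_min t1 orbT.
have uvm : v - u <= T / 2 ^+ n by rewrite lerBlDl uE -gridS ge_min lexx.
have uT : 0 <= u <= T by rewrite u0 (le_trans uv).
have vT' : 0 <= v <= T by rewrite vT (le_trans u0).
rewrite /k -uE; set cc := h u * h v * I v w.
have -> : h u * (I v w - I u w) - (Rr v - Rr u) =
    beta * ((ti f v - ti f u) - (ti (fun=> cc) v - ti (fun=> cc) u)).
  rewrite !ti_cst ?(le_trans u0 uv)//.
  have -> : h u * (I v w - I u w) - (Rr v - Rr u) = beta * (ti f v - ti f u) - (h v - h u) * I v w.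
    by rewrite /Rr; ring.
  by rewrite (hlip u v uT vT') /cc; ring.
have ic := tint_cst T0 cc.
rewrite (_ : _ - _ - _ = ti (fun s => f s - cc) v - ti (fun s => f s - cc) u); last first.
  by rewrite !(tiB fi ic)//; [ring|case/andP: uT].
rewrite normrM gtr0_norm// -mulrA ler_wpM2l ?(ltW b0)//.
apply: (@le_trans _ _ (2 * d * (v - u))).
  apply: (ti_inc_bound T0 (tintB fi ic)) => // s /andP[us sv].
  have sT : 0 <= s <= T by rewrite (le_trans u0 us) (le_trans sv vT).
  rewrite (_ : f s - cc = (f s - f v) + (h v - h u) * (h v * I v w)); last by rewrite /f /cc; ring.
  apply: (le_trans (ler_normD _ _)); have -> : 2 * d = d + d by ring.
  apply: lerD.
    apply: (@le_trans _ _ (Num.min d (e / 6))); last by rewrite ge_min lexx.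
    apply: hf => //; apply: le_trans mn1; rewrite ler0_norm ?subr_le0// opprB.
    by apply: le_trans uvm; rewrite lerB.
  rewrite normrM; apply: le_trans q3.
  have h1 : `|h v - h u| <= beta * q.
    apply: (le_trans (hd u v uT vT')); rewrite ler_wpM2l ?(ltW b0)//.
    by rewrite ger0_norm ?subr_ge0// (le_trans uvm).
  have h2 : `|h v * I v w| <= 1 + C1.
    rewrite normrM; case/andP: (h01 v vT') => hv0 hv1; rewrite gtr0_norm//.
    apply: (@le_trans _ _ (1 * C1)); last by rewrite mul1r lerDr.
    by apply: ler_pM => //; [exact: ltW|exact: hI1].
  have -> : beta * (1 + C1) * q = beta * q * (1 + C1) by ring.
  exact: ler_pM.
by rewrite ler_wpM2l// mulr_ge0// ltW.
Qed.

End stopping.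

(* Otherwise [lra] and [ring] unfold Lebesgue integrals to compare their atoms. *)
#[local] Opaque ti.

(** * Pathwise calculus *)

Section calculus.
Context (R : realType) (T : R) (T0 : 0 < T).
Local Notation g := (grid T).
Implicit Types a b f k phi : R -> R.

Lemma ti_inc_abs f k (u v : R) : tint T f -> tint T k -> 0 <= u -> u <= v -> v <= T ->
  (forall s : R, u <= s <= v -> `|f s| <= k s) -> `|ti f v - ti f u| <= ti k v - ti k u.
Proof.
move=> fi ki u0 uv vT fk; rewrite ler_norml; apply/andP; split.
  have kN : tint T (fun s => -1 * k s) by exact: tintZ.
  rewrite lerNl opprB; have uT : u <= T by exact: le_trans uv vT.
  have := ti_inc_le kN fi u0 uv vT _; rewrite !(tiZ _ ki)// !mulN1r.
  have H s : u <= s <= v -> -1 * k s <= f s by move=> /fk; rewrite ler_norml mulN1r => /andP[].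
  by move=> /(_ H); lra.
by apply: (ti_inc_le fi ki u0 uv vT) => s /fk; rewrite ler_norml => /andP[].
Qed.

(** Summing the local bounds over a fine grid bounds the total increment by an arbitrarily small
    multiple of [ti phi t]. This replaces differentiation almost everywhere in the rules below. *)
Lemma le_increment (Rr phi : R -> R) (t : R) : tint T phi -> 0 <= t <= T ->
  (forall e : R, 0 < e -> exists N : nat, forall u v : R, 0 <= u -> u <= v -> v <= T ->
    v - u <= T / 2 ^+ N -> Rr v - Rr u <= e * (ti phi v - ti phi u)) -> Rr t <= Rr 0.
Proof.
move=> iphi /andP[t0 tT] H; apply/ler_addgt0Pr => e e0.
pose c := 1 + `|ti phi t|; have c0 : 0 < c by rewrite ltr_pwDl.
have [N HN] := H (e / c) (divr_gt0 e0 c0).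
rewrite -lerBlDl.
have tele (f : R -> R) : f t - f 0 = \sum_(i < 2 ^ N) (f (Num.min (g N i.+1) t) - f (Num.min (g N i) t)).
  rewrite -(big_mkord xpredT (fun i => f (Num.min (g N i.+1) t) - f (Num.min (g N i) t))).
  by rewrite telescope_sumr// gridT grid0 min_r// min_l.
rewrite tele; apply: (@le_trans _ _ (e / c * (ti phi t - ti phi 0))).
  rewrite (tele (ti phi)) mulr_sumr; apply: ler_sum => i _.
  have gi : g N i <= g N i.+1 by rewrite grid_le.
  apply: HN.
  - by rewrite le_min grid_ge0.
  - by rewrite le_min !ge_min gi lexx !orbT.
  - by rewrite ge_min tT orbT.
  - apply: (@le_trans _ _ (g N i.+1 - g N i)); last by rewrite gridS addrC addKr.
    by case: (leP (g N i.+1) t); case: (leP (g N i) t); lra.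
rewrite ti0 subr0 mulrAC ler_pdivrMr// ler_wpM2l ?(ltW e0)// /c.
by have := ler_norm (ti phi t); lra.
Qed.

Lemma eq_increment (Rr phi : R -> R) (t : R) : tint T phi -> 0 <= t <= T ->
  (forall e : R, 0 < e -> exists N : nat, forall u v : R, 0 <= u -> u <= v -> v <= T ->
    v - u <= T / 2 ^+ N -> `|Rr v - Rr u| <= e * (ti phi v - ti phi u)) -> Rr t = Rr 0.
Proof.
move=> iphi tT H; apply/eqP; rewrite eq_le; apply/andP; split.
  apply: (@le_increment Rr phi) => // e /H[N HN]; exists N => u v u0 uv vT uvN.
  exact: le_trans (ler_norm _) (HN u v u0 uv vT uvN).
rewrite -lerN2; apply: (@le_increment (fun t => - Rr t) phi) => // e /H[N HN].
exists N => u v u0 uv vT uvN; rewrite -opprD -[X in - (Rr v - X)]opprK; rewrite opprK.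
by apply: le_trans (HN u v u0 uv vT uvN); rewrite -normrN; exact: ler_norm.
Qed.

Lemma ucont_le (f : R -> R) (e : R) : ucont T f -> 0 < e -> exists N : nat, forall u v : R,
  0 <= u -> u <= v -> v <= T -> v - u <= T / 2 ^+ N ->
  forall s r : R, u <= s <= v -> u <= r <= v -> `|f s - f r| <= e.
Proof.
move=> uf /uf[N HN]; exists N => u v u0 uv vT uvN s r /andP[us sv] /andP[ur rv].
apply: HN.
- by rewrite (le_trans u0 us) (le_trans sv vT).
- by rewrite (le_trans u0 ur) (le_trans rv vT).
- by apply: le_trans uvN; rewrite ler_norml; apply/andP; split; lra.
Qed.

Lemma tint_abs f : tint T f -> tint T (fun s => `|f s|).
Proof. by move=> fi; exact: (integrable_abse fi). Qed.

(** On a short interval, freezing one primitive at each end reproduces the increment of the product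
    exactly. The integrand with running primitives differs from it by at most [e] times the sum of
    the absolute values of [a] and [b], and [eq_increment] concludes. *)
Lemma ibp a b (t : R) : tint T a -> tint T b -> 0 <= t <= T ->
  ti a t * ti b t = ti (fun s => ti b s * a s + ti a s * b s) t.
Proof.
move=> ia ib tT; have uA := ti_ucont T0 ia; have uB := ti_ucont T0 ib.
have iBa := tintM_ucont T0 uB ia; have iAb := tintM_ucont T0 uA ib.
have ic := tintD iBa iAb.
set c := (fun s => ti b s * a s + ti a s * b s).
have [absa absb] := (tint_abs ia, tint_abs ib).
suff : ti a t * ti b t - ti c t = ti a 0 * ti b 0 - ti c 0.
  by rewrite !ti0 mul0r subr0 => /eqP; rewrite subr_eq0 => /eqP.
apply: (@eq_increment (fun t => ti a t * ti b t - ti c t) (fun s => `|a s| + `|b s|)) => //.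
  exact: tintD.
move=> e e0; have [N1 H1] := ucont_le uA e0; have [N2 H2] := ucont_le uB e0.
exists (maxn N1 N2) => u v u0 uv vT uvN.
have uvN1 : v - u <= T / 2 ^+ N1 by apply: (le_trans uvN); rewrite (mesh_le T0)// leq_maxl.
have uvN2 : v - u <= T / 2 ^+ N2 by apply: (le_trans uvN); rewrite (mesh_le T0)// leq_maxr.
have uT : u <= T by exact: le_trans uv vT.
pose d s := (ti b v * a s + ti a u * b s) - c s.
have i1 := tintD (tintZ (ti b v) ia) (tintZ (ti a u) ib).
have id_ : tint T d by exact: tintB i1 ic.
have -> : ti a v * ti b v - ti c v - (ti a u * ti b u - ti c u) = ti d v - ti d u.
  rewrite !(tiB i1 ic)// !(tiD (tintZ _ ia) (tintZ _ ib))// !(tiZ _ ia)// !(tiZ _ ib)//.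
  by ring.
have -> : e * (ti (fun s => `|a s| + `|b s|) v - ti (fun s => `|a s| + `|b s|) u) =
    ti (fun s => e * (`|a s| + `|b s|)) v - ti (fun s => e * (`|a s| + `|b s|)) u.
  by rewrite !(tiZ _ (tintD absa absb))//; ring.
apply: ti_inc_abs => //; first exact: tintZ (tintD absa absb).
move=> s suv.
have -> : d s = (ti b v - ti b s) * a s + (ti a u - ti a s) * b s by rewrite /d /c; ring.
apply: (le_trans (ler_normD _ _)); rewrite mulrDr !normrM.
apply: lerD; apply: ler_wpM2r => //.
  by apply: (H2 u v) => //; rewrite uv lexx.
by apply: (H1 u v) => //; rewrite uv lexx.
Qed.

(** Chain rule from convexity: the tangent inequality at [u] and at [v] encloses the increment of
    [V] between two terms, each close to the increment of [ti c]. *)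
Lemma exp_chain_aux a c (V : R -> R) (t : R) : tint T a -> tint T c -> ucont T V ->
  (forall s, c s = V s * a s) ->
  (forall u v : R, V u - V v <= V u * (ti a v - ti a u)) -> 0 <= t <= T ->
  V t + ti c t = V 0 + ti c 0.
Proof.
move=> ia ic uV cE conv tT; have absa := tint_abs ia.
apply: (@eq_increment (fun t => V t + ti c t) (fun s => `|a s|)) => //.
move=> e e0; have [N H] := ucont_le uV e0; exists N => u v u0 uv vT uvN.
have uT : u <= T by exact: le_trans uv vT.
have key r : u <= r <= v -> `|(ti c v - ti c u) - V r * (ti a v - ti a u)| <=
    e * ti (fun s => `|a s|) v - e * ti (fun s => `|a s|) u.
  move=> ruv; have i1 := tintZ (V r) ia.
  have e1 x : x <= T -> ti (fun s => c s - V r * a s) x = ti c x - V r * ti a x.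
    by move=> xT; rewrite (tiB ic i1 xT) (tiZ (V r) ia xT).
  have -> : (ti c v - ti c u) - V r * (ti a v - ti a u) =
      ti (fun s => c s - V r * a s) v - ti (fun s => c s - V r * a s) u.
    by rewrite (e1 v vT) (e1 u uT); ring.
  rewrite -(tiZ e absa vT) -(tiZ e absa uT).
  apply: ti_inc_abs => //; [exact: tintB|exact: tintZ|].
  by move=> s suv; rewrite cE -mulrBl normrM ler_wpM2r//; exact: (H u v).
have h1 := conv u v; have h2 := conv v u.
move: (key u ltac:(by rewrite lexx uv)) (key v ltac:(by rewrite lexx uv)).
rewrite !ler_norml mulrBr => /andP[? ?] /andP[? ?]; apply/andP; split; lra.
Qed.

Lemma exp_chain a (t : R) : tint T a -> 0 <= t <= T ->
  expR (- ti a t) = 1 - ti (fun s => expR (- ti a s) * a s) t.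
Proof.
move=> ia tT; have uA := ti_ucont T0 ia.
have uV : ucont T (fun s => expR (- ti a s)).
  apply: (continuous_ucont T0) => s; apply: continuous_comp; last exact: continuous_expR.
  exact: (ucont_continuous T0 (ucontN uA)).
have ic := tintM_ucont T0 uV ia.
have conv (u v : R) : expR (- ti a u) - expR (- ti a v) <= expR (- ti a u) * (ti a v - ti a u).
  move: (ti a u) (ti a v) => x y.
  have -> : expR (- y) = expR (- x) * expR (- (y - x)) by rewrite -expRD; congr expR; ring.
  have := expR_ge1Dx (- (y - x)); have := expR_gt0 (- x).
  move: (expR (- x)) (expR (- (y - x))) => p q p0 h.
  have -> : p - p * q = p * (1 - q) by ring.
  by rewrite ler_pM2l//; lra.
have := exp_chain_aux ia ic uV (fun s => erefl _) conv tT.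
by rewrite !ti0 oppr0 expR0 addr0 => /eqP; rewrite eq_sym -subr_eq => /eqP <-.
Qed.

Lemma ti_h (h : R -> R) (beta t : R) :
  (forall t : R, 0 <= t <= T -> 0 < h t <= 1) -> ucont T h ->
  (forall u v : R, 0 <= u <= T -> 0 <= v <= T -> h v - h u = beta * (h u * h v) * (v - u)) ->
  0 <= t <= T -> h t = h 0 + ti (fun s => beta * h s ^+ 2) t.
Proof.
move=> h01 uh hlip tT; have uh2 := ucontM T0 uh uh.
have ih2 : tint T (fun s => beta * h s ^+ 2) by exact: tintZ (tint_ucont T0 uh2).
set c := (fun s => beta * h s ^+ 2) in ih2 *.
suff : h t - ti c t = h 0 - ti c 0 by rewrite ti0 subr0 => <-; rewrite subrK.
apply: (@eq_increment (fun t => h t - ti c t) (fun=> 1)) => //; first exact: (tint_cst T0).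
move=> e e0; have be0 : 0 < e / (2 * (1 + `|beta|)) by rewrite divr_gt0// mulr_gt0// ltr_pwDl.
have [N H] := ucont_le uh be0; exists N => u v u0 uv vT uvN.
have uT : u <= T by exact: le_trans uv vT.
have v0 : 0 <= v by exact: le_trans uv.
rewrite !ti_cst// !mul1r.
have i1 := tint_cst T0 (beta * (h u * h v)).
have -> : h v - ti c v - (h u - ti c u) =
   ti (fun s => beta * (h u * h v) - c s) v - ti (fun s => beta * (h u * h v) - c s) u.
  rewrite !(tiB i1 ih2)// !ti_cst//.
  rewrite (_ : _ - _ - _ = (h v - h u) - (ti c v - ti c u)); last by ring.
  by rewrite hlip ?u0 ?v0 ?uT ?vT//; ring.
apply: (ti_inc_bound T0 (tintB i1 ih2)) => // s /andP[us sv].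
have sT : 0 <= s <= T by rewrite (le_trans u0 us) (le_trans sv vT).
have -> : beta * (h u * h v) - c s = beta * ((h u - h s) * h v + h s * (h v - h s)).
  by rewrite /c; ring.
have [hv0 hv1] : 0 < h v /\ h v <= 1 by apply/andP; apply: h01; rewrite v0.
have [hs0 hs1] := andP (h01 s sT).
have d1 : `|h u - h s| <= e / (2 * (1 + `|beta|)) by apply: (H u v); rewrite ?lexx ?uv ?us.
have d2 : `|h v - h s| <= e / (2 * (1 + `|beta|)) by apply: (H u v); rewrite ?lexx ?uv ?us.
rewrite normrM; apply: (@le_trans _ _ (`|beta| * (e / (2 * (1 + `|beta|)) + e / (2 * (1 + `|beta|))))).
  rewrite ler_wpM2l//; apply: (le_trans (ler_normD _ _)); rewrite !normrM (gtr0_norm hv0) (gtr0_norm hs0).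
  apply: lerD.
    by rewrite -[leRHS]mulr1 ler_pM// ltW.
  by rewrite -[leRHS]mul1r ler_pM// ltW.
have -> : e / (2 * (1 + `|beta|)) + e / (2 * (1 + `|beta|)) = e / (1 + `|beta|).
  by field; rewrite gt_eqF// ltr_pwDl.
rewrite mulrA ler_pdivrMr ?ltr_pwDl// mulrC ler_wpM2l ?(ltW e0)//; lra.
Qed.

End calculus.

(** The integral of a nonnegative function is a supremum over the simple functions below it, hence
    monotone for arbitrary functions. *)
Lemma le_integral_ge0 (R : realType) (disp : measure_display) (Om : measurableType disp)
  (nu : {measure set Om -> \bar R}) (f k : Om -> \bar R) :
  (forall w, (0 <= f w)%E) -> (forall w, (f w <= k w)%E) ->
  (\int[nu]_w f w <= \int[nu]_w k w)%E.
Proof.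
move=> f0 fk; have k0 w : (0 <= k w)%E by exact: le_trans (fk w).
rewrite ge0_integralTE// [leRHS]ge0_integralTE//; apply: le_ereal_sup => _ [hh hf <-].
by exists hh => // w; exact: le_trans (hf w) (fk w).
Qed.

(** * Continuous versions, stopped exponentials and events of time 0 *)

Section processes.
Context (R : realType) (disp : measure_display) (Omega : measurableType disp).
Context (P : probability Omega R) (T : R) (m : nat).
Variable B : R -> Omega -> 'cV[R]_m.
Hypotheses (T0 : 0 < T) (hP : measure_is_complete P).
Hypothesis hB : brownian_motion P T B.

Local Notation mu := (@lebesgue_measure R).
Local Notation filt := (filt P B).
Local Notation filt_measurable := (filt_measurable P B).
Local Notation predictable := (predictable P T B).
Local Notation predictable_mx := (predictable_mx P T B).
Local Notation approx := (approx P T B).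
Local Notation stopping := (stopping_time P T B).
Local Notation I0T := (`[0, T]%classic : set (measurableTypeR R)).

Implicit Types (tau : Omega -> R) (L : R -> Omega -> 'cV[R]_m) (N X : R -> Omega -> R).

Lemma predictable_sec_measurable X w : predictable X ->
  measurable_fun I0T (fun s : measurableTypeR R => X s w).
Proof.
move=> pX; have mX := predictable_measurable T0 hP hB pX.
have mD : measurable (`[0, T]%classic `*` setT : set (measurableTypeR R * Omega)).
  by apply: measurableX.
apply: (@measurable_comp _ _ _ (measurableTypeR R) (measurableTypeR R * Omega)%type _
  (`[0, T]%classic `*` setT) _ `[0, T]%classic (fun s => (s, w)) mD _ mX).
  by move=> z /= [s sT <-].
exact: measurable_funTS.
Qed.

(* [ti (X ^~ w)] is a junk value on the null set where [X ^~ w] is not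
   integrable; [V] is continuous and adapted without exception. *)
Lemma ti_version X : predictable X ->
  {ae P, forall w, (\int[mu]_(s in `[0%R, T]) (`|X s w|)%:E < +oo)%E} ->
  exists V : R -> Omega -> R, [/\ forall w, ucont T (fun t => V t w),
    forall t : R, 0 <= t <= T -> filt_measurable t (V t),
    forall w, (forall t, V t w = 0) \/ tint T (X ^~ w) /\ forall t, V t w = ti (X ^~ w) t &
    {ae P, forall w, tint T (X ^~ w) /\ forall t, V t w = ti (X ^~ w) t}].
Proof.
move=> pX [N0 [mN0 PN0 HN0]].
have nN0 : P.-negligible N0 by exists N0; split.
have iX w : ~ N0 w -> tint T (X ^~ w).
  move=> nN; have h : (\int[mu]_(s in `[0%R, T]) (`|X s w|)%:E < +oo)%E.
    by apply: contrapT => h; apply: nN; exact: HN0.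
  by apply/integrableP; split => //; apply/measurable_EFinP; exact: predictable_sec_measurable.
exists (fun t w => if w \in N0 then 0 else ti (X ^~ w) t); split.
- move=> w; case: (boolP (w \in N0)) => [_|/negP]; first exact: ucont_cst.
  by rewrite inE => /iX iXw; exact: ti_ucont.
- move=> t tT; have sF := sigma_filt P B t.
  apply: (gmeas_if sF); first exact: filt_negligible.
    exact: (gmeas_cst sF).
  exact: (ti_adapted tT pX).
- move=> w; case: (boolP (w \in N0)) => [_|/negP]; first by left.
  by rewrite inE => nN; right; split => //; exact: iX.
exists N0; split => // w /= h; apply: contrapT => nN; apply: h; split; first exact: iX.
by move=> t; rewrite memNset.
Qed.

Lemma tonelli_time (X : R -> Omega -> R) :
  measurable_fun (`[0, T]%classic `*` setT : set (measurableTypeR R * Omega)) (fun z => X z.1 z.2) ->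
  (forall s w, 0 <= X s w) ->
  (\int[P]_w \int[mu]_(s in `[0%R, T]) (X s w)%:E = \int[mu]_(s in `[0%R, T]) \int[P]_w (X s w)%:E)%E.
Proof.
move=> mX X0.
pose D : set (measurableTypeR R * Omega) := `[0, T]%classic `*` setT.
have mD : measurable D by apply: measurableX.
pose f := ((fun z : measurableTypeR R * Omega => (X z.1 z.2)%:E) \_ D).
have mf : measurable_fun setT f by apply/(measurable_restrictT _ mD); exact/measurable_EFinP.
have f0 z : (0 <= f z)%E by rewrite /f /patch; case: ifP => // _; rewrite lee_fin.
have E := fubini_tonelli (m1 := mu) (m2 := P) f mf f0.
have e1 s : (\int[P]_w f (s, w) = ((fun s => \int[P]_w (X s w)%:E) \_ `[0%R, T]) s)%E.
  rewrite /f /patch; case: (boolP (s \in `[0%R, T]%classic)) => sT.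
    by apply: eq_integral => w _; rewrite ifT// inE; split => //; rewrite inE in sT.
  rewrite integral0_eq// => w _; rewrite ifF//; apply/negbTE; apply: contra sT.
  by rewrite !inE => -[].
have e2 w : (\int[mu]_s f (s, w) = \int[mu]_(s in `[0%R, T]) (X s w)%:E)%E.
  rewrite [RHS]integral_mkcond; apply: eq_integral => s _; rewrite /f /patch.
  congr (if _ then _ else _); apply/idP/idP; rewrite !inE; [by case|by []].
transitivity (\int[P]_w \int[mu]_s f (s, w))%E; first by apply: eq_integral => w _; rewrite e2.
by rewrite [RHS]integral_mkcond -E; apply: eq_integral => s _; exact: e1.
Qed.

Lemma measurable_exp_half (f k : Omega -> R) : measurable_fun setT f -> measurable_fun setT k ->
  measurable_fun setT (fun w => expR (f w - 2^-1 * k w)).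
Proof.
move=> mf mk; apply: measurableT_comp => //; apply: measurable_funB => //.
by apply: measurable_funM.
Qed.

Section stopped_exponential.
Variables (L : R -> Omega -> 'cV[R]_m) (N : R -> Omega -> R) (A : R -> Omega -> R).
Hypotheses (pL : predictable_mx L) (aL : approx L N).
Hypothesis cN : forall w, {within `[0, T], continuous (fun t : R => N t w)}.
Hypothesis aN : forall t : R, 0 <= t <= T -> filt_measurable t (N t).
Hypothesis uA : forall w, ucont T (fun t => A t w).
Hypothesis aA : forall t : R, 0 <= t <= T -> filt_measurable t (A t).
Hypothesis LA : {ae P, forall w, tint T (fun s => sqnorm (L s w)) /\ forall t, A t w = qvar L t w}.

Definition stoch_exp (t : R) (w : Omega) : R := expR (N t w - 2^-1 * A t w).

Lemma ae_integral_finite : {ae P, forall w, (\int[mu]_(s in `[0%R, T]) (sqnorm (L s w))%:E < +oo)%E}.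
Proof. by apply: filterS LA => w [iL _]; rewrite (ti_EFin iL)// ltry. Qed.

Lemma stoch_exp_continuous w : {within `[0, T], continuous (fun t : R => stoch_exp t w)}.
Proof.
move=> t; apply: continuous_comp; last exact: continuous_expR.
apply: (ucont_continuous T0 (_ : ucont T (fun t => N t w - 2^-1 * A t w))).
by apply: (ucontB T0); [exact: (continuous_ucont T0)|exact: ucontZ].
Qed.

Lemma stoch_exp_adapted (t : R) : 0 <= t <= T -> filt_measurable t (stoch_exp t).
Proof.
move=> tT; have sF := sigma_filt P B t; apply: (gmeas_expR sF); apply: (gmeasB sF); first exact: aN.
by apply: (gmeasM sF); [exact: (gmeas_cst sF)|exact: aA].
Qed.

Lemma stoch_exp_stopped_measurable tau : stopping tau ->
  measurable_fun setT (fun w => stoch_exp (tau w) w).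
Proof.
move=> st; have tauT := proj1 st; have TT : 0 <= T <= T by rewrite ltW//= lexx.
have h := stopped_adapted T0 st stoch_exp_continuous stoch_exp_adapted TT.
have := filt_measurableT hP hB (lexx T) h; congr measurable_fun; apply/funext => w.
by rewrite min_r//; case/andP: (tauT w).
Qed.

(** Cutting the integrand off at [tau] bounds its bracket by [c], so [exp_martingale] applies to the
    stopped process. [A] stands for the bracket as a version continuous and adapted on every
    path. *)
Lemma stopped_martingale tau (c s : R) (Phi : Omega -> R) : 0 <= c -> stopping tau ->
  {ae P, forall w, A (tau w) w <= c} ->
  0 <= s <= T -> filt_measurable s Phi -> (forall w, 0 <= Phi w) ->
  (\int[P]_w (Phi w * stoch_exp (tau w) w)%:E =
   \int[P]_w (Phi w * stoch_exp (Num.min s (tau w)) w)%:E)%E.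
Proof.
move=> c0 st Ac sT mPhi Phi0; have tauT := proj1 st.
have TT : 0 <= T <= T by rewrite ltW//= lexx.
have aL' := approx_stop T0 hP hB pL aL cN aN ae_integral_finite st.
have pL' := stop_mx_pred T0 st pL.
have aN' (t : R) : 0 <= t <= T -> filt_measurable t (fun w => N (Num.min t (tau w)) w).
  by move=> tT; exact: (stopped_adapted T0 st cN aN tT).
have sq w r : sqnorm (stop_mx tau L r w) = if r <= tau w then sqnorm (L r w) else 0.
  by rewrite /stop_mx; case: ifP => // _; rewrite sqnorm0.
have tau0 w : 0 <= tau w by case/andP: (tauT w).
have qE w t : qvar (stop_mx tau L) t w = qvar L (Num.min t (tau w)) w.
  by rewrite /qvar -ti_stop//; apply: ti_eq => r _; rewrite sq.
have bd : {ae P, forall w, (\int[mu]_(s in `[0%R, T]) (sqnorm (stop_mx tau L s w))%:E <= c%:E)%E}.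
  apply: filterS2 LA Ac => w [iL AE] Aw; under eq_integral do rewrite sq.
  have := ti_EFin (tint_cut (tau w) iL) (lexx T); rewrite ti_stop// min_r; last by case/andP: (tauT w).
  by move=> ->; rewrite lee_fin -[ti _ _]/(qvar L (tau w) w) -AE.
have E := exp_martingale T0 hP hB c0 pL' aL' aN' bd sT mPhi Phi0.
have mE (t : R) : 0 <= t <= T -> measurable_fun setT
    (fun w => Phi w * expR (N (Num.min t (tau w)) w - 2^-1 * qvar (stop_mx tau L) t w)).
  move=> tT; apply: measurable_funM.
    by apply: (filt_measurableT hP hB _ mPhi); case/andP: sT.
  have tT' : t <= T by case/andP: tT.
  have m1 := filt_measurableT hP hB tT' (aN' t tT).
  have m2 := filt_measurableT hP hB tT' (qvar_adapted tT pL').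
  exact: (measurable_exp_half m1 m2).
have mS (t : R) : 0 <= t <= T -> measurable_fun setT (fun w => Phi w * stoch_exp (Num.min t (tau w)) w).
  move=> tT; apply: measurable_funM.
    by apply: (filt_measurableT hP hB _ mPhi); case/andP: sT.
  have h := stopped_adapted T0 st stoch_exp_continuous stoch_exp_adapted tT.
  by apply: (filt_measurableT hP hB _ h); case/andP: tT.
have eq_ (t : R) : 0 <= t <= T ->
   (\int[P]_w (Phi w * expR (N (Num.min t (tau w)) w - 2^-1 * qvar (stop_mx tau L) t w))%:E =
    \int[P]_w (Phi w * stoch_exp (Num.min t (tau w)) w)%:E)%E.
  move=> tT; apply: ae_eq_integral_EFin; [exact: mE|exact: mS|].
  by apply: filterS LA => w [_ AE]; rewrite /stoch_exp AE qE.
transitivity (\int[P]_w (Phi w * stoch_exp (Num.min T (tau w)) w)%:E)%E.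
  have mT w : Num.min T (tau w) = tau w by apply: min_r; case/andP: (tauT w).
  by apply: eq_integral => w _; rewrite mT.
exact: (etrans (esym (eq_ T TT)) (etrans E (eq_ s sT))).
Qed.

(** Tonelli's theorem brings the expectation inside the time integral; at a fixed time [s] the
    weight [k s] is known, and the martingale property replaces the exponential at [tau] by its
    value at [min s tau]. *)
Lemma stopped_weight tau (c : R) (k : R -> Omega -> R) : 0 <= c -> stopping tau ->
  {ae P, forall w, A (tau w) w <= c} -> predictable k -> (forall s w, 0 <= k s w) ->
  (\int[P]_w \int[mu]_(s in `[0%R, T]) (stoch_exp (tau w) w * k s w)%:E =
   \int[P]_w \int[mu]_(s in `[0%R, T]) (stoch_exp (Num.min s (tau w)) w * k s w)%:E)%E.
Proof.
move=> c0 st Ac pk k0; have mk := predictable_measurable T0 hP hB pk.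
pose D : set (measurableTypeR R * Omega) := `[0, T]%classic `*` setT.
have mD : measurable D by apply: measurableX.
rewrite tonelli_time; last 2 first.
- apply: measurable_funM => //; apply: measurable_funTS.
  exact: (measurableT_comp (stoch_exp_stopped_measurable st) measurable_snd).
- by move=> s w; rewrite mulr_ge0// expR_ge0.
have pS : predictable (fun s w => stoch_exp (Num.min s (tau w)) w).
  apply: (continuous_adapted_predictable T0).
    move=> w; have tw := proj1 st w; apply: (ucont_continuous T0).
    apply: (@ucont_comp _ _ (fun t => stoch_exp t w) (fun s => Num.min s (tau w))).
    - by apply: (continuous_ucont T0); exact: stoch_exp_continuous.
    - move=> s /andP[s0 sT]; rewrite le_min s0 ge_min sT; by case/andP: tw => ->.
    - by move=> u v; rewrite (minC u) (minC v); exact: lipschitz_min.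
  by move=> t tT; exact: (stopped_adapted T0 st stoch_exp_continuous stoch_exp_adapted tT).
rewrite [RHS]tonelli_time; last 2 first.
- by apply: measurable_funM => //; exact: (predictable_measurable T0 hP hB pS).
- by move=> s w; rewrite mulr_ge0// expR_ge0.
apply: eq_integral => s /[!inE]/=; rewrite in_itv/= => sT.
under eq_integral do rewrite mulrC; under [RHS]eq_integral do rewrite mulrC.
exact: (stopped_martingale c0 st Ac sT (predictable_adapted sT pk)).
Qed.

End stopped_exponential.

(** [filt 0] is generated by null sets and by events of [B 0], which is 0 almost surely. *)
Lemma filt0_trivial E : filt 0 E -> P.-negligible E \/ P.-negligible (~` E).
Proof.
pose G := [set E : set Omega | P.-negligible E \/ P.-negligible (~` E)].
suff : filt 0 `<=` G by move=> h /h.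
apply: smallest_sub.
  split.
  - by left; exact: negligible_set0.
  - by move=> A0 [h|h]; rewrite /G/= setTD setCK; [right|left].
  - move=> F HF; rewrite /G/=; have [[k hk]|nk] := pselect (exists k, P.-negligible (~` F k)).
      by right; apply: negligibleS hk => w /= nF Fw; apply: nF; exists k.
    left; apply: negligible_bigcup => k; case: (HF k) => // h; exfalso; apply: nk; by exists k.
move=> E0 [[s [i [U [s0 mU ->]]]]|nE]; last by left.
have -> : s = 0 by apply/eqP; rewrite eq_le andbC.
have [_ B0 _ _] := hB.
have [U0|U0] := pselect (U 0); [right|left]; apply: negligibleS B0 => w /= h B0w.
  by apply: h; rewrite B0w mxE.
by apply: U0; move: h; rewrite B0w mxE.
Qed.

(** The constant is the infimum of the levels [r] with [X <= r] almost surely; every level event is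
    negligible or has negligible complement. *)
Lemma filt0_constant (X : Omega -> R) : filt_measurable 0 X ->
  exists c, {ae P, forall w, X w = c}.
Proof.
move=> mX; have sF := sigma_filt P B 0.
pose Gr (r : R) := [set w | X w <= r].
have FG r : filt 0 (Gr r) by apply: (gset_le sF) => //; exact: (gmeas_cst sF).
have notT : ~ P.-negligible (setT : set Omega).
  move=> [E [mE PE sE]]; have : E = setT by apply/seteqP; split.
  by move=> ET; move: PE; rewrite ET probability_setT => /eqP; rewrite eqe oner_eq0.
pose Q := [set r | P.-negligible (~` Gr r)].
have hQ r : ~ Q r -> P.-negligible (Gr r) by move=> nQ; case: (filt0_trivial (FG r)).
have mono r r' : r <= r' -> Q r -> Q r'.
  by move=> rr; apply: negligibleS => w /= h1 h2; apply: h1; exact: le_trans h2 rr.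
have Q0 : Q !=set0.
  apply: contrapT => nQ; apply: notT.
  have : P.-negligible (\bigcup_n Gr n%:R).
    by apply: negligible_bigcup => n; apply: hQ => h; apply: nQ; exists n%:R.
  apply: negligibleS => w _; exists (Num.bound (X w)) => //; rewrite /Gr/=.
  have [x0|x0] := leP 0 (X w); first exact/ltW/archi_boundP.
  by rewrite (le_trans (ltW x0)).
have lQ : has_lbound Q.
  apply: contrapT => nl; apply: notT.
  have Qn n : Q (- n%:R).
    apply: contrapT => nQ; apply: nl; exists (- n%:R) => r Qr; rewrite leNgt; apply/negP => rn.
    by apply: nQ; exact: mono (ltW rn) Qr.
  have : P.-negligible (\bigcup_n ~` Gr (- n%:R)).
    by apply: negligible_bigcup => n; exact: Qn.
  apply: negligibleS => w _; exists (Num.bound `|X w|) => //; rewrite /Gr/=; apply/negP.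
  rewrite -ltNge ltrNl; apply: le_lt_trans (archi_boundP (normr_ge0 (X w))).
  by rewrite -normrN; exact: ler_norm.
exists (inf Q).
have H1 n : P.-negligible (~` Gr (inf Q + n.+1%:R^-1)).
  have n0 : 0 < n.+1%:R^-1 :> R by rewrite invr_gt0.
  have [r Qr rl] := inf_adherent n0 (conj Q0 lQ).
  exact: mono (ltW rl) Qr.
have H2 n : P.-negligible (Gr (inf Q - n.+1%:R^-1)).
  apply: hQ => /(ge_inf lQ); rewrite lerBrDl gerDr leNgt invr_gt0 ltr0n.
  by move/negP; apply.
have := negligible_bigcup (fun n => negligibleU (H1 n) (H2 n)).
apply: negligibleS => w /= Xw; apply: contrapT => nU; apply: Xw.
have h n : inf Q - n.+1%:R^-1 < X w <= inf Q + n.+1%:R^-1.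
  apply/andP; split.
    by rewrite ltNge; apply/negP => h; apply: nU; exists n => //; right.
  by apply: contrapT => h; apply: nU; exists n => //; left.
have sm (e : R) : 0 < e -> exists n : nat, n.+1%:R^-1 < e.
  by move=> e0; have [n _ hn] := near_infty_natSinv_lt (PosNum e0); exists n; apply: hn => /=.
apply/eqP; rewrite eq_le; apply/andP; split; apply/ler_addgt0Pr => e /sm[n ne].
  by case/andP: (h n) => _ h2; apply: (le_trans h2); rewrite lerD2l ltW.
by case/andP: (h n) => h1 _; rewrite -lerBlDr; apply: ltW; apply: le_lt_trans h1; rewrite lerB// ltW.
Qed.

End processes.

(** * Measurable selection of the projection *)

Section convex.
Context (R : realType) (n : nat).
Implicit Types (C K : set 'cV[R]_n) (u v p q : 'cV[R]_n).

Lemma convex_comb C p q (l : R) : @convex_set R 'cV[R]_n C -> 0 <= l <= 1 -> C p -> C q ->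
  C (l *: p + (1 - l) *: q).
Proof.
move=> cC /andP[l0 l1] Cp Cq.
have := cC p q (Itv01 l0 l1); rewrite !inE => /(_ Cp Cq).
by rewrite /conv.
Qed.

Lemma closed_entrywise C p (c_ : nat -> 'cV[R]_n) : closed C -> (forall k, C (c_ k)) ->
  (forall i, c_ k i 0 @[k --> \oo] --> p i 0) -> C p.
Proof.
move=> clC Cc cp; apply: clC => A /nbhs_ballP[e /= e0 eA].
have : \forall k \near \oo, forall i, `|p i 0 - c_ k i 0| < e.
  by apply: filter_forall => i; have /cvgrPdist_lt/(_ e e0) := cp i.
move=> [N _ HN]; exists (c_ N); split; first exact: Cc.
apply: eA; split=> // i j; rewrite (ord1 j) /ball/=; exact: (HN N (leqnn N)).
Qed.

(** Two near-minimisers of the distance to [v] are close, because their midpoint cannot be much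
    better. It gives both the uniqueness of the projection and the Cauchy property of minimising
    sequences. *)
Lemma parallelogram v p q : sqnorm (p - q) =
  2 * sqnorm (p - v) + 2 * sqnorm (q - v) - 4 * sqnorm (2^-1 *: p + (1 - 2^-1) *: q - v).
Proof.
have -> : 2^-1 *: p + (1 - 2^-1) *: q - v = 2^-1 *: ((p - v) + (q - v)).
  have -> : 1 - 2^-1 = 2^-1 :> R by lra.
  by apply/matrixP => i j; rewrite !mxE; field.
have -> : p - q = (p - v) - (q - v) by apply/matrixP => i j; rewrite !mxE; ring.
rewrite sqnormZ (sqnormB (p - v)) (sqnormD (p - v)); by field.
Qed.

Lemma Proj_unique K v q : @convex_set R 'cV[R]_n K -> K q ->
  (forall r, K r -> sqnorm (v - q) <= sqnorm (v - r)) -> Proj K v = q.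
Proof.
move=> cK Kq mq; rewrite /Proj.
have [Kq' mq'] := @xgetPex _ 0 [set q | K q /\ forall r, K r -> sqnorm (v - q) <= sqnorm (v - r)]
  (ex_intro _ q (conj Kq mq)).
move: Kq' mq'; set q' := xget _ _ => Kq' mq'.
have h01 : 0 <= (2^-1 : R) <= 1 by lra.
have Km := convex_comb cK h01 Kq' Kq.
apply/eqP; rewrite -subr_eq0 -sqnorm_eq0 eq_le sqnorm_ge0 andbT.
rewrite (parallelogram v).
have sC a b : sqnorm (a - b : 'cV[R]_n) = sqnorm (b - a) by rewrite -sqnormN opprB.
rewrite !(sC _ v); have := mq _ Km; have := mq' _ Km; lra.
Qed.

Lemma variational C v q : @convex_set R 'cV[R]_n C -> C 0 -> C q ->
  (forall r, C r -> sqnorm (q - v) <= sqnorm (r - v)) -> 0 <= dotv q (v - q).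
Proof.
move=> cC C0 Cq mq.
suff H (e : R) : 0 < e -> - dotv q (v - q) <= e.
  by rewrite -oppr_le0; apply/ler_addgt0Pr => e /H; rewrite add0r.
move=> e0; have s0 := sqnorm_ge0 q.
(* Moving from [q] towards 0 by the fraction [l] stays in [C]; after division by [l] the comparison
   of distances has an error of at most [l * sqnorm q]. *)
set l := Num.min 1 (e / (1 + sqnorm q)).
have k0 : 0 < 1 + sqnorm q by lra.
have l0 : 0 < l by rewrite lt_min ltr01 divr_gt0.
have l1 : 0 <= l <= 1 by rewrite ltW//= ge_min lexx.
have ls : l * sqnorm q <= e.
  have : l * (1 + sqnorm q) <= e by rewrite -ler_pdivlMr// ge_min lexx orbT.
  lra.
have := mq _ (convex_comb cC l1 C0 Cq).
have -> : l *: 0 + (1 - l) *: q - v = (q - v) - l *: q.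
  by rewrite scaler0 add0r scalerBl scale1r addrAC.
rewrite [X in _ <= X]sqnormB dotvZr sqnormZ dotvBl dotvBr dotvv (dotvC v q).
move=> H.
have : l * (- 2 * (dotv q v - sqnorm q)) <= l * (l * sqnorm q).
  rewrite expr2 -mulrA in H; lra.
rewrite ler_pM2l// => H'; lra.
Qed.

End convex.

Section minimise.
Context (R : realType) (d m : nat).
Variables (C : set 'cV[R]_d).
Hypotheses (clC : closed C) (cC : @convex_set R 'cV[R]_d C) (C0 : C 0).

(** The sequence is indexed by rational vectors and accuracies: a point of [C] within the accuracy
    of the vector is taken whenever there is one, and some point of [C] otherwise. *)
Lemma countable_dense : exists c_ : nat -> 'cV[R]_d, (forall j, C (c_ j)) /\
  forall p, C p -> exists k_ : nat -> nat, forall i, c_ (k_ j) i 0 @[j --> \oo] --> p i 0.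
Proof.
pose good (k : 'cV[rat]_d * nat) (c : 'cV[R]_d) :=
  C c /\ forall i, `|c i 0 - ratr (k.1 i 0)| < k.2.+1%:R^-1.
have /choice[f fP] (k : 'cV[rat]_d * nat) : exists c, C c /\ ((exists c', good k c') -> good k c).
  have [[c' [Cc' g']]|N] := pselect (exists c', good k c'); first by exists c'.
  by exists 0.
exists (fun j => f (odflt (0, 0%N) (unpickle j))); split; first by move=> j; have [] := fP (odflt (0, 0%N) (unpickle j)).
move=> p Cp.
have /choice[v vP] (j : nat) : exists v : 'cV[rat]_d, forall i, `|p i 0 - ratr (v i 0)| < j.+1%:R^-1.
  have q0 : 0 < j.+1%:R^-1 :> R by rewrite invr_gt0 ltr0n.
  move: q0; set q := _^-1 => q0.
  have /choice[r rP] (i : 'I_d) : exists r : rat, `|p i 0 - ratr r| < q.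
    have [|r] := @rat_in_itvoo R (p i 0 - q) (p i 0 + q); first by lra.
    rewrite in_itv/= => /andP[r1 r2]; exists r; rewrite ltr_norml; apply/andP; split; lra.
  by exists (\col_i r i) => i; rewrite mxE.
exists (fun j => pickle (v j, j)) => i; apply/cvgrPdist_lt => e e0.
have [_ [N _ HN]] : True /\ \forall j \near \oo, j.+1%:R^-1 < e / 2 :> R.
  split=> //; apply: (near_infty_natSinv_lt (PosNum _)); by rewrite divr_gt0.
exists N => // j /= Nj; rewrite pickleK/=.
have [_ g] := fP (v j, j).
have [_ /(_ i)/= g1] : good (v j, j) (f (v j, j)) by apply: g; exists p; split=> //; exact: vP j.
have := vP j i; have := HN j Nj => /=; move: g1; set q := _^-1.
rewrite !ltr_norml => /andP[a1 a2] qe /andP[a3 a4]; apply/andP; split; lra.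
Qed.

Variables (S : 'M[R]_(d, m)) (a : R) (y : 'cV[R]_m).
Hypotheses (a0 : a != 0) (uS : S *m S^T \in unitmx).
Definition fit (p : 'cV[R]_d) : R := sqnorm (a *: (S^T *m p) - y).

Lemma fit_cvg (p_ : nat -> 'cV[R]_d) (p : 'cV[R]_d) : (forall i, p_ k i 0 @[k --> \oo] --> p i 0) ->
  fit (p_ k) @[k --> \oo] --> fit p.
Proof.
move=> cp; apply: cvg_big; first exact: add_continuous.
move=> i _; rewrite !mxE.
rewrite (_ : (fun k => _) = fun k => (a * (\sum_j S^T i j * p_ k j 0) - y i 0) ^+ 2); last first.
  by apply/funext => k; rewrite !mxE.
have H : (a * (\sum_j S^T i j * p_ k j 0) - y i 0) @[k --> \oo] --> a * (\sum_j S^T i j * p j 0) - y i 0.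
  apply: cvgB; last exact: cvg_cst.
  apply: cvgM; first exact: cvg_cst.
  apply: cvg_big; first exact: add_continuous.
  by move=> j _; apply: cvgM; [exact: cvg_cst|exact: cp].
rewrite expr2; exact: (cvgM H H).
Qed.

(** The parallelogram identity makes the images under [a S^T] a Cauchy sequence. Since [S S^T] is
    invertible, each point is a fixed linear function of its image, so the points converge as
    well. *)
Lemma min_sequence (c_ p_ : nat -> 'cV[R]_d) : (forall j, C (p_ j)) ->
  (forall q, C q -> exists k_ : nat -> nat, forall i, c_ (k_ j) i 0 @[j --> \oo] --> q i 0) ->
  (forall j, fit (p_ j.+1) <= fit (p_ j)) -> (forall j, fit (p_ j) <= fit (c_ j)) ->
  exists p, [/\ C p, forall i, p_ k i 0 @[k --> \oo] --> p i 0 & forall q, C q -> fit p <= fit q].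
Proof.
move=> Cp dc pd pc.
have pn : nonincreasing_seq (fit \o p_) by apply/nonincreasing_seqP => k; exact: pd.
have pcv : cvgn (fit \o p_).
  apply: nonincreasing_is_cvgn => //; exists 0 => _ [k _ <-]; exact: sqnorm_ge0.
set l := limn (fit \o p_).
have lp k : l <= fit (p_ k) by exact: (nonincreasing_cvgn_ge pn pcv).
have lq q : C q -> l <= fit q.
  move=> /dc[k_ kq]; have cq := fit_cvg kq.
  rewrite -(cvg_lim _ cq)//; apply: limr_ge; first by apply/cvg_ex; exists (fit q).
  by apply: nearW => j; apply: le_trans (lp (k_ j)) (pc _).
have h01 : 0 <= (2^-1 : R) <= 1 by lra.
have par j k : sqnorm (a *: (S^T *m p_ j) - a *: (S^T *m p_ k)) <= 2 * fit (p_ j) + 2 * fit (p_ k) - 4 * l.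
  rewrite (parallelogram y).
  have := lq _ (convex_comb cC h01 (Cp j) (Cp k)).
  have -> : fit (2^-1 *: p_ j + (1 - 2^-1) *: p_ k) =
    sqnorm (2^-1 *: (a *: (S^T *m p_ j)) + (1 - 2^-1) *: (a *: (S^T *m p_ k)) - y).
    by rewrite /fit mulmxDr -!scalemxAr scalerDr !scalerA ![a * _]mulrC.
  by rewrite /fit; lra.
pose r k i := (a *: (S^T *m p_ k)) i 0.
have rC i : cvgn (fun k => r k i).
  apply/cauchy_cvgP/cauchyP => e e0.
  have e2 : 0 < e ^+ 2 / 4 by rewrite divr_gt0// exprn_gt0.
  have /cvgrPdist_lt/(_ _ e2)[N _ HN] := pcv; rewrite -/l in HN.
  exists (r N i); exists N => // k /= Nk; rewrite /ball/=.
  have h1 := HN N (leqnn N); have h2 := HN k Nk; rewrite /= in h1 h2.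
  have h3 : fit (p_ N) - l < e ^+ 2 / 4 by apply: le_lt_trans h1; rewrite distrC ler_norm.
  have h4 : fit (p_ k) - l < e ^+ 2 / 4 by apply: le_lt_trans h2; rewrite distrC ler_norm.
  have h5 : (r N i - r k i) ^+ 2 < e ^+ 2.
    apply: (@le_lt_trans _ _ (sqnorm (a *: (S^T *m p_ N) - a *: (S^T *m p_ k)))).
      rewrite /sqnorm (bigD1 i)//= !mxE -[leLHS]addr0 lerD//; last by apply: sumr_ge0 => *; exact: sqr_ge0.
      by rewrite /r !mxE.
    have := par N k; lra.
  by rewrite -(@ltr_pXn2r _ 2)// ?nnegrE// ?ltW// real_normK ?num_real.
pose Q := \col_i limn (fun k => r k i).
have aU : S *m S^T \in unitmx := uS.
have pE k : p_ k = a^-1 *: (invmx (S *m S^T) *m S *m (\col_i r k i)).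
  have -> : \col_i r k i = a *: (S^T *m p_ k) by apply/matrixP => i j; rewrite !mxE /r (ord1 j) !mxE.
  by rewrite -scalemxAr scalerA mulVf// scale1r mulmxA -(mulmxA (invmx _)) mulVmx// mul1mx.
pose p := a^-1 *: (invmx (S *m S^T) *m S *m Q).
have pl i : p_ k i 0 @[k --> \oo] --> p i 0.
  rewrite (_ : (fun k => p_ k i 0) = fun k => a^-1 * (\sum_j (invmx (S *m S^T) *m S) i j * r k j)); last first.
    by apply/funext => k; rewrite pE !mxE; congr (_ * _); apply: eq_bigr => j _; rewrite !mxE.
  have -> : p i 0 = a^-1 * (\sum_j (invmx (S *m S^T) *m S) i j * limn (fun k => r k j)).
    by rewrite !mxE; congr (_ * _); apply: eq_bigr => j _; rewrite !mxE.
  apply: cvgM; first exact: cvg_cst.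
  apply: cvg_big; first exact: add_continuous.
  by move=> j _; apply: cvgM; [exact: cvg_cst|exact: rC].
exists p; split=> //; first exact: closed_entrywise pl.
move=> q Cq; apply: le_trans (lq _ Cq).
by rewrite -(cvg_lim _ (fit_cvg pl)).
Qed.

(* Greedy improvement along a dense sequence stays measurable in the data, and by
   the parallelogram identity it converges to the minimiser. *)
Fixpoint improve (c_ : nat -> 'cV[R]_d) (k : nat) : 'cV[R]_d := match k with
  | 0 => c_ 0%N
  | k.+1 => if fit (c_ k.+1) < fit (improve c_ k) then c_ k.+1 else improve c_ k
  end.

Lemma improveP (c_ : nat -> 'cV[R]_d) : (forall j, C (c_ j)) ->
  [/\ forall j, C (improve c_ j), forall j, fit (improve c_ j.+1) <= fit (improve c_ j) &
      forall j, fit (improve c_ j) <= fit (c_ j)].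
Proof.
move=> Cc; split; first by elim=> //= j IH; case: ifP.
  by move=> j /=; case: ltP => // /ltW.
by case=> //= j; case: ltP.
Qed.

End minimise.

(** * The discount function h *)

Section discount.
Context (R : realType) (T beta : R) (T0 : 0 < T) (beta0 : 0 < beta).
Local Notation hh := (h T beta).

Lemma h_den (t : R) : 0 <= t <= T -> 1 <= 1 + beta * (T - t).
Proof. by move=> /andP[_ tT]; rewrite lerDl; apply: mulr_ge0; [exact: ltW|rewrite subr_ge0]. Qed.

Lemma h_bounds (t : R) : 0 <= t <= T -> 0 < hh t <= 1.
Proof.
move=> /h_den d1; have d0 := lt_le_trans ltr01 d1.
by rewrite /h invr_gt0 d0/= invf_le1.
Qed.

Lemma h_neq0 (t : R) : 0 <= t <= T -> hh t != 0.
Proof. by move=> /h_bounds/andP[h0 _]; exact: lt0r_neq0. Qed.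

Lemma h_den_neq0 (t : R) : 0 <= t <= T -> 1 + beta * (T - t) != 0.
Proof. by move=> /h_den d1; exact: lt0r_neq0 (lt_le_trans ltr01 d1). Qed.

Lemma h_increment (u v : R) : 0 <= u <= T -> 0 <= v <= T ->
  hh v - hh u = beta * (hh u * hh v) * (v - u).
Proof.
move=> uT vT; rewrite /h; have := h_den_neq0 uT; have := h_den_neq0 vT.
by move=> a1 a2; field; apply/andP; split.
Qed.

Lemma h_final : hh T = 1.
Proof. by rewrite /h subrr mulr0 addr0 invr1. Qed.

Lemma h_ucont : ucont T hh.
Proof.
move=> e e0; have k0 : 0 < e / beta by rewrite divr_gt0.
have [N HN] := mesh_small T0 k0; exists N => s t sT tT st; rewrite distrC h_increment//.
have /andP[hs0 hs1] := h_bounds sT; have /andP[ht0 ht1] := h_bounds tT.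
have hs : 0 <= hh s * hh t by apply: mulr_ge0; exact: ltW.
have hst : hh s * hh t <= 1 by rewrite -[1]mulr1; apply: ler_pM => //; exact: ltW.
rewrite normrM ger0_norm; last by apply: mulr_ge0 => //; exact: ltW.
apply: (@le_trans _ _ (beta * `|t - s|)).
  by apply: ler_wpM2r => //; rewrite ger_pMr.
by rewrite -ler_pdivlMl// mulrC distrC; apply: le_trans st (ltW HN).
Qed.

End discount.

Section predictable_selection.
Context (R : realType) (disp : measure_display) (Omega : measurableType disp).
Context (P : probability Omega R) (T : R) (m : nat).
Variable B : R -> Omega -> 'cV[R]_m.
Local Notation predictable := (predictable P T B).
Local Notation sP := (sigma_pred P T B).

Lemma predictable_time (f : R -> R) : 0 < T -> measure_is_complete P -> brownian_motion P T B ->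
  ucont T f -> predictable (fun t _ => f t).
Proof.
move=> T0 hP hB uf; apply: (continuous_adapted_predictable T0) => //.
  by move=> _; exact: ucont_continuous.
by move=> t tT; exact: (gmeas_cst (sigma_filt P B t)).
Qed.

(** Each improvement step compares two predictable quantities, so all iterates are predictable, and
    so is their limit, which is the minimiser. *)
Theorem selection d (C : set 'cV[R]_d) (S : R -> Omega -> 'M[R]_(d, m)) (a : R -> R)
    (y : R -> Omega -> 'cV[R]_m) :
  closed C -> @convex_set R 'cV[R]_d C -> C 0 ->
  predictable_mx P T B S -> predictable (fun t _ => a t) -> predictable_mx P T B y ->
  (forall t, 0 <= t <= T -> a t != 0) ->
  (forall t w, 0 <= t <= T -> S t w *m (S t w)^T \in unitmx) ->
  exists p : R -> Omega -> 'cV[R]_d, predictable_mx P T B p /\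
    forall t w, 0 <= t <= T -> C (p t w) /\
      forall q, C q -> fit (S t w) (a t) (y t w) (p t w) <= fit (S t w) (a t) (y t w) q.
Proof.
move=> clC cC C0 pS pa py a0 uS.
have [c_ [Cc dc]] := countable_dense C0.
pose imp n t w := improve (S t w) (a t) (y t w) c_ n.
have pfit (p : R -> Omega -> 'cV[R]_d) : predictable_mx P T B p ->
    predictable (fun t w => fit (S t w) (a t) (y t w) (p t w)).
  move=> pp; apply: predictable_sqnorm; apply: predictable_mxB => //.
  apply: predictable_mxZ => //; apply: predictable_mulmx => //; exact: predictable_trmx.
have pimp n : predictable_mx P T B (imp n).
  elim: n => [|n IH] i j; first exact: predictable_mx_cst.
  have pc : predictable_mx P T B (fun _ _ => c_ n.+1) by exact: predictable_mx_cst.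
  have G := gset_lt sP (predictable_gmeas (pfit _ pc)) (predictable_gmeas (pfit _ IH)).
  apply: gmeas_predictable.
  have H0 := gmeas_if sP G (predictable_gmeas (pc i j)) (predictable_gmeas (IH i j)).
  apply: (eq_ind _ (gmeas (pred_alg P T B)) H0); apply/funext => z; rewrite /imp /=.
  case: ifPn => [/set_mem/= ->//|/negP H].
  by case: ifPn => // H'; exfalso; apply: H; exact/mem_set.
have [p pP] : exists p : R -> Omega -> 'cV[R]_d, forall t w, 0 <= t <= T -> [/\ C (p t w),
    forall i, imp n t w i 0 @[n --> \oo] --> p t w i 0 &
    forall q, C q -> fit (S t w) (a t) (y t w) (p t w) <= fit (S t w) (a t) (y t w) q].
  have /choice[f fP] (z : R * Omega) : exists p : 'cV[R]_d, 0 <= z.1 <= T -> [/\ C p,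
    forall i, imp n z.1 z.2 i 0 @[n --> \oo] --> p i 0 &
    forall q, C q -> fit (S z.1 z.2) (a z.1) (y z.1 z.2) p <= fit (S z.1 z.2) (a z.1) (y z.1 z.2) q].
    have [zT|zT] := boolP (0 <= z.1 <= T); last by exists 0.
    have [h1 h2 h3] := improveP (S z.1 z.2) (a z.1) (y z.1 z.2) Cc.
    by have [p pP] := min_sequence clC cC (a0 _ zT) (uS _ z.2 zT) h1 dc h2 h3; exists p.
  by exists (fun t w => f (t, w)) => t w tT; exact: (fP (t, w)).
exists p; split; last by move=> t w /(pP t w)[].
move=> i j; rewrite (ord1 j).
(* Convergence is only known for times in [[0, T]]; setting iterates and limit to 0 elsewhere makes
   it hold everywhere. *)
apply: (@predictable_eq _ _ _ _ _ _ _ (fun t w => if 0 <= t <= T then p t w i 0 else 0)); last first.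
  by move=> t w ->.
apply: gmeas_predictable.
apply: (gmeas_cvg sP (X_ := fun n z => if 0 <= z.1 <= T then imp n z.1 z.2 i 0 else 0)).
  move=> n; apply: (predictable_gmeas (X := fun t w => if 0 <= t <= T then imp n t w i 0 else 0)).
  by apply: predictable_eq (pimp n i 0) _ => t w ->.
move=> z; case: ifP => zT; last exact: cvg_cst.
by have [_ H _] := pP z.1 z.2 zT; exact: H.
Qed.

End predictable_selection.

(** * Identities and inequalities of the verification argument *)

Lemma increment_split (R : realType) (a b x u v : R) :
  v = (a - b) * u + b * u + x * (a - b) -> a * (x + u) = b * x + v.
Proof. by move=> ->; ring. Qed.

Lemma identity_split (R : realType) (a b ht h0 x i A y0 j G t2 tf : R) :
  ht * (x + A) = h0 * x + G -> - a * (ht * (x + i + A) - (y0 - tf + j)) =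
  - a * (h0 * x - y0) + - a * (ht * i - b * t2 - j) - a * (G + b * t2 + tf).
Proof.
move=> E; rewrite (_ : G = ht * (x + A) - h0 * x); first by ring.
by rewrite E addrAC subrr add0r.
Qed.

(** Completing the square: the terms of the generator quadratic in the strategy and the drift of the
    wealth combine into half the squared integrand of the exponential. *)
Lemma generator_square (R : realType) (m : nat) (alpha a : R) (k z th : 'cV[R]_m) : alpha != 0 ->
  alpha * (a * dotv k th + alpha / 2 * sqnorm (a *: k - (z + alpha^-1 *: th))
    - dotv z th - (2 * alpha)^-1 * sqnorm th) = 2^-1 * sqnorm (- alpha *: (a *: k - z)).
Proof.
move=> a0; rewrite opprD addrA (sqnormB (a *: k - z)) !sqnormZ dotvZr dotvBl dotvZl sqrrN.
move: (sqnorm _) (sqnorm th) (dotv k th) (dotv z th) => u v r s; field.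
by rewrite a0.
Qed.

(** The tangent inequality [1 + u <= exp u] at [u = D - c - ln (b / lambda)]. Equality at [u = 0] is
    what singles out the optimal consumption. *)
Lemma cap_le_exp (R : realType) (lambda b D c : R) : 0 < lambda -> 0 < b ->
  b * (D - c - ln (b / lambda) + 1) <= lambda * expR (- c) * expR D.
Proof.
move=> l0 b0; have bl : 0 < b / lambda by exact: divr_gt0.
have -> : lambda * expR (- c) * expR D = b * expR (D - c - ln (b / lambda)).
  rewrite expRB lnK// expRD; field.
  by rewrite (lt0r_neq0 b0) (lt0r_neq0 l0).
apply: ler_wpM2l; first exact: ltW.
by have := expR_ge1Dx (D - c - ln (b / lambda)); rewrite addrC.
Qed.

Lemma cap_split (R : realType) (alpha b ht X kt c f Y G l L2 : R) :
  alpha * (ht * kt + G) = 2^-1 * L2 -> alpha != 0 ->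
  f <= G - b * ht * Y - b * ht / alpha * (l - 1) -> 0 < alpha ->
  alpha * (b * ht ^+ 2 * X + ht * kt - b * ht * c + f) - 2^-1 * L2 <=
    b * ht * (alpha * (ht * X - Y) - alpha * c - l + 1).
Proof.
move=> <- a0 fG ap; rewrite -subr_ge0; rewrite -subr_ge0 in fG.
have := mulr_ge0 (ltW ap) fG; move=> fG'.
suff -> : b * ht * (alpha * (ht * X - Y) - alpha * c - l + 1) -
  (alpha * (b * ht ^+ 2 * X + ht * kt - b * ht * c + f) - alpha * (ht * kt + G)) =
  alpha * (G - b * ht * Y - b * ht / alpha * (l - 1) - f) by [].
by field.
Qed.

(** Replacing [f] by [min f k] changes it on a null set only and makes the inequality hold at every
    time. *)
Lemma ti_le_ae (R : realType) (T : R) (f k : R -> R) (t : R) : tint T f -> tint T k -> t <= T ->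
  {ae @lebesgue_measure R, forall s : R, 0 <= s <= T -> f s <= k s} -> 0 <= t -> ti f t <= ti k t.
Proof.
move=> tf tk tT fk t0; have T0 : 0 <= T by exact: le_trans tT.
have mf := tint_measurable tf; have mk := tint_measurable tk.
have mm : measurable_fun (`[0, T]%classic : set (measurableTypeR R)) (fun s => Num.min (f s) (k s)).
  exact: measurable_minr.
have tm : tint T (fun s => Num.min (f s) (k s)).
  apply: (tint_le mm (tintD (tint_abs tf) (tint_abs tk))) => s sT.
  by case: (leP (f s) (k s)) => _; [rewrite lerDl|rewrite lerDr].
have -> : ti f t = ti (fun s => Num.min (f s) (k s)) t.
  apply: EFin_inj; rewrite -(ti_EFin tf tT) -(ti_EFin tm tT).
  have sub : `[0, t]%classic `<=` (`[0, T]%classic : set (measurableTypeR R)).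
    by move=> s /=; rewrite !in_itv/= => /andP[-> st]; exact: le_trans st tT.
  apply: ae_eq_integral => //.
  - apply/measurable_EFinP; exact: measurable_funS mf.
  - apply/measurable_EFinP; exact: measurable_funS mm.
  case: fk => A [mA A0 HA]; exists A; split=> // s /= nE; apply: HA => /= fk; apply: nE.
  by rewrite in_itv/= => /andP[s0 st]; rewrite min_l//; apply: fk; rewrite s0 (le_trans st).
have := ti_inc_le tm tk (lexx 0) t0 tT _; rewrite !ti0 !subr0; apply.
by move=> s _; rewrite ge_min lexx orbT.
Qed.

Lemma integral_prob_cst (R : realType) (disp : measure_display) (Om : measurableType disp)
    (P : probability Om R) (k : R) : (\int[P]_w k%:E = k%:E)%E.
Proof. by have /= -> := integral_cst P measurableT k%:E; rewrite probability_setT mule1. Qed.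

Lemma exponent_split (R : realType) (u n d q : R) : u + n - d = u + (n - q) - (d - q).
Proof. by ring. Qed.

Lemma ae_lty_of_integral (R : realType) (disp : measure_display) (Om : measurableType disp)
    (nu : {measure set Om -> \bar R}) (g : Om -> \bar R) : measurable_fun setT g ->
  (forall w, (0 <= g w)%E) -> (\int[nu]_w g w < +oo)%E -> {ae nu, forall w, (g w < +oo)%E}.
Proof.
move=> mg g0 ig; have ig' : nu.-integrable setT g.
  by apply/integrableP; split => //; under eq_integral do rewrite gee0_abs//.
apply: filterS (integrable_ae measurableT ig') => w /(_ I).
by rewrite ge0_fin_numE.
Qed.

Lemma ucont_expR (R : realType) (T : R) (f : R -> R) : 0 < T -> ucont T f -> ucont T (fun t => expR (f t)).
Proof.
move=> T0 uf; apply: (continuous_ucont T0) => t; apply: continuous_comp; last exact: continuous_expR.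
exact: (ucont_continuous T0 uf).
Qed.

(** In the application [expR (- D)] is the surplus, [Mi] the inverse of the exponential martingale
    and [V] the discount by the rate, so that the equation is the factorisation of the surplus. *)
Lemma weight_le (R : realType) (S0 V Mi r l e D : R) : 0 <= S0 -> 0 <= V ->
  S0 * V = expR (- D) * Mi -> r <= l * e * expR D -> S0 * (V * r) <= l * e * Mi.
Proof.
move=> S0p Vp E rl; rewrite mulrA.
apply: le_trans (ler_wpM2l (mulr_ge0 S0p Vp) rl) _; rewrite E.
have e1 : expR (- D) * expR D = 1 by rewrite -expRD addNr expR0.
have -> : expR (- D) * Mi * (l * e * expR D) = (expR (- D) * expR D) * (l * e * Mi) by ring.
by rewrite e1 mul1r.
Qed.

Lemma weight_final (R : realType) (S0 M q k : R) : 0 < M -> S0 * q <= k ->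
  S0 * M <= S0 * M * (1 - q) + M * k.
Proof.
move=> M0 H; have := ler_wpM2l (ltW M0) H.
rewrite -subr_ge0 => H'; rewrite -subr_ge0; suff -> : S0 * M * (1 - q) + M * k - S0 * M = M * k - M * (S0 * q) by [].
by ring.
Qed.

(** * Verification *)

Section stopped_exponential_mean.
Context (R : realType) (disp : measure_display) (Omega : measurableType disp).
Context (P : probability Omega R) (T : R) (m : nat).
Variable B : R -> Omega -> 'cV[R]_m.
Hypotheses (T0 : 0 < T) (hP : measure_is_complete P).
Hypothesis hB : brownian_motion P T B.
Local Notation predictable_mx := (predictable_mx P T B).
Local Notation filt_measurable := (filt_measurable P B).
Local Notation approx := (approx P T B).
Local Notation stopping := (stopping_time P T B).
Implicit Types (H L : R -> Omega -> 'cV[R]_m) (I N : R -> Omega -> R).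

Lemma stopping_min tau rho : stopping tau -> stopping rho ->
  stopping (fun w => Num.min (tau w) (rho w)).
Proof.
move=> [tT tF] [rT rF]; split => [w|t tt].
  by rewrite /Num.min; case: ifP.
have H := gsetU (sigma_filt P B t) (tF t tt) (rF t tt).
apply: (eq_ind _ (filt P B t) H); apply/seteqP; split => w /=.
  by rewrite ge_min => -[->|->]; rewrite ?orbT.
by rewrite ge_min => /orP[]; [left|right].
Qed.

Lemma stopping_cst (t : R) : 0 <= t <= T -> stopping (fun=> t).
Proof.
move=> tT; split => // s _; have sF := sigma_filt P B s.
case: (boolP (t <= s)) => ts.
  by apply: (eq_ind setT (filt P B s) (gsetT sF)); apply/seteqP; split.
apply: (eq_ind set0 (filt P B s) (gset0 sF)); apply/seteqP; split => // w /=; rewrite (negbTE ts).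
Qed.

Lemma approx_initial H I : approx H I ->
  {ae P, forall w, I 0 w = 0}.
Proof.
move=> aH.
have e0 k : 0 < (2^-1) ^+ k.+1 :> R by rewrite exprn_gt0// invr_gt0.
have /choice[E HE] (k : nat) : exists E : set Omega, [/\ measurable E,
    (P E <= ((2^-1) ^+ k.+1)%:E)%E & forall w, ~ E w -> `|0 - I 0 w| <= (2^-1) ^+ k.+1].
  have [n [xi [_ [E [mE PE HE]]]]] := aH _ (e0 k); exists E; split=> // w nE.
  have z0 : 0 <= (0 : R) <= T by rewrite lexx ltW.
  by have := (HE w nE).2 0 z0; rewrite dint0.
have := @ae_cvg_of_small_sets _ _ _ P (fun=> fun=> 0) (I 0) E (fun k => let: And3 a _ _ := HE k in a)
  (fun k => let: And3 _ a _ := HE k in a) (fun k => let: And3 _ _ a := HE k in a).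
by apply: filterS => w /cvg_lim => /(_ (@Rhausdorff R)) <-; rewrite lim_cst.
Qed.

(** Stopped martingale identity between [tau] and time 0, where the exponential equals 1 almost
    surely. *)
Lemma stoch_exp_one L N A tau (c : R) : predictable_mx L -> approx L N ->
  (forall w, {within `[0, T], continuous (fun t : R => N t w)}) ->
  (forall t : R, 0 <= t <= T -> filt_measurable t (N t)) ->
  (forall w, ucont T (A ^~ w)) -> (forall t : R, 0 <= t <= T -> filt_measurable t (A t)) ->
  {ae P, forall w, tint T (fun s => sqnorm (L s w)) /\ forall t, A t w = qvar L t w} ->
  0 <= c -> stopping tau -> {ae P, forall w, A (tau w) w <= c} ->
  (\int[P]_w (stoch_exp N A (tau w) w)%:E = 1)%E.
Proof.
move=> pL aL cN aN uA aA LA c0 st Ac.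
have zT : 0 <= (0 : R) <= T by rewrite lexx ltW.
have := stopped_martingale T0 hP hB pL aL cN aN uA aA LA c0 st Ac zT
  (gmeas_cst (sigma_filt P B 0) 1) (fun _ => ler01).
under eq_integral do rewrite mul1r.
move=> ->; rewrite (_ : (fun w => _) = fun w => (stoch_exp N A 0 w)%:E); last first.
  by apply/funext => w; rewrite mul1r min_l//; have [/(_ w)/andP[]] := st.
rewrite -[RHS](integral_prob_cst P 1).
apply: ae_eq_integral_EFin => //.
  have h := stoch_exp_adapted aN aA zT.
  exact: (filt_measurableT hP hB (ltW T0) h).
apply: filterS (filterI (approx_initial aL) LA) => w [N0 [_ AE]] /=.
by rewrite /stoch_exp N0 AE /qvar ti0 mulr0 subrr expR0.
Qed.

(** Fatou's lemma through truncation: each truncated expectation converges and its approximants stay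
    below [c]. *)
Lemma fatou_le (f_ : nat -> Omega -> R) (f : Omega -> R) (c : \bar R) :
  (forall n, measurable_fun setT (f_ n)) -> measurable_fun setT f ->
  (forall n w, 0 <= f_ n w) -> (forall w, 0 <= f w) ->
  {ae P, forall w, f_ n w @[n --> \oo] --> f w} ->
  (forall n, \int[P]_w (f_ n w)%:E <= c)%E -> (\int[P]_w (f w)%:E <= c)%E.
Proof.
move=> mf_ mf f_0 f0 cf fc; apply: integral_minr_cvg => // K.
have cK := integral_minr_cvg_ae (K := K) mf_ mf f_0 cf.
rewrite -(cvg_lim _ cK)//; apply: lime_le; first by apply/cvg_ex; eexists; exact: cK.
apply: nearW => n; apply: le_trans (fc n); apply: le_integral_EFin => //.
- exact: measurable_minr.
- by move=> w; rewrite le_min f_0 ler0n.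
- by move=> w; rewrite ge_min lexx.
Qed.

End stopped_exponential_mean.

(** * Decomposition of the surplus and upper bound for an arbitrary strategy *)

Section identity.
Context (R : realType) (disp : measure_display) (Omega : measurableType disp).
Context (P : probability Omega R) (T : R) (m : nat).
Variable B : R -> Omega -> 'cV[R]_m.
Hypotheses (T0 : 0 < T) (hP : measure_is_complete P).
Hypothesis hB : brownian_motion P T B.
Local Notation mu := (@lebesgue_measure R).
Local Notation predictable := (predictable P T B).
Local Notation predictable_mx := (predictable_mx P T B).
Local Notation approx := (approx P T B).
Local Notation I0T := (`[0, T]%classic : set (measurableTypeR R)).
Implicit Types (H K L Z : R -> Omega -> 'cV[R]_m) (I N X : R -> Omega -> R).

Lemma tint_norm_lty X w : predictable X ->
  (\int[mu]_(s in `[0%R, T]) (`|X s w|)%:E < +oo)%E -> tint T (X ^~ w).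
Proof.
move=> pX h; apply/integrableP; split => //; apply/measurable_EFinP.
exact: (predictable_sec_measurable T0 hP hB).
Qed.

(** Hitting times and stopped exponentials ask for a bracket that is continuous, nondecreasing and
    adapted on every path, without exception. *)
Lemma clock H : predictable_mx H ->
  {ae P, forall w, (\int[mu]_(t in `[0%R, T]) (sqnorm (H t w))%:E < +oo)%E} ->
  exists A : R -> Omega -> R, [/\ forall w, ucont T (A ^~ w),
  forall t : R, 0 <= t <= T -> filt_measurable P B t (A t),
  forall w, A 0 w = 0 /\ (forall s t : R, 0 <= s -> s <= t -> t <= T -> A s w <= A t w) &
  {ae P, forall w, tint T (fun s => sqnorm (H s w)) /\ forall t, A t w = qvar H t w}].
Proof.
move=> pH iH; have [|A [uA aA mA eA]] := ti_version T0 hP hB (predictable_sqnorm pH).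
  by apply: filterS iH => w iw; have /integrableP[] := qvar_tint T0 hP hB pH iw.
exists A; split=> // w; case: (mA w) => [A0|[tL AE]]; first by split => [|s t *]; rewrite !A0.
split; first by rewrite AE ti0.
by move=> s t s0 st tT; rewrite !AE; apply: ti_homo tL _ s0 st tT => r _; exact: sqnorm_ge0.
Qed.

Variables (alpha beta x : R) (th Z K : R -> Omega -> 'cV[R]_m) (c f Y : R -> Omega -> R) (F : Omega -> R).
Hypotheses (beta0 : 0 < beta).
Hypotheses (pth : predictable_mx th) (bth : exists k, forall t w, 0 <= t <= T -> sqnorm (th t w) <= k).
Hypotheses (pZ : predictable_mx Z) (pK : predictable_mx K) (pc : predictable c) (pf : predictable f).
Hypothesis iZ : {ae P, forall w, (\int[mu]_(t in `[0%R, T]) (sqnorm (Z t w))%:E < +oo)%E}.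
Hypothesis iK : {ae P, forall w, (\int[mu]_(t in `[0%R, T]) (sqnorm (K t w))%:E < +oo)%E}.
Hypothesis ic : {ae P, forall w, (\int[mu]_(t in `[0%R, T]) (`|c t w|)%:E < +oo)%E}.
Hypothesis jf : {ae P, forall w, (\int[mu]_(t in `[0%R, T]) (`|f t w|)%:E < +oo)%E}.
Hypothesis Yeq : {ae P, forall w, forall t : R, 0 <= t <= T ->
   Y t w = F w + \int[mu]_(s in `[t, T]) f s w - (ito P T B Z T w - ito P T B Z t w)}.

Local Notation hh := (h T beta).
Local Notation I := (ito P T B K).
Local Notation J := (ito P T B Z).

(** The wealth in terms of the exposure [K = sigma^T pi], convertible with [wealth]; the market
    enters this section only through [K] and [th]. *)
Definition wlth (t : R) (w : Omega) : R :=
  x + I t w + ti (fun u => dotv (K u w) (th u w)) t - ti (fun u => beta * c u w) t.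
Definition expo_int (s : R) (w : Omega) : 'cV[R]_m := (- alpha) *: (hh s *: K s w - Z s w).
(** The Ito integral of [expo_int], with the integral of [h K] written by parts so that only the two
    integrals already chosen by [ito] occur. *)
Definition expo_mart (t : R) (w : Omega) : R :=
  - alpha * (hh t * I t w - beta * ti (fun s => hh s ^+ 2 * I s w) t - J t w).
Definition drift (s : R) (w : Omega) : R :=
  beta * hh s ^+ 2 * wlth s w + hh s * dotv (K s w) (th s w) - beta * hh s * c s w + f s w.

Lemma expo_int_predictable : predictable_mx expo_int.
Proof.
apply: (predictable_mxZ (X := fun _ _ => - alpha)); first exact: predictable_cst.
apply: predictable_mxB => //; apply: (predictable_mxZ (X := fun s _ => hh s)) => //.
by apply: predictable_time => //; exact: h_ucont.
Qed.

Lemma expo_approx : approx expo_int expo_mart.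
Proof.
have [cI aI apI] := ito_spec T0 hP hB pK iK; have [cJ aJ apJ] := ito_spec T0 hP hB pZ iZ.
have h01 : forall t : R, 0 <= t <= T -> 0 < hh t <= 1 by exact: h_bounds.
have hl := h_increment beta0 (T := T).
have ap := approx_mul T0 hP hB beta0 h01 hl pK apI cI aI iK.
have phK : predictable_mx (fun s w => hh s *: K s w).
  by apply: (predictable_mxZ (X := fun s _ => hh s)) => //; apply: predictable_time => //; exact: h_ucont.
have sK := predictable_smeas T0 hP hB phK; have sZ := predictable_smeas T0 hP hB pZ.
have sKZ := predictable_smeas T0 hP hB (predictable_mxB phK pZ).
exact: (approxZ (- alpha) sKZ (approxB T0 sK sZ ap apJ)).
Qed.

Lemma expo_continuous w : {within `[0, T], continuous (fun t : R => expo_mart t w)}.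
Proof.
have [cI aI apI] := ito_spec T0 hP hB pK iK; have [cJ aJ apJ] := ito_spec T0 hP hB pZ iZ.
have uh := h_ucont T0 beta0.
have uI := continuous_ucont T0 (cI w); have uJ := continuous_ucont T0 (cJ w).
apply: (ucont_continuous T0); apply: ucontM => //; first exact: ucont_cst.
apply: ucontB => //; apply: ucontB => //; first exact: ucontM.
apply: ucontM => //; first exact: ucont_cst.
apply: ti_ucont => //; apply: tint_ucont => //; apply: ucontM => //.
by rewrite (_ : (fun s => _) = fun s => hh s * hh s); [exact: ucontM|apply/funext => s; rewrite expr2].
Qed.

Lemma expo_adapted (t : R) : 0 <= t <= T -> filt_measurable P B t (expo_mart t).
Proof.
move=> tT; have sF := sigma_filt P B t.
have [cI aI apI] := ito_spec T0 hP hB pK iK; have [cJ aJ apJ] := ito_spec T0 hP hB pZ iZ.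
apply: (gmeasM sF); first exact: (gmeas_cst sF).
apply: (gmeasB sF); last exact: aJ.
apply: (gmeasB sF); first by apply: (gmeasM sF); [exact: (gmeas_cst sF)|exact: aI].
apply: (gmeasM sF); first exact: (gmeas_cst sF).
apply: (ti_adapted tT (X := fun s w => hh s ^+ 2 * I s w)).
apply: gmeas_predictable; apply: (gmeasM (sigma_pred P T B)).
  apply: (gmeasX (sigma_pred P T B)).
  apply: (predictable_gmeas (X := fun s _ => hh s)); apply: predictable_time => //; exact: h_ucont.
have pI : predictable I by exact: (continuous_adapted_predictable T0 cI aI).
exact: (predictable_gmeas pI).
Qed.

Lemma tint_expo_int w : tint T (fun s => sqnorm (K s w)) -> tint T (fun s => sqnorm (Z s w)) ->
  tint T (fun s => sqnorm (expo_int s w)).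
Proof.
move=> tK tZ.
have tb := tintD (tintZ (2 * alpha ^+ 2) tK) (tintZ (2 * alpha ^+ 2) tZ).
have mq : measurable_fun I0T (fun s => sqnorm (expo_int s w)).
  apply: (predictable_sec_measurable T0 hP hB (X := fun s w => sqnorm (expo_int s w))).
  exact: (predictable_sqnorm expo_int_predictable).
apply: (tint_le mq tb) => s sT.
rewrite ger0_norm ?sqnorm_ge0// /expo_int sqnormZ sqrrN.
have a0 := sqr_ge0 alpha.
rewrite [leRHS](_ : _ = alpha ^+ 2 * (2 * sqnorm (K s w) + 2 * sqnorm (Z s w))); last by ring.
apply: ler_wpM2l => //.
have := sqnorm_le2 (hh s *: K s w) (- Z s w); rewrite sqnormN sqnormZ.
have /andP[h0 h1] := h_bounds beta0 sT; have k0 := sqnorm_ge0 (K s w).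
have : hh s ^+ 2 * sqnorm (K s w) <= sqnorm (K s w).
  by apply: ler_piMl => //; rewrite expr_le1// ltW.
move: k0 => _; clear tb mq tK tZ.
by move: (sqnorm (K s w)) (sqnorm (Z s w)) (sqnorm _) (hh s ^+ 2) => u v q r; lra.
Qed.

Lemma tint_dotv w : tint T (fun s => sqnorm (K s w)) -> tint T (fun s => dotv (K s w) (th s w)).
Proof.
move=> tK; have [k Hk] := bth.
have tb := tintD (tintZ 2^-1 tK) (tint_cst T0 (2^-1 * k)).
apply: (tint_le _ tb).
  apply: (predictable_sec_measurable T0 hP hB (X := fun s w => dotv (K s w) (th s w))).
  exact: predictable_dotv.
move=> s sT; have := normr_dotv_le (K s w) (th s w); have := Hk s w sT.
by clear tK tb Hk; move: `|_| (sqnorm _) (sqnorm _) => r u v; lra.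
Qed.

(** The integration by parts of [h] with the stochastic part is built into [expo_mart], the one with
    the absolutely continuous part is [ibp], and the equation of [Y] supplies the remaining
    terms. *)
Lemma wealth_identity : {ae P, forall w, [/\ ucont T (wlth ^~ w),
  tint T (fun s => sqnorm (K s w)) /\ tint T (c ^~ w),
  tint T (fun s => sqnorm (expo_int s w)), tint T (drift ^~ w) &
  forall t : R, 0 <= t <= T -> - alpha * (hh t * wlth t w - Y t w) =
    - alpha * (hh 0 * x - Y 0 w) + expo_mart t w - alpha * ti (drift ^~ w) t]}.
Proof.
have [cI aI apI] := ito_spec T0 hP hB pK iK; have [cJ aJ apJ] := ito_spec T0 hP hB pZ iZ.
have I0 := approx_initial T0 apI; have J0 := approx_initial T0 apJ.
apply: filterS (filterI I0 (filterI J0 (filterI iK (filterI iZ (filterI ic (filterI jf Yeq)))))) => w.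
move=> [I0w [J0w [iKw [iZw [icw [jfw Yt]]]]]].
have tK : tint T (fun s => sqnorm (K s w)) := qvar_tint T0 hP hB pK iKw.
have tZ : tint T (fun s => sqnorm (Z s w)) := qvar_tint T0 hP hB pZ iZw.
have tc : tint T (c ^~ w) := tint_norm_lty pc icw.
have tf : tint T (f ^~ w) := tint_norm_lty pf jfw.
have tKt := tint_dotv tK.
have tbc := tintZ beta tc.
have uh := h_ucont T0 beta0.
have uI := continuous_ucont T0 (cI w).
pose a0 s := dotv (K s w) (th s w) - beta * c s w.
have ta0 : tint T a0 by exact: tintB.
have ua0 := ti_ucont T0 ta0.
have XE (t : R) : t <= T -> wlth t w = x + I t w + ti a0 t.
  by move=> tT; rewrite (tiB tKt tbc tT) /wlth addrA.
have uX : ucont T (wlth ^~ w).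
  have u1 := ti_ucont T0 tKt; have u2 := ti_ucont T0 tbc.
  apply: ucontB => //; apply: ucontD => //; apply: ucontD => //; exact: ucont_cst.
have th2 : tint T (fun s => beta * hh s ^+ 2).
  apply: tintZ; apply: tint_ucont => //.
  by rewrite (_ : (fun s => _) = fun s => hh s * hh s); [exact: ucontM|apply/funext => s; rewrite expr2].
have tD : tint T (drift ^~ w).
  apply: tintD tf; apply: tintB; first apply: tintD.
  - have := tintM_ucont T0 uX th2; congr tint; apply/funext => s; ring.
  - exact: tintM_ucont.
  - have := tintM_ucont T0 uh tbc; congr tint; apply/funext => s; ring.
split => //; first exact: tint_expo_int.
move=> t tT; have [t0 tT'] := andP tT.
have TT : 0 <= T <= T by rewrite lexx ltW.
have zT : 0 <= (0 : R) <= T by rewrite lexx ltW.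
have h01 : forall t : R, 0 <= t <= T -> 0 < hh t <= 1 by exact: h_bounds.
have hl := h_increment beta0 (T := T).
have hE (s : R) : 0 <= s <= T -> ti (fun s => beta * hh s ^+ 2) s = hh s - hh 0.
  by move=> sT; rewrite (ti_h T0 h01 uh hl sT) addrAC subrr add0r.
have th2I : tint T (fun s => hh s ^+ 2 * I s w).
  apply: tint_ucont => //; apply: ucontM => //.
  by rewrite (_ : (fun s => _) = fun s => hh s * hh s); [exact: ucontM|apply/funext => s; rewrite expr2].
(* Derivative of [h] times the absolutely continuous part of the wealth, by the product rule with
   [h' = beta h ^ 2]. *)
pose k s := beta * hh s ^+ 2 * (x + ti a0 s) + hh s * a0 s.
have uxa : ucont T (fun s => x + ti a0 s) by apply: ucontD => //; exact: ucont_cst.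
have tk : tint T k.
  apply: tintD; last exact: tintM_ucont.
  have := tintM_ucont T0 uxa th2; congr tint; apply/funext => s; ring.
have E1 : hh t * (x + ti a0 t) = hh 0 * x + ti k t.
  have e1 := ibp T0 th2 ta0 tT; rewrite hE// in e1.
  have e2 := tiZ (hh 0) ta0 tT'; have e3 := tiZ x th2 tT'; rewrite hE// in e3.
  have t3 := tintZ x th2; have t2 := tintZ (hh 0) ta0.
  have t1 : tint T (fun s => ti a0 s * (beta * hh s ^+ 2) + ti (fun s => beta * hh s ^+ 2) s * a0 s).
    by apply: tintD; apply: tintM_ucont => //; exact: ti_ucont.
  have e5 := tiD (tintD t1 t2) t3 tT'; rewrite (tiD t1 t2 tT') e2 e3 -e1 in e5.
  have e4 : ti (fun s => ti a0 s * (beta * hh s ^+ 2) + ti (fun s => beta * hh s ^+ 2) s * a0 s +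
      hh 0 * a0 s + x * (beta * hh s ^+ 2)) t = ti k t.
    apply: ti_eq => s /andP[s0 st]; have sT : 0 <= s <= T by rewrite s0 (le_trans st).
    rewrite (hE s sT) /k; ring.
  have e6 := etrans (esym e4) e5.
  exact: increment_split e6.
have E2 : ti (drift ^~ w) t = ti k t + beta * ti (fun s => hh s ^+ 2 * I s w) t + ti (f ^~ w) t.
  have t2 := tintZ beta th2I.
  rewrite -(tiZ beta th2I tT') -(tiD tk t2 tT') -(tiD (tintD tk t2) tf tT').
  apply: ti_eq => s /andP[s0 st]; rewrite /drift XE ?(le_trans st)// /k /a0; ring.
have fE (u : R) : 0 <= u <= T -> \int[mu]_(s in `[u, T]) f s w = ti (f ^~ w) T - ti (f ^~ w) u.
  move=> /andP[u0 uT]; rewrite (ti_diff tf u0 uT (lexx T)).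
  rewrite Rintegral_itv_obnd_cbnd//; exact: tint_sub.
have E3 : Y t w = Y 0 w - ti (f ^~ w) t + J t w.
  rewrite (Yt t tT) (Yt 0 zT) (fE t tT) (fE 0 zT) J0w ti0.
  by move: (ti _ T) (ti _ t) (J T w) (J t w) => *; ring.
rewrite E3 XE// E2 /expo_mart.
exact: identity_split E1.
Qed.

Hypothesis (alpha0 : 0 < alpha) (pY : predictable Y).
Hypothesis cY : forall w, {within `[0, T], continuous (fun t : R => Y t w)}.
Variable lambda : R.
Hypothesis lambda0 : 0 < lambda.

(* [gen_le] is the generator inequality that any [K = sigma^T pi] with [pi] in
   [C] satisfies; the Fenchel inequality [ln u + 1 <= u] turns it into the bound
   [rate <= lambda * exp (- alpha * c) / surplus]. *)
Definition surplus (t : R) (w : Omega) : R := expR (- alpha * (hh t * wlth t w - Y t w)).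

Definition gen_le (s : R) (w : Omega) : Prop :=
  f s w <= alpha / 2 * sqnorm (hh s *: K s w - (Z s w + alpha^-1 *: th s w))
    - dotv (Z s w) (th s w) - (2 * alpha)^-1 * sqnorm (th s w)
    - beta * hh s * Y s w - beta * hh s / alpha * (ln (beta * hh s / lambda) - 1).

(** The bound on the rate left by the generator inequality: it is the affine side of [cap_le_exp],
    with [alpha * c] as the consumption variable. *)
Definition cap (s : R) (w : Omega) : R :=
  beta * hh s * (alpha * (hh s * wlth s w - Y s w) - alpha * c s w - ln (beta * hh s / lambda) + 1).

Lemma drift_le_cap s w : gen_le s w ->
  alpha * drift s w - 2^-1 * sqnorm (expo_int s w) <= cap s w.
Proof.
move=> fG; have an := lt0r_neq0 alpha0.
have := generator_square (hh s) (K s w) (Z s w) (th s w) an; rewrite -!addrA (addrA (alpha / 2 * _)).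
move=> E; exact: (cap_split _ _ E an fG alpha0).
Qed.

(** The time integrals in [wlth] are junk on null sets, where continuity may fail, while stopping
    calls for a version continuous and adapted everywhere. *)
Lemma wealth_version : exists V : R -> Omega -> R, [/\ forall w, ucont T (V ^~ w),
  forall t : R, 0 <= t <= T -> filt_measurable P B t (V t) &
  {ae P, forall w t, V t w = wlth t w}].
Proof.
have [cI aI apI] := ito_spec T0 hP hB pK iK.
have pKt : predictable (fun s w => dotv (K s w) (th s w)) by exact: predictable_dotv.
have iKt : {ae P, forall w, (\int[mu]_(s in `[0%R, T]) (`|dotv (K s w) (th s w)|)%:E < +oo)%E}.
  apply: filterS iK => w iKw; have := tint_dotv (qvar_tint T0 hP hB pK iKw).
  by move=> /integrableP[].
have pbc : predictable (fun s w => beta * c s w).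
  apply: gmeas_predictable; apply: (gmeasM (sigma_pred P T B)); first exact: (gmeas_cst (sigma_pred P T B)).
  exact: (predictable_gmeas pc).
have ibc : {ae P, forall w, (\int[mu]_(s in `[0%R, T]) (`|beta * c s w|)%:E < +oo)%E}.
  apply: filterS ic => w icw; have := tintZ beta (tint_norm_lty pc icw).
  by move=> /integrableP[].
have [V1 [u1 a1 _ e1]] := ti_version T0 hP hB pKt iKt.
have [V2 [u2 a2 _ e2]] := ti_version T0 hP hB pbc ibc.
exists (fun t w => x + I t w + V1 t w - V2 t w); split.
- move=> w; apply: ucontB => //; apply: ucontD => //; apply: ucontD => //; first exact: ucont_cst.
  exact: continuous_ucont.
- move=> t tT; have sF := sigma_filt P B t.
  apply: (gmeasB sF); last exact: a2.
  apply: (gmeasD sF); last exact: a1.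
  by apply: (gmeasD sF); [exact: (gmeas_cst sF)|exact: aI].
apply: filterS (filterI e1 e2) => w [[_ E1] [_ E2]] t.
by rewrite /wlth E1 E2.
Qed.

Lemma surplus_measurable tau : stopping_time P T B tau ->
  measurable_fun setT (fun w => surplus (tau w) w).
Proof.
move=> st; have [V [uV aV eV]] := wealth_version.
have TT : 0 <= T <= T by rewrite ltW//= lexx.
have uh := h_ucont T0 beta0.
pose D t w := hh t * V t w - Y t w.
have cD w : {within `[0, T], continuous (fun t : R => D t w)}.
  have uY := continuous_ucont T0 (@cY w).
  exact: (ucont_continuous T0 (ucontB T0 (ucontM T0 uh (uV w)) uY)).
have aD (t : R) : 0 <= t <= T -> filt_measurable P B t (D t).
  move=> tT; have sF := sigma_filt P B t; apply: (gmeasB sF); last exact: predictable_adapted pY.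
  by apply: (gmeasM sF); [exact: (gmeas_cst sF)|exact: aV].
have h := stopped_adapted T0 st cD aD TT.
have sF := sigma_filt P B T.
have h2 : filt_measurable P B T (fun w => expR (- alpha * D (Num.min T (tau w)) w)).
  by apply: (gmeas_expR sF); apply: (gmeasM sF); first exact: (gmeas_cst sF).
apply: (filt_measurableT hP hB (lexx T)); apply: (filt_measurable_ae h2).
apply: filterS eV => w E; have [/(_ w)/andP[_ t1] _] := st.
by rewrite min_r// /surplus /D E.
Qed.

Variable A : R -> Omega -> R.
Hypothesis uA : forall w, ucont T (A ^~ w).
Hypothesis aA : forall t : R, 0 <= t <= T -> filt_measurable P B t (A t).
Hypothesis eA : {ae P, forall w, tint T (fun s => sqnorm (expo_int s w)) /\ forall t, A t w = qvar expo_int t w}.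
Hypothesis mA : forall w, A 0 w = 0 /\ (forall s t : R, 0 <= s -> s <= t -> t <= T -> A s w <= A t w).
Local Notation M := (stoch_exp expo_mart A).

Definition rate (s : R) (w : Omega) : R := alpha * drift s w - 2^-1 * sqnorm (expo_int s w).

(** Exponential of [wealth_identity]; half the bracket is moved out of the drift and into [M]. *)
Lemma surplus_exponential : {ae P, forall w, tint T (rate ^~ w) /\
  forall t : R, 0 <= t <= T -> surplus t w = surplus 0 w * M t w * expR (- ti (rate ^~ w) t)}.
Proof.
have TT : 0 <= T <= T by rewrite ltW//= lexx.
apply: filterS (filterI wealth_identity (filterI eA (approx_initial T0 expo_approx))).
move=> w [[_ _ tL tD DE] [[_ AE] N0]].
have t1 := tintZ alpha tD; have t2 := tintZ 2^-1 tL.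
split; first exact: tintB.
move=> t tT; have [t0 tT'] := andP tT; rewrite /surplus /stoch_exp -!expRD; congr expR.
have zT : 0 <= (0 : R) <= T by rewrite lexx ltW.
have E0 := DE 0 zT; rewrite ti0 mulr0 subr0 N0 addr0 in E0; rewrite (DE t tT) E0 AE.
rewrite (tiB t1 t2 tT') (tiZ alpha tD tT') (tiZ 2^-1 tL tT').
exact: exponent_split.
Qed.

Section upper_bound.
Hypothesis iE : (\int[P]_w \int[mu]_(u in `[0%R, T]) (expR (- alpha * c u w))%:E < +oo)%E.
Hypothesis gle : {ae P, forall w, {ae mu, forall s : R, 0 <= s <= T -> gen_le s w}}.

(** The consumption cost divided by [M]; multiplying by [M] at the running time gives back
    [lambda * expR (- alpha * c)]. *)
Definition kweight (s : R) (w : Omega) : R :=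
  lambda * expR (- alpha * c s w) * expR (- (expo_mart s w - 2^-1 * A s w)).

Lemma predictable_exp_cons : predictable (fun s w => expR (- alpha * c s w)).
Proof.
apply: gmeas_predictable; apply: (gmeas_expR (sigma_pred P T B)); apply: (gmeasM (sigma_pred P T B)).
  exact: (gmeas_cst (sigma_pred P T B)).
exact: (predictable_gmeas pc).
Qed.

Lemma predictable_kweight : predictable kweight.
Proof.
have sP := sigma_pred P T B.
have pN := continuous_adapted_predictable T0 expo_continuous expo_adapted.
have pA : predictable A.
  by apply: (continuous_adapted_predictable T0) => // w; exact: ucont_continuous.
apply: gmeas_predictable; apply: (gmeasM sP).
  by apply: (gmeasM sP); [exact: (gmeas_cst sP)|exact: (predictable_gmeas predictable_exp_cons)].
apply: (gmeas_expR sP); apply: (gmeasN sP); apply: (gmeasB sP).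
  exact: (predictable_gmeas pN).
by apply: (gmeasM sP); [exact: (gmeas_cst sP)|exact: (predictable_gmeas pA)].
Qed.

Lemma tint_exp_cons : {ae P, forall w, tint T (fun s => expR (- alpha * c s w))}.
Proof.
have pe := predictable_exp_cons.
have me := time_integral_measurable T0 hP hB pe (fun s w => expR_ge0 _).
have := ae_lty_of_integral me _ iE.
move=> H; apply: filterS (H _) => [w h|w].
  apply: (tint_lty _ _ h) => [|s _]; last exact: expR_ge0.
  exact: (predictable_sec_measurable T0 hP hB (X := fun s w => expR (- alpha * c s w))).
by apply: integral_ge0 => s _; rewrite lee_fin expR_ge0.
Qed.

(** By [exp_chain], the discount [exp (- int rate)] is 1 minus the integral of the rate times the
    discount. The bound on the rate makes [surplus 0] times that integral at most the integral of
    [kweight]; multiplying by [M] gives the claim. *)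
Lemma surplus_lower : {ae P, forall w, tint T (kweight ^~ w) /\
  forall t : R, 0 <= t <= T -> surplus 0 w * M t w <= surplus t w + M t w * ti (kweight ^~ w) t}.
Proof.
apply: filterS (filterI surplus_exponential (filterI tint_exp_cons gle)) => w [[ta SE] [te gw]].
have uN := continuous_ucont T0 (@expo_continuous w).
have uM := ucont_expR T0 (ucontN (ucontB T0 uN (ucontZ 2^-1 (@uA w)))).
have tk : tint T (kweight ^~ w).
  have := tintM_ucont T0 uM (tintZ lambda te); congr tint; apply/funext => s.
  by rewrite /kweight mulrC.
split => // t tT; have [t0 tT'] := andP tT.
have uV := ucont_expR T0 (ucontN (ti_ucont T0 ta)).
have tV := tintM_ucont T0 uV ta.
have V1 := exp_chain T0 ta tT.
have S00 : 0 < surplus 0 w by exact: expR_gt0.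
have kS : surplus 0 w * ti (fun s => expR (- ti (rate ^~ w) s) * rate s w) t <= ti (kweight ^~ w) t.
  rewrite -(tiZ (surplus 0 w) tV tT'); apply: (ti_le_ae (tintZ (surplus 0 w) tV) tk tT' _ t0).
  case: gw => N [mN N0 HN]; exists N; split=> // s /= nH; apply: HN => /= gs; apply: nH => sT.
  have bh : 0 < beta * hh s by apply: mulr_gt0 => //; have /andP[] := h_bounds beta0 sT.
  have r1 := le_trans (drift_le_cap (gs sT))
    (cap_le_exp (alpha * (hh s * wlth s w - Y s w)) (alpha * c s w) lambda0 bh).
  rewrite /kweight (mulNr alpha (c s w)).
  apply: (weight_le (ltW S00) (expR_ge0 _) _ r1).
  have := SE s sT; rewrite {1}/surplus mulNr => ->.
  by rewrite -!mulrA [expR (- ti _ _) * _]mulrC (mulrA (M s w)) /stoch_exp -expRD subrr expR0 mul1r.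
have Mp : 0 < M t w by exact: expR_gt0.
rewrite (SE t tT) V1; exact: weight_final.
Qed.

Lemma hitting_clock (n : nat) : [/\ stopping_time P T B (hitting T A n%:R),
  forall w, A (hitting T A n%:R w) w <= n%:R &
  forall w, A T w < n%:R -> hitting T A n%:R w = T].
Proof.
apply: (hitting_spec T0 (ler0n _ n) uA) => // w; first by move=> s t; have [_] := mA w; exact.
by have [] := mA w.
Qed.

(** Mean of [surplus_lower] at a time that bounds the clock: [M] has mean 1 on the left, and
    [stopped_weight] brings [M] to the running time, where it cancels the denominator in
    [kweight]. *)
Lemma upper_stopped tau (n : nat) (s0 : R) : stopping_time P T B tau -> (forall w, A (tau w) w <= n%:R) ->
  0 <= s0 -> {ae P, forall w, surplus 0 w = s0} ->
  (s0%:E <= \int[P]_w (surplus (tau w) w)%:E +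
    \int[P]_w \int[mu]_(s in `[0%R, T]) (lambda * expR (- alpha * c s w))%:E)%E.
Proof.
move=> st An s0p S0; have tauT := proj1 st.
have TT : 0 <= T <= T by rewrite ltW//= lexx.
have sP := sigma_pred P T B.
have Ac : {ae P, forall w, A (tau w) w <= n%:R} by apply: nearW.
pose cut (k : R -> Omega -> R) s w := if s <= tau w then k s w else 0.
have pcut k : predictable k -> predictable (cut k) by exact: predictable_cut.
have cut0 k s w : 0 <= k s w -> 0 <= cut k s w by rewrite /cut; case: ifP.
have kw0 s w : 0 <= kweight s w by apply: mulr_ge0 (expR_ge0 _); apply: mulr_ge0 (expR_ge0 _); exact: ltW.
have le0 s w : 0 <= lambda * expR (- alpha * c s w) by apply: mulr_ge0 (expR_ge0 _); exact: ltW.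
have pk1 := pcut _ predictable_kweight; have k10 s w := cut0 _ _ _ (kw0 s w).
have mG := time_integral_measurable T0 hP hB pk1 k10.
pose G w := (\int[mu]_(s in `[0%R, T]) (cut kweight s w)%:E)%E.
have G0 w : (0 <= G w)%E by apply: integral_ge0 => s _; rewrite lee_fin.
have mM := stoch_exp_stopped_measurable T0 hP hB expo_continuous expo_adapted uA aA st.
have mS := surplus_measurable st.
have mME : measurable_fun setT (fun w => (M (tau w) w)%:E) by exact/measurable_EFinP.
have M0 w : 0 <= M (tau w) w by exact: expR_ge0.
have -> : (s0%:E = \int[P]_w (s0 * M (tau w) w)%:E)%E.
  by rewrite integralZ_EFin// (stoch_exp_one T0 hP hB expo_int_predictable expo_approx expo_continuous expo_adapted
    uA aA eA (ler0n _ n) st Ac) mule1.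
apply: (@le_trans _ _ (\int[P]_w ((surplus (tau w) w)%:E + (M (tau w) w)%:E * G w))%E).
  apply: ae_ge0_le_integral => //.
  - by move=> w _; rewrite lee_fin mulr_ge0.
  - by apply/measurable_EFinP; exact: measurable_funM.
  - by move=> w _; apply: adde_ge0; [rewrite lee_fin expR_ge0|apply: mule_ge0 => //; rewrite lee_fin].
  - by apply: emeasurable_funD; [exact/measurable_EFinP|exact: emeasurable_funM].
  apply: filterS (filterI S0 surplus_lower) => w [S0w [tk H]] _.
  have [t0 tT] := andP (tauT w).
  have -> : G w = (ti (kweight ^~ w) (tau w))%:E.
    rewrite /G (ti_EFin (tint_cut (tau w) tk) (lexx T)); congr EFin.
    by rewrite (ti_stop _ _ t0) min_r.
  by rewrite -EFinM -EFinD lee_fin -S0w; exact: H.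
rewrite ge0_integralD//; last 4 first.
- by move=> w _; rewrite lee_fin expR_ge0.
- exact/measurable_EFinP.
- by move=> w _; apply: mule_ge0 => //; rewrite lee_fin.
- exact: emeasurable_funM.
apply: leeD => //.
have -> : (\int[P]_w ((M (tau w) w)%:E * G w) =
    \int[P]_w \int[mu]_(s in `[0%R, T]) (M (tau w) w * cut kweight s w)%:E)%E.
  apply: eq_integral => w _; rewrite /G -ge0_integralZl//.
  - by apply/measurable_EFinP; exact: (predictable_sec_measurable T0 hP hB (X := cut kweight) w pk1).
  - by move=> s _; rewrite lee_fin.
  - by rewrite lee_fin.
have := stopped_weight T0 hP hB expo_int_predictable expo_approx expo_continuous expo_adapted uA aA eA
  (ler0n _ n) st Ac pk1 k10.
move=> ->; apply: le_integral_ge0 => w.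
  by apply: integral_ge0 => s _; rewrite lee_fin mulr_ge0// expR_ge0.
have ple : predictable (fun s w => lambda * expR (- alpha * c s w)).
  apply: gmeas_predictable; apply: (gmeasM sP); first exact: (gmeas_cst sP).
  exact: (predictable_gmeas predictable_exp_cons).
have E s : M (Num.min s (tau w)) w * cut kweight s w = cut (fun s w => lambda * expR (- alpha * c s w)) s w.
  rewrite /cut; case: ifP => h; last by rewrite mulr0.
  by rewrite min_l// /kweight /stoch_exp mulrCA -expRD subrr expR0 mulr1.
under eq_integral do rewrite E.
apply: ge0_le_integral => //.
- by move=> s _; rewrite lee_fin; exact: (cut0 (fun s w => lambda * expR (- alpha * c s w))).
- by apply/measurable_EFinP; exact: (predictable_sec_measurable T0 hP hB (X := cut (fun s w => lambda * expR (- alpha * c s w))) w (pcut _ ple)).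
- by apply/measurable_EFinP; exact: (predictable_sec_measurable T0 hP hB (X := fun s w => lambda * expR (- alpha * c s w)) w ple).
- by move=> s _; rewrite lee_fin /cut; case: ifP.
Qed.

Theorem upper_bound (s0 : R) : 0 <= s0 -> {ae P, forall w, surplus 0 w = s0} ->
  unif_integrable P [set fun w => surplus (tau w) w | tau in stopping_time P T B] ->
  (s0%:E <= \int[P]_w (surplus T w)%:E +
    \int[P]_w \int[mu]_(s in `[0%R, T]) (lambda * expR (- alpha * c s w))%:E)%E.
Proof.
move=> s0p S0 ui; set E := (X in (_ + X)%E).
have E0 : (0 <= E)%E.
  apply: integral_ge0 => w _; apply: integral_ge0 => s _; rewrite lee_fin.
  by apply: mulr_ge0 (expR_ge0 _); exact: ltW.
have S0p w t : 0 <= surplus t w by exact: expR_ge0.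
have Tst : stopping_time P T B (fun=> T) by apply: stopping_cst; rewrite ltW//= lexx.
(* An infinite cost makes the bound trivial; a finite one is a real number that can be
   subtracted. *)
have [Einf|Efin] := eqVneq E +oo%E.
  have nS : (0 <= \int[P]_w (surplus T w)%:E)%E by apply: integral_ge0 => w _; rewrite lee_fin.
  have aux (a : \bar R) : (0 <= a)%E -> (s0%:E <= a + +oo)%E by case: a => [r| |]// _; rewrite leey.
  by rewrite Einf; exact: aux.
have [r Er] : exists r : R, E = r%:E by exists (fine E); rewrite fineK// ge0_fin_numE// ltey.
have US tau n (st : stopping_time P T B tau) (An : forall w, A (tau w) w <= n%:R) :
    (s0%:E <= \int[P]_w (surplus (tau w) w)%:E + r%:E)%E by rewrite -Er; exact: upper_stopped.
rewrite Er {Er Efin E0}.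
(* The positive part keeps the constant sequence nonnegative, as [le_integral_vitali] requires. *)
pose q := Num.max (s0 - r) 0.
pose tau n := hitting T A n%:R.
have mT : measurable_fun setT (fun w => surplus T w) by exact: (surplus_measurable Tst).
suff H : (\int[P]_w q%:E <= \int[P]_w (surplus T w)%:E)%E.
  rewrite integral_prob_cst in H.
  rewrite -leeBlDr//; apply: le_trans H; rewrite -EFinB lee_fin le_max lexx//.
have q0 : 0 <= q by rewrite le_max lexx orbT.
apply: (@le_integral_vitali _ _ _ P (fun _ _ => q) (fun n w => surplus (tau n w) w)) => //.
- by move=> n; apply: surplus_measurable; have [] := hitting_clock n.
- by apply: nearW => w; exact: cvg_cst.
(* Each path has a finite clock, so its localising times equal [T] from some index on. *)
- apply: nearW => w; apply: cvg_near_cst.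
  exists (Num.truncn (A T w)).+1 => // n /= hn; rewrite /tau.
  have [_ _ ->//] := hitting_clock n.
  apply: lt_le_trans (truncnS_gt _) _; by rewrite ler_nat.
- move=> e e0; have [k HK] := ui e e0; exists k => n.
  have [st _ _] := hitting_clock n.
  have := HK (fun w => surplus (tau n w) w) (ex_intro2 _ _ _ st erefl).
  under eq_integral do rewrite ger0_norm//.
  by rewrite (_ : [set w | k <= `|_|] = [set w | k <= surplus (tau n w) w])//; apply/seteqP; split => w /=; rewrite ger0_norm.
move=> n; rewrite integral_prob_cst.
have [st An _] := hitting_clock n; have := US _ n st An.
rewrite -leeBlDr// -EFinB => H; rewrite /q /Num.max; case: ifP => _; last exact: H.
by apply: integral_ge0 => w _; rewrite lee_fin.
Qed.

End upper_bound.

End identity.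

(** * Estimates for the uniform integrability of the optimal surplus *)

Lemma utility_combine (R : realType) (w W M X q a u v C2 D J Q E n : R) :
  1 <= w -> w <= W -> 0 < M -> 0 < X -> 0 < q -> q <= 2^-1 -> a <= q * (u - M + X) ->
  0 <= v -> - u <= 1 - v -> w * u <= w * a + C2 * M - J + M * Q -> n * M - J - D * M <= n * E ->
  2^-1 * v + n * M <= W * X + W + (C2 + D) * M + n * E + M * Q.
Proof.
move=> w1 wW M0 X0 q0 q2 aq v0 uv wu nE.
have w0 : 0 <= w by lra.
have f1 := ler_wpM2l w0 aq.
have wq : 2^-1 <= w * (1 - q) by nra.
have f2 := ler_wpM2r v0 wq.
have wq0 : 0 <= w * (1 - q) by lra.
have vu : v <= u + 1 by lra.
have f3 := ler_wpM2l wq0 vu.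
have wqW : w * q <= W by nra.
have f4 := ler_wpM2r (ltW X0) wqW.
have f5 : w * (1 - q) <= W by nra.
have f6 : 0 <= w * q * M by rewrite mulr_ge0 ?mulr_ge0// ltW.
move: f1 f2 f3 f4 f5 f6 wu nE; rewrite !(mulrDr, mulrDl, mulrBr, mulrN, mulr1) !mulrA; lra.
Qed.

(* Young's inequality [exp l * y <= exp l * l - exp l + exp y] absorbs the utility
   of [Y]; [E] pays for the stochastic integral [J]. *)
Lemma utility_arith (R : realType) (w W l Yp C2 J Q E al eta n : R) (p : nat) : (1 < p)%N ->
  1 <= w -> w <= W -> 0 <= Yp -> 0 < al -> 0 < n -> eta = al / n ->
  w * l <= w * (al * Yp) + C2 - al * J + Q ->
  expR l * (1 - eta * J - 2^-1 * eta ^+ 2 * n) <= E ->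
  2^-1 * (expR l * Num.max l 0) + n * expR l <=
    W * expR (p%:R * al * Yp) + W + (C2 + 2^-1 * al ^+ 2) * expR l + n * E + expR l * Q.
Proof.
move=> p1 w1 wW Y0 al0 n0 etaE wl EE.
have M0 : 0 < expR l by exact: expR_gt0.
have p2 : 2 <= p%:R :> R by rewrite (ler_nat R 2).
have p0 : 0 < p%:R :> R by lra.
have young : expR l * (p%:R * al * Yp) <= expR l * l - expR l + expR (p%:R * al * Yp).
  have := expR_ge1Dx (p%:R * al * Yp - l); set a := p%:R * al * Yp => h.
  have := ler_wpM2l (ltW M0) h; rewrite -expRD (_ : l + (a - l) = a); last by ring.
  lra.
have hneg : - (expR l * l) <= 1 - expR l * Num.max l 0.
  have [l0|l0] := leP l 0.
    rewrite mulr0 subr0; have := expR_ge1Dx (- l); have := expRN l => e1.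
    have := ler_wpM2l (ltW M0) (expR_ge1Dx (- l)).
    rewrite -expRD subrr expR0 mulrDr mulr1 mulrN; lra.
  lra.
have wl2 := ler_wpM2l (ltW M0) wl.
have EE2 := ler_wpM2l (ltW n0) EE.
(* With [eta = al / n], multiplying by [n] turns the first-order term into [al * J], the one in the
   logarithmic bound, and the second-order coefficient into the constant [al ^ 2 / 2]. *)
have e3 : n * (expR l * (1 - eta * J - 2^-1 * eta ^+ 2 * n)) =
    n * expR l - al * expR l * J - 2^-1 * al ^+ 2 * expR l.
  by rewrite etaE; field; rewrite lt0r_neq0.
rewrite e3 in EE2.
have X0 : 0 < expR (p%:R * al * Yp) by exact: expR_gt0.
have q0 : 0 < p%:R^-1 :> R by rewrite invr_gt0.
have q2 : p%:R^-1 <= 2^-1 :> R by rewrite lef_pV2 ?posrE.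
have a1 : expR l * (al * Yp) <= p%:R^-1 * (expR l * l - expR l + expR (p%:R * al * Yp)).
  rewrite ler_pdivlMl//; apply: le_trans young.
  by rewrite (_ : p%:R * (expR l * (al * Yp)) = expR l * (p%:R * al * Yp)); last by ring.
have v0 : 0 <= expR l * Num.max l 0.
  by apply: mulr_ge0; [exact: ltW|rewrite le_max lexx orbT].
have wl3 : w * (expR l * l) <= w * (expR l * (al * Yp)) + C2 * expR l - al * expR l * J + expR l * Q.
  by move: wl2; move: (expR l) => M; clear; lra.
exact: (utility_combine w1 wW M0 X0 q0 q2 a1 v0 hneg wl3 EE2).
Qed.

(* The integrating factor is [1 / h t = 1 + beta * (T - t)]. *)
Lemma linear_zero (R : realType) (T beta : R) (dl : R -> R) (t : R) : 0 < T -> 0 < beta ->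
  ucont T dl -> (forall t : R, 0 <= t <= T -> dl t = ti (fun s => beta * h T beta s * dl s) t) ->
  0 <= t <= T -> dl t = 0.
Proof.
move=> T0 beta0 ud dE tT; have [t0 tT'] := andP tT.
have uh := h_ucont T0 beta0.
have tb : tint T (fun s => beta * h T beta s * dl s).
  apply: (tint_ucont T0); apply: (ucontM T0) => //; exact: (ucontM T0 (ucont_cst _ beta) uh).
have tm := tint_cst T0 (- beta).
have e1 := ibp T0 tm tb tT; rewrite (ti_cst _ t0) -(dE t tT) in e1.
set k := fun s => _ in e1.
have e2 : ti k t = ti (fun s => - (1 + beta * T) * (beta * h T beta s * dl s)) t.
  apply: ti_eq => s /andP[s0 st]; have sT : 0 <= s <= T by rewrite s0 (le_trans st).
  rewrite /k -(dE s sT) (ti_cst _ s0) /h.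
  by field; exact: h_den_neq0.
rewrite e2 (tiZ (- (1 + beta * T)) tb tT') -(dE t tT) in e1.
have d1 := h_den beta0 tT.
have : (1 + beta * (T - t)) * dl t = 0 by move: e1; clear; lra.
by move/eqP; rewrite mulf_eq0 (negbTE (h_den_neq0 beta0 tT))/= => /eqP.
Qed.

(** * The optimal strategy *)

Lemma ucont_log_h (R : realType) (T beta lambda : R) : 0 < T -> 0 < beta -> 0 < lambda ->
  ucont T (fun t => ln (beta * h T beta t / lambda)).
Proof.
move=> T0 beta0 l0; have uh := h_ucont T0 beta0.
have ub : ucont T (fun t => beta * h T beta t / lambda).
  apply: (ucontM T0); last exact: ucont_cst.
  by apply: (ucontM T0) => //; exact: ucont_cst.
apply: (continuous_ucont T0); apply/subspace_continuousP => t tT.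
have /subspace_continuousP/(_ t tT) cb := ucont_continuous T0 ub.
apply: (cvg_comp _ _ cb); apply: continuous_ln.
have /andP[h0 _] : 0 < h T beta t <= 1 by apply: h_bounds => //; move: tT; rewrite /= in_itv.
by rewrite divr_gt0// mulr_gt0.
Qed.

Lemma cap_eq (R : realType) (alpha b ht X kt c f Y G l L2 : R) :
  alpha * (ht * kt + G) = 2^-1 * L2 -> alpha != 0 ->
  f = G - b * ht * Y - b * ht / alpha * (l - 1) ->
  alpha * (b * ht ^+ 2 * X + ht * kt - b * ht * c + f) =
    2^-1 * L2 + b * ht * (alpha * (ht * X - Y) - alpha * c - l + 1).
Proof. by move=> <- a0 ->; field. Qed.

Lemma deviation_split (R : realType) (alpha d0 N q e b D : R) : alpha != 0 ->
  - alpha * D = - alpha * d0 + N - (q + alpha * e + b) ->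
  D - (d0 + alpha^-1 * (b - (N - q))) = e.
Proof.
move=> a0 E; apply: (mulfI a0).
have -> : alpha * (D - (d0 + alpha^-1 * (b - (N - q)))) = - (- alpha * D) - alpha * d0 - b + N - q.
  by field.
by rewrite E; ring.
Qed.

Lemma cap_deviation (R : realType) (alpha b hx Y ta l : R) : alpha != 0 ->
  b * (alpha * (hx - Y) - alpha * (ta - alpha^-1 * l) - l + 1) = alpha * (b * (hx - Y - ta)) + b.
Proof. by move=> a0; field. Qed.

Lemma log_arith (R : realType) (al hv W l D d0 b X Y Yp x I kt bc LK c1 Q bT : R) : 0 < al ->
  0 < hv -> hv^-1 <= W -> D = hv * X - Y -> D = d0 + al^-1 * (b - l) -> X = x + I + kt - bc ->
  al * bc <= c1 + Q -> 0 <= LK + kt -> Y <= Yp -> 0 <= b -> b <= bT ->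
  hv^-1 * l <= hv^-1 * (al * Yp) + (`|al * x| + c1 + W * (`|al * d0| + bT)) - al * (I - LK) + Q.
Proof.
move=> al0 h0 hW DX DE XE bcE LK0 YYp b0 bbT; have w0 : 0 < hv^-1 by rewrite invr_gt0.
have an := lt0r_neq0 al0; have hn := lt0r_neq0 h0.
have lE : hv^-1 * l = - (al * X) + hv^-1 * (al * Y) + hv^-1 * (al * d0 + b).
  have -> : l = al * d0 + b - al * D by rewrite DE; field.
  by rewrite DX; field.
have e1 := ler_wpM2l (ltW w0) (ler_wpM2l (ltW al0) YYp).
have e2 : hv^-1 * (al * d0 + b) <= W * (`|al * d0| + bT).
  have e3 : al * d0 + b <= `|al * d0| + bT by rewrite lerD// ler_norm.
  apply: le_trans (ler_wpM2l (ltW w0) e3) _; apply: ler_wpM2r => //.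
  by apply: addr_ge0 => //; exact: le_trans bbT.
have e4 := mulr_ge0 (ltW al0) LK0.
have e5 : - (al * x) <= `|al * x| by rewrite -normrN ler_norm.
rewrite lE XE; move: (hv^-1 * _) (hv^-1 * _) (W * _) `|al * x| e1 e2 e5 => u1 u2 u3 u4 e1 e2 e5.
by move: e4 bcE; clear -e1 e2 e5; lra.
Qed.

Lemma cap_bound (R : realType) (a na b bT l ln' lo kl : R) :
  a <= na -> - lo <= kl -> - l <= ln' -> b <= bT -> a + b - l - lo <= na + bT + kl + ln'.
Proof. lra. Qed.

(** The correction [L . K] that recentres the integral of [K] under the weight [M], plus the wealth
    drift [K . theta]. For a projection the right-hand side is nonnegative, by [variational]. *)
Lemma dotv_drift (R : realType) (m : nat) (alpha a : R) (k z th : 'cV[R]_m) : alpha != 0 -> a != 0 ->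
  dotv (- alpha *: (a *: k - z)) k + dotv k th =
    alpha / a * dotv (a *: k) (z + alpha^-1 *: th - a *: k).
Proof.
move=> al0 a0; rewrite !dotvZl dotvBl dotvZl dotvBr dotvDr !dotvZr (dotvC z k).
by move: (dotv k k) (dotv k z) (dotv k th) => u v r; field; rewrite al0 a0.
Qed.

Lemma exp_lower (R : realType) (l e g a n : R) : a <= n ->
  expR l * (1 - e * g - 2^-1 * e ^+ 2 * n) <= expR (l - e * g - 2^-1 * (e ^+ 2 * a)).
Proof.
move=> an; have -> : l - e * g - 2^-1 * (e ^+ 2 * a) = l + (- (e * g) - 2^-1 * (e ^+ 2 * a)) by rewrite addrA.
rewrite expRD; apply: ler_wpM2l; first exact: expR_ge0.
apply: le_trans (expR_ge1Dx _); rewrite -!addrA !lerD2l lerN2 -mulrA.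
by apply: ler_wpM2l => //; apply: ler_wpM2l => //; exact: sqr_ge0.
Qed.

(** For negative [l] this is the inequality [x exp (- x) <= 1]. *)
Lemma exp_neg_part (R : realType) (l : R) : expR l * Num.max (- l) 0 <= 1.
Proof.
have [l0|l0] := leP (- l) 0; first by rewrite mulr0.
rewrite -(expR0 R) -[0](subrr l) expRD; apply: ler_wpM2l; first exact: expR_ge0.
by apply: le_trans (expR_ge1Dx _); rewrite lerDr.
Qed.

Section optimal.
Context (R : realType) (disp : measure_display) (Omega : measurableType disp).
Context (P : probability Omega R) (T : R) (m : nat).
Variable B : R -> Omega -> 'cV[R]_m.
Hypotheses (T0 : 0 < T) (hP : measure_is_complete P).
Hypothesis hB : brownian_motion P T B.
Local Notation mu := (@lebesgue_measure R).
Local Notation predictable := (predictable P T B).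
Local Notation predictable_mx := (predictable_mx P T B).
Local Notation filt_measurable := (filt_measurable P B).
Local Notation approx := (approx P T B).
Local Notation stopping := (stopping_time P T B).
Variables (alpha beta lambda x y0 : R) (th Z K : R -> Omega -> 'cV[R]_m) (f Y : R -> Omega -> R) (F : Omega -> R).
Hypotheses (alpha0 : 0 < alpha) (beta0 : 0 < beta) (lambda0 : 0 < lambda).
Hypotheses (pth : predictable_mx th) (bth : exists k, forall t w, 0 <= t <= T -> sqnorm (th t w) <= k).
Hypotheses (pZ : predictable_mx Z) (pK : predictable_mx K) (pf : predictable f).
Hypothesis iZ : {ae P, forall w, (\int[mu]_(t in `[0%R, T]) (sqnorm (Z t w))%:E < +oo)%E}.
Hypothesis iK : {ae P, forall w, (\int[mu]_(t in `[0%R, T]) (sqnorm (K t w))%:E < +oo)%E}.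
Hypothesis jf : {ae P, forall w, (\int[mu]_(t in `[0%R, T]) (`|f t w|)%:E < +oo)%E}.
Hypothesis Yeq : {ae P, forall w, forall t : R, 0 <= t <= T ->
   Y t w = F w + \int[mu]_(s in `[t, T]) f s w - (ito P T B Z T w - ito P T B Z t w)}.
Hypothesis pY : predictable Y.
Hypothesis cY : forall w, {within `[0, T], continuous (fun t : R => Y t w)}.
Hypothesis Y0 : {ae P, forall w, Y 0 w = y0}.

Local Notation hh := (h T beta).
Local Notation L := (expo_int T alpha beta Z K).
Local Notation N := (expo_mart P T B alpha beta Z K).

Hypothesis f_eq : forall s w, 0 <= s <= T -> f s w =
  alpha / 2 * sqnorm (hh s *: K s w - (Z s w + alpha^-1 *: th s w))
    - dotv (Z s w) (th s w) - (2 * alpha)^-1 * sqnorm (th s w)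
    - beta * hh s * Y s w - beta * hh s / alpha * (ln (beta * hh s / lambda) - 1).

Variables A AK : R -> Omega -> R.
Hypothesis uA : forall w, ucont T (A ^~ w).
Hypothesis aA : forall t : R, 0 <= t <= T -> filt_measurable t (A t).
Hypothesis mA : forall w, A 0 w = 0 /\ (forall s t : R, 0 <= s -> s <= t -> t <= T -> A s w <= A t w).
Hypothesis eA : {ae P, forall w, tint T (fun s => sqnorm (L s w)) /\ forall t, A t w = qvar L t w}.

Local Notation M := (stoch_exp N A).
Local Notation d0 := (hh 0 * x - y0).
Local Notation bh := (fun s => beta * hh s).

(* The feedback equation for the optimal consumption is solved explicitly: [copt]
   is a functional of the exponential martingale, and [optimal_target] shows that
   it has the feedback form. *)
Definition logm (t : R) (w : Omega) : R := N t w - 2^-1 * A t w.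
Definition target (t : R) (w : Omega) : R := d0 + alpha^-1 * (ti bh t - logm t w).
Definition copt (t : R) (w : Omega) : R := target t w - alpha^-1 * ln (beta * hh t / lambda).

Let uh := h_ucont T0 beta0.
Let ubh : ucont T bh := ucontM T0 (ucont_cst _ beta) uh.

Lemma logm_ucont w : ucont T (logm ^~ w).
Proof.
apply: (ucontB T0); last exact: ucontZ.
exact: (continuous_ucont T0 (@expo_continuous _ _ _ _ _ _ _ T0 hP hB alpha _ _ _ beta0 pZ pK iZ iK w)).
Qed.

Lemma logm_adapted (t : R) : 0 <= t <= T -> filt_measurable t (logm t).
Proof.
move=> tT; have sF := sigma_filt P B t; apply: (gmeasB sF); first exact: expo_adapted.
by apply: (gmeasM sF); [exact: (gmeas_cst sF)|exact: aA].
Qed.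

Lemma target_ucont w : ucont T (target ^~ w).
Proof.
have ut := ti_ucont T0 (tint_ucont T0 ubh).
apply: (ucontD T0); first exact: ucont_cst.
apply: ucontZ; apply: (ucontB T0) => //; exact: logm_ucont.
Qed.

Lemma copt_ucont w : ucont T (copt ^~ w).
Proof.
have ul := ucont_log_h T0 beta0 lambda0.
by apply: (ucontB T0) (target_ucont w) _; exact: ucontZ.
Qed.

Lemma copt_predictable : predictable copt.
Proof.
apply: (continuous_adapted_predictable T0) => [w|t tT].
  exact: (ucont_continuous T0 (copt_ucont w)).
have sF := sigma_filt P B t; have cF k := gmeas_cst sF k.
apply: (gmeasB sF); last exact: cF.
apply: (gmeasD sF); first exact: cF.
apply: (gmeasM sF); first exact: cF.
apply: (gmeasB sF); first exact: cF.
exact: logm_adapted.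
Qed.

Lemma copt_integrable : {ae P, forall w, (\int[mu]_(t in `[0%R, T]) (`|copt t w|)%:E < +oo)%E}.
Proof. by apply: nearW => w; have /integrableP[] := tint_ucont T0 (copt_ucont w). Qed.

Local Notation X := (wlth P T B beta x th K copt).

(** With [copt] as consumption the rate is affine in the gap between [h X - Y] and [target]. Hence
    the gap solves a homogeneous linear equation of rate [beta h] and vanishes by [linear_zero]. *)
Lemma optimal_target : {ae P, forall w, forall t : R, 0 <= t <= T -> hh t * X t w - Y t w = target t w}.
Proof.
have WI := wealth_identity T0 hP hB alpha x beta0 pth bth pZ pK copt_predictable pf iZ iK copt_integrable jf Yeq.
apply: filterS (filterI WI (filterI eA Y0)) => w [[uX _ tL tD DE] [[_ AE] Y0w]].
have an := lt0r_neq0 alpha0.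
have uY := continuous_ucont T0 (@cY w).
pose dl t := hh t * X t w - Y t w - target t w.
have ud : ucont T dl by exact: (ucontB T0 (ucontB T0 (ucontM T0 uh uX) uY) (target_ucont w)).
have tbd : tint T (fun s => beta * hh s * dl s) by exact: (tint_ucont T0 (ucontM T0 ubh ud)).
have tb : tint T bh by exact: tint_ucont.
suff dE (t : R) : 0 <= t <= T -> dl t = ti (fun s => beta * hh s * dl s) t.
  move=> t tT; apply/eqP; rewrite -subr_eq0; apply/eqP.
  exact: (linear_zero T0 beta0 ud dE tT).
move=> tT; have [_ tT'] := andP tT.
have t1 := tintZ 2^-1 tL; have t2 := tintZ alpha tbd.
have DT : alpha * ti (drift P T B beta x th K copt f ^~ w) t =
    2^-1 * A t w + alpha * ti (fun s => beta * hh s * dl s) t + ti bh t.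
  rewrite AE -(tiZ alpha tD tT') -(tiZ alpha tbd tT') /qvar -(tiZ 2^-1 tL tT').
  rewrite -(tiD t1 t2 tT') -(tiD (tintD t1 t2) tb tT').
  apply: ti_eq => s /andP[s0 st]; have sT : 0 <= s <= T by rewrite s0 (le_trans st).
  have E := generator_square (hh s) (K s w) (Z s w) (th s w) an; rewrite -!addrA (addrA (alpha / 2 * _)) in E.
  rewrite (cap_eq _ _ E an (f_eq w sT)) -[RHS]addrA; congr (_ + _).
  exact: cap_deviation.
have H := DE t tT; rewrite Y0w DT in H.
exact: (deviation_split an H).
Qed.

Variable p : nat.
Variable WY : R.
Hypothesis p1 : (1 < p)%N.
Hypothesis uAK : forall w, ucont T (AK ^~ w).
Hypothesis aAK : forall t : R, 0 <= t <= T -> filt_measurable t (AK t).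
Hypothesis mAK : forall w, AK 0 w = 0 /\ (forall s t : R, 0 <= s -> s <= t -> t <= T -> AK s w <= AK t w).
Hypothesis eAK : {ae P, forall w, tint T (fun s => sqnorm (K s w)) /\ forall t, AK t w = qvar K t w}.
Hypothesis EY : forall tau, stopping tau ->
  (\int[P]_w (expR (p%:R * alpha * Num.max (Y (tau w) w) 0))%:E <= WY%:E)%E.
Hypothesis var : forall s w, 0 <= s <= T ->
  0 <= dotv (hh s *: K s w) (Z s w + alpha^-1 *: th s w - hh s *: K s w).

Definition logm_neg (s : R) (w : Omega) : R := Num.max (- logm s w) 0.
(** The integral of [K] with the drift correction that makes it a local martingale under the weight
    [M]. *)
Definition girsanov (t : R) (w : Omega) : R := ito P T B K t w - ti (fun s => dotv (L s w) (K s w)) t.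

Lemma logm_neg_ge0 s w : 0 <= logm_neg s w.
Proof. by rewrite le_max lexx orbT. Qed.

Lemma logm_neg_predictable : predictable logm_neg.
Proof.
apply: predictable_max0; apply: predictableN; apply: (continuous_adapted_predictable T0) => [w|t tT].
  exact: (ucont_continuous T0 (logm_ucont w)).
exact: logm_adapted.
Qed.

Lemma logm_neg_tint w : tint T (logm_neg ^~ w).
Proof.
apply: (tint_le (predictable_sec_measurable T0 hP hB w logm_neg_predictable)
  (tint_abs (tint_ucont T0 (logm_ucont w)))) => s sT.
rewrite ger0_norm ?logm_neg_ge0// /logm_neg ge_max normr_ge0 andbT -normrN ler_norm.
by [].
Qed.

Lemma tint_LK w : tint T (fun s => sqnorm (L s w)) -> tint T (fun s => sqnorm (K s w)) ->
  tint T (fun s => dotv (L s w) (K s w)).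
Proof.
move=> tL tK; have tb := tintD (tintZ 2^-1 tL) (tintZ 2^-1 tK).
apply: (tint_le _ tb) => [|s _]; last exact: normr_dotv_le.
apply: (predictable_sec_measurable T0 hP hB (X := fun s w => dotv (L s w) (K s w))).
exact: (predictable_dotv (expo_int_predictable T0 hP hB alpha beta0 pZ pK) pK).
Qed.

(** [optimal_target] expresses [ln M / h] through the wealth and [Y / h]. Of the terms of the
    wealth, the drift plus the correction [L . K] is nonnegative by [var], and consumption is at
    most a constant plus a multiple of [ln^- M]; the rest is [girsanov]. *)
Lemma log_estimate : exists C2 : R, 0 <= C2 /\ {ae P, forall w, forall t : R, 0 <= t <= T ->
  (hh t)^-1 * logm t w <= (hh t)^-1 * (alpha * Num.max (Y t w) 0) + C2 - alpha * girsanov t w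
    + beta * ti (logm_neg ^~ w) t}.
Proof.
have [kl Hkl] := ucont_bounded T0 (ucont_log_h T0 beta0 lambda0).
have tbc := tint_ucont T0 ubh.
have bhT (t : R) : 0 <= t <= T -> 0 <= ti bh t <= beta * T.
  move=> tT; have [t0 tT'] := andP tT.
  have := ti_inc_le tbc (tint_cst T0 beta) (lexx 0) t0 tT' _.
  rewrite !ti0 !subr0 (ti_cst _ t0) => H; apply/andP; split.
    apply: ti_ge0 => s /andP[s0 st]; have sT : 0 <= s <= T by rewrite s0 (le_trans st).
    by apply: mulr_ge0; [exact: ltW|have /andP[/ltW] := h_bounds beta0 sT].
  apply: le_trans (H _) _ => [s /andP[s0 st]|].
    have sT : 0 <= s <= T by rewrite s0 (le_trans st).
    by rewrite ger_pMr//; have /andP[] := h_bounds beta0 sT.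
  by apply: ler_wpM2l => //; exact: ltW.
(* Bound on the deterministic part of [alpha * copt]: the initial term, the integral of [beta h], at
   most [beta * T], and the logarithm. *)
pose kp := `|alpha * d0| + beta * T + `|kl|.
have kp0 : 0 <= kp by rewrite !addr_ge0// mulr_ge0// ltW.
exists (`|alpha * x| + beta * kp * T + (1 + beta * T) * (`|alpha * d0| + beta * T)); split.
  have bT : 0 <= beta * T by rewrite mulr_ge0// ltW.
  apply: addr_ge0; first by apply: addr_ge0 => //; apply: mulr_ge0; [apply: mulr_ge0 => //|]; exact: ltW.
  by apply: mulr_ge0; apply: addr_ge0.
apply: filterS (filterI optimal_target (filterI eA eAK)) => w [DE [[tL _] [tK _]]] t tT.
have [t0 tT'] := andP tT.
have tc := tint_ucont T0 (copt_ucont w).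
have tl := logm_neg_tint w.
have tLK := tint_LK tL tK.
have tKt := tint_dotv T0 hP hB pth bth pK tK.
have /andP[hp h1] := h_bounds beta0 tT.
have an := lt0r_neq0 alpha0.
have bl := bhT t tT; have [b0 b1] := andP bl.
apply: (log_arith alpha0 hp _ (esym (DE t tT)) erefl erefl _ _ _ b0 b1).
- rewrite /h invrK lerD2l; apply: ler_wpM2l; first exact: ltW.
  by rewrite gerBl.
- have tbc' := tintZ beta tc; have t2 := tintZ beta tl.
  rewrite -(tiZ alpha tbc' tT') -(tiZ beta tl tT').
  have t3 := tint_cst T0 (beta * kp).
  have -> : beta * kp * T + ti (fun s => beta * logm_neg s w) t =
    (beta * kp * T - beta * kp * t) + ti (fun s => beta * kp + beta * logm_neg s w) t.
    by rewrite (tiD t3 t2 tT') (ti_cst _ t0) addrA subrK.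
  apply: (@le_trans _ _ (ti (fun s => beta * kp + beta * logm_neg s w) t)); last first.
    rewrite lerDr subr_ge0; apply: ler_wpM2l => //; apply: mulr_ge0 => //; exact: ltW.
  have := ti_inc_le (tintZ alpha tbc') (tintD t3 t2) (lexx 0) t0 tT' _.
  rewrite !ti0 !subr0; apply => s /andP[s0 st]; have sT : 0 <= s <= T by rewrite s0 (le_trans st).
  rewrite mulrCA -mulrDr; apply: ler_wpM2l; first exact: ltW.
  have /andP[c0 c1] := bhT s sT; have := Hkl s sT; rewrite /copt /target.
  have : - logm s w <= logm_neg s w by rewrite le_max lexx.
  move: (ti bh s) (logm s w) (logm_neg s w) (ln _) c0 c1 => b l ln' lo c0 c1 h2 h3.
  have -> : alpha * (d0 + alpha^-1 * (b - l) - alpha^-1 * lo) = alpha * d0 + b - l - lo by field.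
  have h4 : - lo <= `|kl| by apply: le_trans (ler_norm kl); apply: le_trans h3; rewrite -normrN ler_norm.
  have h5 := ler_norm (alpha * d0).
  exact: cap_bound h5 h4 h2 c1.
- rewrite -(tiD tLK tKt tT'); apply: ti_ge0 => s /andP[s0 st].
  have sT : 0 <= s <= T by rewrite s0 (le_trans st).
  have /andP[hs0 _] := h_bounds beta0 sT.
  rewrite (dotv_drift _ _ _ an (lt0r_neq0 hs0)); apply: mulr_ge0; last exact: var.
  by rewrite divr_ge0// ltW.
- by rewrite le_max lexx.
Qed.

(* Instead of a change of measure, [M] is compared with the stochastic
   exponential of [L - eta K], which is [M exp (- eta girsanov - eta^2/2 int |K|^2)]. *)
Lemma girsanov_stopped tau (n : nat) : stopping tau -> (forall w, A (tau w) w <= n%:R) ->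
  (forall w, AK (tau w) w <= n%:R) -> let eta := alpha / n%:R in
  exists E : Omega -> R, [/\ measurable_fun setT E, forall w, 0 <= E w, (\int[P]_w (E w)%:E = 1)%E &
    {ae P, forall w, expR (logm (tau w) w) *
      (1 - eta * girsanov (tau w) w - 2^-1 * eta ^+ 2 * n%:R) <= E w}].
Proof.
move=> st An AKn eta; have tauT := proj1 st.
have [cI aI apI] := ito_spec T0 hP hB pK iK.
have pL := expo_int_predictable T0 hP hB alpha beta0 pZ pK.
have aL := expo_approx T0 hP hB alpha beta0 pZ pK iZ iK.
have cN := expo_continuous T0 hP hB beta0 pZ pK iZ iK (alpha := alpha).
have aN := expo_adapted T0 hP hB alpha beta0 pZ pK iZ iK.
pose eK s w := eta *: K s w.
have peK : predictable_mx eK by apply: (predictable_mxZ (X := fun _ _ => eta)) => //; exact: predictable_cst.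
pose L' s w := L s w - eK s w.
have pL' : predictable_mx L' by exact: predictable_mxB.
pose N' t w := N t w - eta * ito P T B K t w.
have sm H (pH : predictable_mx H) := predictable_smeas T0 hP hB pH.
have aL' : approx L' N' := approxB T0 (sm _ pL) (sm _ peK) aL (approxZ eta (sm _ pK) apI).
have cN' w : {within `[0, T], continuous (fun t : R => N' t w)}.
  apply: (ucont_continuous T0); apply: (ucontB T0); first exact: (continuous_ucont T0 (@cN w)).
  by apply: ucontZ; exact: (continuous_ucont T0 (@cI w)).
have aN' (t : R) : 0 <= t <= T -> filt_measurable t (N' t).
  move=> tT; have sF := sigma_filt P B t; apply: (gmeasB sF); first exact: aN.
  by apply: (gmeasM sF); [exact: (gmeas_cst sF)|exact: aI].
have LK w : tint T (fun s => sqnorm (L s w)) -> tint T (fun s => sqnorm (K s w)) ->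
    tint T (fun s => sqnorm (L' s w)) /\ forall t : R, 0 <= t <= T -> qvar L' t w =
      qvar L t w - 2 * eta * ti (fun s => dotv (L s w) (K s w)) t + eta ^+ 2 * qvar K t w.
  move=> tL tK; have tLK := tint_LK tL tK.
  have t2 := tintZ (2 * eta) tLK; have t3 := tintZ (eta ^+ 2) tK.
  have E s : sqnorm (L' s w) = sqnorm (L s w) - 2 * eta * dotv (L s w) (K s w) + eta ^+ 2 * sqnorm (K s w).
    by rewrite /L' sqnormB /eK dotvZr sqnormZ mulrA.
  have -> : (fun s => sqnorm (L' s w)) = fun s => sqnorm (L s w) - 2 * eta * dotv (L s w) (K s w) + eta ^+ 2 * sqnorm (K s w).
    by apply/funext.
  split; first exact: tintD (tintB tL t2) t3.
  move=> t /andP[_ tT]; rewrite /qvar -(tiZ (2 * eta) tLK tT) -(tiZ (eta ^+ 2) tK tT).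
  rewrite -(tiB tL t2 tT) -(tiD (tintB tL t2) t3 tT); apply: ti_eq => s _; exact: E.
have [|A' [uA' aA' mA' eA']] := clock T0 hP hB pL'.
  apply: filterS (filterI eA eAK) => w [[tL _] [tK _]].
  have /integrableP[_ h] := (LK w tL tK).1.
  rewrite (_ : (\int[mu]_(t in _) _)%E = (\int[mu]_(t in `[0%R, T]) `|(sqnorm (L' t w))%:E|)%E)//.
  by apply: eq_integral => s _; rewrite gee0_abs// lee_fin sqnorm_ge0.
(* The squared norm of a difference is at most twice the sum of the squared norms, so the new
   exponential also has a bounded bracket at [tau], and therefore mean 1. *)
have A'E : {ae P, forall w, N' (tau w) w - 2^-1 * A' (tau w) w =
    logm (tau w) w - eta * girsanov (tau w) w - 2^-1 * (eta ^+ 2 * AK (tau w) w) /\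
    A' (tau w) w <= 2 * n%:R + 2 * eta ^+ 2 * n%:R}.
  apply: filterS (filterI eA (filterI eAK eA')) => w [[tL AE] [[tK AKE] [tL' A'E]]].
  have tT := tauT w; have [t0 tT'] := andP tT; split.
    rewrite A'E (LK w tL tK).2// /logm AE AKE /girsanov /N'.
    by move: (qvar L _ _) (qvar K _ _) (ti _ _) (ito _ _ _ _ _ _) (N _ _) => a b c d e; field.
  rewrite A'E; have := An w; have := AKn w; rewrite AE AKE => hK hL.
  have t1 := tintZ 2 tL; have t2 := tintZ (2 * eta ^+ 2) tK.
  have := ti_inc_le tL' (tintD t1 t2) (lexx 0) t0 tT' _.
  rewrite !ti0 !subr0 (tiD t1 t2 tT') (tiZ 2 tL tT') (tiZ (2 * eta ^+ 2) tK tT') => H.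
  apply: le_trans (H _) _ => [s _|].
    have := sqnorm_le2 (L s w) (- eK s w); rewrite sqnormN /eK sqnormZ.
    by rewrite -mulrA.
  by apply: lerD; apply: ler_wpM2l => //; apply: mulr_ge0 => //; exact: sqr_ge0.
have mE := stoch_exp_stopped_measurable T0 hP hB cN' aN' uA' aA' st.
exists (fun w => stoch_exp N' A' (tau w) w); split => //.
- by move=> w; exact: expR_ge0.
- apply: (stoch_exp_one T0 hP hB pL' aL' cN' aN' uA' aA' eA' _ st); last first.
    by apply: filterS A'E => w [_]; exact.
  by rewrite addr_ge0// mulr_ge0// mulr_ge0// sqr_ge0.
apply: filterS A'E => w [E _]; rewrite /stoch_exp E; exact: exp_lower.
Qed.

Let pL := expo_int_predictable T0 hP hB alpha beta0 pZ pK.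
Let aL := expo_approx T0 hP hB alpha beta0 pZ pK iZ iK.
Let cN w : {within `[0, T], continuous (N ^~ w)} :=
  @expo_continuous _ _ _ _ _ _ _ T0 hP hB alpha _ _ _ beta0 pZ pK iZ iK w.
Let aN (t : R) (tT : 0 <= t <= T) : filt_measurable t (N t) :=
  expo_adapted T0 hP hB alpha beta0 pZ pK iZ iK tT.

Lemma stopped_measurable (V : R -> Omega -> R) tau : stopping tau -> (forall w, ucont T (V ^~ w)) ->
  (forall t : R, 0 <= t <= T -> filt_measurable t (V t)) -> measurable_fun setT (fun w => V (tau w) w).
Proof.
move=> st uV aV; have TT : 0 <= T <= T by rewrite ltW//= lexx.
have h := stopped_adapted T0 st (fun w => ucont_continuous T0 (uV w)) aV TT.
have := filt_measurableT hP hB (lexx T) h; congr measurable_fun; apply/funext => w.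
by rewrite min_r//; have [/(_ w)/andP[]] := st.
Qed.

(** [stopped_weight] brings [M] to the running time, where [M ln^- M <= 1]. *)
Lemma neg_part_stopped tau (n : nat) : stopping tau -> (forall w, A (tau w) w <= n%:R) ->
  (\int[P]_w (M (tau w) w * ti (logm_neg ^~ w) (tau w))%:E <= T%:E)%E.
Proof.
move=> st An; have tauT := proj1 st.
have sP := sigma_pred P T B.
have Ac : {ae P, forall w, A (tau w) w <= n%:R} by apply: nearW.
pose cut s w := if s <= tau w then logm_neg s w else 0.
have pcut : predictable cut by exact: (predictable_cut T0 st logm_neg_predictable).
have cut0 s w : 0 <= cut s w by rewrite /cut; case: ifP => // _; exact: logm_neg_ge0.
have M0 t w : 0 <= M t w by exact: expR_ge0.
have -> : (\int[P]_w (M (tau w) w * ti (logm_neg ^~ w) (tau w))%:E =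
    \int[P]_w \int[mu]_(s in `[0%R, T]) (M (tau w) w * cut s w)%:E)%E.
  apply: eq_integral => w _; have [t0 tT] := andP (tauT w).
  have tk := tint_cut (tau w) (logm_neg_tint w).
  rewrite (ti_EFin (tintZ (M (tau w) w) tk) (lexx T)) (tiZ _ tk (lexx T)).
  by rewrite (ti_stop _ _ t0) min_r.
have := stopped_weight T0 hP hB pL aL cN aN uA aA eA (ler0n _ n) st Ac pcut cut0.
move=> ->; apply: (@le_trans _ _ (\int[P]_w \int[mu]_(s in `[0%R, T]) (1 : R)%:E)%E).
  apply: le_integral_ge0 => w.
    by apply: integral_ge0 => s _; rewrite lee_fin mulr_ge0.
  have pM : predictable M.
    have cM := stoch_exp_continuous T0 cN uA.
    by apply: (continuous_adapted_predictable T0) => //; exact: (stoch_exp_adapted aN aA).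
  have pS : predictable (fun s w => M s w * cut s w).
    by apply: gmeas_predictable; apply: (gmeasM sP); exact: predictable_gmeas.
  have E s : M (Num.min s (tau w)) w * cut s w = M s w * cut s w.
    by rewrite /cut; case: ifP => h; [rewrite min_l|rewrite !mulr0].
  under eq_integral do rewrite E.
  apply: ge0_le_integral => //.
  - by move=> s _; rewrite lee_fin mulr_ge0.
  - by apply/measurable_EFinP; exact: (predictable_sec_measurable T0 hP hB (X := fun s w => M s w * cut s w) w pS).
  move=> s _; rewrite lee_fin /cut; case: ifP => _; last by rewrite mulr0.
  rewrite /logm_neg /stoch_exp -/(logm s w); exact: exp_neg_part.
rewrite (_ : (fun w => _) = fun w => T%:E); last first.
  apply/funext => w; rewrite integral_cst//= mul1e.
  by etransitivity; [exact: lebesgue_measure_itv|rewrite /= lte_fin T0 sube0].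
by rewrite integral_prob_cst.
Qed.

(** Expectation of [utility_arith]. Both [M] and the comparison exponential have mean 1, so the two
    terms of size [n] cancel and the constant does not depend on [n]. *)
Lemma ui_stopped : exists C3 : R, forall tau (n : nat), stopping tau -> (0 < n)%N ->
  (forall w, A (tau w) w <= n%:R) -> (forall w, AK (tau w) w <= n%:R) ->
  (\int[P]_w (M (tau w) w * Num.max (logm (tau w) w) 0)%:E <= C3%:E)%E.
Proof.
have [C2 [C20 LE]] := log_estimate.
pose W := 1 + beta * T.
have bT : 0 <= beta * T by rewrite mulr_ge0// ltW.
have W0 : 0 <= W by rewrite addr_ge0.
pose D := C2 + 2^-1 * alpha ^+ 2.
have D0 : 0 <= D by rewrite addr_ge0// mulr_ge0// sqr_ge0.
exists (2 * (W * WY + W + D + beta * T)) => tau n st n0 An AKn.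
have nR : 0 < n%:R :> R by rewrite ltr0n.
have tauT := proj1 st.
have [E [mE E0 E1 EG]] := girsanov_stopped st An AKn.
have mY : measurable_fun setT (fun w => Y (tau w) w).
  apply: (stopped_measurable st) => [w|t tT]; first exact: (continuous_ucont T0 (@cY w)).
  exact: predictable_adapted pY.
have ml : measurable_fun setT (fun w => logm (tau w) w).
  by apply: (stopped_measurable st) => *; [exact: logm_ucont|exact: logm_adapted].
have mQ : measurable_fun setT (fun w => ti (logm_neg ^~ w) (tau w)).
  apply: (stopped_measurable (V := fun t w => ti (logm_neg ^~ w) t) st) => [w|t tT].
    exact: (ti_ucont T0 (logm_neg_tint w)).
  exact: (ti_adapted tT logm_neg_predictable).
have mM := stoch_exp_stopped_measurable T0 hP hB cN aN uA aA st.
have mL : measurable_fun setT (fun w => Num.max (logm (tau w) w) 0).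
  exact: measurable_maxr.
have mex : measurable_fun setT (fun w => expR (p%:R * alpha * Num.max (Y (tau w) w) 0)).
  apply: measurableT_comp; first exact: measurable_expR.
  apply: measurable_funM => //; exact: measurable_maxr.
have M0 w : 0 <= M (tau w) w by exact: expR_ge0.
have Q0 w : 0 <= ti (logm_neg ^~ w) (tau w) by apply: ti_ge0 => s _; exact: logm_neg_ge0.
have L0 w : 0 <= Num.max (logm (tau w) w) 0 by rewrite le_max lexx orbT.
have M1 : (\int[P]_w (M (tau w) w)%:E = 1)%E.
  apply: (stoch_exp_one T0 hP hB pL aL cN aN uA aA eA (ler0n _ n) st); exact: nearW.
pose a1 w := 2^-1 * (M (tau w) w * Num.max (logm (tau w) w) 0).
pose b0 w := W * expR (p%:R * alpha * Num.max (Y (tau w) w) 0).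
pose b1 w := b0 w + W.
pose b2 w := b1 w + D * M (tau w) w.
pose b3 w := b2 w + n%:R * E w.
pose b4 w := b3 w + beta * (M (tau w) w * ti (logm_neg ^~ w) (tau w)).
have MQ0 w : 0 <= M (tau w) w * ti (logm_neg ^~ w) (tau w) by rewrite mulr_ge0.
have b00 w : 0 <= b0 w by rewrite mulr_ge0// expR_ge0.
have b10 w : 0 <= b1 w by rewrite addr_ge0.
have b20 w : 0 <= b2 w by rewrite addr_ge0// mulr_ge0.
have b30 w : 0 <= b3 w by rewrite addr_ge0// mulr_ge0.
have bQ0 w : 0 <= beta * (M (tau w) w * ti (logm_neg ^~ w) (tau w)) by rewrite mulr_ge0// ltW.
have b40 w : 0 <= b4 w by rewrite addr_ge0.
have ma1 : measurable_fun setT a1 by apply: measurable_funM => //; exact: measurable_funM.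
have mb0 : measurable_fun setT b0 by exact: measurable_funM.
have mb1 : measurable_fun setT b1 by exact: measurable_funD.
have mb2 : measurable_fun setT b2 by apply: measurable_funD => //; exact: measurable_funM.
have mb3 : measurable_fun setT b3 by apply: measurable_funD => //; exact: measurable_funM.
have DM0 w : 0 <= D * M (tau w) w by rewrite mulr_ge0.
have nE0 w : 0 <= n%:R * E w by rewrite mulr_ge0.
have mDM : measurable_fun setT (fun w => D * M (tau w) w) by exact: measurable_funM.
have mnE : measurable_fun setT (fun w => n%:R * E w) by exact: measurable_funM.
have mMQ : measurable_fun setT (fun w => M (tau w) w * ti (logm_neg ^~ w) (tau w)) by exact: measurable_funM.
have mbQ : measurable_fun setT (fun w => beta * (M (tau w) w * ti (logm_neg ^~ w) (tau w))) by exact: measurable_funM.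
have mb4 : measurable_fun setT b4 by exact: measurable_funD.
have a10 w : 0 <= a1 w by rewrite mulr_ge0// mulr_ge0.
have KEY : {ae P, forall w, a1 w + n%:R * M (tau w) w <= b4 w}.
  apply: filterS (filterI LE EG) => w [LEw EGw].
  have tT := tauT w; have /andP[hp h1] := h_bounds beta0 tT.
  rewrite /a1 /b4 /b3 /b2 /b1 /b0 /stoch_exp -/(logm (tau w) w) (mulrCA beta).
  have w1 : 1 <= (hh (tau w))^-1 by rewrite invf_ge1.
  have wW : (hh (tau w))^-1 <= W.
    rewrite /h invrK lerD2l; apply: ler_wpM2l; first exact: ltW.
    by rewrite gerBl; case/andP: tT.
  have Yp : 0 <= Num.max (Y (tau w) w) 0 by rewrite le_max lexx orbT.
  exact: (utility_arith p1 w1 wW Yp alpha0 nR erefl (LEw _ tT) EGw).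
have nM0 w : 0 <= n%:R * M (tau w) w by rewrite mulr_ge0.
have mnM : measurable_fun setT (fun w => n%:R * M (tau w) w) by exact: measurable_funM.
have H := ae_le_integral_EFin (measurable_funD ma1 mnM) mb4 (fun w => addr_ge0 (a10 w) (nM0 w)) b40 KEY.
have I4 : (\int[P]_w (b4 w)%:E <= (W * WY + W + D + n%:R + beta * T)%:E)%E.
  have i0 : (\int[P]_w (b0 w)%:E <= (W * WY)%:E)%E.
    rewrite integralZ_EFin//.
    by rewrite EFinM; apply: lee_wpmul2l; [rewrite lee_fin|exact: EY].
  have i1 : (\int[P]_w (b1 w)%:E <= (W * WY + W)%:E)%E.
    have WW (w : Omega) : 0 <= W by [].
    have mW : measurable_fun setT (fun _ : Omega => W) by exact: measurable_cst.
    rewrite (integralD_EFin P mb0 mW b00 WW) (EFinD (W * WY) W).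
    by apply: leeD => //; rewrite integral_prob_cst.
  have i2 : (\int[P]_w (b2 w)%:E <= (W * WY + W + D)%:E)%E.
    rewrite (integralD_EFin P mb1 mDM b10 DM0) (EFinD (W * WY + W) D); apply: leeD => //.
    by rewrite (integralZ_EFin P mM M0 D0) M1 mule1.
  have i3 : (\int[P]_w (b3 w)%:E <= (W * WY + W + D + n%:R)%:E)%E.
    rewrite (integralD_EFin P mb2 mnE b20 nE0) (EFinD (W * WY + W + D) n%:R); apply: leeD => //.
    by rewrite (integralZ_EFin P mE E0 (ler0n _ n)) E1 mule1.
  rewrite (integralD_EFin P mb3 mbQ b30 bQ0) (EFinD (W * WY + W + D + n%:R) (beta * T)); apply: leeD => //.
  rewrite (integralZ_EFin P mMQ MQ0 (ltW beta0)) EFinM; apply: lee_wpmul2l; first by rewrite lee_fin ltW.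
  exact: (neg_part_stopped st An).
have mMl : measurable_fun setT (fun w => M (tau w) w * Num.max (logm (tau w) w) 0) by exact: measurable_funM.
have Ml0 w : 0 <= M (tau w) w * Num.max (logm (tau w) w) 0 by rewrite mulr_ge0.
have := le_trans H I4; rewrite (integralD_EFin P ma1 mnM a10 nM0) (integralZ_EFin P mM M0 (ler0n _ n)) M1 mule1.
rewrite /a1 (integralZ_EFin P mMl Ml0)//.
rewrite (_ : W * WY + W + D + n%:R + beta * T = W * WY + W + D + beta * T + n%:R); last by ring.
rewrite (EFinD (W * WY + W + D + beta * T) n%:R) leeD2rE// => H2.
have : (2%:E * (2^-1%:E * \int[P]_w (M (tau w) w * Num.max (logm (tau w) w) 0)%:E) <=
  2%:E * (W * WY + W + D + beta * T)%:E)%E by exact: lee_wpmul2l.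
by rewrite muleA -EFinM mulfV// mul1e -EFinM.
Qed.

Let A2 t w := A t w + AK t w.

Lemma clock_ge0 w (t : R) : 0 <= t <= T -> 0 <= A t w /\ 0 <= AK t w.
Proof.
move=> /andP[t0 tT]; have [a0 am] := mA w; have [k0 km] := mAK w.
by rewrite -[X in X <= A t w]a0 -[X in X <= AK t w]k0; split; [exact: am|exact: km].
Qed.

(** Hitting times of the sum of the two clocks bound both at once, and on each path they lie beyond
    [tau] from some index on. Levels start at 1 because [ui_stopped] divides by the level. *)
Lemma localise tau : stopping tau -> exists s_ : nat -> Omega -> R,
  (forall n, [/\ stopping (s_ n), forall w, A (s_ n w) w <= n.+1%:R & forall w, AK (s_ n w) w <= n.+1%:R]) /\
  forall w, exists N0, forall n, (N0 <= n)%N -> s_ n w = tau w.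
Proof.
move=> st; have tauT := proj1 st.
have uA2 w : ucont T (A2 ^~ w) by exact: ucontD.
have mA2 w (s t : R) : 0 <= s -> s <= t -> t <= T -> A2 s w <= A2 t w.
  move=> s0 ts tT; have [_ am] := mA w; have [_ km] := mAK w.
  by apply: lerD; [exact: am|exact: km].
have A20 w : A2 0 w = 0 by rewrite /A2 (proj1 (mA w)) (proj1 (mAK w)) addr0.
have aA2 (t : R) : 0 <= t <= T -> filt_measurable t (A2 t).
  by move=> tT; apply: (gmeasD (sigma_filt P B t)); [exact: aA|exact: aAK].
pose rho n := hitting T A2 n.+1%:R.
have H n := hitting_spec T0 (ler0n R n.+1) uA2 mA2 A20 aA2.
exists (fun n w => Num.min (tau w) (rho n w)); split => [n|w].
  have [rs rA _] := H n; have rT := proj1 rs.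
  have E w : A2 (Num.min (tau w) (rho n w)) w <= n.+1%:R.
    apply: le_trans (rA w); apply: mA2; last by case/andP: (rT w).
      by rewrite le_min; case/andP: (tauT w) => ->; case/andP: (rT w) => ->.
    by rewrite ge_min lexx orbT.
  have sT w : 0 <= Num.min (tau w) (rho n w) <= T.
    by have [/(_ w)] := stopping_min st rs.
  split; first exact: stopping_min.
    move=> w; apply: le_trans (E w); rewrite lerDl; by have [] := clock_ge0 w (sT w).
  move=> w; apply: le_trans (E w); rewrite lerDr; by have [] := clock_ge0 w (sT w).
exists (Num.truncn (A2 T w)).+1 => n hn; have [_ _ rT] := H n.
rewrite min_l//; rewrite /rho rT; first by case/andP: (tauT w).
apply: lt_trans (truncnS_gt _) _; by rewrite ltr_nat ltnS.
Qed.

(** Fatou's lemma along the localising times, the bound of [ui_stopped] being uniform in the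
    level. *)
Lemma log_integrable : exists C3 : R, forall tau, stopping tau ->
  (\int[P]_w (M (tau w) w * Num.max (logm (tau w) w) 0)%:E <= C3%:E)%E.
Proof.
have [C3 H] := ui_stopped; exists C3 => tau st.
have [s_ [sP sE]] := localise st.
have mM t' : stopping t' -> measurable_fun setT (fun w => M (t' w) w * Num.max (logm (t' w) w) 0).
  move=> st'; have ml : measurable_fun setT (fun w => logm (t' w) w).
    by apply: (stopped_measurable st') => *; [exact: logm_ucont|exact: logm_adapted].
  apply: measurable_funM; first exact: (stoch_exp_stopped_measurable T0 hP hB cN aN uA aA st').
  exact: measurable_maxr.
have p0 (t : R) w : 0 <= M t w * Num.max (logm t w) 0.
  by apply: mulr_ge0; [exact: expR_ge0|rewrite le_max lexx orbT].
apply: (fatou_le (P := P) (f_ := fun n w => M (s_ n w) w * Num.max (logm (s_ n w) w) 0)) => //.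
- by move=> n; have [st' _ _] := sP n; exact: mM.
- exact: mM.
- apply: nearW => w; have [N0 HN] := sE w; apply: cvg_near_cst; exists N0 => // n /= /HN ->.
  by [].
by move=> n; have [st' a1 a2] := sP n; exact: (H _ _ st' (ltn0Sn n) a1 a2).
Qed.

Lemma mart_le1 tau : stopping tau -> (\int[P]_w (M (tau w) w)%:E <= 1)%E.
Proof.
move=> st; have [s_ [sP sE]] := localise st.
have mM t' (st' : stopping t') := stoch_exp_stopped_measurable T0 hP hB cN aN uA aA st'.
apply: (fatou_le (P := P) (f_ := fun n w => M (s_ n w) w)) => //.
- by move=> n; have [st' _ _] := sP n; exact: mM.
- exact: mM.
- by move=> n w; exact: expR_ge0.
- by move=> w; exact: expR_ge0.
- apply: nearW => w; have [N0 HN] := sE w; apply: cvg_near_cst; exists N0 => // n /= /HN ->.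
  by [].
move=> n; have [st' a1 _] := sP n.
by rewrite (stoch_exp_one T0 hP hB pL aL cN aN uA aA eA (ler0n _ n.+1) st')//; exact: nearW.
Qed.

Local Notation S := (surplus P T B alpha beta x th K copt Y).
Definition phi (t : R) : R := expR (- ti bh t).
Local Notation s0 := (expR (- alpha * d0)).

Lemma optimal_surplus : {ae P, forall w, forall t : R, 0 <= t <= T -> S t w = s0 * (M t w * phi t)}.
Proof.
have an := lt0r_neq0 alpha0.
apply: filterS optimal_target => w H t tT; rewrite /surplus (H t tT) /target /stoch_exp -/(logm t w) /phi -!expRD.
by congr expR; move: (logm t w) (ti bh t) => a b; field.
Qed.

Lemma phi_le1 (t : R) : 0 <= t <= T -> phi t <= 1.
Proof.
move=> /andP[t0 tT]; rewrite -(expR0 R) ler_expR oppr_le0; apply: ti_ge0 => s /andP[s0 st].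
have sT : 0 <= s <= T by rewrite s0 (le_trans st).
by apply: mulr_ge0; [exact: ltW|have /andP[/ltW] := h_bounds beta0 sT].
Qed.

(** De la Vallee-Poussin's criterion with [x ln^+ x]: where the surplus is at least [s0 exp r], one
    has [ln M >= r], so the surplus is at most [s0 / r] times [M ln^+ M]. The choice of [r] makes
    the mean at most [e]. *)
Lemma optimal_ui : unif_integrable P [set fun w => S (tau w) w | tau in stopping].
Proof.
move=> e e0; have [C3 H] := log_integrable.
pose C := Num.max C3 0 + 1.
have C0 : 0 < C by rewrite ltr_wpDl// le_max lexx orbT.
have s00 : 0 < s0 by exact: expR_gt0.
pose r := s0 * C / e.
have r0 : 0 < r by rewrite divr_gt0// mulr_gt0.
exists (s0 * expR r) => _ [tau st <-]; have tauT := proj1 st.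
have mS : measurable_fun setT (fun w => S (tau w) w).
  exact: (surplus_measurable T0 hP hB alpha x beta0 pth bth pK copt_predictable iK copt_integrable pY cY st).
have mSn : measurable_fun setT (fun w => `|S (tau w) w|) by exact: measurableT_comp.
have mset : measurable [set w | s0 * expR r <= `|S (tau w) w|].
  have := mSn measurableT _ (measurable_itv `[s0 * expR r, +oo[); rewrite setTI; congr measurable.
  by apply/seteqP; split => w /=; rewrite in_itv/= andbT.
rewrite (integral_EFin_setI _ _ mset).
have mMl : measurable_fun setT (fun w => M (tau w) w * Num.max (logm (tau w) w) 0).
  have ml : measurable_fun setT (fun w => logm (tau w) w).
    by apply: (stopped_measurable st) => *; [exact: logm_ucont|exact: logm_adapted].
  apply: measurable_funM; first exact: (stoch_exp_stopped_measurable T0 hP hB cN aN uA aA st).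
  exact: measurable_maxr.
have p0 w : 0 <= M (tau w) w * Num.max (logm (tau w) w) 0.
  by apply: mulr_ge0; [exact: expR_ge0|rewrite le_max lexx orbT].
have k0 : 0 <= s0 / r by rewrite divr_ge0// ltW.
apply: (@le_trans _ _ (\int[P]_w ((s0 / r) * (M (tau w) w * Num.max (logm (tau w) w) 0))%:E)%E).
  apply: ae_le_integral_EFin.
  - by apply: measurable_funM => //; exact: measurable_indic.
  - exact: measurable_funM.
  - by move=> w; rewrite mulr_ge0.
  - by move=> w; rewrite mulr_ge0.
  apply: filterS optimal_surplus => w /(_ _ (tauT w)) E.
  rewrite indicE; case: (boolP (w \in _)) => [|_]; last by rewrite mul0r mulr_ge0.
  rewrite inE /= mul1r ger0_norm ?expR_ge0// E => h.
  have M0 : 0 < M (tau w) w by exact: expR_gt0.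
  have h1 : s0 * (M (tau w) w * phi (tau w)) <= s0 * M (tau w) w.
    by apply: ler_wpM2l; [exact: ltW|apply: ler_piMr; [exact: ltW|exact: phi_le1]].
  have h2 := le_trans h h1; apply: le_trans h1 _; move: h2; rewrite ler_pM2l// ler_expR -/(logm (tau w) w) => rl.
  rewrite -mulrA ler_pM2l// mulrCA ler_peMr//; first exact: ltW.
  by rewrite mulrC ler_pdivlMr// mul1r le_max rl.
rewrite integralZ_EFin//; apply: (@le_trans _ _ ((s0 / r)%:E * C%:E)%E).
  apply: lee_wpmul2l; first by rewrite lee_fin.
  apply: le_trans (H _ st) _; rewrite lee_fin /C.
  by apply: (@le_trans _ _ (Num.max C3 0)); [rewrite le_max lexx|rewrite lerDl].
rewrite -EFinM lee_fin /r; have sn := lt0r_neq0 s00; have cn := lt0r_neq0 C0; have en := lt0r_neq0 e0.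
by rewrite (_ : s0 / (s0 * C / e) * C = e)//; field; rewrite sn cn en.
Qed.

(** For [copt] the consumption cost equals [s0 phi beta h M], and [phi] decreases at rate
    [beta h phi]. As [M] has mean at most 1, the two costs are at most [s0 (1 - phi T)] and
    [s0 phi T]. *)
Lemma optimal_value :
  (\int[P]_w \int[mu]_(u in `[0%R, T]) (expR (- alpha * copt u w))%:E < +oo)%E /\
  (\int[P]_w (S T w)%:E +
    \int[P]_w \int[mu]_(s in `[0%R, T]) (lambda * expR (- alpha * copt s w))%:E <= s0%:E)%E.
Proof.
have an := lt0r_neq0 alpha0; have ln0 := lt0r_neq0 lambda0.
have TT : 0 <= T <= T by rewrite ltW//= lexx.
have s00 : 0 < s0 by exact: expR_gt0.
have sP := sigma_pred P T B.
have pe : predictable (fun s w => lambda * expR (- alpha * copt s w)).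
  apply: gmeas_predictable; apply: (gmeasM sP); first exact: (gmeas_cst sP).
  apply: (gmeas_expR sP); apply: (gmeasM sP); first exact: (gmeas_cst sP).
  exact: (predictable_gmeas copt_predictable).
have e0 s w : 0 <= lambda * expR (- alpha * copt s w) by apply: mulr_ge0 (expR_ge0 _); exact: ltW.
have eE s w : 0 <= s <= T -> lambda * expR (- alpha * copt s w) = s0 * (phi s * (beta * hh s)) * M s w.
  move=> sT; have bh0 : 0 < beta * hh s by rewrite mulr_gt0//; have /andP[] := h_bounds beta0 sT.
  have -> : - alpha * copt s w = - alpha * d0 + - ti bh s + logm s w + ln (beta * hh s / lambda).
    by rewrite /copt /target; move: (ti bh s) (logm s w) (ln _) => a b c; field.
  rewrite /stoch_exp -/(logm s w) /phi; move: (logm s w) (- ti bh s) => l b.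
  have bl : beta * hh s / lambda \is Num.pos by rewrite posrE; exact: divr_gt0.
  rewrite !expRD (lnK bl).
  by move: (expR (- alpha * _)) (expR b) (expR l) => e1 e2 e3; field.
have up : ucont T phi by apply: (ucont_expR T0); apply: ucontN; exact: (ti_ucont T0 (tint_ucont T0 ubh)).
have upb : ucont T (fun s => phi s * (beta * hh s)) by exact: ucontM.
have tpb := tint_ucont T0 upb.
have EC := exp_chain T0 (tint_ucont T0 ubh) TT.
have ph0 s : 0 <= phi s by exact: expR_ge0.
have pb0 s : 0 <= s <= T -> 0 <= phi s * (beta * hh s).
  by move=> sT; apply: mulr_ge0 => //; apply: mulr_ge0; [exact: ltW|have /andP[/ltW] := h_bounds beta0 sT].
have I2 : (\int[P]_w \int[mu]_(s in `[0%R, T]) (lambda * expR (- alpha * copt s w))%:E <=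
    (s0 * (1 - phi T))%:E)%E.
  rewrite (tonelli_time P (predictable_measurable T0 hP hB pe) e0).
  have -> : s0 * (1 - phi T) = ti (fun s => s0 * (phi s * (beta * hh s))) T.
    by rewrite (tiZ s0 tpb (lexx T)) /phi EC opprB addrCA subrr addr0.
  rewrite -(ti_EFin (tintZ s0 tpb) (lexx T)).
  rewrite integral_mkcond [X in (_ <= X)%E]integral_mkcond; apply: le_integral_ge0 => s.
    by rewrite /patch; case: ifP => // _; apply: integral_ge0 => w _; rewrite lee_fin.
  rewrite /patch; case: ifP => //; rewrite inE/= in_itv/= => sT.
  have mMs : measurable_fun setT (M s).
    exact: (stoch_exp_stopped_measurable T0 hP hB cN aN uA aA (stopping_cst P B sT)).
  have c0 : 0 <= s0 * (phi s * (beta * hh s)) by apply: mulr_ge0; [exact: ltW|exact: pb0].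
  under eq_integral do rewrite (eE _ _ sT).
  rewrite (integralZ_EFin P mMs (fun w => expR_ge0 _) c0).
  have := lee_wpmul2l _ (mart_le1 (stopping_cst P B sT)); rewrite -[leRHS]mule1; apply.
  by rewrite lee_fin.
split.
  have ie : (\int[P]_w \int[mu]_(u in `[0%R, T]) (expR (- alpha * copt u w))%:E =
      (lambda^-1)%:E * \int[P]_w \int[mu]_(s in `[0%R, T]) (lambda * expR (- alpha * copt s w))%:E)%E.
    have l0 : (0 <= (lambda^-1)%:E)%E by rewrite lee_fin invr_ge0 ltW.
    rewrite -ge0_integralZl//.
    - apply: eq_integral => w _; rewrite -ge0_integralZl//.
      + by apply: eq_integral => s _; rewrite -EFinM mulrA mulVf// mul1r.
      + by apply/measurable_EFinP; exact: (predictable_sec_measurable T0 hP hB w pe).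
      + by move=> s _; rewrite lee_fin.
    - exact: (time_integral_measurable T0 hP hB pe e0).
    - by move=> w _; apply: integral_ge0 => s _; rewrite lee_fin.
  rewrite ie; apply: le_lt_trans (lee_wpmul2l _ I2) _; first by rewrite lee_fin invr_ge0 ltW.
  by rewrite -EFinM ltey.
have st := stopping_cst P B TT.
have mMT := stoch_exp_stopped_measurable T0 hP hB cN aN uA aA st.
have mS := surplus_measurable T0 hP hB alpha x beta0 pth bth pK copt_predictable iK copt_integrable pY cY st.
have -> : (s0%:E = (s0 * phi T)%:E + (s0 * (1 - phi T))%:E)%E.
  by rewrite -EFinD; congr EFin; ring.
apply: leeD => //.
have k0 : 0 <= s0 * phi T by apply: mulr_ge0 => //; exact: ltW.
have mkM : measurable_fun setT (fun w => s0 * phi T * M T w) by exact: measurable_funM.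
rewrite (ae_eq_integral_EFin mS mkM); last first.
  by apply: filterS optimal_surplus => w /(_ T TT) ->; rewrite -mulrA (mulrC (phi T)).
rewrite (integralZ_EFin P mMT (fun w => expR_ge0 _) k0).
have := lee_wpmul2l _ (mart_le1 st); rewrite -[leRHS]mule1; apply.
by rewrite lee_fin.
Qed.

End optimal.

Lemma signal_arith (R : realType) (q qy yy z a k : R) : 0 <= qy - q -> qy <= 2^-1 * q + 2^-1 * yy ->
  yy <= 2 * z + 2 * a -> a <= k -> q <= 2 * z + 2 * k.
Proof. lra. Qed.

Lemma ae_measurable (R : realType) (disp : measure_display) (Om : measurableType disp)
    (P : probability Om R) (X X' : Om -> R) : measure_is_complete P ->
  measurable_fun setT X -> {ae P, forall w, X w = X' w} -> measurable_fun setT X'.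
Proof.
move=> hP mX [A [mA PA HA]] _ U mU; rewrite setTI.
have mXU : measurable (X @^-1` U) by rewrite -[X in measurable X]setTI; exact: mX.
apply: (measurable_negl hP mXU); exists A; split=> // w /= [h1 h2]; apply: HA => /= E.
  by apply: h2; rewrite -E.
by apply: h2; rewrite E.
Qed.

(** Membership in the closed set is expressed by countably many distances, so that it becomes a
    predictable event along a predictable process. *)
Lemma countable_distance (R : realType) (d : nat) (C : set 'cV[R]_d) (c_ : nat -> 'cV[R]_d) (q : 'cV[R]_d) :
  closed C -> (forall j, C (c_ j)) ->
  (forall q, C q -> exists k_ : nat -> nat, forall i, c_ (k_ j) i 0 @[j --> \oo] --> q i 0) ->
  C q <-> forall n, exists j, sqnorm (q - c_ j) < n.+1%:R^-1.
Proof.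
move=> clC Cc dc; split=> [/dc[k_ kq] n|H].
  have : sqnorm (q - c_ (k_ j)) @[j --> \oo] --> (0 : R).
    rewrite -(@sqnorm0 R d); apply: cvg_big; first exact: add_continuous.
    move=> i _; rewrite !mxE expr2.
    rewrite (_ : (fun k => _) = fun k => (q i 0 - c_ (k_ k) i 0) * (q i 0 - c_ (k_ k) i 0)); last first.
      by apply/funext => k; rewrite !mxE expr2.
    have e : (q i 0 - c_ (k_ j) i 0) @[j --> \oo] --> (0 : R).
      by rewrite -(subrr (q i 0)); apply: cvgB; [exact: cvg_cst|exact: kq].
    exact: (cvgM e e).
  have n0 : 0 < n.+1%:R^-1 :> R by rewrite invr_gt0.
  move=> /cvgrPdist_lt/(_ _ n0)[N _ /(_ N (leqnn N))]; rewrite /= sub0r normrN ger0_norm ?sqnorm_ge0//.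
  by exists (k_ N).
have /choice[k kP] := H; apply: (closed_entrywise clC (fun n => Cc (k n))) => i.
apply/cvgrPdist_lt => e e0.
have e2 : 0 < e ^+ 2 by exact: exprn_gt0.
have [_ [N _ HN]] : True /\ \forall j \near \oo, j.+1%:R^-1 < e ^+ 2 :> R.
  by split=> //; exact: (near_infty_natSinv_lt (PosNum e2)).
exists N => // n Nn /=; rewrite -(@ltr_pXn2r _ 2)// ?nnegrE// ?(ltW e0)// real_normK ?num_real//.
apply: lt_trans (HN n Nn); apply: le_lt_trans (kP n).
rewrite /sqnorm (bigD1 i)//= !mxE lerDl; apply: sumr_ge0 => *; exact: sqr_ge0.
Qed.

Lemma exp_combine (R : realType) (a u v : R) : expR (- a * u) * expR (a * v) = expR (- a * (u - v)).
Proof. by rewrite -expRD; congr expR; ring. Qed.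

(** * The market *)

Section market.
Context (R : realType) (disp : measure_display) (Omega : measurableType disp).
Context (P : probability Omega R) (T : R) (d m : nat) (alpha beta lambda : R).
Variables (B : R -> Omega -> 'cV[R]_m) (b : R -> Omega -> 'cV[R]_d) (sigma : R -> Omega -> 'M[R]_(d, m)).
Variables (C : set 'cV[R]_d) (F : Omega -> R) (p : nat) (eps : R) (Y : R -> Omega -> R) (Z : R -> Omega -> 'cV[R]_m).
Hypotheses (hT : 0 < T) (halpha : 0 < alpha) (hbeta : 0 < beta) (hlambda : 0 < lambda).
Hypotheses (hP : measure_is_complete P) (hB : brownian_motion P T B).
Hypotheses (hb : predictable_mx P T B b) (hs : predictable_mx P T B sigma).
Hypothesis hss : forall (t : R) w, 0 <= t <= T -> sigma t w *m (sigma t w)^T \in unitmx.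
Hypothesis hth : bounded_process T (theta b sigma).
Hypotheses (hCclosed : closed C) (hCconv : @convex_set R 'cV[R]_d C) (hC0 : C 0).
Hypothesis hYZ : bsde_solution P T B F (generator T b sigma alpha beta lambda C) Y Z.
Variable x : R.

Local Notation mu := (@lebesgue_measure R).
Local Notation hh := (h T beta).
Local Notation th := (theta b sigma).
Local Notation f := (fun t w => generator T b sigma alpha beta lambda C t w (Y t w) (Z t w)).
Local Notation y := (fun t w => Z t w + alpha^-1 *: th t w).

Lemma theta_predictable : predictable_mx P T B th.
Proof.
have pss : predictable_mx P T B (fun t w => sigma t w *m (sigma t w)^T).
  exact: predictable_mulmx hs (predictable_trmx hs).
exact: predictable_mulmx (predictable_mulmx (predictable_trmx hs) (predictable_invmx pss hss)) hb.
Qed.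

Lemma theta_bounded : exists k, forall t w, 0 <= t <= T -> sqnorm (th t w) <= k.
Proof.
have [k Hk] := hth; exists (m%:R * k ^+ 2) => t w tT; apply: sqnorm_bound => i; exact: Hk.
Qed.

Let pZ : predictable_mx P T B Z. Proof. by have [[]] := hYZ. Qed.
Let pY : predictable P T B Y. Proof. by have [[]] := hYZ. Qed.

Lemma signal_predictable : predictable_mx P T B y.
Proof.
apply: predictable_mxD pZ _; apply: (predictable_mxZ (X := fun _ _ => alpha^-1)).
  exact: predictable_cst.
exact: theta_predictable.
Qed.

Lemma best_portfolio : exists pi : R -> Omega -> 'cV[R]_d, predictable_mx P T B pi /\
  forall t w, 0 <= t <= T -> C (pi t w) /\
    forall q, C q -> fit (sigma t w) (hh t) (y t w) (pi t w) <= fit (sigma t w) (hh t) (y t w) q.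
Proof.
apply: (selection hCclosed hCconv hC0 hs _ signal_predictable _ hss) => [|t tT].
  by apply: predictable_time => //; exact: h_ucont.
exact: h_neq0.
Qed.

Lemma inf_fit_le t w q : C q ->
  inf [set sqnorm (hh t *: ((sigma t w)^T *m v) - y t w) | v in C] <= fit (sigma t w) (hh t) (y t w) q.
Proof.
move=> Cq; apply: ge_inf; last by exists q.
by exists 0 => _ [v _ <-]; exact: sqnorm_ge0.
Qed.

Section best.
Variable pi : R -> Omega -> 'cV[R]_d.
Hypothesis ppi : predictable_mx P T B pi.
Hypothesis Cpi : forall t w, 0 <= t <= T -> C (pi t w).
Hypothesis best : forall t w, 0 <= t <= T ->
  forall q, C q -> fit (sigma t w) (hh t) (y t w) (pi t w) <= fit (sigma t w) (hh t) (y t w) q.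
Local Notation K := (fun t w => (sigma t w)^T *m pi t w).

(** The infimum is attained at the selected portfolio. This formula is also where the predictability
    of the generator comes from. *)
Lemma generator_best s w : 0 <= s <= T -> f s w =
  alpha / 2 * sqnorm (hh s *: K s w - y s w) - dotv (Z s w) (th s w)
    - (2 * alpha)^-1 * sqnorm (th s w) - beta * hh s * Y s w
    - beta * hh s / alpha * (ln (beta * hh s / lambda) - 1).
Proof.
move=> sT; rewrite /generator; congr (_ * _ - _ - _ - _ - _).
apply/eqP; rewrite eq_le; apply/andP; split; first exact: (inf_fit_le s w (Cpi w sT)).
apply: lb_le_inf.
  by exists (fit (sigma s w) (hh s) (y s w) 0), 0.
by move=> _ [v Cv <-]; exact: best.
Qed.

Lemma hsigmaC_convex t w : @convex_set R 'cV[R]_m (hsigmaC T sigma beta C t w).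
Proof.
move=> u v l; rewrite !inE => -[q Cq <-] [r Cr <-].
have := hCconv l (mem_set Cq) (mem_set Cr); rewrite inE => Cqr.
exists (conv l (q : convex_lmodType 'cV[R]_d) r) => //.
rewrite /conv/= mulmxDr -!scalemxAr scalerDr !scalerA.
by rewrite ![hh t * _]mulrC.
Qed.

Lemma best_min t w : 0 <= t <= T -> forall r, hsigmaC T sigma beta C t w r ->
  sqnorm (hh t *: K t w - y t w) <= sqnorm (r - y t w).
Proof. by move=> tT _ [q Cq <-]; exact: best. Qed.

Lemma best_Proj t w : 0 <= t <= T -> hh t *: K t w = Proj (hsigmaC T sigma beta C t w) (y t w).
Proof.
move=> tT; apply: esym; apply: Proj_unique.
- exact: hsigmaC_convex.
- by exists (pi t w) => //; exact: Cpi.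
move=> r hr; rewrite -(sqnormN (_ - _)) opprB -[X in _ <= X]sqnormN opprB; exact: best_min.
Qed.

Lemma best_variational t w : 0 <= t <= T ->
  0 <= dotv (hh t *: K t w) (y t w - hh t *: K t w).
Proof.
move=> tT; apply: (variational (hsigmaC_convex (t := t) (w := w))).
- by exists 0 => //; rewrite mulmx0 scaler0.
- by exists (pi t w) => //; exact: Cpi.
exact: best_min.
Qed.

Lemma best_exposure_predictable : predictable_mx P T B K.
Proof. exact: predictable_mulmx (predictable_trmx hs) ppi. Qed.

(** For [q = h K] the variational inequality bounds the squared norm of [q] by [q . y], hence by the
    squared norm of [y]. As [1 / h <= 1 + beta T], the exposure inherits square integrability from
    [Z] and the bounded [theta]. *)
Lemma best_exposure_integrable :
  {ae P, forall w, (\int[mu]_(t in `[0%R, T]) (sqnorm (K t w))%:E < +oo)%E}.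
Proof.
have [_ _ iZ _ _] := hYZ; have [k Hk] := theta_bounded.
have pK := best_exposure_predictable.
apply: filterS iZ => w iZw; have tZ := qvar_tint hT hP hB pZ iZw.
pose W := (1 + beta * T) ^+ 2.
have tb := tintD (tintZ (W * 2) tZ) (tint_cst hT (W * 2 * (alpha^-1 ^+ 2 * k))).
have mK : measurable_fun (`[0, T]%classic : set (measurableTypeR R)) (fun s => sqnorm (K s w)).
  apply: (predictable_sec_measurable hT hP hB (X := fun s w => sqnorm (K s w))).
  exact: predictable_sqnorm pK.
have : tint T (fun s => sqnorm (K s w)).
  apply: (tint_le mK tb) => s sT; rewrite ger0_norm ?sqnorm_ge0//.
  have /andP[h0 h1] := h_bounds hbeta sT; have hn := lt0r_neq0 h0.
  have H := best_variational w sT; rewrite dotvBr dotvv in H.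
  have H2 := dotv_le (hh s *: K s w) (y s w).
  have H3 := sqnorm_le2 (Z s w) (alpha^-1 *: th s w); rewrite sqnormZ in H3.
  have H4 : alpha^-1 ^+ 2 * sqnorm (th s w) <= alpha^-1 ^+ 2 * k.
    by apply: ler_wpM2l; [exact: sqr_ge0|exact: Hk].
  have -> : sqnorm (K s w) = (hh s)^-1 ^+ 2 * sqnorm (hh s *: K s w).
    by rewrite sqnormZ mulrA -exprMn mulVf// expr1n mul1r.
  have wW : (hh s)^-1 <= 1 + beta * T.
    rewrite /h invrK lerD2l; apply: ler_wpM2l; first exact: ltW.
    by rewrite gerBl; case/andP: sT.
  have w0 : 0 <= (hh s)^-1 by rewrite invr_ge0 ltW.
  have W2 : (hh s)^-1 ^+ 2 <= W by rewrite /W !expr2; exact: ler_pM.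
  have W0 : 0 <= W by exact: sqr_ge0.
  apply: (@le_trans _ _ (W * sqnorm (hh s *: K s w))).
    by apply: ler_wpM2r => //; exact: sqnorm_ge0.
  have -> : W * 2 * sqnorm (Z s w) + W * 2 * (alpha^-1 ^+ 2 * k) =
      W * (2 * sqnorm (Z s w) + 2 * (alpha^-1 ^+ 2 * k)) by rewrite -!(mulrA W) -mulrDr.
  clearbody W; apply: ler_wpM2l => //.
  move: H H2 H3 H4; exact: signal_arith.
by move=> /integrableP[_]; congr (_ < _)%E; apply: eq_integral => s _; rewrite /= ger0_norm ?sqnorm_ge0.
Qed.

End best.

(* The constraint is only assumed for each fixed time; Fubini transfers it to
   almost every time along almost every path. *)
Lemma constraint_ae (pi : R -> Omega -> 'cV[R]_d) : predictable_mx P T B pi ->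
  (forall t : R, 0 <= t <= T -> {ae P, forall w, C (pi t w)}) ->
  {ae P, forall w, {ae mu, forall s : R, 0 <= s <= T -> C (pi s w)}}.
Proof.
move=> ppi Cpi; have sP := sigma_pred P T B.
have [c_ [Cc dc]] := countable_dense hC0.
pose G := \bigcap_n \bigcup_j [set z : R * Omega | sqnorm (pi z.1 z.2 - c_ j) < n.+1%:R^-1].
have GC s w : G (s, w) <-> C (pi s w).
  rewrite (countable_distance _ hCclosed Cc dc); split => [H n|H n _].
    by have [j _ hj] := H n I; exists j.
  by have [j hj] := H n; exists j.
have pG : pred_alg P T B G.
  apply: (gset_bigcap sP) => n; apply: (gset_bigcup sP) => j.
  apply: (gset_lt sP _ (gmeas_cst sP _)).
  have pc : predictable_mx P T B (fun _ _ => c_ j) by exact: predictable_mx_cst.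
  exact: (predictable_gmeas (predictable_sqnorm (predictable_mxB ppi pc))).
have pX := predictable_indic (gsetC sP pG).
have X0 s w : 0 <= (\1_(~` G) (s, w) : R) by [].
have mX := time_integral_measurable hT hP hB pX X0.
have E0 : (\int[P]_w \int[mu]_(s in `[0%R, T]) (\1_(~` G) (s, w))%:E = 0)%E.
  rewrite (tonelli_time P (predictable_measurable hT hP hB pX) X0).
  apply: integral0_eq => s /=; rewrite in_itv/= => sT.
  have mXs : measurable_fun setT (fun w => \1_(~` G) (s, w) : R).
    have /andP[_ sT'] := sT.
    exact: (filt_measurableT hP hB sT' (predictable_adapted sT pX)).
  have -> : 0%E = (\int[P]_w ((fun=> 0) w)%:E)%E by rewrite integral_prob_cst.
  apply: ae_eq_integral_EFin => //; apply: filterS (Cpi s sT) => w Cw.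
  by rewrite indicE memNset// => h; apply: h; apply/GC.
have g0 w : (0 <= \int[mu]_(s in `[0%R, T]) (\1_(~` G) (s, w))%:E)%E.
  by apply: integral_ge0 => s _; rewrite lee_fin.
have := ae_eq_integral_abs P measurableT mX; move=> -[H _].
have H0 : (\int[P]_w `|\int[mu]_(s in `[0%R, T]) (\1_(~` G) (s, w))%:E| = 0)%E.
  by rewrite -E0; apply: eq_integral => w _; rewrite gee0_abs.
apply: filterS (H H0) => w /(_ I) /= Iw.
have mw := predictable_sec_measurable hT hP hB w pX.
have mwE : measurable_fun (`[0, T]%classic : set (measurableTypeR R)) (fun s => (\1_(~` G) (s, w) : R)%:E).
  exact/measurable_EFinP.
have := @ae_eq_integral_abs _ _ _ mu `[0, T]%classic (measurable_itv _) _ mwE.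
move=> -[H2 _]; have H3 : (\int[mu]_(s in `[0%R, T]) `|(\1_(~` G) (s, w))%:E| = 0)%E.
  by rewrite -[RHS]Iw; apply: eq_integral => s _; rewrite gee0_abs// lee_fin.
have [N [mN N0 HN]] := H2 H3; exists N; split=> // s /= nC; apply: HN => /= h; apply: nC => sT.
have := h; rewrite in_itv/= => /(_ sT) [] /eqP; rewrite indicE.
case: (boolP ((s, w) \in ~` G)) => [_|/negP nG _]; first by rewrite oner_eq0.
by apply/GC; apply: contrapT => ng; apply: nG; exact/mem_set.
Qed.

Let jf : {ae P, forall w, (\int[mu]_(t in `[0%R, T]) (`|f t w|)%:E < +oo)%E}.
Proof. by have [] := hYZ. Qed.
Let iZ : {ae P, forall w, (\int[mu]_(t in `[0%R, T]) (sqnorm (Z t w))%:E < +oo)%E}.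
Proof. by have [] := hYZ. Qed.
Let cY : forall w, {within `[0, T], continuous (fun t : R => Y t w)}.
Proof. by have [] := hYZ. Qed.
Let Yeq : {ae P, forall w, forall t : R, 0 <= t <= T ->
   Y t w = F w + \int[mu]_(s in `[t, T]) f s w - (ito P T B Z T w - ito P T B Z t w)}.
Proof. by have [] := hYZ. Qed.

Lemma Y_terminal : {ae P, forall w, Y T w = F w}.
Proof.
have TT : 0 <= T <= T by rewrite ltW//= lexx.
apply: filterS Yeq => w /(_ T TT) ->.
by rewrite subrr subr0 set_itv1 Rintegral_set1 addr0.
Qed.

Lemma generator_predictable : predictable P T B f.
Proof.
have [pi [ppi H]] := best_portfolio; have sP := sigma_pred P T B.
have Cpi t w tT := (H t w tT).1; have best t w tT := (H t w tT).2.
have pK := best_exposure_predictable ppi.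
have ph : predictable P T B (fun s _ => hh s) by apply: predictable_time => //; exact: h_ucont.
have pl : predictable P T B (fun s _ => ln (beta * hh s / lambda)).
  by apply: predictable_time => //; exact: ucont_log_h.
have cP k := gmeas_cst sP k.
apply: (@predictable_eq _ _ _ _ _ _ _ (fun s w =>
  alpha / 2 * sqnorm (hh s *: ((sigma s w)^T *m pi s w) - y s w) - dotv (Z s w) (th s w)
    - (2 * alpha)^-1 * sqnorm (th s w) - beta * hh s * Y s w
    - beta * hh s / alpha * (ln (beta * hh s / lambda) - 1))); last first.
  by move=> s w sT; rewrite (generator_best Cpi best).
have g1 := predictable_gmeas (predictable_sqnorm (predictable_mxB (predictable_mxZ ph pK) signal_predictable)).
have g2 := predictable_gmeas (predictable_dotv pZ theta_predictable).
have g3 := predictable_gmeas (predictable_sqnorm theta_predictable).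
have gh := predictable_gmeas ph.
apply: gmeas_predictable.
apply: (gmeasB sP); first apply: (gmeasB sP); first apply: (gmeasB sP); first apply: (gmeasB sP).
- by apply: (gmeasM sP).
- by [].
- by apply: (gmeasM sP).
- apply: (gmeasM sP); last exact: (predictable_gmeas pY).
  by apply: (gmeasM sP).
apply: (gmeasM sP).
  by apply: (gmeasM sP) => //; apply: (gmeasM sP).
by apply: (gmeasB sP) => //; exact: (predictable_gmeas pl).
Qed.

Local Notation X pi c := (wealth P T B b sigma beta x pi c).
Local Notation S pi c := (surplus P T B alpha beta x th (fun t w => (sigma t w)^T *m pi t w) c Y).

Lemma surplusE (pi : R -> Omega -> 'cV[R]_d) (c : R -> Omega -> R) (t : R) w :
  S pi c t w = expR (- alpha * hh t * X pi c t w) * expR (alpha * Y t w).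
Proof. by rewrite -expRD /surplus mulrBr mulrA [- alpha * Y t w]mulNr opprK. Qed.

(** Since [h T = 1] and [Y T = F] almost surely, the terminal cost is the surplus at [T]. Both costs
    are nonnegative, so the integral splits, infinite values included. *)
Lemma objectiveE (pi : R -> Omega -> 'cV[R]_d) (c : R -> Omega -> R) :
  predictable_mx P T B pi -> predictable P T B c ->
  {ae P, forall w, (\int[mu]_(t in `[0%R, T]) (sqnorm ((sigma t w)^T *m pi t w))%:E < +oo)%E} ->
  {ae P, forall w, (\int[mu]_(t in `[0%R, T]) (`|c t w|)%:E < +oo)%E} ->
  objective P T B b sigma alpha beta lambda F x pi c =
  (- (\int[P]_w (S pi c T w)%:E +
     \int[P]_w \int[mu]_(s in `[0%R, T]) (lambda * expR (- alpha * c s w))%:E))%E.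
Proof.
move=> ppi pc iK ic; have TT : 0 <= T <= T by rewrite ltW//= lexx.
have sP := sigma_pred P T B.
have pK := best_exposure_predictable ppi.
have mS := surplus_measurable hT hP hB alpha x hbeta theta_predictable theta_bounded pK pc iK ic pY cY
  (stopping_cst P B TT).
have SE : {ae P, forall w, S pi c T w = expR (- alpha * (X pi c T w - F w))}.
  apply: filterS Y_terminal => w YT; rewrite surplusE h_final mulr1 YT; exact: exp_combine.
have mE := ae_measurable hP mS SE.
have pe : predictable P T B (fun s w => lambda * expR (- alpha * c s w)).
  apply: gmeas_predictable; apply: (gmeasM sP); first exact: (gmeas_cst sP).
  apply: (gmeas_expR sP); apply: (gmeasM sP); first exact: (gmeas_cst sP).
  exact: (predictable_gmeas pc).
have e0 s w : 0 <= lambda * expR (- alpha * c s w) by apply: mulr_ge0 (expR_ge0 _); exact: ltW.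
have mG := time_integral_measurable hT hP hB pe e0.
have G0 w : (0 <= \int[mu]_(s in `[0%R, T]) (lambda * expR (- alpha * c s w))%:E)%E.
  by apply: integral_ge0 => s _; rewrite lee_fin.
have mEE : measurable_fun setT (fun w => (expR (- alpha * (X pi c T w - F w)))%:E) by exact/measurable_EFinP.
have E0 w : (0 <= (expR (- alpha * (X pi c T w - F w)))%:E)%E by rewrite lee_fin expR_ge0.
rewrite (ae_eq_integral_EFin mS mE SE).
rewrite -(ge0_integralD P measurableT (fun w _ => E0 w) mEE (fun w _ => G0 w) mG).
rewrite -integral_ge0N; last by move=> w _; apply: adde_ge0 => //; rewrite lee_fin expR_ge0.
by apply: eq_integral => w _; apply: esym; apply: oppeD; exact: fin_num_adde_defr.
Qed.

Variable y0 : R.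
Hypothesis Y0 : {ae P, forall w, Y 0 w = y0}.
Local Notation s0 := (expR (- alpha * (hh 0 * x - y0))).

Lemma surplus_initial (pi : R -> Omega -> 'cV[R]_d) (c : R -> Omega -> R) :
  predictable_mx P T B pi ->
  {ae P, forall w, (\int[mu]_(t in `[0%R, T]) (sqnorm ((sigma t w)^T *m pi t w))%:E < +oo)%E} ->
  {ae P, forall w, S pi c 0 w = s0}.
Proof.
move=> ppi iK; have pK := best_exposure_predictable ppi.
have [_ _ apI] := ito_spec hT hP hB pK iK.
apply: filterS (filterI Y0 (approx_initial hT apI)) => w [Yw I0].
by rewrite /surplus /wlth I0 !ti0 Yw !addr0 subr0.
Qed.

(** The infimum over [C] in the generator is below its value at any admissible portfolio, which is
    [gen_le]; [constraint_ae] provides the constraint along paths. *)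
Lemma admissible_bound (pi : R -> Omega -> 'cV[R]_d) (c : R -> Omega -> R) :
  admissible P T B b sigma alpha beta C Y x (pi, c) ->
  (objective P T B b sigma alpha beta lambda F x pi c <= (- s0)%:E)%E.
Proof.
move=> [[ppi pc] [iK ic] Cpi iE ui]; rewrite objectiveE// EFinN leeN2.
have pK := best_exposure_predictable ppi.
have pL := expo_int_predictable hT hP hB alpha hbeta pZ pK.
have [|A [uA aA mA eA]] := clock hT hP hB pL.
  have WI := wealth_identity hT hP hB alpha x hbeta theta_predictable theta_bounded pZ pK pc
    generator_predictable iZ iK ic jf Yeq.
  apply: filterS WI => w [_ _ /integrableP[_ h] _ _]; move: h; congr (_ < _)%E.
  by apply: eq_integral => s _; rewrite /= ger0_norm ?sqnorm_ge0.
apply: (upper_bound hT hP hB hbeta theta_predictable theta_bounded pZ pK pc generator_predictable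
  iZ iK ic jf Yeq halpha pY cY hlambda uA aA eA mA iE _ (expR_ge0 _) (surplus_initial c ppi iK)).
- apply: filterS (constraint_ae ppi Cpi) => w [N0 [mN N00 HN]]; exists N0; split=> // s /= ns.
  apply: HN => /= H; apply: ns => sT; rewrite /gen_le /generator; do 4 apply: lerB => //.
  by apply: ler_wpM2l; [rewrite divr_ge0// ltW|exact: (inf_fit_le s w (H sT))].
move=> e e0; have [k Hk] := ui e e0; exists k => _ [tau st <-].
apply: (Hk (fun w => S pi c (tau w) w)); exists tau => //; apply/funext => w.
by rewrite surplusE.
Qed.

Hypothesis hp : (1 < p)%N.
Hypothesis hYZc : bsde_class P T (p%:R * alpha) eps Y Z.

(** The value at a stopping time is below the supremum controlled by [bsde_class]; that supremum is
    over a bounded set because paths are continuous on [[0, T]]. *)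
Lemma exponential_moment : exists WY : R, forall tau, stopping_time P T B tau ->
  (\int[P]_w (expR (p%:R * alpha * Num.max (Y (tau w) w) 0))%:E <= WY%:E)%E.
Proof.
have := hYZc; rewrite /bsde_class; set E := (\int[P]_w _)%E => Elt.
have E0 : (0 <= E)%E.
  apply: integral_ge0 => w _; apply: adde_ge0; first by apply: adde_ge0; rewrite lee_fin expR_ge0.
  by apply: integral_ge0 => s _; rewrite lee_fin sqnorm_ge0.
exists (fine E) => tau st; rewrite fineK ?ge0_fin_numE//; apply: le_integral_ge0 => w.
  by rewrite lee_fin expR_ge0.
rewrite -[leLHS]adde0; apply: leeD; last first.
  by apply: integral_ge0 => s _; rewrite lee_fin sqnorm_ge0.
rewrite -[leLHS]adde0; apply: leeD; last by rewrite lee_fin expR_ge0.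
rewrite lee_fin ler_expR; apply: ler_wpM2l; first by rewrite mulr_ge0// ltW.
have tT := (proj1 st) w; apply: sup_ubound; last by exists (tau w) => //; rewrite /= in_itv.
have [k Hk] := ucont_bounded hT (continuous_ucont hT (@cY w)).
exists `|k| => _ [t /= + <-]; rewrite in_itv/= => /Hk kt.
by rewrite ge_max normr_ge0 andbT (le_trans (ler_norm _))// (le_trans kt)// ler_norm.
Qed.

Theorem optimal_pair : exists (pi : R -> Omega -> 'cV[R]_d) (c : R -> Omega -> R),
  [/\ admissible P T B b sigma alpha beta C Y x (pi, c),
      (objective P T B b sigma alpha beta lambda F x pi c >= (- s0)%:E)%E,
      forall t : R, 0 <= t <= T -> {ae P, forall w, hh t *: ((sigma t w)^T *m pi t w) =
          Proj (hsigmaC T sigma beta C t w) (y t w)} &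
      forall t : R, 0 <= t <= T -> {ae P, forall w, c t w = hh t * X pi c t w - Y t w
          - alpha^-1 * ln (beta * hh t / lambda)}].
Proof.
have [pi [ppi H]] := best_portfolio.
have Cpi t w tT := (H t w tT).1; have best t w tT := (H t w tT).2.
have pK := best_exposure_predictable ppi.
have iK := best_exposure_integrable ppi Cpi best.
have pth := theta_predictable; have bth := theta_bounded; have pf := generator_predictable.
have f_eq s w sT := generator_best Cpi best w sT (s := s).
have var s w sT := best_variational Cpi best w sT (t := s).
have pL := expo_int_predictable hT hP hB alpha hbeta pZ pK.
have c0 : predictable P T B (fun _ _ => 0 : R) by exact: predictable_cst.
have [AK [uAK aAK mAK eAK]] := clock hT hP hB pK iK.
have [|A [uA aA mA eA]] := clock hT hP hB pL.
  apply: filterS (filterI iZ iK) => w [iZw iKw].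
  have := tint_expo_int hT hP hB alpha hbeta pZ pK (qvar_tint hT hP hB pK iKw) (qvar_tint hT hP hB pZ iZw).
  by move=> /integrableP[_]; congr (_ < _)%E; apply: eq_integral => s _; rewrite /= ger0_norm ?sqnorm_ge0.
have [WY EY] := exponential_moment.
have pc := copt_predictable hT hP hB alpha x y0 hbeta hlambda pZ pK iZ iK uA aA.
have ic := copt_integrable hT hP hB alpha x y0 hbeta hlambda pZ pK iZ iK uA.
have OT := optimal_target hT hP hB x halpha hbeta hlambda pth bth pZ pK pf iZ iK jf Yeq cY Y0 f_eq uA aA eA.
have ui := optimal_ui hT hP hB x halpha hbeta hlambda pth bth pZ pK pf iZ iK jf Yeq pY cY Y0 f_eq
  uA aA mA eA hp uAK aAK mAK eAK EY var.
have [iE OV] := optimal_value hT hP hB x halpha hbeta hlambda pth bth pZ pK pf iZ iK jf Yeq pY cY Y0 f_eq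
  uA aA mA eA uAK aAK mAK.
set c := copt _ _ _ _ _ _ _ _ _ _ _ in pc ic OT ui iE OV.
exists pi, c; split.
- split=> //.
    by move=> t tT; apply: nearW => w; exact: Cpi.
  move=> e e0; have [k Hk] := ui e e0; exists k => _ [tau st <-].
  apply: (Hk (fun w => expR (- alpha * hh (tau w) * X pi c (tau w) w) * expR (alpha * Y (tau w) w))).
  by exists tau => //; apply/funext => w; rewrite -surplusE.
- by rewrite objectiveE// EFinN leeN2.
- by move=> t tT; apply: nearW => w; exact: best_Proj.
- move=> t tT; apply: filterS OT => w /(_ t tT) E.
  rewrite [hh t * X pi c t w - _]E; reflexivity.
Qed.

End market.

Theorem theorem7p5 (R : realType) (disp : measure_display)
  (Omega : measurableType disp) (P : probability Omega R)
  (T : R) (d m : nat) (alpha beta lambda : R)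
  (B : R -> Omega -> 'cV[R]_m)
  (b : R -> Omega -> 'cV[R]_d) (sigma : R -> Omega -> 'M[R]_(d, m))
  (C : set 'cV[R]_d) (F : Omega -> R) (p : nat) (eps : R)
  (Y : R -> Omega -> R) (Z : R -> Omega -> 'cV[R]_m)
  (hT : 0 < T) (hd : (1 <= d)%N) (hdm : (d <= m)%N)
  (halpha : 0 < alpha) (hbeta : 0 < beta) (hlambda : 0 < lambda)
  (hP : measure_is_complete P)
  (hB : brownian_motion P T B)
  (hb : predictable_mx P T B b) (hbb : bounded_process T b)
  (hs : predictable_mx P T B sigma) (hsb : bounded_process T sigma)
  (hss : forall (t : R) w, 0 <= t <= T -> sigma t w *m (sigma t w)^T \in unitmx)
  (hth : bounded_process T (theta b sigma))
  (hCclosed : closed C) (hCconv : @convex_set R 'cV[R]_d C) (hC0 : C 0)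
  (hF : filt_measurable P B T F) (hp : (1 < p)%N) (heps : 0 < eps)
  (hFp : ('E_P[fun w => (expR (p%:R * alpha * Num.max (F w) 0))%R] < +oo)%E)
  (hFm : ('E_P[fun w => (expR (eps * Num.max (- F w) 0))%R] < +oo)%E)
  (hYZ : bsde_solution P T B F
           (generator T b sigma alpha beta lambda C) Y Z)
  (hYZc : bsde_class P T (p%:R * alpha) eps Y Z)
  (x : R) :
  {ae P, forall w,
     value P T B b sigma alpha beta lambda C F Y x =
     (- expR (- alpha * (h T beta 0 * x - Y 0 w)))%:E} /\
  exists (pi : R -> Omega -> 'cV[R]_d) (c : R -> Omega -> R),
    [/\ admissible P T B b sigma alpha beta C Y x (pi, c),
        objective P T B b sigma alpha beta lambda F x pi c =
          value P T B b sigma alpha beta lambda C F Y x,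
        forall t : R, 0 <= t <= T -> {ae P, forall w,
          h T beta t *: ((sigma t w)^T *m pi t w) =
          Proj (hsigmaC T sigma beta C t w)
            (Z t w + alpha^-1 *: theta b sigma t w)} &
        forall t : R, 0 <= t <= T -> {ae P, forall w,
          c t w = h T beta t * wealth P T B b sigma beta x pi c t w - Y t w
                  - alpha^-1 * ln (beta * h T beta t / lambda)}].
Proof.
have zT : 0 <= (0 : R) <= T by rewrite lexx ltW.
have [[pY _] _ _ _ _] := hYZ.
(* [Y 0] is a random variable in this formulation; triviality of [filt 0] provides the constant
   common to the upper and the lower bound. *)
have [y0 Y0] := filt0_constant hB (predictable_adapted zT pY).
have [pi [c [adm lower proj cons]]] := optimal_pair hT halpha hbeta hlambda hP hB hb hs hss hth hCclosed
  hCconv hC0 hYZ x Y0 hp hYZc.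
have upper q : admissible P T B b sigma alpha beta C Y x q ->
    (objective P T B b sigma alpha beta lambda F x q.1 q.2 <= (- expR (- alpha * (h T beta 0 * x - y0)))%:E)%E.
  case: q => pi' c' /= adm'.
  exact: (admissible_bound hT halpha hbeta hlambda hP hB hb hs hss hth hCclosed hCconv hC0 hYZ Y0 adm').
have VE : value P T B b sigma alpha beta lambda C F Y x = (- expR (- alpha * (h T beta 0 * x - y0)))%:E.
  apply/eqP; rewrite eq_le; apply/andP; split.
    by apply: ge_ereal_sup => _ [q aq <-]; exact: upper.
  by apply: le_trans lower _; apply: ereal_sup_ubound; exists (pi, c).
split; first by apply: filterS Y0 => w ->.
exists pi, c; split=> //; rewrite VE; apply/eqP; rewrite eq_le lower andbT; exact: upper adm.
Qed.
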